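(* There exists a randomized algorithm which, given an instance of size $n$ of the fair $k$-median problem in a general metric space, outputs a solution of cost at most $O(\log k)$ times the optimal cost (with no violation of the fairness constraints), in running time $n^{O(l)}$, where $l$ is the number of client groups.
   Context: Fair $k$-median problem: the input is a metric space $(X,dist)$ with a set of clients $\mathcal{C}$ and a set of facilities $\mathcal{F}$, $X=\mathcal{C}\cup\mathcal{F}$ with $|X|=n$ (the size of the instance), a non-negative integer $k$, an integer $l$, and two vectors $\boldsymbol\alpha,\boldsymbol\beta\in\mathbb{R}^l$ with $0\le\alpha_i\le\beta_i\le 1$. The client set is partitioned into $l$ pairwise disjoint groups $\mathcal{C}=\mathcal{C}_1\cup\dots\cup\mathcal{C}_l$ (a client in $\mathcal{C}_i$ is of type $i$). A feasible solution is a set $F\subseteq\mathcal{F}$ with $|F|\le k$ and an assignment $\mu:\mathcal{C}\to F$ such that for every $f\in F$ and every $i\in[l]$, $\alpha_i\le \frac{|\{c\in\mathcal{C}_i:\mu(c)=f\}|}{|\{c\in\mathcal{C}:\mu(c)=f\}|}\le\beta_i$. Its cost is $\sum_{c\in\mathcal{C}}dist(c,\mu(c))$, and the goal is to minimize the cost. *)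

(* Defs.v *)
From mathcomp Require Import all_boot all_order all_algebra.
From mathcomp Require Import reals exp.
From mathcomp Require Import metric_structure.

Set Implicit Arguments.
Unset Strict Implicit.
Unset Printing Implicit Defensive.

Import Order.TTheory GRing.Theory Num.Theory.
Local Open Scope ring_scope.

(* The points of the space are numbered by ['I_npoints] through [point].
   A point may be a client and a facility at the same time; a group may be
   empty. *)
Record instance (R : realType) := Instance {
  npoints : nat;
  space : metricType R;
  point : 'I_npoints -> space;
  point_bij : bijective point;
  nopen : nat;
  ngroups : nat;
  facilities : {set 'I_npoints};
  group : 'I_ngroups -> {set 'I_npoints};
  group_disjoint : forall i j, i != j -> [disjoint group i & group j];
  cover_points : (\bigcup_i group i) :|: facilities = [set: 'I_npoints];
  alpha : 'I_ngroups -> R;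
  beta : 'I_ngroups -> R;
  alpha_beta : forall i, 0 <= alpha i <= beta i /\ beta i <= 1
}.

Definition clients (R : realType) (I : instance R) : {set 'I_(npoints I)} :=
  \bigcup_i @group R I i.

Definition pdist (R : realType) (I : instance R) (x y : 'I_(npoints I)) : R :=
  mdist (point x) (point y).

(* Only the values of [assign] at clients are meaningful. *)
Record solution (R : realType) (I : instance R) := Solution {
  opened : {set 'I_(npoints I)};
  assign : 'I_(npoints I) -> 'I_(npoints I)
}.

Definition served (R : realType) (I : instance R) (S : solution I)
    (A : {set 'I_(npoints I)}) (f : 'I_(npoints I)) : nat :=
  #|[set c in A | assign S c == f]|.

(* For an open facility that serves no client the ratio is 0/0; it imposes no
   constraint. *)
Definition feasible (R : realType) (I : instance R) (S : solution I) : Prop :=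
  [/\ opened S \subset facilities I,
      (#|opened S| <= nopen I)%N,
      (forall c, c \in clients I -> assign S c \in opened S)
    & forall f, f \in opened S -> (0 < served S (clients I) f)%N ->
      forall i : 'I_(ngroups I),
        alpha i <= (served S (group i) f)%:R / (served S (clients I) f)%:R
                <= beta i].

Definition cost (R : realType) (I : instance R) (S : solution I) : R :=
  \sum_(c in clients I) pdist c (assign S c).

Definition optimal (R : realType) (I : instance R) (S : solution I) : Prop :=
  feasible S /\ forall S' : solution I, feasible S' -> cost S <= cost S'.

(* Randomized algorithms are programs of a structured real RAM.
   - The memory consists of arrays with two indices, some holding natural
     numbers and some holding reals; array names are constants of the program,
     indices are computed.
   - Natural numbers admit only addition and truncated subtraction, so that a
     number produced in t steps has O(t) more bits than the input.
   - Reals admit the field operations and comparison; there is no rounding, and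
     the only real constants are images of natural numbers.
   - Random choices are uniform draws from {0, ..., m - 1}.
   The size of the expressions in a program is fixed, so each instruction takes
   constantly many elementary operations and counts as one step. *)
Inductive iexp :=
  | IConst of nat
  | IGet of nat & iexp & iexp
  | IAdd of iexp & iexp
  | ISub of iexp & iexp.

Inductive rexp :=
  | RNat of iexp
  | RGet of nat & iexp & iexp
  | RAdd of rexp & rexp
  | RSub of rexp & rexp
  | RMul of rexp & rexp
  | RDiv of rexp & rexp.

Inductive bexp :=
  | ILe of iexp & iexp
  | RLe of rexp & rexp
  | BNot of bexp
  | BAnd of bexp & bexp.

Inductive cmd :=
  | Skip
  | ISet of nat & iexp & iexp & iexp
  | RSet of nat & iexp & iexp & rexp
  | Draw of nat & iexp & iexp & iexp
  | Seq of cmd & cmd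
  | If of bexp & cmd & cmd
  | While of bexp & cmd.

Definition memory (V : Type) := nat -> nat -> nat -> V.

Definition update (V : Type) (m : memory V) (a i j : nat) (v : V) : memory V :=
  fun a' i' j' => if [&& a' == a, i' == i & j' == j] then v else m a' i' j'.

Record state (R : realType) := State { imem : memory nat; rmem : memory R }.

Fixpoint ieval (R : realType) (s : state R) (e : iexp) : nat :=
  match e with
  | IConst n => n
  | IGet a e1 e2 => imem s a (ieval s e1) (ieval s e2)
  | IAdd e1 e2 => (ieval s e1 + ieval s e2)%N
  | ISub e1 e2 => (ieval s e1 - ieval s e2)%N
  end.

Fixpoint reval (R : realType) (s : state R) (e : rexp) : R :=
  match e with
  | RNat e1 => (ieval s e1)%:R
  | RGet a e1 e2 => rmem s a (ieval s e1) (ieval s e2)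
  | RAdd e1 e2 => reval s e1 + reval s e2
  | RSub e1 e2 => reval s e1 - reval s e2
  | RMul e1 e2 => reval s e1 * reval s e2
  | RDiv e1 e2 => reval s e1 / reval s e2
  end.

Fixpoint beval (R : realType) (s : state R) (b : bexp) : bool :=
  match b with
  | ILe e1 e2 => (ieval s e1 <= ieval s e2)%N
  | RLe e1 e2 => reval s e1 <= reval s e2
  | BNot b1 => ~~ beval s b1
  | BAnd b1 b2 => beval s b1 && beval s b2
  end.

Definition set_imem (R : realType) (s : state R) (a i j v : nat) : state R :=
  State (update (imem s) a i j v) (rmem s).

Definition set_rmem (R : realType) (s : state R) (a i j : nat) (v : R) :
    state R :=
  State (imem s) (update (rmem s) a i j v).

(* The commands still to be executed, and the memory. *)
Definition config (R : realType) : Type := (seq cmd * state R)%type.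

(* [Next m f]: one step leads to each of [f 0], ..., [f m] with probability
   1 / (m + 1). *)
Variant transition (R : realType) :=
  | Halt
  | Next (m : nat) of ('I_m.+1 -> config R).

Arguments Halt {R}.

Definition det (R : realType) (c : config R) : transition R :=
  @Next R 0 (fun _ => c).

(* A draw from {0, ..., m - 1} with m = 0 yields 0. *)
Definition step (R : realType) (c : config R) : transition R :=
  let: (K, s) := c in
  match K with
  | [::] => Halt
  | Skip :: K' => det (K', s)
  | ISet a e1 e2 e :: K' =>
      det (K', set_imem s a (ieval s e1) (ieval s e2) (ieval s e))
  | RSet a e1 e2 e :: K' =>
      det (K', set_rmem s a (ieval s e1) (ieval s e2) (reval s e))
  | Draw a e1 e2 e :: K' =>
      @Next R (ieval s e).-1
        (fun v => (K', set_imem s a (ieval s e1) (ieval s e2) v))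
  | Seq c1 c2 :: K' => det ([:: c1, c2 & K'], s)
  | If b c1 c2 :: K' => det ((if beval s b then c1 else c2) :: K', s)
  | While b c1 :: K' =>
      det (if beval s b then [:: c1, While b c1 & K'] else K', s)
  end.

(* Every execution from [c] halts within [T] steps, in a state satisfying
   [P]. *)
Fixpoint always (R : realType) (T : nat) (P : state R -> Prop) (c : config R) :
    Prop :=
  match step c with
  | Halt => P c.2
  | Next m f => if T is T'.+1 then forall v, always T' P (f v) else False
  end.

(* The expectation of [g] in the final state, when every execution from [c]
   halts within [T] steps. *)
Fixpoint expect (R : realType) (T : nat) (g : state R -> R) (c : config R) : R :=
  match step c with
  | Halt => g c.2
  | Next m f =>
      if T is T'.+1 then (\sum_(v < m.+1) expect T' g (f v)) / m.+1%:R else 0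
  end.

(* The function [f] on ['I_n], extended to [nat] by the value [d]. *)
Definition extend (V : Type) (d : V) (n : nat) (f : 'I_n -> V) (i : nat) : V :=
  oapp f d (insub i).

Definition input_imem (R : realType) (I : instance R) : memory nat :=
  fun a i j =>
  match a, i, j with
  | 0, 0, 0 => npoints I
  | 1, 0, 0 => nopen I
  | 2, 0, 0 => ngroups I
  | 3, i, 0 => extend 0%N (fun x => nat_of_bool (x \in facilities I)) i
  | 4, i, j =>
      extend 0%N (fun g : 'I_(ngroups I) =>
        extend 0%N (fun x => nat_of_bool (x \in group g)) j) i
  | _, _, _ => 0%N
  end.

Definition input_rmem (R : realType) (I : instance R) : memory R :=
  fun a i j =>
  match a, i, j with
  | 0, i, j => extend 0 (fun x : 'I_(npoints I) => extend 0 (pdist x) j) i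
  | 1, i, 0 => extend 0 (@alpha R I) i
  | 2, i, 0 => extend 0 (@beta R I) i
  | _, _, _ => 0
  end.

Definition start (R : realType) (p : cmd) (I : instance R) : config R :=
  ([:: p], State (input_imem I) (input_rmem I)).

(* The output is read in the integer arrays 5 (nonzero at the open facilities)
   and 6 (the facility assigned to a client); an entry of the latter that is not
   the number of a point [x] of the space is read as the client itself. *)
Definition output (R : realType) (I : instance R) (s : state R) : solution I :=
  Solution [set x : 'I_(npoints I) | imem s 5 x 0 != 0%N]
           (fun c => insubd c (imem s 6 c 0%N)).

(* Main.v *)
From mathcomp Require Import fingroup perm.
Require Import Defs.
From mathcomp Require Import all_boot all_order all_algebra.
From mathcomp Require Import reals exp.
From mathcomp Require Import metric_structure boolp.
From mathcomp Require Import zify ring lra.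

(* Ignoring fairness, local search with best single swaps, started from a
   farthest-point solution, opens centers of connection cost at most 8 OPT.
   Moving every cluster of the optimal fair solution to the center nearest to
   its facility merges fair clusters, so it remains fair, and it shows that the
   clients can be reassigned among the centers at transport cost O(OPT).
   The metric on the centers is replaced by a random dominating ultrametric
   (Calinescu, Karloff and Rabani; Fakcharoenphol, Rao and Talwar) of expected
   distortion O(log k).  On an ultrametric the transport cost from the actual
   to the demanded client counts depends only on the surplus of each cluster of
   the hierarchy, so a dynamic program over the merges of clusters, whose
   states are the (n+1)^l vectors of client counts, finds the best fair demands,
   and serving clients greedily inside the smallest clusters attains its value.
   The hierarchy needs a random order of the centers, for which drawing
   priorities from {0, ..., n^2 - 1} suffices, ties costing a constant factor,
   and a random real scale in [1/8, 1/4), which the machine cannot draw.  For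
   fixed priorities the cost is a step function of the scale, so some scale
   that is 1/8 or a ratio of two distances is no worse than the average; all of
   them are tried. *)

Set Implicit Arguments.
Unset Strict Implicit.
Unset Printing Implicit Defensive.

Import Order.TTheory GRing.Theory Num.Theory.
Local Open Scope ring_scope.

(** * Structured programs and their running time *)

Arguments imem {R} s _%_nat_scope _%_nat_scope _%_nat_scope.
Arguments rmem {R} s _%_nat_scope _%_nat_scope _%_nat_scope.

Section Programs.
Context {R : realType}.
Implicit Types (s : state R) (K : seq cmd) (T : nat).

(** The tree metric lives on the at most [k] opened centers and not on the whole space; this is what
    makes the loss O(log k) instead of O(log n), and it is why good centers are found beforehand
    without regard to fairness. Only the cost is an expectation: the tree metric dominates for every
    outcome of the draws and every scale tried, so the tree value of the kept assignment bounds its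
    true transport cost, and the fairness of the output is certain. The scale is chosen after the
    priorities, which is harmless because the comparison with the average over scales is made for
    each fixed choice of priorities. The radii of the hierarchy are themselves distances between
    centers: the number of levels then does not depend on the spread of the metric, no logarithm has
    to be computed, and the breakpoints in the scale are ratios of two distances. The time bound is
    syntactic: all loop bounds are known at entry and are at most (n+1)^l + n + l, so the length of
    the program, a constant, becomes the exponent. *)

Definition leads (t : nat) (c c' : config R) : Prop :=
  forall T, (forall P, always (t + T) P c <-> always T P c') /\
            (forall g, expect (t + T) g c = expect T g c').

Lemma leads0 c : leads 0 c c.
Proof. by []. Qed.

Lemma leads_trans t1 t2 c1 c2 c3 :
  leads t1 c1 c2 -> leads t2 c2 c3 -> leads (t1 + t2) c1 c3.
Proof.
move=> h1 h2 T; rewrite -addnA; have [a1 e1] := h1 (t2 + T)%N.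
have [a2 e2] := h2 T; split=> [P|g]; first by rewrite a1 a2.
by rewrite e1 e2.
Qed.

Lemma leads_det c c' : step c = det c' -> leads 1 c c'.
Proof.
move=> h T; split=> [P|g]; rewrite add1n /= h /det; last by rewrite big_ord1 divr1.
by split=> [/(_ ord0)|//].
Qed.

Lemma always_leq T T' P (c : config R) : (T <= T')%N -> always T P c -> always T' P c.
Proof.
elim: T T' c => [|T IH] [|T'] c //=; case: (step c) => [|m f] //= leT h v.
exact: IH (h v).
Qed.

(** A budget that runs out contributes 0 to the expectation, so enlarging it changes nothing only
    when every execution already halts within the smaller one. *)
Lemma expect_leq T T' g (c : config R) :
  (T <= T')%N -> always T (fun _ => True) c -> expect T' g c = expect T g c.
Proof.
elim: T T' c => [|T IH] [|T'] c //=; case: (step c) => [|m f] //= leT h.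
by congr (_ / _); apply: eq_bigr => v _; apply: IH.
Qed.

End Programs.

(** The deterministic fragment with loops bounded in advance: its semantics [run] is a total
    function, and its running time is bounded by recursion on the syntax. *)
Inductive prog :=
  | PSkip
  | PSetI of nat & iexp & iexp & iexp
  | PSetR of nat & iexp & iexp & rexp
  | PSeq of prog & prog
  | PIf of bexp & prog & prog
  | PFor of nat & nat & prog.

Declare Scope prog_scope.
Delimit Scope prog_scope with P.
Bind Scope prog_scope with prog.

Definition rg (a : nat) : iexp := IGet a (IConst 0) (IConst 0).
Definition iv (a : nat) (e : iexp) : iexp := IGet a e (IConst 0).
Definition rrg (a : nat) : rexp := RGet a (IConst 0) (IConst 0).
Definition rv (a : nat) (e : iexp) : rexp := RGet a e (IConst 0).
Definition ILt (e1 e2 : iexp) : bexp := BNot (ILe e2 e1).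
Definition RLt (e1 e2 : rexp) : bexp := BNot (RLe e2 e1).
Definition IEq (e1 e2 : iexp) : bexp := BAnd (ILe e1 e2) (ILe e2 e1).

Notation "p ;; q" := (PSeq p q) (at level 80, right associativity) : prog_scope.
Notation seti a e := (PSetI a (IConst 0) (IConst 0) e).
Notation setr a e := (PSetR a (IConst 0) (IConst 0) e).

Fixpoint compile (p : prog) : cmd :=
  match p with
  | PSkip => Skip
  | PSetI a e1 e2 e => ISet a e1 e2 e
  | PSetR a e1 e2 e => RSet a e1 e2 e
  | PSeq p q => Seq (compile p) (compile q)
  | PIf b p q => If b (compile p) (compile q)
  | PFor x n p =>
      Seq (ISet x (IConst 0) (IConst 0) (IConst 0))
        (While (ILt (rg x) (rg n))
          (Seq (compile p)
            (ISet x (IConst 0) (IConst 0) (IAdd (rg x) (IConst 1)))))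
  end.

(** A loop reads its bound once, at entry, whereas the compiled [While] rereads it at every test;
    the two agree under [wf], which forbids writing the bound. *)
Fixpoint run (R : realType) (p : prog) (s : state R) : state R :=
  match p with
  | PSkip => s
  | PSetI a e1 e2 e => set_imem s a (ieval s e1) (ieval s e2) (ieval s e)
  | PSetR a e1 e2 e => set_rmem s a (ieval s e1) (ieval s e2) (reval s e)
  | PSeq p q => run q (run p s)
  | PIf b p q => if beval s b then run p s else run q s
  | PFor x n p =>
      iter (imem s n 0 0)
        (fun s => let s' := run p s in set_imem s' x 0 0 (imem s' x 0 0).+1)
        (set_imem s x 0 0 0)
  end.
Arguments run {R} p s : simpl never.

(** Syntactic write sets. An array outside them keeps its contents, and membership is decided by
    computation, which yields the frame rules [runI] and [runR]. *)
Fixpoint wI (p : prog) : seq nat :=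
  match p with
  | PSkip => [::]
  | PSetI a _ _ _ => [:: a]
  | PSetR _ _ _ _ => [::]
  | PSeq p q | PIf _ p q => wI p ++ wI q
  | PFor x _ p => x :: wI p
  end.

Fixpoint wR (p : prog) : seq nat :=
  match p with
  | PSkip | PSetI _ _ _ _ => [::]
  | PSetR a _ _ _ => [:: a]
  | PSeq p q | PIf _ p q => wR p ++ wR q
  | PFor _ _ p => wR p
  end.

Fixpoint bounds (p : prog) : seq nat :=
  match p with
  | PSkip | PSetI _ _ _ _ | PSetR _ _ _ _ => [::]
  | PSeq p q | PIf _ p q => bounds p ++ bounds q
  | PFor _ n p => n :: bounds p
  end.

(* [L] stands for the arrays written by the whole program. *)
Fixpoint wf (L : seq nat) (p : prog) : bool :=
  match p with
  | PSkip | PSetI _ _ _ _ | PSetR _ _ _ _ => true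
  | PSeq p q | PIf _ p q => wf L p && wf L q
  | PFor x n p => [&& n \notin L, x \notin wI p & wf L p]
  end.

(** The exponent of the time bound in base [W + 2], where [W] bounds all loop bounds; the 4 charged
    for a loop pays for its [W] iterations and their overhead. *)
Fixpoint psize (p : prog) : nat :=
  match p with
  | PSkip | PSetI _ _ _ _ | PSetR _ _ _ _ => 1
  | PSeq p q | PIf _ p q => (psize p + psize q).+1
  | PFor _ _ p => (psize p).+4
  end.

Lemma notin_sub (L1 L2 : seq nat) a :
  all [in L2] L1 -> a \notin L2 -> a \notin L1.
Proof. by move=> /allP h; apply: contra => /h. Qed.

Section Run.
Context {R : realType}.
Implicit Types (s : state R) (p q : prog).

Lemma runSeq p q s : run (PSeq p q) s = run q (run p s).
Proof. by []. Qed.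

Lemma runSetI a e1 e2 e s :
  run (PSetI a e1 e2 e) s = set_imem s a (ieval s e1) (ieval s e2) (ieval s e).
Proof. by []. Qed.

Lemma runSetR a e1 e2 e s :
  run (PSetR a e1 e2 e) s = set_rmem s a (ieval s e1) (ieval s e2) (reval s e).
Proof. by []. Qed.

Lemma runIf b p q s :
  run (PIf b p q) s = if beval s b then run p s else run q s.
Proof. by []. Qed.

Lemma runSkip s : run PSkip s = s.
Proof. by []. Qed.

Lemma runI p s a i j : a \notin wI p -> imem (run p s) a i j = imem s a i j.
Proof.
elim: p s i j => [|a' e1 e2 e|a' e1 e2 e|p IHp q IHq|b p IHp q IHq|x n p IHp] s i j //=.
- by rewrite inE => /negbTE h; rewrite ?runSetI /= /update h.
- by rewrite mem_cat negb_or => /andP[h1 h2]; rewrite runSeq IHq // IHp.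
- rewrite mem_cat negb_or => /andP[h1 h2]; rewrite runIf.
  by case: ifP => _; rewrite ?IHq ?IHp.
- rewrite inE negb_or => /andP[/negbTE ax h]; rewrite /run -/run.
  elim: (imem s n 0%N 0%N) => [|m IH] /=; first by rewrite /update ax.
  by rewrite /update ax /= IHp // IH.
Qed.

Lemma runR p s a i j : a \notin wR p -> rmem (run p s) a i j = rmem s a i j.
Proof.
elim: p s i j => [|a' e1 e2 e|a' e1 e2 e|p IHp q IHq|b p IHp q IHq|x n p IHp] s i j //=.
- by rewrite inE => /negbTE h; rewrite ?runSetR /= /update h.
- by rewrite mem_cat negb_or => /andP[h1 h2]; rewrite runSeq IHq // IHp.
- rewrite mem_cat negb_or => /andP[h1 h2]; rewrite runIf.
  by case: ifP => _; rewrite ?IHq ?IHp.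
- move=> h; rewrite /run -/run.
  by elim: (imem s n 0%N 0%N) => [|m IH] //=; rewrite IHp // IH.
Qed.

Definition keeps p s s' : Prop :=
  (forall a i j, a \notin wI p -> imem s' a i j = imem s a i j) /\
  (forall a i j, a \notin wR p -> rmem s' a i j = rmem s a i j).

Lemma for_ind (P : nat -> state R -> Prop) m x n p s :
  imem s n 0 0 = m -> x \notin wI p ->
  (forall i s' v, P i s' -> P i (set_imem s' x 0 0 v)) ->
  P 0%N s ->
  (forall i s', (i < m)%N -> P i s' -> imem s' x 0 0 = i ->
     keeps (PFor x n p) s s' -> P i.+1 (run p s')) ->
  P m (run (PFor x n p) s).
Proof.
move=> <- xp stab P0 PS; rewrite /run -/run; set b := imem s n 0 0.
pose S m := iter m (fun s => let s' := run p s in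
  set_imem s' x 0 0 (imem s' x 0 0).+1) (set_imem s x 0 0 0).
suff H k : (k <= b)%N -> [/\ P k (S k), imem (S k) x 0 0 = k & keeps (PFor x n p) s (S k)].
  by have [] := H b (leqnn _).
elim: k => [|m0 IH] lemb.
  split; [exact: stab|by rewrite /S /= /update eqxx|split=> // a i j /=].
  by rewrite inE negb_or => /andP[/negbTE ax _]; rewrite /update ax.
have [Pm Xm [kI kR]] := IH (ltnW lemb); rewrite /S /= -/(S m0); split.
- by apply/stab/PS.
- by rewrite /update eqxx runI ?Xm.
- split=> a i j h /=.
    have := h; rewrite inE negb_or => /andP[/negbTE ax h'].
    by rewrite /update ax /= runI // kI.
  by rewrite runR // kR.
Qed.

Lemma keeps_trans p s1 s2 s3 : keeps p s1 s2 -> keeps p s2 s3 -> keeps p s1 s3.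
Proof.
by move=> [i1 r1] [i2 r2]; split=> a i j h; rewrite ?i2 ?i1 ?r2 ?r1.
Qed.

(** Positions [(i, j)] advance in lexicographic order, and a finished row [(i, M)] is read again as
    [(i.+1, 0)]; hence the final position [(N, 0)]. *)
Lemma for2_ind (P : nat -> nat -> state R -> Prop) N M x y n m p s :
  imem s n 0 0 = N -> imem s m 0 0 = M ->
  x \notin wI (PFor y m p) -> y \notin wI p -> m \notin wI (PFor x n (PFor y m p)) ->
  (forall i j s' v, P i j s' -> P i j (set_imem s' x 0 0 v)) ->
  (forall i j s' v, P i j s' -> P i j (set_imem s' y 0 0 v)) ->
  (forall i s', (i < N)%N -> P i M s' -> P i.+1 0%N s') ->
  P 0%N 0%N s ->
  (forall i j s', (i < N)%N -> (j < M)%N -> P i j s' ->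
     imem s' x 0 0 = i -> imem s' y 0 0 = j ->
     keeps (PFor x n (PFor y m p)) s s' -> P i j.+1 (run p s')) ->
  P N 0%N (run (PFor x n (PFor y m p)) s).
Proof.
move=> nN mM xp yp mp stx sty row P0 PS.
apply: (@for_ind (fun i => P i 0%N)) => // [i s' v|i s' lti Pi xi ks]; first exact: stx.
apply: (row) => //; apply: (@for_ind (P i)) => //; first by case: ks => h _; rewrite h.
  by move=> j s2 v; exact: sty.
move=> j s2 ltj Pj yj k2; apply: PS => //.
  by case: k2 => h _; rewrite h.
apply: (keeps_trans ks); case: k2 => h1 h2.
split=> a i' j' h; last exact: h2.
by apply: h1; move: h; rewrite /= !inE !negb_or => /andP[].
Qed.

Fixpoint ptime (W : nat) p : nat :=
  match p with
  | PSkip | PSetI _ _ _ _ | PSetR _ _ _ _ => 1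
  | PSeq p q | PIf _ p q => (ptime W p + ptime W q).+1
  | PFor _ _ p => (W * (ptime W p).+3).+3
  end.

Lemma psize_gt0 p : (0 < psize p)%N.
Proof. by case: p. Qed.

Lemma ptime_le W p : (ptime W p <= (W + 2) ^ psize p)%N.
Proof.
have c2 : (2 <= W + 2)%N by lia.
have ge2 m : (0 < m)%N -> (2 <= (W + 2) ^ m)%N.
  by case: m => // m _; rewrite expnS (leq_trans c2) // leq_pmulr // expn_gt0; lia.
elim: p => [|a' e1 e2 e|a' e1 e2 e|p IHp q IHq|b p IHp q IHq|x n p IHp] /=;
  try by rewrite expn1; lia.
1,2: rewrite expnS expnD; have := ge2 _ (psize_gt0 p); have := ge2 _ (psize_gt0 q);
  move: IHp IHq; set x := (_ ^ psize p)%N; set y := (_ ^ psize q)%N; nia.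
rewrite !expnS; have := ge2 _ (psize_gt0 p); move: IHp; set y := (_ ^ _)%N.
move=> h1 h2; have : ((W * (ptime W p).+3).+3 <= W * (y + 3) + 3)%N by nia.
move/leq_trans; apply; nia.
Qed.

Lemma compile_leads (L : seq nat) (W : nat) p s K :
  wf L p -> {subset wI p <= L} ->
  (forall n, n \in bounds p -> (imem s n 0 0 <= W)%N) ->
  exists2 t, (t <= ptime W p)%N &
    leads t (compile p :: K, s) (K, run p s).
Proof.
elim: p s K => [|a' e1 e2 e|a' e1 e2 e|p IHp q IHq|b p IHp q IHq|x n p IHp] s K /=.
1,2,3: by move=> _ _ _; exists 1%N => //; apply: leads_det.
- move=> /andP[wp wq] sL bW.
  have [||t1 lt1 h1] := IHp s (compile q :: K) wp.
  + by move=> z zp; apply: sL; rewrite mem_cat zp.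
  + by move=> m mp; apply: bW; rewrite mem_cat mp.
  have [||t2 lt2 h2] := IHq (run p s) K wq.
  + by move=> z zp; apply: sL; rewrite mem_cat zp orbT.
  + move=> m mp; rewrite runI; first by apply: bW; rewrite mem_cat mp orbT.
    (* A loop bound of [q] written by [p] would belong to [L], which [wf] excludes. *)
    apply/negP => mw; have mL : m \in L by apply: sL; rewrite mem_cat mw.
    elim: (q) wq mp => //= [q1 I1 q2 I2|_ q1 I1 q2 I2|y k q1 I1].
    * by move=> /andP[? ?]; rewrite mem_cat => /orP[]; auto.
    * by move=> /andP[? ?]; rewrite mem_cat => /orP[]; auto.
    * by move=> /and3P[kL _ ?]; rewrite inE => /orP[/eqP e|]; auto; rewrite -e mL in kL.
  exists (1 + (t1 + t2))%N; first by lia.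
  by apply: leads_trans (leads_trans h1 h2); exact: leads_det.
- move=> /andP[wp wq] sL bW.
  have hp : exists2 t, (t <= ptime W p)%N & leads t (compile p :: K, s) (K, run p s).
    by apply: IHp => // z zp; [apply: sL|apply: bW]; rewrite mem_cat zp.
  have hq : exists2 t, (t <= ptime W q)%N & leads t (compile q :: K, s) (K, run q s).
    by apply: IHq => // z zp; [apply: sL|apply: bW]; rewrite mem_cat zp orbT.
  rewrite runIf; case hb: (beval s b).
    have [t lt h] := hp; exists (1 + t)%N; first by lia.
    by apply: leads_trans _ h; apply: leads_det; rewrite /= hb.
  have [t lt h] := hq; exists (1 + t)%N; first by lia.
  by apply: leads_trans _ h; apply: leads_det; rewrite /= hb.
- move=> /and3P[nL xp wp] sL bW.
  have nx : n == x = false by apply/negbTE; apply: contra nL => /eqP->; apply: sL; rewrite inE eqxx.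
  have nwp : n \notin wI p by apply: contra nL => h; apply: sL; rewrite inE h orbT.
  pose f s := let s' := run p s in set_imem s' x 0 0 (imem s' x 0 0).+1.
  pose b := imem s n 0 0.
  set body := Seq (compile p) _; set w := While _ _.
  pose S m := iter m f (set_imem s x 0 0 0).
  have Sk m a i j : a \notin x :: wI p -> imem (S m) a i j = imem s a i j.
    rewrite inE negb_or => /andP[/negbTE ax ap].
    by elim: m => [|m IH] /=; rewrite /update ax //= runI.
  have Sx m : imem (S m) x 0 0 = m.
    elim: m => [|m IH] /=; first by rewrite /update eqxx.
    by rewrite /update eqxx /= runI // IH.
  have Sn m : imem (S m) n 0 0 = b by apply: Sk; rewrite inE nx.
  have H m : (m <= b)%N -> exists2 t, (t <= m * (ptime W p).+3)%N &
      leads t (w :: K, S 0%N) (w :: K, S m).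
    elim: m => [|m IH] lm; first by exists 0%N => //; apply: leads0.
    have [t lt h] := IH (ltnW lm).
    have [||t' lt' h'] := IHp (S m) (ISet x (IConst 0) (IConst 0) (IAdd (rg x) (IConst 1)) :: w :: K) wp.
    + by move=> z zp; apply: sL; rewrite inE zp orbT.
    + move=> k kp; have kL : k \notin L.
        elim: (p) wp kp => //= [q1 I1 q2 I2|_ q1 I1 q2 I2|y j q1 I1].
        * by move=> /andP[? ?]; rewrite mem_cat => /orP[]; auto.
        * by move=> /andP[? ?]; rewrite mem_cat => /orP[]; auto.
        * by move=> /and3P[kL _ ?]; rewrite inE => /orP[/eqP->|]; auto.
      rewrite Sk; first by apply: bW; rewrite inE kp orbT.
      by apply: contra kL; exact: sL.
    exists (t + (1 + (1 + (t' + 1))))%N; first by rewrite mulSn; lia.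
    apply: leads_trans h _; apply: (leads_trans (c2 := (body :: w :: K, S m))).
      by apply: leads_det; rewrite /= Sx Sn -ltnNge lm.
    apply: leads_trans; first by apply: leads_det; reflexivity.
    apply: leads_trans h' _; apply: leads_det; rewrite /=.
    by congr (det (_, set_imem _ _ _ _ _)); rewrite addn1.
  have [t lt h] := H b (leqnn _).
  exists (1 + (1 + (t + 1)))%N.
    have : (b <= W)%N by apply: bW; rewrite inE eqxx.
    by move=> bW'; nia.
  apply: leads_trans; first by apply: leads_det; reflexivity.
  apply: (leads_trans (c2 := (w :: K, S 0%N))); first by apply: leads_det.
  apply: leads_trans h _; apply: leads_det.
  by rewrite /= Sx Sn leqnn.
Qed.

(** The only random command of the algorithm, kept out of [prog] so that [run] remains a
    function. *)
Definition draws (a x n m : nat) : cmd :=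
  Seq (ISet x (IConst 0) (IConst 0) (IConst 0))
    (While (ILt (rg x) (rg n))
      (Seq (Draw a (rg x) (IConst 0) (rg m))
        (ISet x (IConst 0) (IConst 0) (IAdd (rg x) (IConst 1))))).

Definition drawn1 (a x : nat) s (v : nat) : state R :=
  let s' := set_imem s a (imem s x 0 0) 0 v in
  set_imem s' x 0 0 (imem s' x 0 0 + 1).

(** The deterministic replay of the loop when the successive draws are the entries of [t]. *)
Definition drawn (a x : nat) (t : seq nat) s : state R :=
  foldl (drawn1 a x) (set_imem s x 0 0 0) t.

Lemma drawnP a x t s : a != x ->
  [/\ forall i, (i < size t)%N -> imem (drawn a x t s) a i 0 = nth 0%N t i,
      forall b i j, b \notin [:: a; x] ->
        imem (drawn a x t s) b i j = imem s b i j &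
      forall b i j, rmem (drawn a x t s) b i j = rmem s b i j].
Proof.
move=> ax; rewrite /drawn; set s0 := set_imem s x 0 0 0.
have xa : (x == a) = false by rewrite eq_sym; exact/negbTE.
suff [] : [/\ imem (foldl (drawn1 a x) s0 t) x 0 0 = size t,
      forall i, (i < size t)%N -> imem (foldl (drawn1 a x) s0 t) a i 0 = nth 0%N t i,
      forall b i j, b \notin [:: a; x] ->
        imem (foldl (drawn1 a x) s0 t) b i j = imem s0 b i j &
      forall b i j, rmem (foldl (drawn1 a x) s0 t) b i j = rmem s0 b i j].
  move=> _ h1 h2 h3; split=> // b i j hb; rewrite h2 //= /update.
  by move: hb; rewrite !inE negb_or => /andP[_ /negbTE->].
elim/last_ind: t => [|t v [IHx IHa IHb IHr]]; first by split=> //=; rewrite /update eqxx.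
rewrite -cats1 foldl_cat /= cats1 size_rcons.
move: (foldl _ _ _) IHx IHa IHb IHr => S IHx IHa IHb IHr; split.
- by rewrite /drawn1 /= /update !eqxx /= xa /= IHx addn1.
- move=> i; rewrite /drawn1 /= /update (negbTE ax) !eqxx /= nth_rcons ltnS IHx andbT.
  by case: ltngtP => // lti _; exact: IHa.
- move=> b i j hb; have := hb; rewrite !inE negb_or => /andP[/negbTE h1 /negbTE h2].
  by rewrite /update h1 h2 /= IHb //= /update h2.
- by move=> b i j; rewrite /drawn1 /= IHr.
Qed.

Lemma big_tuple_cons n (N : nat) (F : seq nat -> R) :
  \sum_(t : n.+1.-tuple 'I_N.+1) F [seq val i | i <- t] =
  \sum_(v < N.+1) \sum_(t : n.-tuple 'I_N.+1) F (val v :: [seq val i | i <- t]).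
Proof.
rewrite pair_big /=.
rewrite (reindex (fun p : 'I_N.+1 * n.-tuple 'I_N.+1 => [tuple of p.1 :: p.2])) //=.
exists (fun t : n.+1.-tuple _ => (thead t, [tuple of behead t])).
  by move=> [v t] _ /=; rewrite theadE; congr pair; apply: val_inj.
by move=> t _; rewrite [in RHS](tuple_eta t); apply: val_inj.
Qed.

(** Entering the loop takes 2 steps, each iteration 4 (test, [Seq], [Draw], increment) and the last
    test 1. The range is written [N.+1] with a predecessor because a draw from an empty range counts
    as a draw with one outcome. *)
Lemma draws_correct (a x n m : nat) s K :
  let k := imem s n 0 0 in let N := (imem s m 0 0).-1 in
  a != x -> n \notin [:: a; x] -> m \notin [:: a; x] ->
  (forall T P,
     (forall t : k.-tuple 'I_N.+1, always T P (K, drawn a x [seq val i | i <- t] s)) ->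
     always (k * 4 + 3 + T) P (draws a x n m :: K, s)) /\
  (forall T g, expect (k * 4 + 3 + T) g (draws a x n m :: K, s) =
     (\sum_(t : k.-tuple 'I_N.+1)
        expect T g (K, drawn a x [seq val i | i <- t] s)) / (N.+1 ^ k)%:R).
Proof.
move=> k N ax; rewrite !inE !negb_or => /andP[/negbTE na /negbTE nx] /andP[/negbTE ma /negbTE mx].
rewrite /draws; set w := While _ _; set s0 := set_imem s x 0 0 0.
have xa : (x == a) = false by rewrite eq_sym; exact/negbTE.
have L0 : leads 2 (Seq (ISet x (IConst 0) (IConst 0) (IConst 0)) w :: K, s) (w :: K, s0).
  apply: (leads_trans (t1 := 1) (t2 := 1)); first by apply: leads_det; reflexivity.
  by apply: leads_det.
have H j s1 : (j <= k)%N -> imem s1 x 0 0 = (k - j)%N -> imem s1 n 0 0 = k ->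
    (imem s1 m 0 0).-1 = N ->
    (forall T P,
     (forall t : j.-tuple 'I_N.+1, always T P (K, foldl (drawn1 a x) s1 [seq val i | i <- t])) ->
     always (j * 4 + 1 + T) P (w :: K, s1)) /\
    (forall T g, expect (j * 4 + 1 + T) g (w :: K, s1) =
     (\sum_(t : j.-tuple 'I_N.+1)
        expect T g (K, foldl (drawn1 a x) s1 [seq val i | i <- t])) / (N.+1 ^ j)%:R).
  elim: j s1 => [|j IH] s1 lej hx hn hm.
    have L : leads 1 (w :: K, s1) (K, s1).
      by apply: leads_det; rewrite /= hx hn subn0 leqnn.
    split=> [T P h|T g].
      by have [h1 _] := L T; apply/h1; exact: (h [tuple]).
    rewrite mul0n add0n expn0 divr1; have [_ h2] := L T; rewrite h2.
    rewrite (big_pred1 [tuple]) // => t; apply/esym/eqP; exact: tuple0.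
  pose s2 (v : nat) := drawn1 a x s1 v.
  have [] : (forall T P, always (4 + T) P (w :: K, s1) <->
               (forall v : 'I_N.+1, always T P (w :: K, s2 v))) /\
         (forall T g, expect (4 + T) g (w :: K, s1) =
               (\sum_(v < N.+1) expect T g (w :: K, s2 v)) / N.+1%:R).
    pose c v : config R := (ISet x (IConst 0) (IConst 0) (IAdd (rg x) (IConst 1)) :: w :: K,
           set_imem s1 a (imem s1 x 0 0) 0 v).
    have L1 : leads 2 (w :: K, s1) (Draw a (rg x) (IConst 0) (rg m) ::
         ISet x (IConst 0) (IConst 0) (IAdd (rg x) (IConst 1)) :: w :: K, s1).
      apply: (leads_trans (t1 := 1) (t2 := 1) (c2 := (Seq (Draw a (rg x) (IConst 0) (rg m))
        (ISet x (IConst 0) (IConst 0) (IAdd (rg x) (IConst 1))) :: w :: K, s1)));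
        apply: leads_det => //.
      by rewrite /= hx hn -ltnNge ltn_subrL /= (leq_ltn_trans (leq0n j)).
    have L2 v : leads 1 (c v) (w :: K, s2 v) by apply: leads_det; reflexivity.
    split=> [T P|T g].
      have [h1 _] := L1 (2 + T)%N; rewrite (_ : 4 + T = 2 + (2 + T))%N // h1 /= hm.
      by split=> h v; have [h2 _] := L2 v T; apply/h2; exact: (h v).
    have [_ h1] := L1 (2 + T)%N; rewrite (_ : 4 + T = 2 + (2 + T))%N // h1 /= hm.
    congr (_ / _); apply: eq_bigr => v _; have [_ h2] := L2 v T; exact: h2.
  move=> A E; have IHv v := IH (s2 v).
  have sx v : imem (s2 v) x 0 0 = (k - j)%N.
    by rewrite /s2 /drawn1 /= /update !eqxx xa /= hx; lia.
  have sn v : imem (s2 v) n 0 0 = k by rewrite /s2 /drawn1 /= /update nx na.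
  have sm v : (imem (s2 v) m 0 0).-1 = N by rewrite /s2 /drawn1 /= /update mx ma.
  split=> [T P h|T g].
    rewrite (_ : _ + T = 4 + (j * 4 + 1 + T))%N; last by lia.
    apply/A => v; have [h1 _] := IHv v (ltnW lej) (sx v) (sn v) (sm v).
    by apply: h1 => t; exact: (h [tuple of v :: t]).
  rewrite (_ : _ + T = 4 + (j * 4 + 1 + T))%N; last by lia.
  rewrite E (big_tuple_cons _ _ (fun t => expect T g (K, foldl (drawn1 a x) s1 t))) /=.
  rewrite expnS natrM invfM mulrCA mulrC; congr (_ * _); rewrite mulr_suml.
  apply: eq_bigr => v _; have [_ h2] := IHv v (ltnW lej) (sx v) (sn v) (sm v).
  by rewrite h2.
have [|||h1 h2] := H k s0 (leqnn _).
- by rewrite /= /update eqxx subnn.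
- by rewrite /= /update nx.
- by rewrite /= /update mx.
split=> [T P h|T g].
  rewrite (_ : _ + T = 2 + (k * 4 + 1 + T))%N; last by lia.
  by have [h0 _] := L0 (k * 4 + 1 + T)%N; apply/h0; apply: h1.
rewrite (_ : _ + T = 2 + (k * 4 + 1 + T))%N; last by lia.
by have [_ h0] := L0 (k * 4 + 1 + T)%N; rewrite h0 h2.
Qed.

End Run.

Ltac frame := repeat match goal with
  | |- context [imem (run ?p ?s) ?a ?i ?j] => rewrite (@runI _ p s a i j); last by []
  | |- context [rmem (run ?p ?s) ?a ?i ?j] => rewrite (@runR _ p s a i j); last by []
  end.
Ltac mem := rewrite ?runSeq ?runSetI ?runSetR /= /update ?eqxx ?andbT /=.

(** * The algorithm *)

(* The arrays 0 to 6 are those of the input and of the output. *)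
Notation aN := 0%N (only parsing).
Notation aNopen := 1%N (only parsing).
Notation aL := 2%N (only parsing).
Notation aFac := 3%N (only parsing).
Notation aGroup := 4%N (only parsing).
Notation aOpen := 5%N (only parsing).
Notation aAssign := 6%N (only parsing).
Notation aK := 10%N (only parsing).
Notation aK1 := 11%N (only parsing).
Notation aB := 12%N (only parsing).
Notation aV := 13%N (only parsing).
Notation aM := 14%N (only parsing).
Notation aPow := 15%N (only parsing).
Notation aDig := 16%N (only parsing).
Notation aTyp := 17%N (only parsing).
Notation aCl := 18%N (only parsing).
Notation aFair := 19%N (only parsing).
Notation aCen := 20%N (only parsing).
Notation aNear := 21%N (only parsing).
Notation aPri := 22%N (only parsing).
Notation aCarry := 23%N (only parsing).
Notation aCnt := 24%N (only parsing).
Notation aFlag := 25%N (only parsing).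
Notation aFx := 26%N (only parsing).
Notation aBj := 27%N (only parsing).
Notation aBo := 28%N (only parsing).
Notation aTmp := 29%N (only parsing).
Notation xA := 30%N (only parsing).
Notation xB := 31%N (only parsing).
Notation xJ := 32%N (only parsing).
Notation xO := 33%N (only parsing).
Notation xC := 34%N (only parsing).
Notation xI := 35%N (only parsing).
Notation xP := 36%N (only parsing).
Notation xQ := 37%N (only parsing).
Notation xP' := 38%N (only parsing).
Notation xQ' := 39%N (only parsing).
Notation xV := 40%N (only parsing).
Notation xX := 41%N (only parsing).
Notation xY := 42%N (only parsing).
Notation xT := 43%N (only parsing).
Notation xT' := 44%N (only parsing).
Notation aCtr := 50%N (only parsing).
Notation aAlive := 51%N (only parsing).
Notation aClu := 52%N (only parsing).
Notation aCnt0 := 53%N (only parsing).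
Notation aMa := 54%N (only parsing).
Notation aMb := 55%N (only parsing).
Notation aCh := 56%N (only parsing).
Notation aPa := 57%N (only parsing).
Notation aPb := 58%N (only parsing).
Notation aNeed := 59%N (only parsing).
Notation aRep := 60%N (only parsing).
Notation aAsg := 61%N (only parsing).
Notation aDone := 62%N (only parsing).
Notation aRes := 63%N (only parsing).
Notation aTot := 64%N (only parsing).
Notation aHas := 65%N (only parsing).
Notation aTi := 66%N (only parsing).
Notation rDist := 0%N (only parsing).
Notation rAlpha := 1%N (only parsing).
Notation rBeta := 2%N (only parsing).
Notation rTot := 10%N (only parsing).
Notation rMin := 11%N (only parsing).
Notation rFar := 12%N (only parsing).
Notation rVal := 13%N (only parsing).
Notation rBc := 14%N (only parsing).
Notation rD := 15%N (only parsing).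
Notation rScale := 16%N (only parsing).
Notation rH := 17%N (only parsing).
Notation rLev := 18%N (only parsing).
Notation rU := 19%N (only parsing).
Notation rMh := 20%N (only parsing).
Notation rA := 21%N (only parsing).
Notation rT := 22%N (only parsing).
Notation rBest := 23%N (only parsing).

Definition ione := IConst 1.
Definition itrue (e : iexp) : bexp := ILe ione e.
Definition rnat (n : nat) : rexp := RNat (IConst n).
Definition rneg1 : rexp := RSub (rnat 0) (rnat 1).
Definition BOr (b c : bexp) : bexp := BNot (BAnd (BNot b) (BNot c)).
Definition dist (e1 e2 : iexp) : rexp := RGet rDist e1 e2.

(** With truncated subtraction, [a - (a - b)] is the minimum of [a] and [b], so [aK] is the number
    of slots [min(k, n)], which keeps the running time independent of [k]. Natural numbers cannot be
    multiplied: [n^2] and the powers of [n + 1] are built by repeated addition. *)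
Definition p_sizes : prog := (
  seti aK (ISub (rg aNopen) (ISub (rg aNopen) (rg aN))) ;;
  seti aK1 (ISub (rg aK) ione) ;;
  seti aB (IAdd (rg aN) ione) ;;
  PFor xA aN (seti aM (IAdd (rg aM) (rg aN))) ;;
  PSetI aPow (IConst 0) (IConst 0) ione ;;
  PFor xA aL (
    PSetI aPow (IAdd (rg xA) ione) (IConst 0) (iv aPow (rg xA)) ;;
    PFor xB aN (PSetI aPow (IAdd (rg xA) ione) (IConst 0)
      (IAdd (iv aPow (IAdd (rg xA) ione)) (iv aPow (rg xA))))) ;;
  seti aV (iv aPow (rg aL)))%P.

Definition p_types : prog :=
  PFor xA aL (PFor xC aN (PIf (itrue (IGet aGroup (rg xA) (rg xC)))
    (PSetI aTyp (rg xC) (IConst 0) (rg xA) ;; PSetI aCl (rg xC) (IConst 0) ione)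
    PSkip))%P.

(* A vector of client counts, one for each group, is coded by a number in base
   [n + 1]; the digits of all codes are tabulated by counting, as there is no
   instruction that divides natural numbers. *)
Definition p_digits_row : prog :=
  PFor xI aL (PIf (ILe (rg aB) (IAdd (IGet aDig (rg xV) (rg xI)) (rg aCarry)))
    (PSetI aDig (IAdd (rg xV) ione) (rg xI) (IConst 0))
    (PSetI aDig (IAdd (rg xV) ione) (rg xI)
       (IAdd (IGet aDig (rg xV) (rg xI)) (rg aCarry)) ;; seti aCarry (IConst 0)))%P.

Definition p_digits : prog :=
  PFor xV aV (seti aCarry ione ;; p_digits_row)%P.

Definition p_fair_tot : prog :=
  PFor xI aL (seti aCnt (IAdd (rg aCnt) (IGet aDig (rg xV) (rg xI))))%P.

Definition p_fair_ok : prog :=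
  PFor xI aL (PIf (BAnd
      (RLe (RMul (rv rAlpha (rg xI)) (RNat (rg aCnt))) (RNat (IGet aDig (rg xV) (rg xI))))
      (RLe (RNat (IGet aDig (rg xV) (rg xI))) (RMul (rv rBeta (rg xI)) (RNat (rg aCnt)))))
    PSkip (seti aFlag (IConst 0)))%P.

Definition p_fair : prog :=
  PFor xV aV (seti aCnt (IConst 0) ;; p_fair_tot ;; seti aFlag ione ;; p_fair_ok ;;
    PSetI aFair (rg xV) (IConst 0) (rg aFlag))%P.

(** The sum of all distances bounds each of them; it serves as infinity in minima and as the first
    threshold of the hierarchy. *)
Definition p_total : prog :=
  PFor xP aN (PFor xQ aN (setr rTot (RAdd (rrg rTot) (dist (rg xP) (rg xQ)))))%P.

Definition p_far_dist : prog :=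
  PFor xI aK (PIf (BAnd (ILt (rg xI) (rg xJ))
      (RLt (dist (rg xC) (iv aCen (rg xI))) (rrg rMin)))
    (setr rMin (dist (rg xC) (iv aCen (rg xI)))) PSkip)%P.

Definition p_far : prog :=
  PFor xC aN (PIf (itrue (iv aCl (rg xC)))
    (setr rMin (rrg rTot) ;; p_far_dist ;;
     PIf (RLt (rrg rFar) (rrg rMin))
       (setr rFar (rrg rMin) ;; seti aFx (rg xC)) PSkip)
    PSkip)%P.

(** The comparison is not strict, so that a facility is recorded even if its distance equals the
    start value [rTot], as happens when all distances vanish. *)
Definition p_near_fac : prog :=
  PFor xO aN (PIf (BAnd (itrue (iv aFac (rg xO)))
      (RLe (dist (rg aFx) (rg xO)) (rrg rMin)))
    (setr rMin (dist (rg aFx) (rg xO)) ;;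
     PSetI aCen (rg xJ) (IConst 0) (rg xO)) PSkip)%P.

(** Farthest-point traversal over the clients, each chosen client contributing its nearest facility.
    The value -1 of [rFar] is below every distance, so some client is always selected if there is
    one. *)
Definition p_init : prog :=
  PFor xJ aK (setr rFar rneg1 ;; p_far ;; setr rMin (rrg rTot) ;; p_near_fac)%P.

Definition p_eval_min : prog :=
  PFor xI aK (PIf (RLt (dist (rg xC) (iv aTmp (rg xI))) (rrg rMin))
    (setr rMin (dist (rg xC) (iv aTmp (rg xI)))) PSkip)%P.

Definition p_eval_sum : prog :=
  PFor xC aN (PIf (itrue (iv aCl (rg xC)))
    (setr rMin (dist (rg xC) (iv aTmp (IConst 0))) ;; p_eval_min ;;
     setr rVal (RAdd (rrg rVal) (rrg rMin))) PSkip)%P.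

Definition p_eval : prog := (setr rVal (rnat 0) ;; p_eval_sum)%P.

Definition p_copy : prog :=
  PFor xI aK (PSetI aTmp (rg xI) (IConst 0) (iv aCen (rg xI)))%P.

Definition p_swap_o : prog :=
  PFor xO aN (PIf (itrue (iv aFac (rg xO)))
    (p_copy ;; PSetI aTmp (rg xJ) (IConst 0) (rg xO) ;; p_eval ;;
     PIf (RLt (rrg rVal) (rrg rBc))
       (setr rBc (rrg rVal) ;; seti aBj (rg xJ) ;; seti aBo (rg xO)) PSkip)
    PSkip)%P.

(** The search starts from the trivial swap of slot 0 with its own facility, so a round never
    increases the cost. *)
Definition p_swap : prog :=
  (p_copy ;; p_eval ;; setr rBc (rrg rVal) ;; seti aBj (IConst 0) ;;
   seti aBo (iv aCen (IConst 0)) ;; PFor xJ aK p_swap_o ;;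
   PSetI aCen (rg aBj) (IConst 0) (rg aBo))%P.

(** A fixed number [n^2] of rounds replaces a stopping test; it suffices because the excess cost
    contracts geometrically. *)
Definition p_search : prog := PFor xA aN (PFor xB aN p_swap).

Definition p_near : prog :=
  PFor xC aN (PFor xI aK (PIf
    (RLt (dist (rg xC) (iv aCen (rg xI))) (dist (rg xC) (iv aCen (iv aNear (rg xC)))))
    (PSetI aNear (rg xC) (IConst 0) (rg xI)) PSkip))%P.

(** The hierarchy is built on slots, the positions in the list of centers. Different slots may hold
    the same facility, so this is a pseudometric. *)
Definition p_slots : prog :=
  PFor xP aK (PFor xQ aK (PSetR rD (rg xP) (rg xQ)
    (dist (iv aCen (rg xP)) (iv aCen (rg xQ)))))%P.

(** Adding [(n + 1)^i] increments digit [i] of a code, so [aTot] becomes the code of the vector of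
    all client counts. *)
Definition p_count : prog :=
  PFor xC aN (PIf (itrue (iv aCl (rg xC)))
    (PSetI aCnt0 (iv aNear (rg xC)) (iv aTyp (rg xC))
       (IAdd (IGet aCnt0 (iv aNear (rg xC)) (iv aTyp (rg xC))) ione) ;;
     seti aTot (IAdd (rg aTot) (iv aPow (iv aTyp (rg xC))))) PSkip)%P.

Definition p_prepare : prog :=
  (p_types ;; p_digits ;; p_fair ;; p_total ;; p_init ;; p_search ;; p_near ;;
   p_slots ;; p_count)%P.

Definition p_level_r : prog :=
  PFor xX aK (PFor xY aK (PIf
    (BAnd (RLe (RGet rD (rg xX) (rg xY)) (rrg rH))
          (RLe (rrg rLev) (RGet rD (rg xX) (rg xY))))
    (setr rLev (RGet rD (rg xX) (rg xY))) PSkip))%P.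

(** The center of a slot is the slot of least priority in its ball of radius [rScale * rLev], equal
    priorities being ordered by index. The slot itself, which lies in the ball, is the start
    value. *)
Definition p_centers_x : prog :=
  PFor xY aK (PIf (BAnd
      (RLe (RGet rD (rg xX) (rg xY)) (RMul (rrg rScale) (rrg rLev)))
      (BAnd (ILe (iv aPri (rg xY)) (iv aPri (iv aCtr (rg xX))))
         (BNot (BAnd (ILe (iv aPri (iv aCtr (rg xX))) (iv aPri (rg xY)))
                     (ILe (iv aCtr (rg xX)) (rg xY))))))
    (PSetI aCtr (rg xX) (IConst 0) (rg xY)) PSkip)%P.

Definition p_centers : prog :=
  PFor xX aK (PSetI aCtr (rg xX) (IConst 0) (rg xX) ;; p_centers_x)%P.

Definition p_separate : prog :=
  PFor xX aK (PFor xY aK (PIf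
    (BAnd (BNot (IEq (iv aCtr (rg xX)) (iv aCtr (rg xY))))
          (RLt (RGet rU (rg xX) (rg xY)) (rrg rLev)))
    (PSetR rU (rg xX) (rg xY) (rrg rLev)) PSkip))%P.

Definition p_level : prog :=
  (setr rLev (rnat 0) ;; p_level_r ;; p_centers ;; p_separate ;;
   setr rH (RDiv (rrg rLev) (rnat 2)))%P.

(** The two nested loops run [K^2] levels. This exhausts the distances, since each positive level
    disposes at least of the pair that attains it. *)
Definition p_tree : prog :=
  (setr rH (rrg rTot) ;;
   PFor xX aK (PFor xY aK (PSetR rU (rg xX) (rg xY) (rnat 0))) ;;
   PFor xT aK (PFor xT' aK p_level))%P.

(* In the tables [rA] and [rT], -1 marks an unreachable code. *)
Definition p_leaves : prog :=
  PFor xX aK (PSetI aAlive (rg xX) (IConst 0) ione ;;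
    PFor xI aL (PSetI aClu (rg xX) (rg xI) (IGet aCnt0 (rg xX) (rg xI))) ;;
    PFor xV aV (PIf (itrue (iv aFair (rg xV)))
      (PSetR rA (rg xX) (rg xV) (rnat 0)) (PSetR rA (rg xX) (rg xV) rneg1)))%P.

(** Repeatedly merging the closest pair of clusters is Kruskal's algorithm; on an ultrametric it
    turns the hierarchy into a binary tree. The smaller index [aPa] remains the representative, so
    cluster 0 survives all merges. *)
Definition p_closest : prog :=
  (seti aFlag (IConst 0) ;;
   PFor xX aK (PFor xY aK (PIf
     (BAnd (ILt (rg xX) (rg xY))
       (BAnd (BAnd (itrue (iv aAlive (rg xX))) (itrue (iv aAlive (rg xY))))
         (BOr (ILe (rg aFlag) (IConst 0))
           (RLt (RGet rU (rg xX) (rg xY)) (RGet rU (rg aPa) (rg aPb))))))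
     (seti aFlag ione ;; seti aPa (rg xX) ;; seti aPb (rg xY)) PSkip)))%P.

Definition imin (e1 e2 : iexp) : iexp := ISub e1 (ISub e1 e2).

Definition p_match : prog :=
  PFor xI aL (
    seti aCnt (IAdd (rg aCnt) (IAdd
      (imin (ISub (IGet aClu (rg aPa) (rg xI)) (IGet aDig (rg xX) (rg xI)))
            (ISub (IGet aDig (rg xY) (rg xI)) (IGet aClu (rg aPb) (rg xI))))
      (imin (ISub (IGet aDig (rg xX) (rg xI)) (IGet aClu (rg aPa) (rg xI)))
            (ISub (IGet aClu (rg aPb) (rg xI)) (IGet aDig (rg xY) (rg xI)))))) ;;
    PIf (IEq (IAdd (IGet aDig (rg xX) (rg xI)) (IGet aDig (rg xY) (rg xI)))
             (IGet aDig (IAdd (rg xX) (rg xY)) (rg xI)))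
      PSkip (seti aFlag (IConst 0)))%P.

Definition p_try : prog :=
  PIf (BAnd (ILt (IAdd (rg xX) (rg xY)) (rg aV))
      (BAnd (RLe (rnat 0) (RGet rA (rg aPa) (rg xX)))
            (RLe (rnat 0) (RGet rA (rg aPb) (rg xY)))))
    (seti aCnt (IConst 0) ;; seti aFlag ione ;; p_match ;;
     setr rMin (RAdd (RAdd (RGet rA (rg aPa) (rg xX)) (RGet rA (rg aPb) (rg xY)))
       (RMul (rv rMh (rg xT)) (RNat (rg aCnt)))) ;;
     PIf (BAnd (itrue (rg aFlag)) (BOr (RLt (rv rT (IAdd (rg xX) (rg xY))) (rnat 0))
           (RLt (rrg rMin) (rv rT (IAdd (rg xX) (rg xY))))))
       (PSetR rT (IAdd (rg xX) (rg xY)) (IConst 0) (rrg rMin) ;;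
        PSetI aCh (rg xT) (IAdd (rg xX) (rg xY)) (rg xX)) PSkip)
    PSkip%P.

Definition p_convolve : prog :=
  (PFor xV aV (PSetR rT (rg xV) (IConst 0) rneg1) ;;
   PFor xX aV (PFor xY aV p_try))%P.

Definition p_merge : prog :=
  (p_closest ;;
   PSetI aMa (rg xT) (IConst 0) (rg aPa) ;;
   PSetI aMb (rg xT) (IConst 0) (rg aPb) ;;
   PSetR rMh (rg xT) (IConst 0) (RGet rU (rg aPa) (rg aPb)) ;;
   p_convolve ;;
   PFor xV aV (PSetR rA (rg aPa) (rg xV) (rv rT (rg xV))) ;;
   PFor xI aL (PSetI aClu (rg aPa) (rg xI)
     (IAdd (IGet aClu (rg aPa) (rg xI)) (IGet aClu (rg aPb) (rg xI)))) ;;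
   PSetI aAlive (rg aPb) (IConst 0) (IConst 0))%P.

Definition p_dp : prog := (p_leaves ;; PFor xT aK1 p_merge)%P.

(** The merges are undone from the last to the first: the demand of the merged cluster, stored at
    its representative, is split as recorded in [aCh]. *)
Definition p_backtrack : prog :=
  (PFor xX aK (PSetI aNeed (rg xX) (IConst 0) (IConst 0)) ;;
   PSetI aNeed (IConst 0) (IConst 0) (rg aTot) ;;
   PFor xT aK1 (
     seti aTi (ISub (rg aK1) (IAdd (rg xT) ione)) ;;
     seti aFlag (IGet aCh (rg aTi) (iv aNeed (iv aMa (rg aTi)))) ;;
     PSetI aNeed (iv aMb (rg aTi)) (IConst 0)
       (ISub (iv aNeed (iv aMa (rg aTi))) (rg aFlag)) ;;
     PSetI aNeed (iv aMa (rg aTi)) (IConst 0) (rg aFlag)))%P.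

Definition p_stage : prog :=
  PFor xC aN (PFor xX aK (PIf
    (BAnd (BAnd (itrue (iv aCl (rg xC))) (ILe (iv aDone (rg xC)) (IConst 0)))
      (BAnd (IEq (iv aRep (iv aNear (rg xC))) (iv aRep (rg xX)))
        (itrue (IGet aRes (rg xX) (iv aTyp (rg xC))))))
    (PSetI aDone (rg xC) (IConst 0) ione ;;
     PSetI aAsg (rg xC) (IConst 0) (rg xX) ;;
     PSetI aRes (rg xX) (iv aTyp (rg xC))
       (ISub (IGet aRes (rg xX) (iv aTyp (rg xC))) ione)) PSkip))%P.

(** One stage precedes every merge and one follows the last, so a client is served inside the
    smallest cluster that can still serve it. *)
Definition p_greedy : prog :=
  (PFor xX aK (PSetI aRep (rg xX) (IConst 0) (rg xX) ;;
     PFor xI aL (PSetI aRes (rg xX) (rg xI) (IGet aDig (iv aNeed (rg xX)) (rg xI)))) ;;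
   PFor xC aN (PSetI aDone (rg xC) (IConst 0) (IConst 0)) ;;
   PFor xT aK1 (p_stage ;;
     PFor xX aK (PIf (IEq (iv aRep (rg xX)) (iv aMb (rg xT)))
       (PSetI aRep (rg xX) (IConst 0) (iv aMa (rg xT))) PSkip)) ;;
   p_stage)%P.

Definition p_output : prog :=
  (PFor xC aN (PSetI aOpen (rg xC) (IConst 0) (IConst 0)) ;;
   PFor xC aN (PIf (itrue (iv aCl (rg xC)))
     (PSetI aAssign (rg xC) (IConst 0) (iv aCen (iv aAsg (rg xC))) ;;
      PSetI aOpen (iv aCen (iv aAsg (rg xC))) (IConst 0) ione) PSkip))%P.

(** Ratios outside [[1/8, 1/4)] are replaced by 1/8. A zero denominator needs no test: the quotient
    is then 0 and is replaced as well. *)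
Definition p_candidate : prog :=
  (setr rScale (RDiv (RGet rD (rg xP) (rg xQ)) (RGet rD (rg xP') (rg xQ'))) ;;
   PIf (BAnd (RLe (RDiv (rnat 1) (rnat 8)) (rrg rScale))
             (RLt (rrg rScale) (RDiv (rnat 1) (rnat 4))))
     PSkip (setr rScale (RDiv (rnat 1) (rnat 8))) ;;
   p_tree ;; p_dp ;;
   PIf (BAnd (RLe (rnat 0) (RGet rA (IConst 0) (rg aTot)))
         (BOr (ILe (rg aHas) (IConst 0))
              (RLt (RGet rA (IConst 0) (rg aTot)) (rrg rBest))))
     (seti aHas ione ;; setr rBest (RGet rA (IConst 0) (rg aTot)) ;;
      p_backtrack ;; p_greedy ;; p_output) PSkip)%P.

Definition p_solve : prog :=
  PFor xP aK (PFor xQ aK (PFor xP' aK (PFor xQ' aK p_candidate))).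

Definition fair_kmedian : cmd :=
  Seq (compile p_sizes) (Seq (compile p_prepare)
    (Seq (draws aPri xX aK aM) (compile p_solve))).

Lemma wf_sizes : wf (wI p_sizes) p_sizes. Proof. by []. Qed.
Lemma wf_prepare : wf (wI p_prepare) p_prepare. Proof. by []. Qed.
Lemma wf_solve : wf (wI p_solve) p_solve. Proof. by []. Qed.

(** * Input tables *)

Section Prepare.
Context {R : realType}.
Implicit Types (s : state R).

Lemma sizes_spec s : imem s aM 0 0 = 0%N ->
  let n := imem s aN 0 0 in let s' := run p_sizes s in
  [/\ imem s' aK 0 0 = minn (imem s aNopen 0 0) n,
      imem s' aK1 0 0 = (minn (imem s aNopen 0 0) n).-1,
      imem s' aB 0 0 = n.+1, imem s' aM 0 0 = (n * n)%N &
      imem s' aV 0 0 = (n.+1 ^ imem s aL 0 0)%N /\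
      forall i, (i <= imem s aL 0 0)%N -> imem s' aPow i 0 = (n.+1 ^ i)%N].
Proof.
move=> M0 n s'; rewrite /s' /p_sizes !runSeq.
set s3 := run (seti aB _) _.
have kl : imem s3 aL 0 0 = imem s aL 0 0 by [].
have kn : imem s3 aN 0 0 = n by [].
have kM : imem s3 aM 0 0 = 0%N by [].
have k3 : [/\ imem s3 aK 0 0 = minn (imem s aNopen 0 0) n,
      imem s3 aK1 0 0 = (minn (imem s aNopen 0 0) n).-1 & imem s3 aB 0 0 = n.+1].
  rewrite /s3 /n; mem. split. lia. lia. lia.
move: s3 kl kn kM k3 => s3 kl kn kM k3.
set s4 := run (PFor xA aN (seti aM _)) s3.
have M4 : imem s4 aM 0 0 = (n * n)%N.
  apply: (@for_ind _ (fun i s => imem s aM 0 0 = (i * n)%N)) => //.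
  by move=> i s0 lt h _ [kI _]; mem; rewrite h kI // kn mulSn addnC.
set s5 := run (PSetI aPow _ _ _) s4.
set s6 := run (PFor xA aL _) s5.
have [k4 k5] : imem s5 aN 0 0 = n /\ imem s5 aL 0 0 = imem s aL 0 0.
  by rewrite /s5 !(runI (p := PSetI _ _ _ _)) // /s4 !runI.
have H6 : forall i, (i <= imem s aL 0 0)%N -> imem s6 aPow i 0 = (n.+1 ^ i)%N.
  apply: (@for_ind _ (fun m s => forall i, (i <= m)%N -> imem s aPow i 0 = (n.+1 ^ i)%N)) => //.
    by move=> [|i] // _.
  move=> i s0 lt h xi [kI _] j; rewrite leq_eqVlt => /predU1P[->|ltj].
    rewrite runSeq; set s7 := run (PSetI _ _ _ _) s0.
    have n7 : imem s7 aN 0 0 = n by rewrite /s7 runI // kI.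
    rewrite expnSr mulnSr addnC.
    have i7 : imem s7 aPow i.+1 0 = (n.+1 ^ i)%N.
      by rewrite /s7; mem; rewrite xi addn1 eqxx /= h.
    suff [] : imem (run (PFor xB aN (PSetI aPow (IAdd (rg xA) ione) (IConst 0)
        (IAdd (iv aPow (IAdd (rg xA) ione)) (iv aPow (rg xA))))) s7) aPow i.+1 0 =
          (n.+1 ^ i + n.+1 ^ i * n)%N /\
       forall j, (j <= i)%N -> imem (run (PFor xB aN (PSetI aPow (IAdd (rg xA) ione) (IConst 0)
        (IAdd (iv aPow (IAdd (rg xA) ione)) (iv aPow (rg xA))))) s7) aPow j 0 = (n.+1 ^ j)%N by [].
    apply: (@for_ind _ (fun m s => imem s aPow i.+1 0 = (n.+1 ^ i + n.+1 ^ i * m)%N /\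
      forall j, (j <= i)%N -> imem s aPow j 0 = (n.+1 ^ j)%N)) => //.
      split; first by rewrite i7 muln0 addn0.
      by move=> k lek; rewrite /s7; mem; rewrite xi addn1 ltn_eqF ?ltnS //= h.
    move=> m s8 ltm [h8 h8'] xm [k8 _]; mem.
    have x8 : imem s8 xA 0 0 = i by rewrite k8 // /s7; mem.
    rewrite x8 addn1 eqxx h8 h8' // mulnS; split; first by lia.
    by move=> k lek; rewrite ltn_eqF ?ltnS //= h8'.
  rewrite ltnS in ltj.
  rewrite runSeq; set s7 := run (PSetI _ _ _ _) s0.
  suff : forall j, (j <= i)%N -> imem (run (PFor xB aN (PSetI aPow (IAdd (rg xA) ione) (IConst 0)
        (IAdd (iv aPow (IAdd (rg xA) ione)) (iv aPow (rg xA))))) s7) aPow j 0 = (n.+1 ^ j)%N by apply.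
  have n7 : imem s7 aN 0 0 = n by rewrite /s7 runI // kI.
  apply: (@for_ind _ (fun m s => forall j, (j <= i)%N -> imem s aPow j 0 = (n.+1 ^ j)%N) n) => //.
    by move=> k lek; rewrite /s7; mem; rewrite xi addn1 ltn_eqF ?ltnS //= h.
  move=> m s8 ltm h8 xm [k8 _] k lek; mem.
  have x8 : imem s8 xA 0 0 = i by rewrite k8 // /s7; mem.
  by rewrite x8 addn1 ltn_eqF ?ltnS //= h8.
have k6 a i j : a \notin wI (PFor xA aL (PSetI aPow (IAdd (rg xA) ione) (IConst 0) (iv aPow (rg xA)) ;;
    PFor xB aN (PSetI aPow (IAdd (rg xA) ione) (IConst 0)
      (IAdd (iv aPow (IAdd (rg xA) ione)) (iv aPow (rg xA)))))) ->
    a \notin wI (PFor xA aN (seti aM (IAdd (rg aM) (rg aN)))) ->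
    imem s6 a i j = imem s3 a i j.
  move=> h1 h2; rewrite runI // /s5 runI; last by apply: contra h1; rewrite !inE => /eqP->.
  by rewrite /s4 runI.
case: k3 => h1 h2 h3; split; first (by rewrite runI // k6); first (by rewrite runI // k6);
  first (by rewrite runI // k6); first by rewrite runI // runI // /s5 runI.
split; last by move=> i lei; rewrite runI // H6.
by rewrite runSetI; mem; rewrite (k6 aL) // kl H6.
Qed.

Lemma types_spec s :
  let n := imem s aN 0 0 in let l := imem s aL 0 0 in let s' := run p_types s in
  (forall c, (c < n)%N -> imem s aCl c 0 = 0%N) ->
  forall c, (c < n)%N ->
  [/\ (imem s' aCl c 0 <= 1)%N,
      (0 < imem s' aCl c 0)%N ->
        (imem s' aTyp c 0 < l)%N /\ (0 < imem s aGroup (imem s' aTyp c 0) c)%N &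
      forall g, (g < l)%N -> (0 < imem s aGroup g c)%N -> (0 < imem s' aCl c 0)%N].
Proof.
move=> n l s' h0.
pose P i j s' := forall c, (c < n)%N ->
  [/\ (imem s' aCl c 0 <= 1)%N,
      (0 < imem s' aCl c 0)%N ->
        (imem s' aTyp c 0 < l)%N /\ (0 < imem s aGroup (imem s' aTyp c 0) c)%N &
      forall g, (g < i)%N || (g == i) && (c < j)%N ->
        (0 < imem s aGroup g c)%N -> (0 < imem s' aCl c 0)%N].
suff : P l 0%N s'.
  move=> h c ltc; have [h1 h2 h3] := h c ltc; split=> // g gl.
  by apply: h3; rewrite gl.
apply: (@for2_ind _ P l n) => //.
- move=> i s1 lti h c ltc; have [h1 h2 h3] := h c ltc; split=> // g.
  by rewrite andbF orbF ltnS leq_eqVlt => /orP[/eqP->|gi]; apply: h3;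
    rewrite ?eqxx ?ltc ?gi ?orbT.
- by move=> c ltc; split; rewrite h0 // => g; rewrite andbF.
move=> i j s1 lti ltj h xi xj [kI _] c ltc; have [h1 h2 h3] := h c ltc.
rewrite runIf /= xi xj kI //; case: ifP => hg; last first.
  rewrite runSkip; split=> // g /orP[gi|/andP[/eqP-> cj]]; first by apply: h3; rewrite gi.
  move: cj; rewrite ltnS leq_eqVlt => /orP[/eqP->|cj]; first by rewrite hg.
  by apply: h3; rewrite eqxx cj orbT.
mem; rewrite !xj xi; case: (altP (c =P j)) => [->|ncj]; first by split=> //; rewrite hg.
split=> // g /orP[gi|/andP[/eqP-> cj]]; first by apply: h3; rewrite gi.
by apply: h3; rewrite eqxx orbC ltn_neqAle ncj -ltnS cj.
Qed.

(** Adding 1 with carry: after [m] digits, the new partial value plus the carry times [(n + 1)^m] is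
    1 plus the old partial value. A carry may be left over at the end, when the old code was the
    last one. *)
Lemma digits_row_spec s (v n l : nat) :
  imem s aL 0 0 = l -> imem s xV 0 0 = v -> imem s aB 0 0 = n.+1 -> imem s aCarry 0 0 = 1%N ->
  (forall i, (i < l)%N -> (imem s aDig v i <= n)%N) ->
  let s' := run p_digits_row s in
  [/\ forall w i, w != v.+1 -> imem s' aDig w i = imem s aDig w i,
      forall i, (i < l)%N -> (imem s' aDig v.+1 i <= n)%N &
      exists2 c, (c <= 1)%N & (\sum_(i < l) imem s' aDig v.+1 i * n.+1 ^ i + c * n.+1 ^ l =
        1 + \sum_(i < l) imem s aDig v i * n.+1 ^ i)%N].
Proof.
move=> hl hv hB hc hd s'.
pose P m s' := [/\ forall w i, w != v.+1 -> imem s' aDig w i = imem s aDig w i,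
      forall i, (i < m)%N -> (imem s' aDig v.+1 i <= n)%N,
      (imem s' aCarry 0 0 <= 1)%N &
      (\sum_(i < m) imem s' aDig v.+1 i * n.+1 ^ i + imem s' aCarry 0 0 * n.+1 ^ m =
        1 + \sum_(i < m) imem s aDig v i * n.+1 ^ i)%N].
suff : P l s' by case=> h1 h2 h3 h4; split=> //; exists (imem s' aCarry 0 0).
apply: (@for_ind _ P l) => //; first by split; rewrite ?hc // !big_ord0.
move=> i s1 lti [h1 h2 h3 h4] xi [kI _].
have vv : (v == v.+1) = false by lia.
have d1 : imem s1 aDig v i = imem s aDig v i by rewrite h1 ?vv.
have v1 : imem s1 xV 0 0 = v by rewrite kI.
have B1 : imem s1 aB 0 0 = n.+1 by rewrite kI.
have := hd i lti; rewrite runIf /= xi v1 B1 d1 => dn.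
have new s2 : (forall w j, imem s2 aDig w j =
     if (w == v.+1) && (j == i) then imem s2 aDig v.+1 i else imem s1 aDig w j) ->
   (imem s2 aDig v.+1 i <= n)%N -> (imem s2 aCarry 0 0 <= 1)%N ->
   (imem s2 aDig v.+1 i + imem s2 aCarry 0 0 * n.+1 = imem s aDig v i + imem s1 aCarry 0 0)%N ->
   P i.+1 s2.
  move=> e2 b2 c2 q2; split=> //.
  - by move=> w j wv; rewrite e2 (negbTE wv) /= h1.
  - move=> j; rewrite ltnS leq_eqVlt => /orP[/eqP-> //|ji].
    by rewrite e2 (ltn_eqF ji) andbF h2.
  - rewrite !big_ord_recr /=.
    have -> : (\sum_(j < i) imem s2 aDig v.+1 j * n.+1 ^ j =
       \sum_(j < i) imem s1 aDig v.+1 j * n.+1 ^ j)%N.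
      by apply: eq_bigr => j _; rewrite e2 (ltn_eqF (ltn_ord j)) andbF.
    move: h4; rewrite expnS; set A := (\sum_(_ < _) _)%N; set C := (\sum_(_ < _) _)%N.
    set E := (n.+1 ^ i)%N; nia.
case: ifP => hif; apply: new; mem; rewrite ?xi ?v1 ?addn1 ?eqxx ?vv /= ?d1; try lia.
- move: h3 dn hif; move: (imem s1 aCarry 0 0) (imem s aDig v i) => c d; case: c => [|[|c]] //; lia.
Qed.

Lemma digits_spec s (n l : nat) :
  imem s aL 0 0 = l -> imem s aB 0 0 = n.+1 -> imem s aV 0 0 = (n.+1 ^ l)%N ->
  (forall i, imem s aDig 0 i = 0%N) ->
  let s' := run p_digits s in
  forall v, (v < n.+1 ^ l)%N ->
    (forall i, (i < l)%N -> (imem s' aDig v i <= n)%N) /\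
    (\sum_(i < l) imem s' aDig v i * n.+1 ^ i = v)%N.
Proof.
move=> hl hB hV h0 s'.
pose P m s' := forall v, (v <= m)%N -> (v < n.+1 ^ l)%N ->
    (forall i, (i < l)%N -> (imem s' aDig v i <= n)%N) /\
    (\sum_(i < l) imem s' aDig v i * n.+1 ^ i = v)%N.
suff : P (n.+1 ^ l)%N s' by move=> h v lv; apply: h => //; exact: ltnW.
apply: (@for_ind _ P (n.+1 ^ l)%N) => //.
  move=> v; rewrite leqn0 => /eqP-> _; split=> [i _|]; first by rewrite h0.
  by rewrite big1 // => i _; rewrite h0.
move=> m s1 ltm h xm [kI _]; rewrite runSeq; set s2 := run (seti _ _) s1.
have [hm1 hm2] := h m (leqnn _) ltm.
have [|||||k2 d2 [c c1 e2]] := @digits_row_spec s2 m n l.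
- by rewrite /s2; mem; rewrite kI.
- by rewrite /s2; mem.
- by rewrite /s2; mem; rewrite kI.
- by rewrite /s2; mem.
- by move=> i lti; rewrite /s2; mem; apply: hm1.
move=> v; rewrite leq_eqVlt => /orP[/eqP->|lv] ltv; last first.
  have [v1 v2] := h v lv ltv; have nv : v != m.+1 by rewrite neq_ltn lv.
  split=> [i li|]; first by rewrite k2 // /s2; mem; apply: v1.
  by rewrite -[RHS]v2; apply: eq_bigr => i _; rewrite k2.
(* A final carry would force the next code to reach [n.+1 ^ l], which it does not. *)
split=> //; move: e2; rewrite hm2 => e2; case: c c1 e2 => [|[]] // _ e2; lia.
Qed.

Lemma fair_tot_spec s (l v : nat) :
  imem s aL 0 0 = l -> imem s xV 0 0 = v -> imem s aCnt 0 0 = 0%N ->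
  imem (run p_fair_tot s) aCnt 0 0 = (\sum_(i < l) imem s aDig v i)%N.
Proof.
move=> hl hv h0.
apply: (@for_ind _ (fun m s' => imem s' aCnt 0 0 = \sum_(i < m) imem s aDig v i)%N l) => //.
  by rewrite big_ord0.
move=> i s1 lti h xi [kI _]; mem; rewrite h xi big_ord_recr /=.
by rewrite (kI xV) // hv (kI aDig).
Qed.

Lemma fair_ok_spec s (l v : nat) :
  imem s aL 0 0 = l -> imem s xV 0 0 = v -> imem s aFlag 0 0 = 1%N ->
  (imem (run p_fair_ok s) aFlag 0 0 <= 1)%N /\
  ((0 < imem (run p_fair_ok s) aFlag 0 0)%N <->
   forall i, (i < l)%N ->
     rmem s rAlpha i 0 * (imem s aCnt 0 0)%:R <= (imem s aDig v i)%:R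
       <= rmem s rBeta i 0 * (imem s aCnt 0 0)%:R).
Proof.
move=> hl hv h0.
pose P m s' := (imem s' aFlag 0 0 <= 1)%N /\
  ((0 < imem s' aFlag 0 0)%N <-> forall i, (i < m)%N ->
     rmem s rAlpha i 0 * (imem s aCnt 0 0)%:R <= (imem s aDig v i)%:R
       <= rmem s rBeta i 0 * (imem s aCnt 0 0)%:R).
apply: (@for_ind _ P l) => //; first by split; rewrite h0.
move=> i s1 lti [h1 h2] xi [kI kR].
rewrite runIf /= xi (kI xV) // hv (kI aDig) // (kI aCnt) // !kR //.
case: ifP => hif.
  split=> //; rewrite runSkip h2; split=> h j; last by move=> lj; apply: h; rewrite ltnS ltnW.
  by rewrite ltnS leq_eqVlt => /predU1P[->|/h].
split; first by mem.
by mem; split=> // /(_ i (leqnn _)); rewrite hif.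
Qed.

Lemma fair_spec s (l V : nat) :
  imem s aL 0 0 = l -> imem s aV 0 0 = V ->
  forall v, (v < V)%N ->
  (0 < imem (run p_fair s) aFair v 0)%N <->
   forall i, (i < l)%N ->
     rmem s rAlpha i 0 * (\sum_(j < l) imem s aDig v j)%:R <= (imem s aDig v i)%:R
       <= rmem s rBeta i 0 * (\sum_(j < l) imem s aDig v j)%:R.
Proof.
move=> hl hV.
apply: (@for_ind _ (fun m s' => forall v, (v < m)%N -> (0 < imem s' aFair v 0)%N <->
   forall i, (i < l)%N ->
     rmem s rAlpha i 0 * (\sum_(j < l) imem s aDig v j)%:R <= (imem s aDig v i)%:R
       <= rmem s rBeta i 0 * (\sum_(j < l) imem s aDig v j)%:R) V) => //.
move=> m s1 ltm h xm [kI kR] v; rewrite !runSeq.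
set s2 := run (seti aCnt _) s1; set s3 := run p_fair_tot s2.
set s4 := run (seti aFlag _) s3; set s5 := run p_fair_ok s4.
have e3 : imem s3 aCnt 0 0 = (\sum_(i < l) imem s aDig m i)%N.
  rewrite (@fair_tot_spec _ l m) //; first by apply: eq_bigr => i _; rewrite /s2; mem; rewrite kI.
  by rewrite /s2; mem; rewrite kI.
have L4 : imem s4 aL 0 0 = l by rewrite /s4 /s3 /s2; frame; rewrite kI.
have V4 : imem s4 xV 0 0 = m by rewrite /s4 /s3 /s2; frame.
have C4 : imem s4 aCnt 0 0 = (\sum_(i < l) imem s aDig m i)%N by rewrite /s4; frame.
have D4 i j : imem s4 aDig i j = imem s aDig i j by rewrite /s4 /s3 /s2; frame; rewrite kI.
have R4 a i j : rmem s4 a i j = rmem s a i j by rewrite /s4 /s3 /s2; frame; rewrite kR.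
have V5 : imem s5 xV 0 0 = m by rewrite /s5; frame.
have F5 i : imem s5 aFair i 0 = imem s1 aFair i 0 by rewrite /s5 /s4 /s3 /s2; frame.
have [] := @fair_ok_spec s4 l m L4 V4; first by rewrite /s4; mem.
rewrite -/s5 => b5 f5; mem; rewrite V5 ltnS leq_eqVlt.
case: eqP => [->|_] /=.
  move=> _; rewrite f5 C4; split=> H i li; have := H i li; rewrite !R4 D4 //.
by rewrite F5; apply: h.
Qed.

End Prepare.

(** * Local search for k-median: the program *)

Section Minf.
Context {R : realType}.

(** Mirrors the loops [p_far_dist] and [p_eval_min]: a start value, replaced only on strict
    decrease. *)
Fixpoint minf (top : R) (f : nat -> R) (m : nat) : R :=
  if m is k.+1 then if f k < minf top f k then f k else minf top f k else top.

Lemma minf_leS top f m : minf top f m.+1 <= minf top f m.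
Proof. by rewrite /=; case: ltP => // /ltW. Qed.

Lemma minf_anti top f m m' : (m <= m')%N -> minf top f m' <= minf top f m.
Proof.
elim: m' => [|m' IH]; first by rewrite leqn0 => /eqP->.
rewrite leq_eqVlt => /predU1P[->//|lt]; exact: le_trans (minf_leS _ _ _) (IH lt).
Qed.

Lemma minf_le top f m i : (i < m)%N -> minf top f m <= f i.
Proof.
by move=> lt; apply: le_trans (minf_anti top f lt) _; rewrite /=; case: ltP.
Qed.

Lemma minf_top top f m : minf top f m <= top.
Proof. exact: (minf_anti top f (leq0n m)). Qed.

Lemma minf_ex top f m : minf top f m = top \/ exists2 i, (i < m)%N & minf top f m = f i.
Proof.
elim: m => [|m IH] /=; first by left.
case: ltP => _; first by right; exists m.
by case: IH => [|[i lt e]]; [left|right; exists i => //; exact: ltnW].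
Qed.

Lemma le_minf top f g m : (forall i, (i < m)%N -> f i <= g i) -> minf top f m <= minf top g m.
Proof.
move=> h; case: (minf_ex top g m) => [->|[i lt ->]]; first exact: minf_top.
exact: le_trans (minf_le top f lt) (h i lt).
Qed.

Lemma eq_minf top f g m : (forall i, (i < m)%N -> f i = g i) -> minf top f m = minf top g m.
Proof. by move=> h; apply/eqP; rewrite eq_le !le_minf // => i /h->. Qed.

End Minf.

Definition upd (t : nat -> nat) (j o i : nat) : nat := if i == j then o else t i.

Definition mind (R : realType) (d : nat -> nat -> R) (t : nat -> nat) (K c : nat) : R :=
  minf (d c (t 0%N)) (fun i => d c (t i)) K.

Definition kcost (R : realType) (d : nat -> nat -> R) (cl : nat -> bool) (n K : nat)
    (t : nat -> nat) : R :=
  \sum_(c < n | cl c) mind d t K c.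

Lemma kcost_ext (R : realType) (d : nat -> nat -> R) cl n K t t' :
  (0 < K)%N -> (forall i, (i < K)%N -> t i = t' i) -> kcost d cl n K t = kcost d cl n K t'.
Proof.
move=> K0 h; apply: eq_bigr => c _; rewrite /mind h //; apply: eq_minf => i /h-> //.
Qed.

Section Kmedian.
Context {R : realType}.
Implicit Types (s : state R).

Lemma total_spec s n : imem s aN 0 0 = n ->
  (forall x y, 0 <= rmem s rDist x y) -> 0 <= rmem s rTot 0 0 ->
  forall x y, (x < n)%N -> (y < n)%N -> rmem s rDist x y <= rmem (run p_total s) rTot 0 0.
Proof.
move=> hn d0 t0.
pose P i j s' := 0 <= rmem s' rTot 0 0 /\ forall x y, (x < n)%N -> (y < n)%N ->
  (x < i)%N || (x == i) && (y < j)%N -> rmem s rDist x y <= rmem s' rTot 0 0.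
suff : P n 0%N (run p_total s) by move=> [_ h] x y xn yn; apply: h; rewrite // xn.
apply: (@for2_ind _ P n n) => //.
- move=> i s1 lti [h0 h]; split=> // x y xn yn.
  rewrite ltn0 andbF orbF ltnS leq_eqVlt => /orP[/eqP->|xi]; apply: h => //.
    by rewrite eqxx yn orbT.
  by rewrite xi.
- by split=> // x y _ _; rewrite ltn0 andbF.
move=> i j s1 lti ltj [h0 h] xi xj [_ kR]; rewrite /P; mem; rewrite (kR rDist) // xi xj.
split=> [|x y xn yn]; first exact: addr_ge0.
case/orP=> [xi'|/andP[/eqP-> yj]].
  by apply: le_trans (h x y xn yn _) _; rewrite ?xi' // lerDl.
move: yj; rewrite ltnS leq_eqVlt => /orP[/eqP->|yj]; first by rewrite lerDr.
by apply: le_trans (h i y lti yn _) _; rewrite ?eqxx ?yj ?orbT // lerDl.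
Qed.

Lemma far_dist_spec s K J c : imem s aK 0 0 = K -> imem s xJ 0 0 = J -> imem s xC 0 0 = c ->
  rmem (run p_far_dist s) rMin 0 0 =
  minf (rmem s rMin 0 0) (fun i => rmem s rDist c (imem s aCen i 0)) (minn K J).
Proof.
move=> hK hJ hc.
apply: (@for_ind _ (fun m s' => rmem s' rMin 0 0 =
  minf (rmem s rMin 0 0) (fun i => rmem s rDist c (imem s aCen i 0)) (minn m J)) K) => //.
  by rewrite min0n.
move=> i s1 lti h xi [kI kR]; rewrite runIf /= (kI xJ) // hJ (kI xC) // hc xi (kI aCen) // !(kR rDist) // h -!ltNge.
case: ltnP => iJ.
  rewrite (minn_idPl iJ) /=; case: ifP => _; last by rewrite runSkip h (minn_idPl (ltnW iJ)).
  by mem; rewrite (kI xC) // hc xi (kI aCen) // (kR rDist).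
by rewrite runSkip h (minn_idPr iJ) (minn_idPr (leqW iJ)).
Qed.

Lemma far_spec s n K J : imem s aN 0 0 = n -> imem s aK 0 0 = K -> imem s xJ 0 0 = J ->
  (J <= K)%N -> rmem s rFar 0 0 = -1 -> (forall c i, 0 <= rmem s rDist c i) -> 0 <= rmem s rTot 0 0 ->
  let m c := minf (rmem s rTot 0 0) (fun i => rmem s rDist c (imem s aCen i 0)) J in
  let x := imem (run p_far s) aFx 0 0 in
  forall c, (c < n)%N -> (0 < imem s aCl c 0)%N ->
    [/\ (x < n)%N, (0 < imem s aCl x 0)%N & m c <= m x].
Proof.
move=> hn hK hJ JK far d0 t0 m x.
have m0 c : 0 <= m c by rewrite /m; case: (minf_ex (rmem s rTot 0 0) (fun i => rmem s rDist c (imem s aCen i 0)) J) => [->|[i _ ->]].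
pose P i s' := (rmem s' rFar 0 0 = -1 /\ forall c, (c < i)%N -> imem s aCl c 0 = 0%N) \/
  [/\ (imem s' aFx 0 0 < n)%N, (0 < imem s aCl (imem s' aFx 0 0) 0)%N,
   rmem s' rFar 0 0 = m (imem s' aFx 0 0) &
   forall c, (c < i)%N -> (0 < imem s aCl c 0)%N -> m c <= rmem s' rFar 0 0].
suff : P n (run p_far s).
  case=> [[_ h] c cn|[h1 h2 h3 h4] c cn hc]; first by rewrite h.
  by split=> //; rewrite -h3 h4.
apply: (@for_ind _ P n) => //; first by left.
move=> i s1 lti h xi [kI kR]; rewrite runIf /= xi (kI aCl) //.
case: posnP => cl0 /=.
  rewrite runSkip; case: h => [[h1 h2]|[h1 h2 h3 h4]]; [left|right]; split=> // c.
    by rewrite ltnS leq_eqVlt => /predU1P[->|/h2].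
  by rewrite ltnS leq_eqVlt => /predU1P[->|/h4//]; rewrite cl0.
rewrite !runSeq; set s2 := run (setr _ _) s1; set s3 := run p_far_dist s2.
have m3 : rmem s3 rMin 0 0 = m i.
  rewrite /s3 (@far_dist_spec _ K J i); last 3 first.
  - by rewrite /s2; frame; rewrite kI.
  - by rewrite /s2; frame; rewrite kI.
  - by rewrite /s2; frame.
  rewrite (minn_idPr JK) /m /s2; mem; rewrite kR //.
  by apply: eq_minf => k _; rewrite kI // kR.
have f3 : rmem s3 rFar 0 0 = rmem s1 rFar 0 0 by rewrite /s3 /s2; frame; mem.
have x3 : imem s3 aFx 0 0 = imem s1 aFx 0 0 by rewrite /s3 /s2; frame.
have c3 : imem s3 xC 0 0 = i by rewrite /s3 /s2; frame.
rewrite runIf /= m3 f3; case: ltP => [lt|le] /=; rewrite /P; mem; last first.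
  rewrite runSkip f3 x3; case: h => [[h1 h2]|[h1 h2 h3 h4]].
    by move: le; rewrite h1 => /(le_trans (m0 i)); rewrite ler0N1.
  right; split=> // c; rewrite ltnS leq_eqVlt => /predU1P[->//|/h4]; exact.
rewrite m3 c3; right; split=> // c; rewrite ltnS leq_eqVlt => /predU1P[->//|ci hc].
case: h => [[h1 h2]|[h1 h2 h3 h4]]; first by rewrite h2 in hc.
exact: le_trans (h4 c ci hc) (ltW lt).
Qed.

Lemma near_fac_spec s n J x : imem s aN 0 0 = n -> imem s xJ 0 0 = J -> imem s aFx 0 0 = x ->
  (forall o, (o < n)%N -> rmem s rDist x o <= rmem s rMin 0 0) ->
  let s' := run p_near_fac s in
  (forall j, j != J -> imem s' aCen j 0 = imem s aCen j 0) /\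
  forall o, (o < n)%N -> (0 < imem s aFac o 0)%N ->
    [/\ (imem s' aCen J 0 < n)%N, (0 < imem s aFac (imem s' aCen J 0) 0)%N &
        rmem s rDist x (imem s' aCen J 0) <= rmem s rDist x o].
Proof.
move=> hn hJ hx hd s'.
pose P i s' := (forall j, j != J -> imem s' aCen j 0 = imem s aCen j 0) /\
  (((forall o, (o < i)%N -> imem s aFac o 0 = 0%N) /\ rmem s' rMin 0 0 = rmem s rMin 0 0) \/
  [/\ (imem s' aCen J 0 < n)%N, (0 < imem s aFac (imem s' aCen J 0) 0)%N,
      rmem s' rMin 0 0 = rmem s rDist x (imem s' aCen J 0) &
      forall o, (o < i)%N -> (0 < imem s aFac o 0)%N -> rmem s' rMin 0 0 <= rmem s rDist x o]).
suff : P n s'.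
  case=> h [[h0 _]|[h1 h2 h3 h4]]; split=> // o on fo; first by rewrite h0 in fo.
  by split=> //; rewrite -h3 h4.
apply: (@for_ind _ P n) => //; first by split=> //; left.
move=> i s1 lti [h h'] xi [kI kR]; rewrite runIf /= xi (kI aFac) // (kI aFx) // hx (kR rDist) //.
case: posnP => f0 /=.
  rewrite runSkip; split=> //; case: h' => [[h1 h2]|[h1 h2 h3 h4]]; [left|right]; split=> // o.
    by rewrite ltnS leq_eqVlt => /predU1P[->|/h1].
  by rewrite ltnS leq_eqVlt => /predU1P[->|/h4//]; rewrite f0.
have J1 : imem s1 xJ 0 0 = J by rewrite kI.
have x1 : imem s1 aFx 0 0 = x by rewrite kI.
case: leP => hif; rewrite /P; mem.
  rewrite J1 x1 xi (kR rDist) // eqxx; split=> [j jJ|]; first by rewrite (negbTE jJ) h.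
  right; split=> // o; rewrite ltnS leq_eqVlt => /predU1P[->//|oi fo].
  case: h' => [[h1 h2]|[h1 h2 h3 h4]]; first by rewrite h1 in fo.
  exact: le_trans hif (h4 o oi fo).
rewrite runSkip; split=> //; case: h' => [[h1 h2]|[h1 h2 h3 h4]].
  by move: hif; rewrite h2 ltNge hd.
right; split=> // o; rewrite ltnS leq_eqVlt => /predU1P[->_|oi fo]; last exact: h4.
exact: ltW.
Qed.

(** Each slot keeps a witness: the client that was farthest from the earlier slots and for which the
    slot was opened. Later rounds leave the earlier slots alone, so the witnesses persist. *)
Lemma init_spec s n K : imem s aN 0 0 = n -> imem s aK 0 0 = K ->
  (forall c i, 0 <= rmem s rDist c i) -> 0 <= rmem s rTot 0 0 ->
  (forall x y, (x < n)%N -> (y < n)%N -> rmem s rDist x y <= rmem s rTot 0 0) ->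
  let cen j := imem (run p_init s) aCen j 0 in
  let m j c := minf (rmem s rTot 0 0) (fun i => rmem s rDist c (cen i)) j in
  forall c o, (c < n)%N -> (0 < imem s aCl c 0)%N -> (o < n)%N -> (0 < imem s aFac o 0)%N ->
  forall j, (j < K)%N -> exists x, [/\ (x < n)%N, (0 < imem s aCl x 0)%N,
    (cen j < n)%N, (0 < imem s aFac (cen j) 0)%N & 
    (forall o, (o < n)%N -> (0 < imem s aFac o 0)%N -> rmem s rDist x (cen j) <= rmem s rDist x o) /\
    (forall c, (c < n)%N -> (0 < imem s aCl c 0)%N -> m j c <= m j x)].
Proof.
move=> hn hK d0 t0 ht cen m c0 o0 c0n hc0 o0n ho0.
pose Q (cen : nat -> nat) j x := [/\ (x < n)%N, (0 < imem s aCl x 0)%N,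
    (cen j < n)%N, (0 < imem s aFac (cen j) 0)%N & 
    (forall o, (o < n)%N -> (0 < imem s aFac o 0)%N -> rmem s rDist x (cen j) <= rmem s rDist x o) /\
    (forall c, (c < n)%N -> (0 < imem s aCl c 0)%N ->
      minf (rmem s rTot 0 0) (fun i => rmem s rDist c (cen i)) j <=
      minf (rmem s rTot 0 0) (fun i => rmem s rDist x (cen i)) j)].
apply: (@for_ind _ (fun m s' => forall j, (j < m)%N -> exists x, Q (fun j => imem s' aCen j 0) j x) K) => //.
move=> i s1 lti h xi [kI kR] j; rewrite !runSeq.
set s2 := run (setr rFar _) s1; set s3 := run p_far s2; set s4 := run (setr rMin _) s3.
set s5 := run p_near_fac s4.
have [||||||||x1 x2 x3] := @far_spec s2 n K i _ _ _ _ _ _ _ c0 c0n.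
- by rewrite /s2; frame; rewrite kI.
- by rewrite /s2; frame; rewrite kI.
- by rewrite /s2; frame.
- exact: ltnW.
- by rewrite /s2; mem; rewrite sub0r.
- by move=> a b; rewrite /s2; mem; rewrite kR.
- by rewrite /s2; mem; rewrite kR.
- by rewrite /s2; mem; rewrite kI.
have [||||k5 h5] := @near_fac_spec s4 n i (imem s3 aFx 0 0).
- by rewrite /s4 /s3 /s2; frame; rewrite kI.
- by rewrite /s4 /s3 /s2; frame.
- by rewrite /s4; frame.
- move=> o on; rewrite /s4; mem; rewrite /s3 /s2; frame; rewrite !kR //.
  by apply: ht.
have [|y1 y2 y3] := h5 o0 o0n; first by rewrite /s4 /s3 /s2; frame; rewrite kI.
have k4 k : k != i -> imem s5 aCen k 0 = imem s1 aCen k 0.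
  by move=> ki; rewrite k5 // /s4 /s3 /s2; frame.
rewrite ltnS leq_eqVlt => /predU1P[->|ji]; last first.
  have [x [q1 q2 q3 q4 [q5 q6]]] := h j ji; exists x.
  have kj : imem s5 aCen j 0 = imem s1 aCen j 0 by rewrite k4 // ltn_eqF.
  split; rewrite ?kj //; split=> // c cn hc.
  have e c' : minf (rmem s rTot 0 0) (fun k => rmem s rDist c' (imem s5 aCen k 0)) j =
     minf (rmem s rTot 0 0) (fun k => rmem s rDist c' (imem s1 aCen k 0)) j.
    by apply: eq_minf => k kj'; rewrite k4 // ltn_eqF // (ltn_trans kj').
  by rewrite !e q6.
exists (imem s3 aFx 0 0).
have F4 k : imem s4 aFac k 0 = imem s aFac k 0 by rewrite /s4 /s3 /s2; frame; rewrite kI.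
have C2 k : imem s2 aCl k 0 = imem s aCl k 0 by rewrite /s2; frame; rewrite kI.
have D4 a b : rmem s4 rDist a b = rmem s rDist a b by rewrite /s4 /s3 /s2; frame; rewrite kR.
rewrite -/s3 C2 in x2; rewrite -/s3 in x1; rewrite -/s5 F4 in y2.
split=> //; split=> [o on fo|c cn hc].
  by have [|_ _] := h5 o on; rewrite ?F4 // !D4.
have [||||||||_ _] := @far_spec s2 n K i _ _ _ _ _ _ _ c cn.
- by rewrite /s2; frame; rewrite kI.
- by rewrite /s2; frame; rewrite kI.
- by rewrite /s2; frame.
- exact: ltnW.
- by rewrite /s2; mem; rewrite sub0r.
- by move=> a b; rewrite /s2; mem; rewrite kR.
- by rewrite /s2; mem; rewrite kR.
- by rewrite C2.
rewrite -/s3.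
have e c' : minf (rmem s2 rTot 0 0) (fun k => rmem s2 rDist c' (imem s2 aCen k 0)) i =
   minf (rmem s rTot 0 0) (fun k => rmem s rDist c' (imem s5 aCen k 0)) i.
  rewrite /s2; mem; rewrite kR //; apply: eq_minf => k ki; rewrite k4 ?ltn_eqF //.
  by rewrite kR.
by rewrite !e.
Qed.

Lemma eval_spec s n K : imem s aN 0 0 = n -> imem s aK 0 0 = K ->
  rmem (run p_eval s) rVal 0 0 =
  kcost (fun x y => rmem s rDist x y) (fun c => 0 < imem s aCl c 0)%N n K (fun i => imem s aTmp i 0).
Proof.
move=> hn hK; rewrite /p_eval runSeq; set s1 := run (setr _ _) s.
set d := (fun x y => rmem s rDist x y); set t := (fun i => imem s aTmp i 0).
rewrite /kcost big_mkcond.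
apply: (@for_ind _ (fun m s' => rmem s' rVal 0 0 =
  \sum_(c < m) if (0 < imem s aCl c 0)%N then mind d t K c else 0) n).
- by rewrite /s1; frame.
- by [].
- by [].
- by rewrite big_ord0 /s1; mem.
move=> i s2 lti h xi [kI kR]; rewrite big_ord_recr /= -h.
have cl2 : imem s2 aCl i 0 = imem s aCl i 0 by rewrite kI // /s1; frame.
rewrite runIf /= xi cl2; case: posnP => _ /=; first by rewrite runSkip addr0.
set s3 := run (setr rMin _) s2; set s4 := run p_eval_min s3.
have t3 k : imem s3 aTmp k 0 = t k by rewrite /s3; frame; rewrite kI // /s1; frame.
have d3 x y : rmem s3 rDist x y = d x y by rewrite /s3; frame; rewrite kR // /s1; frame.
have x3 : imem s3 xC 0 0 = i by rewrite /s3; frame.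
have m3 : rmem s3 rMin 0 0 = d i (t 0%N).
  rewrite /s3; mem; rewrite xi kR //; rewrite /s1; frame; rewrite /d /t.
  by congr (rmem _ _ _ _); rewrite kI // /s1; frame.
have m4 : rmem s4 rMin 0 0 = mind d t K i.
  apply: (@for_ind _ (fun m s' => rmem s' rMin 0 0 = minf (d i (t 0%N)) (fun k => d i (t k)) m) K) => //.
    by rewrite /s3; frame; rewrite kI // /s1; frame.
  move=> k s5 ltk h5 xk [kI5 kR5]; rewrite runIf /= xk (kI5 xC) // x3 (kI5 aTmp) // t3 (kR5 rDist) // d3 h5 -ltNge.
  case: ifP => _; last by rewrite runSkip.
  by mem; rewrite xk (kI5 xC) // x3 (kI5 aTmp) // t3 (kR5 rDist) // d3.
mem; congr (_ + _) => //; rewrite /s4 /s3; frame; by mem.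
Qed.

Lemma copy_spec s K : imem s aK 0 0 = K ->
  forall i, (i < K)%N -> imem (run p_copy s) aTmp i 0 = imem s aCen i 0.
Proof.
move=> hK.
apply: (@for_ind _ (fun m s' => forall i, (i < m)%N -> imem s' aTmp i 0 = imem s aCen i 0) K) => //.
move=> i s1 lti h xi [kI _] j; rewrite ltnS leq_eqVlt; mem; rewrite xi kI //.
by case: eqP => [->//|_] /= /h.
Qed.

Definition best_swap (d : nat -> nat -> R) (cl fac : nat -> bool) (n K : nat)
    (t t' : nat -> nat) : Prop :=
  [/\ kcost d cl n K t' <= kcost d cl n K t,
      forall j o, (j < K)%N -> (o < n)%N -> fac o ->
        kcost d cl n K t' <= kcost d cl n K (upd t j o) &
      exists j o, [/\ (j < K)%N, o = t j \/ ((o < n)%N /\ fac o) &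
        forall i, (i < K)%N -> t' i = upd t j o i]].

Lemma swap_spec s n K : (0 < K)%N -> imem s aN 0 0 = n -> imem s aK 0 0 = K ->
  best_swap (fun x y => rmem s rDist x y) (fun c => 0 < imem s aCl c 0)%N
    (fun c => 0 < imem s aFac c 0)%N n K
    (fun i => imem s aCen i 0) (fun i => imem (run p_swap s) aCen i 0).
Proof.
move=> K0 hn hK; set d := (fun x y => _); set cl := (fun c => _); set fac := (fun c => _).
set t := (fun i => _); pose F := kcost d cl n K.
rewrite /p_swap !runSeq.
set s1 := run p_copy s; set s2 := run p_eval s1; set s3 := run (setr _ _) s2.
set s4 := run (seti aBj _) s3; set s5 := run (seti aBo _) s4.
have F2 : rmem s2 rVal 0 0 = F t.
  rewrite (@eval_spec s1 n K); [|by rewrite /s1; frame|by rewrite /s1; frame].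
  rewrite /F /kcost; apply: eq_big => [c|c _]; first by rewrite /cl /s1; frame.
  rewrite /mind /s1 (copy_spec hK) //; frame; apply: eq_minf => i iK; rewrite (copy_spec hK) //; by frame.
have b5 : rmem s5 rBc 0 0 = F t by rewrite /s5 /s4; frame; rewrite /s3; mem.
have j5 : imem s5 aBj 0 0 = 0%N by rewrite /s5; frame; rewrite /s4; mem.
have o5 : imem s5 aBo 0 0 = t 0%N.
  rewrite /s5; mem; rewrite /s4 /s3 /s2; frame; rewrite /s1; frame; by [].
pose P i j s' := [/\ (imem s' aBj 0 0 < K)%N,
    imem s' aBo 0 0 = t (imem s' aBj 0 0) \/ ((imem s' aBo 0 0 < n)%N /\ fac (imem s' aBo 0 0)),
    rmem s' rBc 0 0 = F (upd t (imem s' aBj 0 0) (imem s' aBo 0 0)),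
    rmem s' rBc 0 0 <= F t &
    forall k o, (k < K)%N -> (o < n)%N -> fac o -> (k < i)%N || (k == i) && (o < j)%N ->
       rmem s' rBc 0 0 <= F (upd t k o)].
set s6 := run (PFor xJ aK p_swap_o) s5.
have : P K 0%N s6.
  apply: (@for2_ind _ P K n) => //; try by rewrite /s5 /s4 /s3 /s2 /s1; frame.
  - move=> i s' lti [h1 h2 h3 h4 h5]; split=> // k o kK on fo.
    rewrite ltn0 andbF orbF ltnS leq_eqVlt => /orP[/eqP->|ki]; apply: h5 => //.
      by rewrite eqxx on orbT.
    by rewrite ki.
  - split; rewrite ?j5 ?o5 ?b5 //; first by left.
      by apply: kcost_ext => // i iK; rewrite /upd; case: eqP => [->|].
    by move=> k o _ _ _; rewrite ltn0 andbF.
  move=> i j s' lti ltj [h1 h2 h3 h4 h5] xi xj [kI kR].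
  have F' c : imem s' aFac c 0 = imem s aFac c 0 by rewrite kI // /s5 /s4 /s3 /s2 /s1; frame.
  rewrite runIf /= xj F'; case: ifP => fj; last first.
    rewrite runSkip; split=> // k o kK on fo; rewrite ltnS (leq_eqVlt o) => /orP[ki|/andP[/eqP-> /orP[/eqP oj|oj]]].
    + by apply: h5; rewrite ?ki.
    + by move: fo; rewrite oj /fac fj.
    + by apply: h5; rewrite ?eqxx ?oj ?orbT.
  rewrite !runSeq; set s7 := run p_copy s'; set s8 := run (PSetI aTmp _ _ _) s7.
  set s9 := run p_eval s8.
  have c' k : imem s' aCen k 0 = t k by rewrite kI // /s5 /s4 /s3 /s2 /s1; frame.
  have t8 k : (k < K)%N -> imem s8 aTmp k 0 = upd t i j k.
    move=> kK; rewrite /s8; mem; rewrite /upd /s7; frame; rewrite xi xj.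
    by case: eqP => // _ /=; rewrite (@copy_spec s' K) // kI // /s5 /s4 /s3 /s2 /s1; frame.
  have n8 : imem s8 aN 0 0 = n by rewrite /s8 /s7; frame; rewrite kI // /s5 /s4 /s3 /s2 /s1; frame.
  have K8 : imem s8 aK 0 0 = K by rewrite /s8 /s7; frame; rewrite kI // /s5 /s4 /s3 /s2 /s1; frame.
  have F9 : rmem s9 rVal 0 0 = F (upd t i j).
    rewrite (@eval_spec s8 n K) //.
    rewrite (@kcost_ext _ _ _ _ _ _ (upd t i j)) //.
    rewrite /F /kcost; apply: eq_big => [c|c _].
      by rewrite /cl /s8 /s7; frame; rewrite kI // /s5 /s4 /s3 /s2 /s1; frame.
    have D8 x y : rmem s8 rDist x y = d x y.
      by rewrite /s8 /s7; frame; rewrite kR // /s5 /s4 /s3 /s2 /s1; frame.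
    by rewrite /mind D8; apply: eq_minf => k _; rewrite D8.
  have b9 : rmem s9 rBc 0 0 = rmem s' rBc 0 0 by rewrite /s9 /s8 /s7; frame.
  have bj9 : imem s9 aBj 0 0 = imem s' aBj 0 0 by rewrite /s9 /s8 /s7; frame.
  have bo9 : imem s9 aBo 0 0 = imem s' aBo 0 0 by rewrite /s9 /s8 /s7; frame.
  have xi9 : imem s9 xJ 0 0 = i by rewrite /s9 /s8 /s7; frame.
  have xj9 : imem s9 xO 0 0 = j by rewrite /s9 /s8 /s7; frame.
  rewrite runIf /= F9 b9 -ltNge; case: ltP => hlt; last first.
    rewrite runSkip; split; rewrite ?b9 ?bj9 ?bo9 // => k o kK on fo.
    rewrite ltnS (leq_eqVlt o) => /orP[ki|/andP[/eqP-> /orP[/eqP->|oj]]] //.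
    + by apply: h5; rewrite ?ki.
    + by apply: h5; rewrite ?eqxx ?oj ?orbT.
  rewrite /P; mem; rewrite xi9 xj9 F9; split=> //; first by right.
    exact: le_trans (ltW hlt) h4.
  move=> k o kK on fo; rewrite ltnS (leq_eqVlt o) => /orP[ki|/andP[/eqP-> /orP[/eqP->|oj]]] //.
  - by apply: le_trans (ltW hlt) _; apply: h5; rewrite ?ki.
  - by apply: le_trans (ltW hlt) _; apply: h5; rewrite ?eqxx ?oj ?orbT.
case=> h1 h2 h3 h4 h5.
have fin i : (i < K)%N -> imem (run (PSetI aCen (rg aBj) (IConst 0) (rg aBo)) s6) aCen i 0 =
    upd t (imem s6 aBj 0 0) (imem s6 aBo 0 0) i.
  by move=> iK; mem; rewrite /upd /s6 /s5 /s4 /s3 /s2 /s1; frame.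
have FF : F (fun i => imem (run (PSetI aCen (rg aBj) (IConst 0) (rg aBo)) s6) aCen i 0) = rmem s6 rBc 0 0.
  by rewrite h3; apply: kcost_ext.
split; rewrite -/F ?FF //.
  by move=> j o jK on fo; apply: h5; rewrite // jK.
by exists (imem s6 aBj 0 0), (imem s6 aBo 0 0); split.
Qed.

(** The property is indexed by the number of swaps made, so that a rate of convergence can be
    carried through the rounds. *)
Lemma search_spec (Q : nat -> (nat -> nat) -> Prop) s n K :
  (0 < K)%N -> imem s aN 0 0 = n -> imem s aK 0 0 = K ->
  Q 0%N (fun i => imem s aCen i 0) ->
  (forall m t t', Q m t -> best_swap (fun x y => rmem s rDist x y) (fun c => 0 < imem s aCl c 0)%N
    (fun c => 0 < imem s aFac c 0)%N n K t t' -> Q m.+1 t') ->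
  Q (n * n)%N (fun i => imem (run p_search s) aCen i 0).
Proof.
move=> K0 hn hK Q0 QS.
pose P i j s' := Q (i * n + j)%N (fun i => imem s' aCen i 0).
suff : P n 0%N (run p_search s) by rewrite /P addn0.
apply: (@for2_ind _ P n n) => //.
  by move=> i s' lti; rewrite /P addn0 mulSn addnC.
move=> i j s' lti ltj h xi xj [kI kR].
rewrite /P addnS; apply: (QS _ (fun i => imem s' aCen i 0)) => //.
have := @swap_spec s' n K K0; rewrite !kI // => /(_ hn hK).
have D x y : rmem s' rDist x y = rmem s rDist x y by rewrite kR.
have C c : imem s' aCl c 0 = imem s aCl c 0 by rewrite kI.
have Fc c : imem s' aFac c 0 = imem s aFac c 0 by rewrite kI.
have E t : kcost (fun x y => rmem s' rDist x y) (fun c => 0 < imem s' aCl c 0)%N n K t =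
   kcost (fun x y => rmem s rDist x y) (fun c => 0 < imem s aCl c 0)%N n K t.
  rewrite /kcost; apply: eq_big => [c|c _]; first by rewrite C.
  by rewrite /mind D; apply: eq_minf => k _; rewrite D.
case=> h1 h2 [a [b [h3 h4 h5]]]; split; rewrite -?E //.
  by move=> k o kK on fo; rewrite -E; apply: h2 => //; rewrite Fc.
by exists a, b; split=> //; case: h4 => [|[b1 b2]]; [left|right; split=> //; rewrite -Fc].
Qed.

Lemma near_spec s n K : (0 < K)%N -> imem s aN 0 0 = n -> imem s aK 0 0 = K ->
  (forall c, (c < n)%N -> imem s aNear c 0 = 0%N) ->
  forall c, (c < n)%N -> (imem (run p_near s) aNear c 0 < K)%N /\
    forall i, (i < K)%N -> rmem s rDist c (imem s aCen (imem (run p_near s) aNear c 0) 0) <=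
      rmem s rDist c (imem s aCen i 0).
Proof.
move=> K0 hn hK h0.
pose P i j s' := forall c, (c < n)%N -> (imem s' aNear c 0 < K)%N /\
    forall k, (k < K)%N -> (c < i)%N || (c == i) && (k < j)%N ->
      rmem s rDist c (imem s aCen (imem s' aNear c 0) 0) <= rmem s rDist c (imem s aCen k 0).
suff : P n 0%N (run p_near s).
  by move=> h c cn; have [h1 h2] := h c cn; split=> // i iK; apply: h2; rewrite ?cn.
apply: (@for2_ind _ P n K) => //.
- move=> i s' lti h c cn; have [h1 h2] := h c cn; split=> // k kK.
  rewrite ltn0 andbF orbF ltnS leq_eqVlt => /orP[/eqP e|ki]; apply: h2 => //.
    by rewrite e eqxx kK orbT.
  by rewrite ki.
- by move=> c cn; rewrite h0 //; split=> // k _; rewrite ltn0 andbF.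
move=> i j s' lti ltj h xi xj [kI kR] c cn; have [h1 h2] := h c cn.
rewrite runIf /= xi xj !(kI aCen) // !(kR rDist) // -ltNge; case: ltP => hif.
  mem; rewrite xi xj; case: (altP (c =P i)) => [ci|ci].
    split=> // k kK; rewrite ltnS (leq_eqVlt k) ci ltnn /= => /orP[/eqP->//|kj].
    apply: le_trans (ltW hif) _; rewrite -ci; apply: h2 => //.
    by rewrite ci eqxx kj orbT.
  by split=> // k kK; rewrite orbF => ki; apply: h2; rewrite // ki.
rewrite runSkip; split=> // k kK; rewrite ltnS (leq_eqVlt k) => /orP[ki|/andP[/eqP ci /orP[/eqP->|kj]]].
- by apply: h2; rewrite // ki.
- by rewrite ci.
- by apply: h2; rewrite // ci eqxx kj orbT.
Qed.

Lemma slots_spec s K : imem s aK 0 0 = K ->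
  forall i j, (i < K)%N -> (j < K)%N ->
  rmem (run p_slots s) rD i j = rmem s rDist (imem s aCen i 0) (imem s aCen j 0).
Proof.
move=> hK.
pose P i j s' := forall a b, (a < K)%N -> (b < K)%N -> (a < i)%N || (a == i) && (b < j)%N ->
  rmem s' rD a b = rmem s rDist (imem s aCen a 0) (imem s aCen b 0).
suff : P K 0%N (run p_slots s) by move=> h i j iK jK; apply: h; rewrite ?iK.
apply: (@for2_ind _ P K K) => //.
- move=> i s' lti h a b aK bK; rewrite ltn0 andbF orbF ltnS leq_eqVlt => /orP[/eqP e|ki]; apply: h => //.
    by rewrite e eqxx bK orbT.
  by rewrite ki.
- by move=> a b _ _; rewrite ltn0 andbF.
move=> i j s' lti ltj h xi xj [kI kR] a b aK bK.
mem; rewrite xi xj !(kI aCen) // (kR rDist) //.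
case: (altP (a =P i)) => [ai|ai] /=; last by rewrite orbF => ai'; apply: h; rewrite // ai'.
rewrite ai ltnn /= ltnS leq_eqVlt; case: eqP => [->//|_] /= bj.
by apply: h; rewrite // eqxx bj orbT.
Qed.

Lemma count_spec s n : imem s aN 0 0 = n ->
  (forall a i, imem s aCnt0 a i = 0%N) -> imem s aTot 0 0 = 0%N ->
  (forall a i, imem (run p_count s) aCnt0 a i =
    \sum_(c < n) [&& 0 < imem s aCl c 0, imem s aNear c 0 == a & imem s aTyp c 0 == i])%N /\
  imem (run p_count s) aTot 0 0 =
    (\sum_(c < n | 0 < imem s aCl c 0) imem s aPow (imem s aTyp c 0) 0)%N.
Proof.
move=> hn h0 t0; rewrite big_mkcond.
apply: (@for_ind _ (fun m s' => (forall a i, imem s' aCnt0 a i =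
    \sum_(c < m) [&& 0 < imem s aCl c 0, imem s aNear c 0 == a & imem s aTyp c 0 == i])%N /\
  imem s' aTot 0 0 =
    (\sum_(c < m) if 0 < imem s aCl c 0 then imem s aPow (imem s aTyp c 0) 0 else 0)%N) n) => //.
  by split=> [a i|]; rewrite big_ord0.
move=> c s' ltc [h1 h2] xc [kI kR]; rewrite runIf /= xc (kI aCl) //.
case: posnP => c0; first by rewrite runSkip; split=> [a i|]; rewrite big_ord_recr /= c0 ?h1 ?h2 addn0.
mem; rewrite xc (kI aNear) // (kI aTyp) // (kI aPow) // h2; split=> [a i|]; rewrite big_ord_recr /= c0 //.
rewrite -h1 (eq_sym a) (eq_sym i); case: eqP => [<-|_] /=; last by rewrite addn0.
by case: eqP => [<-|_] //=; rewrite addn0.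
Qed.

End Kmedian.

(** * Local search for k-median: the approximation ratio *)

(** By induction, from [(1 - x) (1 + (m + 1) x) <= 1 + m x]. *)
Lemma pow_bernoulli (R : realType) (x : R) m : 0 <= x <= 1 -> (1 - x) ^+ m * (1 + m%:R * x) <= 1.
Proof.
move=> /andP[x0 x1]; have y0 : 0 <= 1 - x by rewrite subr_ge0.
elim: m => [|m IH]; first by rewrite expr0 mul1r mul0r addr0.
apply: le_trans IH; rewrite exprSr -mulrA ler_wpM2l ?exprn_ge0 // -natr1.
have m0 : 0 <= m%:R :> R by []; nra.
Qed.

Section LocalSearch.
Context {R : realType}.
Variables (n K : nat) (d : nat -> nat -> R) (cl fac : nat -> bool).
Hypothesis K0 : (0 < K)%N.
Hypothesis d0 : forall x y, 0 <= d x y.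
Hypothesis dsym : forall x y, d x y = d y x.
Hypothesis dtri : forall x y z, (x < n)%N -> (y < n)%N -> (z < n)%N -> d x z <= d x y + d y z.
Variables (O : {set 'I_n}) (o : 'I_n -> 'I_n).
Hypothesis OK : (#|O| <= K)%N.
Hypothesis Ofac : forall x, x \in O -> fac x.
Hypothesis oO : forall c : 'I_n, cl c -> o c \in O.

Let P : R := \sum_(c < n | cl c) d c (o c).

Lemma mind_le t c j : (j < K)%N -> mind d t K c <= d c (t j).
Proof. by move=> jK; apply: minf_le. Qed.

Lemma mind_ex t c : exists j : 'I_K, mind d t K c = d c (t j).
Proof.
rewrite /mind; case: (minf_ex (d c (t 0%N)) (fun i => d c (t i)) K) => [->|[i iK ->]].
  by exists (Ordinal K0).
by exists (Ordinal iK).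
Qed.

Lemma opt_ge (c : 'I_n) : cl c -> d c (o c) <= P.
Proof. by move=> hc; rewrite /P (bigD1 c) //= lerDl sumr_ge0. Qed.

Lemma opt_ge0 : 0 <= P.
Proof. by rewrite sumr_ge0. Qed.

Section Swap.
Variable t : nat -> nat.
Hypothesis tn : forall j, (j < K)%N -> (t j < n)%N.

Lemma exists_nearest (A : finType) (f : A -> R) (a0 : A) : exists a, forall b, f a <= f b.
Proof. by case: (@arg_minP _ _ _ a0 predT f isT) => a _ h; exists a => b; apply: h. Qed.

Lemma exists_nearest_slot : exists phi : 'I_n -> 'I_K, forall (x : 'I_n) (j : 'I_K), d x (t (phi x)) <= d x (t j).
Proof.
have [x|phi h] := @fin_all_exists _ (fun=> 'I_K)
  (fun (x : 'I_n) (j : 'I_K) => forall j' : 'I_K, d x (t j) <= d x (t j')); last by exists phi.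
exact: (exists_nearest (fun j : 'I_K => d x (t j)) (Ordinal K0)).
Qed.

(** The single-swap analysis of local search. Every optimal facility is swapped in once, in exchange
    for a slot that is nearest to no other optimal facility in use. The clients of the optimal
    facility gain, in total, [kcost] minus [P]; a client whose slot is closed loses at most twice
    its optimal cost, and the closed slots are chosen so that these losses add up to at most
    [4 * P]. The best swap does at least as well as the average of these swaps. *)
Lemma swap_avg (t' : nat -> nat) : best_swap d cl fac n K t t' ->
  #|O|%:R * (kcost d cl n K t' - kcost d cl n K t) <= 5 * P - kcost d cl n K t.
Proof.
case=> _ hbest _; have [phi hphi] := exists_nearest_slot.
have [c|a ha] := @fin_all_exists _ (fun=> 'I_K)
  (fun (c : 'I_n) (j : 'I_K) => mind d t K c = d c (t j)); first exact: mind_ex.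
pose F := kcost d cl n K; pose Sc (c : 'I_n) := mind d t K c; pose Oc (c : 'I_n) := d c (o c).
(* A client of [j] outside the cluster of [x] moves to the slot nearest to its optimal facility.
   That slot is at most as far from the optimal facility as the client's old slot, so the new cost
   is at most [Oc + (Oc + Sc)]. *)
have swap1 (x : 'I_n) (j : 'I_K) : (forall c : 'I_n, cl c -> o c != x -> phi (o c) != j) ->
    F (upd t j x) <= \sum_(c < n | cl c)
      (Sc c + (o c == x)%:R * (Oc c - Sc c) + (a c == j)%:R * (2 * Oc c)).
  move=> hj; apply: ler_sum => c hc.
  have O0 : 0 <= Oc c by rewrite /Oc.
  case: (altP (o c =P x)) => [ocx|ocx] /=.
    have : mind d (upd t j x) K c <= Oc c.
      by apply: le_trans (mind_le _ _ (ltn_ord j)) _; rewrite /upd eqxx -ocx.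
    by case: (a c == j) => /=; lra.
  case: (altP (a c =P j)) => [acj|acj] /=.
    have nj := hj c hc ocx.
    have : mind d (upd t j x) K c <= d c (t (phi (o c))).
      apply: le_trans (mind_le _ _ (ltn_ord (phi (o c)))) _.
      by rewrite /upd -val_eqE /= in nj *; rewrite (negbTE nj).
    have h1 := @dtri c (o c) (t (phi (o c))) (ltn_ord _) (ltn_ord _) (tn (ltn_ord _)).
    have h2 := hphi (o c) (a c).
    have h3 := @dtri (o c) c (t (a c)) (ltn_ord _) (ltn_ord _) (tn (ltn_ord _)).
    rewrite -ha (dsym (o c) c) -/(Oc c) -/(Sc c) in h3; rewrite -/(Oc c) in h1; lra.
  have : mind d (upd t j x) K c <= d c (t (a c)).
    apply: le_trans (mind_le _ _ (ltn_ord (a c))) _.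
    by rewrite -val_eqE /= in acj; rewrite /upd (negbTE acj).
  by rewrite -ha -/(Sc c); lra.
pose deg j := #|[set x in O | phi x == j]|.
pose N := [set j | deg j == 0%N].
pose B := [set x in O | deg (phi x) != 1%N].
have degO x : x \in O -> (0 < deg (phi x))%N.
  by move=> xO; apply/card_gt0P; exists x; rewrite inE xO eqxx.
have sumO (Q : 'I_K -> nat) : (\sum_(x in O) Q (phi x) = \sum_j deg j * Q j)%N.
  rewrite (partition_big phi predT) //=; apply: eq_bigr => j _.
  rewrite (eq_bigr (fun=> Q j)); last by move=> x /andP[_ /eqP->].
  by rewrite sum_nat_const; congr (_ * _)%N; apply: eq_card => x; rewrite !inE.
(* Summed over slots from [deg * (deg != 1) + 2 <= 2 * deg + 2 * (deg == 0)], using that there are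
   at most [K] optimal facilities. *)
have cardB : (#|B| <= 2 * #|N|)%N.
  have eB : #|B| = (\sum_j deg j * (deg j != 1%N))%N.
    by rewrite -sumO -sum1_card big_mkcond /= [RHS]big_mkcond; apply: eq_bigr => x _; rewrite inE; case: (x \in O) => //=; case: eqP.
  have eO : #|O| = (\sum_j deg j * 1)%N by rewrite -(sumO (fun=> 1%N)) sum1_card.
  have eN : #|N| = (\sum_j (deg j == 0%N))%N.
    by rewrite -sum1_card big_mkcond; apply: eq_bigr => j _; rewrite inE; case: eqP.
  have : (#|B| + 2 * K <= 2 * #|O| + 2 * #|N|)%N; last by lia.
  have eK : (2 * K = \sum_(j < K) 2)%N by rewrite sum_nat_const card_ord mulnC.
  rewrite eB eO eN eK !big_distrr -!big_split /=.
  apply: leq_sum => j _; case: (deg j) => [|[|m]] //=; lia.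
(* A facility that alone has its nearest slot takes that slot. All the others, collected in [B],
   take one common slot of degree 0. *)
have [s hs] : exists s : 'I_n -> 'I_K, (forall x, x \in O -> forall c : 'I_n, cl c -> o c != x -> phi (o c) != s x) /\
    \sum_(x in O) \sum_(c < n | cl c) ((a c == s x)%:R * (2 * Oc c)) <= 4 * P.
  pose w j := \sum_(c < n | cl c && (a c == j)) Oc c.
  have w0 j : 0 <= w j by rewrite sumr_ge0 // => c _; rewrite /Oc.
  (* The cheapest slot of degree 0: as [B] has at most twice as many elements as [N], using it for
     all of [B] costs at most twice the sum over [N]. *)
  have [s1 [hs1 hs2]] : exists s1 : 'I_K, (B != set0 -> s1 \in N) /\
      #|B|%:R * w s1 <= 2 * \sum_(j in N) w j.
    have [BE|BN] := eqVneq B set0.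
      by exists (Ordinal K0); rewrite BE cards0 mul0r; split=> //; rewrite mulr_ge0 // sumr_ge0.
    have [j0 j0N] : exists j0, j0 \in N.
      by apply/card_gt0P; rewrite -card_gt0 in BN; lia.
    case: (@arg_minP _ _ _ j0 (mem N) w j0N) => j jN hj; exists j; split=> //.
    apply: (@le_trans _ _ (2 * (#|N|%:R * w j))).
      by rewrite mulrA -natrM; apply: ler_wpM2r; rewrite ?w0 ?ler_nat.
    apply: ler_wpM2l => //; rewrite -sum1_card natr_sum mulr_suml; apply: ler_sum => k kN.
    by rewrite mul1r; apply: hj.
  exists (fun x => if x \in B then s1 else phi x); split.
    move=> x xO c hc ocx; case: ifP => xB.
      have : s1 \in N by apply: hs1; apply/set0Pn; exists x.
      rewrite inE cards_eq0 => /eqP h; apply: contraTneq (oO hc) => e.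
      by have := in_set0 (o c); rewrite -h inE e eqxx andbT => ->.
    move: xB; rewrite inE xO /= => /negbFE/cards1P[y hy]; apply: contra ocx => /eqP e.
    have : o c \in [set y] by rewrite -hy inE oO //= e.
    have : x \in [set y] by rewrite -hy inE xO /=.
    by rewrite !inE => /eqP-> /eqP->.
  rewrite (bigID (mem B)) /=.
  have -> : \sum_(x in O | x \in B) \sum_(c < n | cl c) ((a c == if x \in B then s1 else phi x)%:R * (2 * Oc c)) =
     #|B|%:R * (2 * w s1).
    rewrite (eq_bigl (mem B)); last by move=> x; rewrite !inE; case: (x \in O).
    rewrite -sum1_card natr_sum mulr_suml; apply: eq_bigr => x xB; have {}xB : x \in B by [].
    rewrite mul1r /w mulr_sumr xB [in RHS]big_mkcondr; apply: eq_bigr => c _.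
    by case: eqP; rewrite ?mul1r ?mul0r.
  have -> : 4 * P = \sum_j 4 * w j.
    by rewrite -mulr_sumr; congr (_ * _); rewrite /P (partition_big a predT).
  have le2 : \sum_(x in O | x \notin B) \sum_(c < n | cl c) ((a c == if x \in B then s1 else phi x)%:R * (2 * Oc c))
      <= \sum_(j | j \notin N) 2 * w j.
    have -> : \sum_(x in O | x \notin B) \sum_(c < n | cl c) ((a c == if x \in B then s1 else phi x)%:R * (2 * Oc c))
       = \sum_(x in O | x \notin B) 2 * w (phi x).
      apply: eq_bigr => x /andP[_ /negbTE->].
      by rewrite /w mulr_sumr [in RHS]big_mkcondr; apply: eq_bigr => c _; case: eqP; rewrite ?mul1r ?mul0r.
    rewrite (partition_big phi (fun j => j \notin N)) /=; last first.
      by move=> x /andP[xO _]; rewrite inE -lt0n degO.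
    apply: ler_sum => j _.
    rewrite (eq_bigr (fun=> 2 * w j)); last by move=> x /andP[_ /eqP->].
    rewrite sumr_const; set m := #|_|.
    have m1 : (m <= 1)%N.
      rewrite leqNgt; apply/negP => /card_gt1P[x [y [hx hy]]].
      have {hx} : (x \in O) && (x \notin B) && (phi x == j) by move: hx; rewrite {1}unfold_in.
      have {hy} : (y \in O) && (y \notin B) && (phi y == j) by move: hy; rewrite {1}unfold_in.
      move=> /andP[/andP[yO yB] /eqP ey] /andP[/andP[xO xB] /eqP ex].
      move: xB; rewrite inE xO /= => /negbNE/cards1P[z hz].
      have : x \in [set z] by rewrite -hz inE xO /=.
      have : y \in [set z] by rewrite -hz inE yO /= ey ex.
      by rewrite !inE => /eqP-> /eqP->; rewrite eqxx.
    by case: m m1 => [|[]] // _; rewrite ?mulr0n ?mulr1n // mulr_ge0.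
  rewrite (bigID (mem N)) /= -mulr_sumr.
  have : \sum_(j | j \notin N) 2 * w j <= \sum_(j | j \notin N) 4 * w j.
    by apply: ler_sum => j _; apply: ler_wpM2r; rewrite ?w0 ?ler_nat.
  lra.
case: hs => hs1 hs2.
have : \sum_(x in O) (F t' - F t) <= 5 * P - F t; last first.
  by rewrite sumr_const -[(F t' - F t) *+ _]mulr_natl.
apply: (@le_trans _ _ (\sum_(x in O) \sum_(c < n | cl c)
      ((o c == x)%:R * (Oc c - Sc c) + (a c == s x)%:R * (2 * Oc c)))).
  apply: ler_sum => x xO; have := swap1 x (s x) (hs1 x xO).
  have := hbest (s x) x (ltn_ord _) (ltn_ord _) (Ofac xO).
  rewrite (eq_bigr (fun c => Sc c + ((o c == x)%:R * (Oc c - Sc c) + (a c == s x)%:R * (2 * Oc c)))); last first.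
    by move=> c _; rewrite addrA.
  rewrite big_split /= -/F -/(kcost d cl n K t) -/(F t); lra.
rewrite (eq_bigr (fun x => \sum_(c < n | cl c) (o c == x)%:R * (Oc c - Sc c) +
   \sum_(c < n | cl c) (a c == s x)%:R * (2 * Oc c))); last by move=> x _; rewrite big_split.
rewrite big_split /= exchange_big /=.
have -> : \sum_(c < n | cl c) \sum_(x in O) (o c == x)%:R * (Oc c - Sc c) = P - F t.
  rewrite /P /F /kcost -sumrB; apply: eq_bigr => c hc.
  rewrite (bigD1 (o c)) ?oO //= eqxx mul1r big1 ?addr0 // => x /andP[_ hx].
  by rewrite eq_sym (negbTE hx) mul0r.
lra.
Qed.

End Swap.

(** The swaps considered, at most [K] of them, together recover the whole excess over [5 * P], so
    the best one recovers a fraction [1 / K]. The bound [E] stands in for the excess, which may be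
    negative. *)
Lemma swap_step (t t' : nat -> nat) (E : R) : (forall j, (j < K)%N -> (t j < n)%N) -> 0 <= E ->
  best_swap d cl fac n K t t' -> kcost d cl n K t - 5 * P <= E ->
  kcost d cl n K t' - 5 * P <= (1 - K%:R^-1) * E.
Proof.
move=> tn E0 hb hE; have := swap_avg tn hb; have [hm _ _] := hb.
set F' := kcost d cl n K t' in hm *; set F := kcost d cl n K t in hm hE *.
have K1 : 1 <= K%:R :> R by rewrite ler1n.
have iK0 : 0 < K%:R^-1 :> R by rewrite invr_gt0; lra.
have iK1 : K%:R^-1 <= 1 :> R by rewrite invf_le1; lra.
have KK : K%:R * K%:R^-1 = 1 :> R by rewrite divff //; lra.
have Om : #|O|%:R <= K%:R :> R by rewrite ler_nat.
move: (#|O|%:R) Om => m Om havg.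
case: (lerP F (5 * P)) => hF; first by apply: le_trans (_ : 0 <= _); [lra|apply: mulr_ge0; lra].
have h1 : K%:R * (F' - F) <= 5 * P - F by apply: le_trans havg; nra.
have h2 : F' - F <= K%:R^-1 * (5 * P - F).
  by rewrite ler_pdivlMl //; lra.
nra.
Qed.

(** Every client is within [3 * P] of a slot. The [K] clients for which slots were opened, together
    with the given one, are more than the optimal facilities, so two of them share an optimal
    facility. The later one reaches the slot of the earlier one through that facility along three
    distances, each at most [P], and the given client is no farther from the slots than the later
    one was. *)
Lemma init_cost (top : R) (cen : nat -> nat) :
  (forall x y, (x < n)%N -> (y < n)%N -> d x y <= top) ->
  (forall j, (j < K)%N -> exists x, [/\ (x < n)%N, cl x, (cen j < n)%N, fac (cen j) &
    (forall y, (y < n)%N -> fac y -> d x (cen j) <= d x y) /\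
    (forall c, (c < n)%N -> cl c -> minf top (fun i => d c (cen i)) j <=
      minf top (fun i => d x (cen i)) j)]) ->
  kcost d cl n K cen <= 3 * n%:R * P.
Proof.
move=> htop hinit.
have cn j : (j < K)%N -> (cen j < n)%N by move=> /hinit[x []].
suff H (c : 'I_n) : cl c -> mind d cen K c <= 3 * P.
  apply: le_trans (ler_sum _ H) _; rewrite sumr_const -[X in X <= _]mulr_natl.
  set m := (#|_|); have : m%:R <= n%:R :> R.
    by rewrite ler_nat -[X in (_ <= X)%N]card_ord max_card.
  by have := opt_ge0; nra.
move=> hc.
have [j|x hx] := @fin_all_exists _ (fun=> 'I_n) (fun (j : 'I_K) (x : 'I_n) => [/\ cl x,
    forall y, (y < n)%N -> fac y -> d x (cen j) <= d x y &
    forall i, (i < j)%N -> mind d cen K c <= d x (cen i)]).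
  have [x [xn hx _ _ [h1 h2]]] := hinit j (ltn_ord j); exists (Ordinal xn); split=> //= i ij.
  apply: le_trans (minf_le top (fun i => d x (cen i)) ij); apply: le_trans (h2 c _ hc) => //.
  case: (minf_ex top (fun i => d c (cen i)) j) => [->|[k kj ->]].
    by apply: le_trans (mind_le _ _ K0) _; apply: htop => //; apply: cn.
  by apply: mind_le; apply: ltn_trans (ltn_ord j).
(* The last index stands for the client [c] itself. *)
pose X (i : 'I_K.+1) : 'I_n := oapp x c (insub (i : nat)).
have XE (i : 'I_K.+1) (iK : (i < K)%N) : X i = x (Ordinal iK) by rewrite /X insubT.
have Xc i : cl (X i) by rewrite /X; case: insubP => //= j _ _; have [] := hx j.
have : ~~ injectiveb (fun i => o (X i)).
  apply/negP => /injectiveP inj.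
  have := card_imset predT inj; rewrite card_ord => e.
  have : ((fun i => o (X i)) @: predT) \subset O.
    by apply/subsetP => y /imsetP[i _ ->]; apply: oO.
  by move/subset_leq_card; rewrite e => h; move: (leq_trans h OK); rewrite ltnn.
case/injectivePn => i0 [j0 ne0 e0].
have [i [j [ij e]]] : exists i j : 'I_K.+1, (i < j)%N /\ o (X i) = o (X j).
  by move: ne0; rewrite neq_ltn => /orP[]; [exists i0, j0|exists j0, i0].
have iK : (i < K)%N by have := ltn_ord j; lia.
have [hxi h1 _] := hx (Ordinal iK).
have h2 : mind d cen K c <= d (X j) (cen i).
  rewrite /X; case: insubP => [k /= _ ek|/= _]; last exact: mind_le.
  by have [_ _] := hx k; apply; rewrite ek.
have oI := ltn_ord (o (X i)).
have ofac : fac (o (X i)) by apply/Ofac/oO.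
have := h1 (o (X i)) oI ofac; rewrite /= -(XE i iK).
have := @dtri (X j) (o (X i)) (cen i) (ltn_ord _) oI (cn _ iK).
have := @dtri (o (X i)) (X i) (cen i) oI (ltn_ord _) (cn _ iK).
have := opt_ge (Xc i); have := opt_ge (Xc j); rewrite -e (dsym (o (X i)) (X i)); lra.
Qed.

(** By Bernoulli, [(1 - 1/K)^(n^2)] is at most [1 / (1 + n^2 / K)], hence at most [1 / n] as
    [K <= n]. This cancels the factor [n] of the initial cost and leaves a ratio of 5 + 3 = 8. *)
Lemma search_rate : (K <= n)%N -> (1 - K%:R^-1) ^+ (n * n) * (3 * n%:R * P) <= 3 * P.
Proof.
move=> Kn; have K1 : 1 <= K%:R :> R by rewrite ler1n.
have iK0 : 0 < K%:R^-1 :> R by rewrite invr_gt0; lra.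
have iK1 : K%:R^-1 <= 1 :> R by rewrite invf_le1; lra.
have := @pow_bernoulli R K%:R^-1 (n * n); rewrite ltW // iK1 => /(_ isT).
set q := (1 - _) ^+ _ => hq.
have q0 : 0 <= q by rewrite exprn_ge0 //; lra.
have : n%:R <= 1 + (n * n)%:R * K%:R^-1 :> R.
  have nK : K%:R <= n%:R :> R by rewrite ler_nat.
  have KK : K%:R * K%:R^-1 = 1 :> R by rewrite divff //; lra.
  have : K%:R * K%:R^-1 <= n%:R * K%:R^-1 :> R by apply: ler_wpM2r => //; exact: ltW.
  rewrite KK natrM -mulrA.
  have : 0 <= n%:R :> R by []; nra.
move=> hn; have : q * n%:R <= 1 by apply: le_trans hq; exact: ler_wpM2l.
have := opt_ge0; have : 0 <= n%:R :> R by []; nra.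
Qed.

End LocalSearch.

(** * Averaging over scales *)

Section Averaging.
Context {R : realType}.

(** The length of the intersection of the intervals [[a, b)] and [[lo, hi)]. *)
Definition overlap (a b lo hi : R) : R := Num.max 0 (Num.min b hi - Num.max a lo).

Lemma overlap_ge0 a b lo hi : 0 <= overlap a b lo hi.
Proof. by rewrite /overlap le_max lexx. Qed.

Lemma overlap_split a b lo mid hi : lo <= mid -> mid <= hi ->
  overlap a b lo mid + overlap a b mid hi <= overlap a b lo hi.
Proof.
rewrite /overlap => h1 h2.
case: (leP b mid) => ?; case: (leP b hi) => ?; case: (leP a lo) => ?; case: (leP a mid) => ?;
 rewrite ?maxEle; repeat case: ifP; move=> *; lra.
Qed.

Lemma overlap_scale r a b lo hi : 0 < r ->
  r * overlap (a / r) (b / r) lo hi = overlap a b (r * lo) (r * hi).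
Proof.
move=> r0; rewrite /overlap maxr_pMr ?ltW // mulr0 mulrBr minr_pMr ?ltW // maxr_pMr ?ltW //.
by rewrite ![r * (_ / r)]mulrC !divfK ?gt_eqF.
Qed.

(* Averaging over [lo, hi): the step function only increases at left ends, so
   one of the points where it has just dropped is no worse than the mean. *)
Lemma below_average (J : finType) (c A B : J -> R) (lo hi : R) : lo < hi ->
  (forall j, 0 <= c j) ->
  exists2 b, lo <= b < hi /\ (b = lo \/ exists j, b = B j) &
    (hi - lo) * (\sum_j c j * ((A j <= b) && (b < B j))%:R) <= \sum_j c j * overlap (A j) (B j) lo hi.
Proof.
move=> lohi c0.
(* Induction on the number of right ends inside [(lo, hi)], cutting at the first of them. *)
have [m] := ubnP #|[set j | (lo < B j) && (B j < hi)]|.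
elim: m lo lohi => // m IH lo lohi; rewrite ltnS => hm.
pose F b := \sum_j c j * ((A j <= b) && (b < B j))%:R.
have [E|/set0Pn[j0]] := eqVneq [set j | (lo < B j) && (B j < hi)] set0.
  exists lo; first by rewrite lexx lohi; split=> //; left.
  rewrite mulr_sumr; apply: ler_sum => j _; rewrite mulrCA; apply: ler_wpM2l => //.
  have hj : ~~ ((lo < B j) && (B j < hi)).
    by have := in_set0 j; rewrite -E inE => ->.
  case: (boolP (_ && _)) => [/andP[h1 h2]|_]; last by rewrite mulr0 overlap_ge0.
  rewrite h2 /= -leNgt in hj.
  by rewrite mulr1 /overlap (min_idPr hj) (max_idPr h1) le_max lexx orbT.
rewrite inE => hj0.
case: (@arg_minP _ _ _ j0 (fun j => (lo < B j) && (B j < hi)) B hj0) => j1 /andP[l1 h1] min1.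
have [|b [/andP[b1 b2] hb3] hb4] := IH (B j1) h1.
  apply: leq_trans hm; apply: proper_card; apply/properP; split.
    by apply/subsetP => j; rewrite !inE => /andP[h ->]; rewrite (lt_trans l1 h).
  by exists j1; rewrite !inE ?l1 ?h1 // ltxx.
(* Up to the first right end no interval containing [lo] ends, so the mean over this piece is at
   least the value at [lo]. *)
have hlo : (B j1 - lo) * F lo <= \sum_j c j * overlap (A j) (B j) lo (B j1).
  rewrite mulr_sumr; apply: ler_sum => j _; rewrite mulrCA; apply: ler_wpM2l => //.
  case: (boolP (_ && _)) => [/andP[g1 g2]|_]; last by rewrite mulr0 overlap_ge0.
  have hj : B j1 <= B j.
    by case: (ltP (B j) hi) => h; [apply: min1; rewrite g2|apply: le_trans (ltW h1) h].
  by rewrite mulr1 /overlap (min_idPr hj) (max_idPr g1) le_max lexx orbT.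
have hs : \sum_j c j * overlap (A j) (B j) lo (B j1) + \sum_j c j * overlap (A j) (B j) (B j1) hi
    <= \sum_j c j * overlap (A j) (B j) lo hi.
  rewrite -big_split /=; apply: ler_sum => j _; rewrite -mulrDr; apply: ler_wpM2l => //.
  by apply: overlap_split; exact: ltW.
case: (lerP (F lo) (F b)) => hF.
  exists lo; first by rewrite lexx lohi; split=> //; left.
  rewrite -/(F lo); rewrite -/(F b) in hb4; nra.
exists b.
  rewrite b2 (le_trans (ltW l1) b1); split=> //; right.
  by case: hb3 => [->|//]; exists j1.
rewrite -/(F b); rewrite -/(F b) in hb4; nra.
Qed.

(** Because the levels at least halve, the windows [[r i / 8, r i / 4)] are disjoint. Their traces
    on [[a, b)] therefore add up to no more than its length. *)
Lemma overlap_levels (r : nat -> R) a b m : (forall i, 0 <= r i) ->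
  (forall i, 2 * r i.+1 <= r i) -> a <= b ->
  \sum_(i < m) overlap a b (r i / 8) (r i / 4) <= b - a.
Proof.
move=> r0 r2 ab.
suff : \sum_(i < m) overlap a b (r i / 8) (r i / 4) <= Num.max 0 (b - Num.max a (r m / 4)).
  move/le_trans; apply; rewrite ge_max subr_ge0 ab /= lerB // le_max lexx //.
elim: m => [|m IH]; first by rewrite big_ord0 le_max lexx.
rewrite big_ord_recr /=.
apply: (@le_trans _ _ (Num.max 0 (b - Num.max a (r m / 4)) + overlap a b (r m / 8) (r m / 4))).
  by rewrite lerD2r.
have h1 := r2 m; have h2 := r0 m; have h3 := r0 m.+1; rewrite /overlap; clear IH.
case: (leP b (r m / 4)) => ?; case: (leP a (r m / 8)) => ?; case: (leP a (r m / 4)) => ?;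
  case: (leP a (r m.+1 / 4)) => ?; rewrite ?maxEle; repeat case: ifP; move=> *; lra.
Qed.

End Averaging.

(** * Reciprocal ranks and harmonic numbers *)

Section Ranks.
Context {R : realType}.

Definition harmonic_sum (k : nat) : R := \sum_(j < k) j.+1%:R^-1.

(** A maximal element has rank [#|S|]; removing it can only lower the other ranks, and induction
    applies. Ties only increase ranks. *)
Lemma sum_rank_le (T : finType) (f : T -> R) (S : {set T}) :
  \sum_(s in S) (#|[set t in S | f t <= f s]|%:R)^-1 <= harmonic_sum #|S|.
Proof.
have [m] := ubnP #|S|; elim: m S => // m IH S; rewrite ltnS => hm.
have [->|/set0Pn[s0 s0S]] := eqVneq S set0.
  by rewrite big_set0 /harmonic_sum cards0 big_ord0.
case: (@arg_maxP _ _ _ s0 (mem S) f s0S) => s1 s1S max1.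
have {}s1S : s1 \in S by [].
rewrite (bigD1 s1) //= (cardsD1 s1 S) s1S add1n /harmonic_sum big_ord_recr /= addrC lerD //; last first.
  have -> : [set t in S | f t <= f s1] = S.
    by apply/setP => t; rewrite inE; case: (boolP (t \in S)) => // tS; exact: max1.
  by rewrite (cardsD1 s1 S) s1S.
apply: (@le_trans _ _ (\sum_(s in S :\ s1) (#|[set t in S :\ s1 | f t <= f s]|%:R)^-1)).
  rewrite (eq_bigl (fun s => s \in S :\ s1)); last by move=> s; rewrite !inE andbC.
  apply: ler_sum => s sS.
  have h : (0 < #|[set t in S :\ s1 | (f t <= f s)%R]|)%N.
    by apply/card_gt0P; exists s; rewrite inE sS lexx.
  rewrite lef_pV2 ?posrE ?ltr0n // ?ler_nat.
    apply: subset_leq_card; apply/subsetP => t.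
    by rewrite !inE => /andP[/andP[_ ->] ->].
  apply: leq_trans h _; apply: subset_leq_card; apply/subsetP => t.
  by rewrite !inE => /andP[/andP[_ ->] ->].
by apply: IH; move: hm; rewrite (cardsD1 s1 S) s1S.
Qed.

(** In fact the sum is at most [1 + ln k] for positive [k], by telescoping
    [ln (1 - 1/k) <= - 1/k]. *)
Lemma harmonic_le (k : nat) : harmonic_sum k <= 2 * Num.max 1 (ln k%:R).
Proof.
case: k => [|k]; first by rewrite /harmonic_sum big_ord0 mulr_ge0 // le_max ler01.
suff H : harmonic_sum k.+1 <= 1 + ln k.+1%:R.
  apply: le_trans H _; rewrite mulrDl !mul1r lerD // le_max lexx // orbT //.
elim: k => [|k IH]; first by rewrite /harmonic_sum big_ord_recr big_ord0 /= add0r invr1 ln1 addr0.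
rewrite /harmonic_sum big_ord_recr /= -/(harmonic_sum k.+1).
have p2 : 0 < k.+2%:R :> R by [].
have i1 : k.+2%:R^-1 < 1 :> R by rewrite invf_lt1 ?ltr1n.
have i2 : k.+2%:R * k.+2%:R^-1 = 1 :> R by rewrite divff ?gt_eqF.
have e : k.+1%:R = k.+2%:R * (1 + - k.+2%:R^-1) :> R.
  by apply/eqP; rewrite mulrDr mulr1 mulrN i2 eq_sym subr_eq natr1.
have := @le_ln1Dx R (- k.+2%:R^-1); rewrite ltrN2 => /(_ i1).
have : ln k.+1%:R = ln k.+2%:R + ln (1 + - k.+2%:R^-1) :> R.
  by rewrite e lnM // posrE subr_gt0.
move: IH; clear; move: (ln (k.+1%:R : R)) (ln (k.+2%:R : R)) (ln _) (k.+2%:R^-1) (harmonic_sum _) => a b c d0 h; lra.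
Qed.

End Ranks.

(** * Random tree metrics *)

Section FirstProbability.
Variables (K N : nat).
Hypothesis KN : (K * K <= N.+1)%N.
Local Notation T := {ffun 'I_K -> 'I_N.+1}.

(** The comparison is weak, so with tied priorities several elements may be first. *)
Definition is_first (A : {set 'I_K}) (s : 'I_K) (f : T) : bool :=
  [forall t in A, (f s <= f t)%N].

(** Exchanging the priorities of [s] and [t] is a bijection between the two events. *)
Lemma first_sym (A : {set 'I_K}) s t : s \in A -> t \in A ->
  #|[set f | is_first A s f]| = #|[set f | is_first A t f]|.
Proof.
move=> sA tA; pose g (f : T) : T := [ffun i => f (tperm s t i)].
have gK : involutive g by move=> f; apply/ffunP => i; rewrite !ffunE tpermK.
rewrite -(card_imset _ (can_inj gK)); apply: eq_card => f; rewrite [RHS]inE.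
have tpA u : u \in A -> tperm s t u \in A by case: tpermP => // ->.
apply/imsetP/idP => [[h] | hf].
  rewrite inE => /forall_inP hh ->; apply/forall_inP => u uA; rewrite !ffunE tpermR.
  exact: hh (tpA u uA).
exists (g f); last by rewrite gK.
rewrite inE; apply/forall_inP => u uA; rewrite !ffunE tpermL.
by move/forall_inP: hf; apply; exact: tpA.
Qed.

(** Overwriting [f s] by an arbitrary value is injective on the functions with a tie, since [f s]
    can be recovered from [f t]. *)
Lemma tie_count (s t : 'I_K) : s != t -> (#|[set f : T | f s == f t]| * N.+1 <= N.+1 ^ K)%N.
Proof.
move=> st; rewrite -[X in (_ * X)%N]card_ord -cardsT -cardsX.
have -> : (N.+1 ^ K)%N = #|{: T}| by rewrite card_ffun !card_ord.
pose h (p : T * 'I_N.+1) : T := [ffun i => if i == s then p.2 else p.1 i].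
rewrite -(@card_in_imset _ _ h); first exact: max_card.
move=> [f v] [f' v']; rewrite !inE /= !andbT => /eqP e /eqP e' /ffunP hh.
have hv : v = v' by have := hh s; rewrite !ffunE eqxx.
congr pair => //; apply/ffunP => i; have [->|ne] := eqVneq i s.
  by rewrite e e'; have := hh t; rewrite !ffunE eq_sym (negbTE st).
by have := hh i; rewrite !ffunE (negbTE ne).
Qed.

(** The elements of [A] are first equally often, and the number of first elements exceeds 1 by at
    most the number of tied pairs. The expected number of ordered tied pairs is at most
    [K^2 / (N + 1) <= 1]; this is where the range of the draws matters and where the factor 2 comes
    from. *)
Lemma first_count (A : {set 'I_K}) s : s \in A ->
  (#|A| * #|[set f | is_first A s f]| <= 2 * N.+1 ^ K)%N.
Proof.
move=> sA.
have -> : (#|A| * #|[set f | is_first A s f]| = \sum_(t in A) #|[set f | is_first A t f]|)%N.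
  rewrite -sum_nat_const; apply: eq_bigr => t tA; exact: first_sym.
pose ties (f : T) := (\sum_(p : 'I_K * 'I_K | p.1 != p.2) (f p.1 == f p.2))%N.
have mins f : (\sum_(t in A) is_first A t f <= 1 + ties f)%N.
  have [/pred0P E|/existsP[m /andP[mA hm]]] := boolP (pred0b (fun t => (t \in A) && is_first A t f)).
    by rewrite big1 // => t tA; have := E t; rewrite /= tA /= => ->.
  rewrite (bigD1 m) //= hm leq_add2l /ties.
  rewrite [X in (_ <= X)%N](eq_bigr (fun p => f p.1 == f p.2 : nat)) //.
  rewrite -(pair_big_dep predT (fun i j => i != j) (fun i j => (f i == f j : nat))) /=.
  rewrite [X in (_ <= X)%N](bigD1 m) //=; apply: leq_trans (leq_addr _ _).
  rewrite big_mkcond [X in (_ <= X)%N]big_mkcond; apply: leq_sum => t _.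
  case: ifP => [/andP[tA tm]|_] //; rewrite eq_sym tm.
  case: (boolP (is_first A t f)) => // ht; rewrite lt0b -val_eqE eqn_leq.
  by move/forall_inP: hm => -> //; move/forall_inP: ht => ->.
have -> : (\sum_(t in A) #|[set f | is_first A t f]| = \sum_(f : T) \sum_(t in A) is_first A t f)%N.
  rewrite exchange_big /=; apply: eq_bigr => t _.
  by rewrite -sum1_card big_mkcond; apply: eq_bigr => f _; rewrite inE; case: is_first.
apply: (@leq_trans (\sum_(f : T) (1 + ties f))%N); first exact: leq_sum.
rewrite big_split /= sum1_card card_ffun !card_ord mul2n -addnn leq_add2l.
rewrite exchange_big /=.
have h p : (p : 'I_K * 'I_K).1 != p.2 -> ((\sum_(f : T) (f p.1 == f p.2)) * N.+1 <= N.+1 ^ K)%N.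
  move=> hp; apply: leq_trans (tie_count hp); rewrite leq_mul2r -sum1_card.
  rewrite [X in (_ <= X)%N]big_mkcond /=.
  by apply: leq_sum => f _; rewrite inE; case: eqP.
rewrite -(@leq_pmul2r N.+1) // big_distrl /=.
apply: (@leq_trans (\sum_(p : 'I_K * 'I_K | p.1 != p.2) N.+1 ^ K)%N); first exact: leq_sum.
apply: (@leq_trans (\sum_(p : 'I_K * 'I_K) N.+1 ^ K)%N).
  by rewrite [X in (X <= _)%N]big_mkcond; apply: leq_sum => p _; case: ifP.
by rewrite sum_nat_const card_prod !card_ord mulnC leq_mul2l KN orbT.
Qed.

End FirstProbability.

(** * Levels among the distances *)

Section Levels.
Context {R : realType}.
Variables (K : nat) (D : nat -> nat -> R).
Hypothesis D0 : forall x y, 0 <= D x y.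

(** The largest distance not exceeding [h], or 0. It is stated as a relation with a unique solution,
    so that the value computed by the program can be identified with it. *)
Definition is_level (h r : R) : Prop :=
  [/\ 0 <= r, (forall x y, (x < K)%N -> (y < K)%N -> D x y <= h -> D x y <= r) &
    r = 0 \/ exists x y, [/\ (x < K)%N, (y < K)%N, D x y <= h & r = D x y]].

Lemma is_level_uniq h r r' : is_level h r -> is_level h r' -> r = r'.
Proof.
move=> [a1 a2 a3] [b1 b2 b3]; apply/eqP; rewrite eq_le; apply/andP; split.
  by case: a3 => [->//|[x [y [xK yK le ->]]]]; exact: b2.
by case: b3 => [->//|[x [y [xK yK le ->]]]]; exact: a2.
Qed.

Definition level (h : R) : R :=
  \big[Num.max/0]_(p : 'I_K * 'I_K | D p.1 p.2 <= h) D p.1 p.2.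

Lemma levelP h : is_level h (level h).
Proof.
split.
- exact: bigmax_ge_id.
- move=> x y xK yK le; exact: (@bigmax_sup _ _ _ _ (Ordinal xK, Ordinal yK)).
- rewrite /level; elim/big_ind: _ => [|u v hu hv|[x y] /= le]; first by left.
    by rewrite maxEle; case: ifP.
  by right; exists x, y; split.
Qed.

Variable top : R.
Hypothesis Dtop : forall x y, (x < K)%N -> (y < K)%N -> D x y <= top.
Hypothesis top0 : 0 <= top.

(** Thresholds restart at half of the last level. Scales at which no distance occurs are skipped, so
    the levels are at least halved each time but never number more than the pairs of slots. *)
Fixpoint hseq (i : nat) : R := if i is j.+1 then level (hseq j) / 2 else top.
Definition rseq (i : nat) : R := level (hseq i).

Lemma rseq_ge0 i : 0 <= rseq i.
Proof. by have [] := levelP (hseq i). Qed.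

Lemma hseq_ge0 i : 0 <= hseq i.
Proof. by case: i => [|i] //=; rewrite divr_ge0 //; exact: rseq_ge0. Qed.

Lemma rseq_le i : rseq i <= hseq i.
Proof.
have [_ _] := levelP (hseq i); rewrite -/(rseq i); case=> [->|[x [y [_ _ h ->]]]] //.
exact: hseq_ge0.
Qed.

Lemma rseq_half i : 2 * rseq i.+1 <= rseq i.
Proof. by have := rseq_le i.+1; rewrite /= -/(rseq i); lra. Qed.

(** The threshold sequence starts above all distances and falls below the given positive one within
    [K^2] steps; the step at which it passes gives the level. *)
Lemma level_cover x y : (x < K)%N -> (y < K)%N -> 0 < D x y ->
  exists2 i, (i < K * K)%N & rseq i / 2 < D x y <= rseq i.
Proof.
move=> xK yK Dp.
(* The pairs still under the threshold; each step loses at least the pair that attains the level. *)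
pose S i := [set p : 'I_K * 'I_K | 0 < D p.1 p.2 <= hseq i].
have card_S i : (i <= K * K)%N -> (#|S i| <= K * K - i)%N.
  elim: i => [|i IH] lei.
    by apply: leq_trans (max_card _) _; rewrite card_prod !card_ord subn0.
  have [_ h1 h2] := levelP (hseq i); rewrite -/(rseq i) in h1 h2.
  have hh : hseq i.+1 = rseq i / 2 by [].
  have rl := rseq_le i; have r0 := rseq_ge0 i.
  case: h2 => [e|[a [b [aK bK le e]]]].
    rewrite (_ : S i.+1 = set0) ?cards0 //; apply/setP => -[u v]; rewrite !inE hh e mul0r /=.
    by apply/negP => /andP[u1 u2]; lra.
  have [e0|rn0] := eqVneq (rseq i) 0.
    rewrite (_ : S i.+1 = set0) ?cards0 //; apply/setP => -[u v]; rewrite !inE hh e0 mul0r /=.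
    by apply/negP => /andP[u1 u2]; lra.
  have rp : 0 < rseq i by rewrite lt_neqAle eq_sym rn0 r0.
  have : (#|S i.+1| < #|S i|)%N; last by have := IH (ltnW lei); lia.
  apply: proper_card; apply/properP; split.
    apply/subsetP => -[u v]; rewrite !inE hh /= => /andP[-> /= h3]; lra.
  exists (Ordinal aK, Ordinal bK); rewrite !inE ?hh /= -e ?rp ?rl //= -ltNge; lra.
have hlast : hseq (K * K) < D x y.
  rewrite ltNge; apply/negP => le.
  have : (Ordinal xK, Ordinal yK) \in S (K * K)%N by rewrite inE /= Dp le.
  have := card_S (K * K)%N (leqnn _); rewrite subnn leqn0 cards_eq0 => /eqP->.
  by rewrite inE.
have [i iK [i1 i2]] : exists2 i, (i < K * K)%N & D x y <= hseq i /\ hseq i.+1 < D x y.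
  elim: (K * K)%N hlast => [|m IH] hm; first by move: hm; rewrite /= ltNge Dtop.
  case: (leP (D x y) (hseq m)) => h; first by exists m.
  by have [i im hi] := IH h; exists i => //; exact: ltnW.
exists i => //; have [_ h _] := levelP (hseq i).
by rewrite h // andbT; move: i2; rewrite /= -/(rseq i).
Qed.

End Levels.

(** * Hierarchies from priorities: domination and expected stretch *)

Section Centers.
Context {R : realType}.
Variables (K : nat) (D : nat -> nat -> R) (top : R).
Hypothesis D0 : forall x y, 0 <= D x y.
Hypothesis Dxx : forall x, (x < K)%N -> D x x = 0.
Hypothesis Dsym : forall x y, D x y = D y x.
Hypothesis Dtri : forall x y z, (x < K)%N -> (y < K)%N -> (z < K)%N -> D x z <= D x y + D y z.
Hypothesis Dtop : forall x y, (x < K)%N -> (y < K)%N -> D x y <= top.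
Hypothesis top0 : 0 <= top.
Local Notation r := (rseq K D top).
Local Notation T := (K * K)%N.

Definition lexle (f : nat -> nat) (c s : nat) : bool :=
  (f c < f s)%N || (f c == f s) && (c <= s)%N.

Definition is_center (f : nat -> nat) (rad : R) (x c : nat) : Prop :=
  [/\ (c < K)%N, D x c <= rad & forall s, (s < K)%N -> D x s <= rad -> lexle f c s].

(* The tree metric of priorities [f] and scale [b]: the largest level at which
   two slots have different centers. *)
Definition tree_spec (f : nat -> nat) (b : R) (U : nat -> nat -> R) : Prop :=
  exists ctr : nat -> nat -> nat,
    (forall i x, (i < T)%N -> (x < K)%N -> is_center f (b * r i) x (ctr i x)) /\
    forall x y, (x < K)%N -> (y < K)%N ->
      (forall i, (i < T)%N -> ctr i x != ctr i y -> r i <= U x y) /\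
      (U x y = 0 \/ exists i, [/\ (i < T)%N, ctr i x != ctr i y & U x y = r i]) /\ 0 <= U x y.

Definition candidate (b : R) : Prop :=
  b = 1 / 8 \/ 1 / 8 <= b < 1 / 4 /\ exists x y p q,
    [/\ (x < K)%N, (y < K)%N, (p < K)%N, (q < K)%N & b = D x y / D p q].

(** At each level, having the same center is an equivalence relation, so a level that separates [x]
    from [z] separates [x] from [y] or [y] from [z]. The partitions of different levels do not have
    to be nested. *)
Lemma tree_ultra f b U : tree_spec f b U ->
  [/\ forall x, (x < K)%N -> U x x = 0,
      forall x y, (x < K)%N -> (y < K)%N -> U x y = U y x,
      forall x y, (x < K)%N -> (y < K)%N -> 0 <= U x y &
      forall x y z, (x < K)%N -> (y < K)%N -> (z < K)%N -> U x z <= Num.max (U x y) (U y z)].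
Proof.
case=> ctr [hc hU]; split.
- by move=> x xK; case: (hU x x xK xK) => _ [[//|[i [_ /eqP]]]].
- suff H x y : (x < K)%N -> (y < K)%N -> U x y <= U y x.
    by move=> x y xK yK; apply/eqP; rewrite eq_le !H.
  move=> xK yK; have [_ [[->|[i [iT ne ->]]] _]] := hU x y xK yK.
    by have [_ []] := hU y x yK xK.
  by have [h _] := hU y x yK xK; apply: h; rewrite // eq_sym.
- by move=> x y xK yK; have [_ []] := hU x y xK yK.
- move=> x y z xK yK zK; have [h1 [_ u1]] := hU x y xK yK; have [h2 _] := hU y z yK zK.
  have [_ [[->|[i [iT ne ->]]] _]] := hU x z xK zK; first by rewrite le_max u1.
  rewrite le_max; case: (eqVneq (ctr i x) (ctr i y)) => [e|/(h1 i iT)->//].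
  by rewrite h2 ?orbT // -e.
Qed.

(** Two slots with the same center at level [i] are at distance at most [2 b r_i < r_i / 2]. The
    level with [r_i / 2 < D x y <= r_i] therefore separates them. *)
Lemma tree_dominates f b U : tree_spec f b U -> b < 1 / 4 ->
  forall x y, (x < K)%N -> (y < K)%N -> D x y <= U x y.
Proof.
move=> [ctr [hc hU]] b4 x y xK yK; have [h1 [_ u0]] := hU x y xK yK.
have [Dp|] := ltP 0 (D x y); last by move=> le; apply: le_trans le u0.
have [i iT /andP[i1 i2]] := level_cover Dtop top0 xK yK Dp.
have [e|ne] := eqVneq (ctr i x) (ctr i y); last exact: le_trans i2 (h1 i iT ne).
have [cK c1 _] := hc i x iT xK; have [_ c2 _] := hc i y iT yK.
have := Dtri xK cK yK; rewrite (Dsym (ctr i x) y) e; rewrite e in c1 => h.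
have : b * r i <= 1 / 4 * r i by apply: ler_wpM2r; [exact: rseq_ge0|exact: ltW].
lra.
Qed.

(** A level [i] separates a pair only if some slot [s] is within [b r_i] of exactly one of its ends
    and has least priority among the slots at least as close to the pair. For fixed [s], the scales
    that allow this, weighted by [r_i] and summed over the levels, have measure at most the distance
    of the pair. Dividing by the length 1/8 of the range of scales gives the factor 8. *)
Lemma tree_below_average (I : finType) (x y : I -> 'I_K) (f : nat -> nat) (U : R -> nat -> nat -> R) :
  (forall b, candidate b -> tree_spec f b (U b)) ->
  exists2 b, candidate b &
    \sum_c U b (x c) (y c) <= 8 * \sum_c \sum_(s < K)
      ([forall t : 'I_K, (Num.min (D (x c) t) (D (y c) t) <= Num.min (D (x c) s) (D (y c) s)) ==>
          (f s <= f t)%N])%:R * D (x c) (y c).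
Proof.
move=> hU.
pose dl c (s : 'I_K) := Num.min (D (x c) s) (D (y c) s).
pose Dl c (s : 'I_K) := Num.max (D (x c) s) (D (y c) s).
pose fst c s := [forall t : 'I_K, (dl c t <= dl c s) ==> (f s <= f t)%N].
(* One weighted interval for each pair, level and slot: the scales at which the slot can cut the
   pair at that level. A single scale serves the sum over all pairs. *)
have [||b [b1 b2] hb] := @below_average R (I * 'I_T * 'I_K)%type
   (fun j => r j.1.2 * (fst j.1.1 j.2)%:R) (fun j => dl j.1.1 j.2 / r j.1.2)
   (fun j => Dl j.1.1 j.2 / r j.1.2) (1 / 8) (1 / 4).
- by lra.
- by move=> j; rewrite mulr_ge0 // rseq_ge0.
(* A right end is a distance divided by a level, and a nonzero level is a distance; a zero level
   would give the scale 0, below 1/8. *)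
have cb : candidate b.
  case: b2 => [->|[[[c i] s] /= e]]; first by left.
  case: (eqVneq (r i) 0) => [r0|rn0].
    by move: b1; rewrite e r0 invr0 mulr0 => /andP[h _]; exfalso; lra.
  right; split=> //; have [_ _ [e0|[p [q [pK qK _ e0]]]]] := levelP K D (hseq K D top i).
    by rewrite /rseq e0 eqxx in rn0.
  rewrite e /Dl /rseq e0; case: (leP (D (x c) s) (D (y c) s)) => _.
    by exists (y c), s, p, q; split.
  by exists (x c), s, p, q; split.
exists b => //; have [ctr [hc hUb]] := hU b cb.
have {}b1 : 1 / 8 <= b < 1 / 4 := b1.
(* The tree distance is the radius of one separating level, and it is charged to the center that
   comes first in the lexicographic order. *)
have step1 c : U b (x c) (y c) <= \sum_(i < T) \sum_(s < K) (r i * (fst c s)%:R) *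
    ((dl c s / r i <= b) && (b < Dl c s / r i))%:R.
  have terms0 i s : 0 <= (r i * (fst c s)%:R) * ((dl c s / r i <= b) && (b < Dl c s / r i))%:R.
    by rewrite !mulr_ge0 // rseq_ge0.
  have [_ [[->|[i [iT ne ->]]] _]] := hUb (x c) (y c) (ltn_ord _) (ltn_ord _).
    by apply: sumr_ge0 => i _; apply: sumr_ge0.
  rewrite (bigD1 (Ordinal iT)) //= ler_wpDr //.
    by apply: sumr_ge0 => j _; apply: sumr_ge0.
  case: (eqVneq (r i) 0) => [r0|rn0]; first by rewrite r0; apply: sumr_ge0 => s _; rewrite !mul0r.
  have rp : 0 < r i by rewrite lt_neqAle eq_sym rn0 rseq_ge0.
  suff [s hs1 hs2] : exists2 s : 'I_K, fst c s & dl c s <= b * r i < Dl c s.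
    rewrite (bigD1 s) //= hs1 mulr1 ler_pdivrMr // ltr_pdivlMr // hs2 mulr1.
    by rewrite lerDl; apply: sumr_ge0.
  (* The earlier center of [u] lies outside the ball of [v]; otherwise it would also be the center
     of [v]. *)
  have H (u v : 'I_K) : lexle f (ctr i u) (ctr i v) -> ctr i u != ctr i v ->
     exists2 s : 'I_K, D u s <= b * r i < D v s &
        forall t : 'I_K, D u t <= b * r i \/ D v t <= b * r i -> (f s <= f t)%N.
    have [uK u1 u2] := hc i u iT (ltn_ord _); have [vK v1 v2] := hc i v iT (ltn_ord _).
    move=> le ne'; exists (Ordinal uK).
      rewrite u1 /= ltNge; apply/negP => le'; have := v2 _ uK le'.
      by move: le ne'; rewrite /lexle; lia.
    move=> t /= [ht|ht]; first by have := u2 t (ltn_ord _) ht; rewrite /lexle; lia.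
    by have := v2 t (ltn_ord _) ht; move: le; rewrite /lexle; lia.
  have : lexle f (ctr i (x c)) (ctr i (y c)) || lexle f (ctr i (y c)) (ctr i (x c)).
    by rewrite /lexle; lia.
  case/orP=> [/H/(_ ne)|/H]; last rewrite eq_sym => /(_ ne).
    case=> s /andP[s1 s2] s3; exists s.
      apply/forallP => t; apply/implyP => le; apply: s3.
      have : dl c t <= b * r i by apply: le_trans le _; rewrite /dl ge_min s1.
      by rewrite /dl ge_min => /orP[]; [left|right].
    by rewrite /dl /Dl ge_min s1 /= lt_max s2 orbT.
  case=> s /andP[s1 s2] s3; exists s.
    apply/forallP => t; apply/implyP => le; apply: s3.
    have : dl c t <= b * r i by apply: le_trans le _; rewrite /dl ge_min s1 orbT.
    by rewrite /dl ge_min => /orP[]; [right|left].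
  by rewrite /dl /Dl ge_min s1 orbT /= lt_max s2.
apply: le_trans (ler_sum _ (fun c _ => step1 c)) _.
have e8 : (1 / 4 - 1 / 8 : R) = 8^-1 by lra.
have hb' : \sum_c \sum_(i < T) \sum_(s < K) (r i * (fst c s)%:R) *
    ((dl c s / r i <= b) && (b < Dl c s / r i))%:R <=
  8 * \sum_c \sum_(i < T) \sum_(s < K) (r i * (fst c s)%:R) * overlap (dl c s / r i) (Dl c s / r i) (1/8) (1/4).
  by rewrite !pair_big /=; move: hb; rewrite e8; lra.
apply: le_trans hb' _; rewrite ler_pM2l //; apply: ler_sum => c _.
rewrite exchange_big /=; apply: ler_sum => s _.
rewrite (eq_bigr (fun i : 'I_T => (fst c s)%:R * overlap (dl c s) (Dl c s) (r i / 8) (r i / 4))); last first.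
  move=> i _; case: (eqVneq (r i) 0) => [r0|rn0].
    rewrite r0 !mul0r /overlap; have : 0 <= dl c s by rewrite /dl le_min !D0.
    have : dl c s <= Dl c s by rewrite /dl /Dl ge_min !le_max lexx.
    move: (dl c s) (Dl c s) => u v uv u0.
    by rewrite (min_idPr (le_trans u0 uv)) (max_idPl u0) sub0r (max_idPl _) ?mulr0 // oppr_le0.
  have rp : 0 < r i by rewrite lt_neqAle eq_sym rn0 rseq_ge0.
  rewrite (_ : r i / 8 = r i * (1 / 8)) ?div1r // (_ : r i / 4 = r i * (1 / 4)) ?div1r //.
  by rewrite -overlap_scale // mulrCA mulrA.
rewrite -mulr_sumr; apply: ler_wpM2l => //.
apply: le_trans (@overlap_levels R r (dl c s) (Dl c s) T _ _ _) _.
- exact: rseq_ge0.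
- by move=> i; exact: rseq_half.
- by rewrite /dl /Dl ge_min !le_max lexx.
(* The distances of [s] to the two ends differ by at most the distance between the ends. *)
rewrite /dl /Dl; have h1 := Dtri (ltn_ord (x c)) (ltn_ord (y c)) (ltn_ord s).
have := Dtri (ltn_ord (y c)) (ltn_ord (x c)) (ltn_ord s); rewrite (Dsym (y c) (x c)).
by case: (leP (D (x c) s) (D (y c) s)) => h; lra.
Qed.

(** A slot must be first among all slots at least as close, whose number is its rank in the order of
    distances to the pair; this has probability at most 2 divided by the rank. *)
Lemma first_expectation (N : nat) (dl : 'I_K -> R) : (T <= N.+1)%N ->
  \sum_(f : {ffun 'I_K -> 'I_N.+1}) \sum_(s < K)
     ([forall t : 'I_K, (dl t <= dl s) ==> (f s <= f t)%N])%:R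
  <= (N.+1 ^ K)%:R * (2 * harmonic_sum K) :> R.
Proof.
move=> KN; rewrite exchange_big /=.
apply: (@le_trans _ _ (\sum_(s < K) (N.+1 ^ K)%:R * (2 * (#|[set t in [set: 'I_K] | dl t <= dl s]|%:R)^-1))).
  apply: ler_sum => s _; set A := [set t in _ | _].
  have sA : s \in A by rewrite !inE lexx.
  have := first_count KN sA; rewrite -(@ler_nat R) !natrM.
  have -> : \sum_(f : {ffun 'I_K -> 'I_N.+1}) ([forall t : 'I_K, (dl t <= dl s) ==> (f s <= f t)%N])%:R
     = #|[set f | is_first (N := N) A s f]|%:R :> R.
    rewrite -sum1_card natr_sum [RHS]big_mkcond /=; apply: eq_bigr => f _.
    have -> : (f \in [set f | is_first (N := N) A s f]) = [forall t : 'I_K, (dl t <= dl s) ==> (f s <= f t)%N].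
      by rewrite inE; apply: eq_forallb => t; rewrite !inE.
    by case: [forall _, _].
  have Ap : 0 < #|A|%:R :> R by rewrite ltr0n; apply/card_gt0P; exists s.
  by rewrite mulrA ler_pdivlMr // mulrC [_ * 2]mulrC.
rewrite -mulr_sumr; apply: ler_wpM2l => //; rewrite -mulr_sumr; apply: ler_wpM2l => //.
have := sum_rank_le dl [set: 'I_K]; rewrite cardsT card_ord; apply: le_trans.
by rewrite [X in _ <= X](eq_bigl xpredT) // => s; rewrite inE.
Qed.

(** As [val] is below the tree cost of every candidate scale, it is below that of the good scale,
    which may depend on the priorities. The factor 16 is 8 for the scale times 2 for the ties. *)
Lemma tree_expectation (N : nat) (I : finType) (x y : I -> 'I_K) (val : seq nat -> R) :
  (T <= N.+1)%N ->
  (forall t : K.-tuple 'I_N.+1, exists U : R -> nat -> nat -> R,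
     (forall b, candidate b -> tree_spec (nth 0%N [seq nat_of_ord i | i <- t]) b (U b)) /\
     (forall b, candidate b -> val [seq nat_of_ord i | i <- t] <= \sum_c U b (x c) (y c))) ->
  (\sum_(t : K.-tuple 'I_N.+1) val [seq nat_of_ord i | i <- t]) / (N.+1 ^ K)%:R
    <= 16 * harmonic_sum K * \sum_c D (x c) (y c).
Proof.
move=> KN hval; rewrite ler_pdivrMr ?ltr0n ?expn_gt0 //.
pose dl c (s : 'I_K) := Num.min (D (x c) s) (D (y c) s).
pose G (f : {ffun 'I_K -> 'I_N.+1}) := 8 * \sum_c \sum_(s < K)
      ([forall t : 'I_K, (dl c t <= dl c s) ==> (f s <= f t)%N])%:R * D (x c) (y c).
pose h (f : {ffun 'I_K -> 'I_N.+1}) : K.-tuple 'I_N.+1 := [tuple f i | i < K].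
have hb : bijective h.
  exists (fun t => [ffun i => tnth t i]) => [f|t].
    by apply/ffunP => i; rewrite ffunE tnth_mktuple.
  by apply: eq_from_tnth => i; rewrite tnth_mktuple ffunE.
rewrite (reindex h) /=; last exact: onW_bij.
apply: (@le_trans _ _ (\sum_f G f)).
  apply: ler_sum => f _; have [U [hU1 hU2]] := hval (h f).
  have [b cb hb2] := tree_below_average x y hU1.
  apply: le_trans (hU2 b cb) _; apply: le_trans hb2 _.
  rewrite le_eqVlt; apply/orP; left; apply/eqP; rewrite /G; congr (_ * _).
  apply: eq_bigr => c _; apply: eq_bigr => s _; congr (_%:R * _); congr nat_of_bool.
  have nthE (i : 'I_K) : nth 0%N [seq nat_of_ord j | j <- h f] i = f i.
    by rewrite (nth_map (f i)) ?size_tuple // -tnth_nth tnth_mktuple.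
  by apply: eq_forallb => t; rewrite !nthE.
rewrite -mulr_sumr exchange_big /= mulr_sumr.
rewrite mulrAC mulr_sumr.
apply: ler_sum => c _.
rewrite (eq_bigr (fun f : {ffun 'I_K -> 'I_N.+1} => (\sum_(s < K)
   ([forall t : 'I_K, (dl c t <= dl c s) ==> (f s <= f t)%N])%:R) * D (x c) (y c))); last first.
  by move=> f _; rewrite mulr_suml.
rewrite -mulr_suml mulrA; apply: ler_wpM2r => //.
have := first_expectation (dl c) KN.
by set X := \sum_f _; set Y := (_ ^ _)%:R; set H := harmonic_sum K; nra.
Qed.

End Centers.

(** * Random tree metrics: the program *)

Section TreeProgram.
Context {R : realType}.
Implicit Types (s : state R).

Definition slotd s (x y : nat) : R := rmem s rD x y.

Lemma level_r_spec s K : imem s aK 0 0 = K -> rmem s rLev 0 0 = 0 ->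
  (forall x y, 0 <= slotd s x y) ->
  is_level K (slotd s) (rmem s rH 0 0) (rmem (run p_level_r s) rLev 0 0).
Proof.
move=> hK l0 d0; set h := rmem s rH 0 0.
pose P i j s' := [/\ 0 <= rmem s' rLev 0 0,
    (forall x y, (x < K)%N -> (y < K)%N -> (x < i)%N || (x == i) && (y < j)%N ->
      slotd s x y <= h -> slotd s x y <= rmem s' rLev 0 0) &
    rmem s' rLev 0 0 = 0 \/ exists x y, [/\ (x < K)%N, (y < K)%N, slotd s x y <= h & rmem s' rLev 0 0 = slotd s x y]].
suff : P K 0%N (run p_level_r s).
  by case=> h1 h2 h3; split=> // x y xK yK; apply: h2; rewrite ?xK.
apply: (@for2_ind _ P K K) => //.
- move=> i s' lti [h1 h2 h3]; split=> // x y xK yK.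
  rewrite ltn0 andbF orbF ltnS leq_eqVlt => /orP[/eqP e|xi]; apply: h2 => //.
    by rewrite e eqxx yK orbT.
  by rewrite xi.
- by split; rewrite ?l0 //; [move=> x y _ _; rewrite ltn0 andbF|left].
move=> i j s' lti ltj [h1 h2 h3] xi xj [kI kR].
rewrite runIf /= xi xj !(kR rD) // (kR rH) // -/h -/(slotd s i j).
case: ifP => [/andP[c1 c2]|cF].
  rewrite /P; mem; rewrite xi xj (kR rD) // -/(slotd s i j); split; first exact: d0.
    move=> x y xK yK /orP[xi'|/andP[/eqP-> yj]] le.
      by apply: le_trans c2; apply: h2; rewrite // xi'.
    move: yj; rewrite ltnS leq_eqVlt => /orP[/eqP->//|yj].
    by apply: le_trans c2; move: le; apply: h2; rewrite // -?e ?eqxx ?yj ?orbT.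
  by right; exists i, j.
rewrite runSkip; split=> // x y xK yK /orP[xi'|/andP[/eqP e yj]] le.
  by apply: h2; rewrite // xi'.
move: yj; rewrite ltnS leq_eqVlt => /orP[/eqP ey|yj]; last first.
  by apply: h2; rewrite // e eqxx yj orbT.
move: cF; rewrite -e -ey le /= => /negbT; rewrite -ltNge; exact: ltW.
Qed.

Lemma centers_x_spec s K x : imem s aK 0 0 = K -> imem s xX 0 0 = x -> (x < K)%N ->
  imem s aCtr x 0 = x -> slotd s x x <= rmem s rScale 0 0 * rmem s rLev 0 0 ->
  is_center K (slotd s) (fun i => imem s aPri i 0) (rmem s rScale 0 0 * rmem s rLev 0 0) x
    (imem (run p_centers_x s) aCtr x 0) /\
  forall y, y != x -> imem (run p_centers_x s) aCtr y 0 = imem s aCtr y 0.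
Proof.
move=> hK hx xK cx dx; set rad := _ * _; set f := (fun i => _).
pose P i s' := [/\ (imem s' aCtr x 0 < K)%N, slotd s x (imem s' aCtr x 0) <= rad,
   forall t, (t < i)%N -> slotd s x t <= rad -> lexle f (imem s' aCtr x 0) t &
   forall y, y != x -> imem s' aCtr y 0 = imem s aCtr y 0].
suff : P K (run p_centers_x s) by case=> h1 h2 h3 h4; split=> //; split=> // t tK; apply: h3.
apply: (@for_ind _ P K) => //; first by split; rewrite ?cx.
move=> i s' lti [h1 h2 h3 h4] xi [kI kR].
rewrite runIf /= (kI xX) // hx xi !(kI aPri) // (kR rD) // (kR rScale) // (kR rLev) //.
rewrite -/(slotd s x i) -/rad -/(f i) -/(f (imem s' aCtr x 0)).
case: ifP => [/and3P[c1 c2 c3]|cF].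
  rewrite /P; mem; rewrite (kI xX) // hx xi eqxx; split=> //.
    move=> t; rewrite ltnS leq_eqVlt => /orP[/eqP->_|ti ht].
      by rewrite /lexle eqxx leqnn orbT.
    by have := h3 t ti ht; move: c2 c3; rewrite /lexle; lia.
  by move=> y yx; rewrite (negbTE yx) h4.
rewrite runSkip; split=> // t; rewrite ltnS leq_eqVlt => /orP[/eqP->|ti] ht; last exact: h3.
by move: cF; rewrite ht /= /lexle; lia.
Qed.

Lemma centers_spec s K : imem s aK 0 0 = K ->
  (forall x, (x < K)%N -> slotd s x x <= rmem s rScale 0 0 * rmem s rLev 0 0) ->
  forall x, (x < K)%N -> is_center K (slotd s) (fun i => imem s aPri i 0)
    (rmem s rScale 0 0 * rmem s rLev 0 0) x (imem (run p_centers s) aCtr x 0).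
Proof.
move=> hK dx; set rad := _ * _; set f := (fun i => _).
apply: (@for_ind _ (fun m s' => forall x, (x < m)%N -> is_center K (slotd s) f rad x (imem s' aCtr x 0)) K) => //.
move=> i s' lti h xi [kI kR] x; rewrite runSeq; set s1 := run (PSetI _ _ _ _) s'.
have D1 u v : slotd s1 u v = slotd s u v by rewrite /slotd /s1; frame; rewrite kR.
have P1 u : imem s1 aPri u 0 = f u by rewrite /s1; frame; rewrite kI.
have R1 : rmem s1 rScale 0 0 * rmem s1 rLev 0 0 = rad by rewrite /s1; frame; rewrite !kR.
have [||||| [h1 h2 h3] h4] := @centers_x_spec s1 K i; rewrite ?R1 ?D1 //.
- by rewrite /s1; frame; rewrite kI.
- by rewrite /s1; mem; rewrite xi eqxx.
- exact: dx.
rewrite ltnS leq_eqVlt => /orP[/eqP->|xi']; last first.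
  rewrite h4 ?(ltn_eqF xi') // /s1; mem; rewrite xi (ltn_eqF xi'); exact: h.
rewrite R1 D1 in h2; split=> // t tK ht.
have := h3 t tK; rewrite R1 D1 => /(_ ht).
by rewrite /lexle !P1.
Qed.

Lemma separate_spec s K : imem s aK 0 0 = K ->
  forall x y, (x < K)%N -> (y < K)%N -> rmem (run p_separate s) rU x y =
    if (imem s aCtr x 0 != imem s aCtr y 0) && (rmem s rU x y < rmem s rLev 0 0)
    then rmem s rLev 0 0 else rmem s rU x y.
Proof.
move=> hK.
pose G x y := if (imem s aCtr x 0 != imem s aCtr y 0) && (rmem s rU x y < rmem s rLev 0 0)
    then rmem s rLev 0 0 else rmem s rU x y.
pose P i j s' := forall x y, (x < K)%N -> (y < K)%N -> rmem s' rU x y =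
   if (x < i)%N || (x == i) && (y < j)%N then G x y else rmem s rU x y.
suff : P K 0%N (run p_separate s) by move=> h x y xK yK; rewrite h // xK.
apply: (@for2_ind _ P K K) => //.
- by move=> i s' lti h x y xK yK; rewrite h // yK andbT ltn0 andbF orbF [in RHS]ltnS [in RHS]leq_eqVlt orbC.
- by move=> x y _ _; rewrite ltn0 andbF.
move=> i j s' lti ltj h xi xj [kI kR] x y xK yK.
have e : rmem s' rU i j = rmem s rU i j by rewrite h // ltnn eqxx ltnn.
rewrite runIf /= xi xj !(kI aCtr) // (kR rLev) // e -eqn_leq -ltNge.
have Gij : G i j = if (imem s aCtr i 0 != imem s aCtr j 0) && (rmem s rU i j < rmem s rLev 0 0)
    then rmem s rLev 0 0 else rmem s rU i j by [].
have stepE : (x < i)%N || (x == i) && (y < j.+1)%N =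
   ((x == i) && (y == j)) || ((x < i)%N || (x == i) && (y < j)%N).
  by lia.
rewrite stepE; case: ifP => hc; last first.
  rewrite runSkip h //; case: eqP => [->|_] //=; case: eqP => [->|_] //=.
  by rewrite !ltnn /= Gij hc.
mem; rewrite xi xj (kR rLev) // h //.
by case: eqP => [->|_] //=; case: eqP => [->|_] //=; rewrite Gij hc.
Qed.

Lemma tree_program s K : imem s aK 0 0 = K ->
  (forall x y, 0 <= slotd s x y) -> (forall x, (x < K)%N -> slotd s x x = 0) ->
  0 <= rmem s rScale 0 0 -> 0 <= rmem s rTot 0 0 ->
  tree_spec K (slotd s) (rmem s rTot 0 0) (fun i => imem s aPri i 0) (rmem s rScale 0 0)
    (fun x y => rmem (run p_tree s) rU x y).
Proof.
move=> hK d0 dxx b0 t0; set top := rmem s rTot 0 0; set b := rmem s rScale 0 0; set f := (fun i => _).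
rewrite /p_tree !runSeq; set s1 := run (setr rH _) s; set s2 := run (PFor xX aK _) s1.
have K1 : imem s1 aK 0 0 = K by rewrite /s1; frame.
have U2 x y : (x < K)%N -> (y < K)%N -> rmem s2 rU x y = 0.
  suff : forall x y, (x < K)%N -> (y < K)%N -> (x < K)%N || (x == K) && (y < 0)%N -> rmem s2 rU x y = 0.
    by move=> h xK yK; apply: h; rewrite ?xK.
  apply: (@for2_ind _ (fun i j s' => forall x y, (x < K)%N -> (y < K)%N ->
     (x < i)%N || (x == i) && (y < j)%N -> rmem s' rU x y = 0) K K) => //.
  - move=> i s' lti h u v uK vK; rewrite ltn0 andbF orbF ltnS leq_eqVlt => /orP[/eqP e|ui]; apply: h => //.
      by rewrite e eqxx vK orbT.
    by rewrite ui.
  - by move=> u v _ _; rewrite ltn0 andbF.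
  move=> i j s' lti ltj h xi xj _ u v uK vK; mem; rewrite xi xj.
  case: (altP (u =P i)) => [ui|_] /=; last by rewrite orbF => ui; apply: h; rewrite // ui.
  rewrite ui ltnn ltnS leq_eqVlt /=; case: eqP => //= _ vj.
  by apply: h; rewrite // eqxx vj orbT.
have H2 : rmem s2 rH 0 0 = top by rewrite /s2; frame; rewrite /s1; mem.
have kI2 a i j : a \notin wI p_tree -> imem s2 a i j = imem s a i j.
  by move=> h; rewrite /s2 /s1 !runI //; exact: notin_sub h.
have kR2 a i j : a \notin wR p_tree -> rmem s2 a i j = rmem s a i j.
  by move=> h; rewrite /s2 /s1 !runR //; exact: notin_sub h.
pose r := rseq K (slotd s) top.
pose P m s' := rmem s' rH 0 0 = hseq K (slotd s) top m /\
  exists ctr : nat -> nat -> nat,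
    (forall i x, (i < m)%N -> (x < K)%N -> is_center K (slotd s) f (b * r i) x (ctr i x)) /\
    forall x y, (x < K)%N -> (y < K)%N ->
      (forall i, (i < m)%N -> ctr i x != ctr i y -> r i <= rmem s' rU x y) /\
      (rmem s' rU x y = 0 \/ exists i, [/\ (i < m)%N, ctr i x != ctr i y & rmem s' rU x y = r i]) /\
      0 <= rmem s' rU x y.
suff : P (K * K)%N (run (PFor xT aK (PFor xT' aK p_level)) s2) by case.
pose P2 i j := P (i * K + j)%N.
suff : P2 K 0%N (run (PFor xT aK (PFor xT' aK p_level)) s2) by rewrite /P2 addn0.
apply: (@for2_ind _ P2 K K) => //; try by rewrite kI2.
- by move=> i s' _; rewrite /P2 addn0 mulSn addnC.
- split; first by rewrite H2.
  exists (fun _ _ => 0%N); split=> // x y xK yK; rewrite U2 //; split=> //; split=> //; by left.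
move=> i j s' lti ltj; rewrite /P2 addnS; set m := (i * K + j)%N.
move=> [hH [ctr [hc hU]]] xi xj [kI kR].
have kI' a u v : a \notin wI p_tree -> imem s' a u v = imem s a u v.
  by move=> h; rewrite kI ?kI2 //; exact: notin_sub h.
have kR' a u v : a \notin wR p_tree -> rmem s' a u v = rmem s a u v.
  by move=> h; rewrite kR ?kR2 //; exact: notin_sub h.
rewrite /p_level !runSeq.
set s3 := run (setr rLev _) s'; set s4 := run p_level_r s3; set s5 := run p_centers s4.
set s6 := run p_separate s5.
have Dk st : (forall u v, rmem st rD u v = rmem s rD u v) -> forall u v, slotd st u v = slotd s u v by [].
have D3 : forall u v, slotd s3 u v = slotd s u v by apply: Dk => u v; rewrite /s3; frame; rewrite kR'.
have D4 : forall u v, slotd s4 u v = slotd s u v by apply: Dk => u v; rewrite /s4 /s3; frame; rewrite kR'.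
have L4 : rmem s4 rLev 0 0 = r m.
  have := @level_r_spec s3 K; rewrite -/s4 => H.
  have [|||h1 h2 h3] := H.
  - by rewrite /s3; frame; rewrite kI'.
  - by rewrite /s3; mem.
  - by move=> x y; rewrite D3.
  have hh : rmem s3 rH 0 0 = hseq K (slotd s) top m by rewrite /s3; frame.
  rewrite hh in h2 h3.
  apply: (@is_level_uniq _ K (slotd s) (hseq K (slotd s) top m)); last exact: levelP.
  split=> //.
    by move=> x y xK yK; have := h2 x y xK yK; rewrite !D3.
  by case: h3 => [|[x [y]]]; rewrite ?D3; [left|right; exists x, y].
have B4 : rmem s4 rScale 0 0 = b by rewrite /s4 /s3; frame; rewrite kR'.
have P4 u : imem s4 aPri u 0 = f u by rewrite /s4 /s3; frame; rewrite kI'.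
have K4 : imem s4 aK 0 0 = K by rewrite /s4 /s3; frame; rewrite kI'.
have r0 : 0 <= r m by rewrite /r rseq_ge0.
have C5 x : (x < K)%N -> is_center K (slotd s) f (b * r m) x (imem s5 aCtr x 0).
  move=> xK; have := @centers_spec s4 K K4; rewrite L4 B4 => H.
  have [|h1 h2 h3] := H _ x xK; first by move=> y yK; rewrite D4 dxx // mulr_ge0.
  rewrite -/s5 D4 in h1 h2 h3; split=> // t tK; rewrite -D4 => ht.
  by have := h3 t tK ht; rewrite /lexle !P4.
have U5 x y : rmem s5 rU x y = rmem s' rU x y by rewrite /s5 /s4 /s3; frame.
have L5 : rmem s5 rLev 0 0 = r m by rewrite /s5; frame.
have K5 : imem s5 aK 0 0 = K by rewrite /s5; frame.
have U7 x y : rmem (run (setr rH (RDiv (rrg rLev) (rnat 2))) s6) rU x y = rmem s6 rU x y by frame.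
split.
  by mem; have -> : rmem s6 rLev 0 0 = r m by rewrite /s6; frame.
exists (fun k x => if k == m then imem s5 aCtr x 0 else ctr k x); split.
  move=> k x; rewrite ltnS leq_eqVlt; case: eqP => [->|_] /= km xK; [exact: C5|exact: hc].
move=> x y xK yK; rewrite U7 /s6 (separate_spec K5 xK yK) U5 L5.
have [h1 [h2 h3]] := hU x y xK yK; split.
  move=> k; rewrite ltnS leq_eqVlt; case: eqP => [->_ ne|_ /= km ne]; last first.
    have := h1 k km ne; case: ifP => // /andP[_ /ltW le] h; exact: le_trans h le.
  by rewrite ne /=; case: ltP.
case: ifP => [/andP[ne _]|_].
  by split=> //; right; exists m; rewrite ltnSn eqxx.
split=> //; case: h2 => [->|[k [km ne ->]]]; [by left|right; exists k].
by rewrite (ltn_eqF km); split=> //; rewrite ltnS ltnW.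
Qed.

End TreeProgram.

(** * Dynamic program over the merges: the program *)

Section Convolution.
Context {R : realType}.
Variables (l V : nat) (dig : nat -> nat -> nat).

(** The addition of codes is then the addition of count vectors. *)
Definition no_carry (u w : nat) : Prop :=
  forall i, (i < l)%N -> (dig u i + dig w i)%N = dig (u + w)%N i.

(* The number of clients that a merge of two clusters can serve inside, when
   the clusters contain [Na], [Nb] clients and receive [u], [w]. *)
Definition matched (Na Nb : nat -> nat) (u w : nat -> nat) : nat :=
  (\sum_(i < l) (minn (Na i - u i) (w i - Nb i) + minn (u i - Na i) (Nb i - w i)))%N.

(** A minimum convolution of two tables in which negative entries mean unreachable. The first clause
    bounds the result by every admissible split, and the second has it attained at [ch]. *)
Definition is_conv (Na Nb : nat -> nat) (h : R) (Aa Ab : nat -> R) (ch : nat -> nat) (T : nat -> R) : Prop :=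
  (forall u w, (u + w < V)%N -> 0 <= Aa u -> 0 <= Ab w -> no_carry u w ->
     0 <= T (u + w)%N <= Aa u + Ab w + h * (matched Na Nb (dig u) (dig w))%:R) /\
  (forall v, (v < V)%N -> 0 <= T v ->
     [/\ (ch v <= v)%N, 0 <= Aa (ch v), 0 <= Ab (v - ch v)%N, no_carry (ch v) (v - ch v) &
       T v = Aa (ch v) + Ab (v - ch v)%N + h * (matched Na Nb (dig (ch v)) (dig (v - ch v)%N))%:R]).

Definition merge_step (K : nat) (U : nat -> nat -> R) (al al' : nat -> bool) (N N' : nat -> nat -> nat)
    (A A' : nat -> nat -> R) (a b : nat) (h : R) (ch : nat -> nat) : Prop :=
  [/\ [/\ (a < b)%N, (b < K)%N, al a & al b],
    h = U a b /\ (forall x y, (x < y)%N -> (y < K)%N -> al x -> al y -> h <= U x y),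
    forall x, (x < K)%N -> al' x = al x && (x != b),
    (forall x i, (x < K)%N -> (i < l)%N -> N' x i = if x == a then (N a i + N b i)%N else N x i) &
    (forall x v, (x < K)%N -> x != a -> (v < V)%N -> A' x v = A x v) /\
    is_conv (N a) (N b) h (A a) (A b) ch (A' a)].

(** A history of the dynamic program indexed by the number of merges, which separates the
    mathematics from a machine that overwrites its tables. *)
Definition dp_run (K m : nat) (U : nat -> nat -> R) (N0 : nat -> nat -> nat) (fair : nat -> bool)
    (al : nat -> nat -> bool) (N : nat -> nat -> nat -> nat) (A : nat -> nat -> nat -> R)
    (ma mb : nat -> nat) (mh : nat -> R) (ch : nat -> nat -> nat) : Prop :=
  [/\ forall x, (x < K)%N -> al 0%N x,
    forall x i, (x < K)%N -> (i < l)%N -> N 0%N x i = N0 x i,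
    forall x v, (x < K)%N -> (v < V)%N -> A 0%N x v = if fair v then 0 else -1 &
    forall t, (t < m)%N -> merge_step K U (al t) (al t.+1) (N t) (N t.+1) (A t) (A t.+1)
      (ma t) (mb t) (mh t) (ch t)].

(** Each merge retires exactly one cluster; in particular two clusters are left before each of the
    [K.-1] merges. *)
Lemma dp_run_alive K m U N0 fair al N A ma mb mh ch :
  dp_run K m U N0 fair al N A ma mb mh ch ->
  forall t, (t <= m)%N -> (#|[set x : 'I_K | al t x]| = K - t)%N.
Proof.
move=> [h0 _ _ hs]; elim=> [|t IH] tm.
  rewrite subn0 -[RHS](card_ord K); apply: eq_card => x; rewrite !inE h0 //.
have [[ab bK aa bb] _ hal _ _] := hs t tm.
have -> : [set x : 'I_K | al t.+1 x] = [set x : 'I_K | al t x] :\ Ordinal bK.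
  by apply/setP => x; rewrite !inE hal // andbC -val_eqE.
have := cardsD1 (Ordinal bK) [set x : 'I_K | al t x].
rewrite (IH (ltnW tm)) inE /= bb; move: #|_| => k; lia.
Qed.

End Convolution.

Section DpProgram.
Context {R : realType}.
Implicit Types (s : state R).

Lemma leaves_spec s K l V : imem s aK 0 0 = K -> imem s aL 0 0 = l -> imem s aV 0 0 = V ->
  let s' := run p_leaves s in
  forall x, (x < K)%N -> [/\ imem s' aAlive x 0 = 1%N,
    forall i, (i < l)%N -> imem s' aClu x i = imem s aCnt0 x i &
    forall v, (v < V)%N -> rmem s' rA x v = if (0 < imem s aFair v 0)%N then 0 else -1].
Proof.
move=> hK hl hV.
apply: (@for_ind _ (fun m s' => forall x, (x < m)%N -> [/\ imem s' aAlive x 0 = 1%N,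
    forall i, (i < l)%N -> imem s' aClu x i = imem s aCnt0 x i &
    forall v, (v < V)%N -> rmem s' rA x v = if (0 < imem s aFair v 0)%N then 0 else -1]) K) => //.
move=> m s' lti h xm [kI kR]; rewrite !runSeq.
set s1 := run (PSetI _ _ _ _) s'; set s2 := run (PFor xI _ _) s1.
have kI1 a i j : a \notin wI p_leaves -> imem s1 a i j = imem s a i j.
  by move=> ha; rewrite /s1 runI ?kI //; exact: notin_sub ha.
have x1 : imem s1 xX 0 0 = m by rewrite /s1; frame.
have C2 : forall i, (i < l)%N -> imem s2 aClu m i = imem s aCnt0 m i.
  apply: (@for_ind _ (fun k s' => forall i, (i < k)%N -> imem s' aClu m i = imem s aCnt0 m i) l) => //.
    by rewrite kI1.
  move=> i s3 lti3 h3 xi [k3 _] j; rewrite ltnS leq_eqVlt; mem.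
  by rewrite (k3 xX) // x1 xi (k3 aCnt0) // kI1 // eqxx /=; case: eqP => [->//|_ /=]; exact: h3.
have C2' : forall x i, x != m -> imem s2 aClu x i = imem s' aClu x i.
  move=> x i xm'; suff : (fun s => imem s aClu x i = imem s' aClu x i) s2 by [].
  apply: (@for_ind _ (fun _ s => imem s aClu x i = imem s' aClu x i) l) => //.
    by rewrite kI1.
  by move=> j s3 ltj h3 xj [k3 _]; mem; rewrite (k3 xX) // x1 (negbTE xm').
set F := PFor xV aV _.
have A3 : forall v, (v < V)%N -> rmem (run F s2) rA m v = if (0 < imem s aFair v 0)%N then 0 else -1.
  apply: (@for_ind _ (fun k s' => forall v, (v < k)%N ->
    rmem s' rA m v = if (0 < imem s aFair v 0)%N then 0 else -1) V) => //.
    by rewrite /s2; frame; rewrite kI1.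
  move=> v s3 ltv h3 xv [k3 _] w; rewrite ltnS leq_eqVlt runIf /= xv.
  have -> : imem s3 aFair v 0 = imem s aFair v 0 by rewrite k3 // /s2; frame; rewrite kI1.
  have x3 : imem s3 xX 0 0 = m by rewrite k3 // /s2; frame.
  case: ifP => hf; mem; rewrite x3 xv eqxx /=; case: eqP => [->|_ /=]; try exact: h3.
    by rewrite hf.
  by rewrite hf sub0r.
have A3' : forall x v, x != m -> rmem (run F s2) rA x v = rmem s' rA x v.
  move=> x v xm'; apply: (@for_ind _ (fun _ s => rmem s rA x v = rmem s' rA x v) V) => //.
  - by rewrite /s2; frame; rewrite kI1.
  - by rewrite /s2 /s1; frame.
  move=> w s3 ltw h3 xw [k3 _]; have x3 : imem s3 xX 0 0 = m by rewrite k3 // /s2; frame.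
  by rewrite runIf; case: ifP => _; mem; rewrite x3 (negbTE xm').
have al3 x : imem (run F s2) aAlive x 0 = imem s1 aAlive x 0 by frame; rewrite /s2; frame.
have cl3 x i : imem (run F s2) aClu x i = imem s2 aClu x i by frame.
move=> x; rewrite ltnS leq_eqVlt => /orP[/eqP->|xi].
  split=> [|i il|v vV]; last exact: A3.
    by rewrite al3 /s1; mem; rewrite xm eqxx.
  by rewrite cl3 C2.
have xm' : x != m by rewrite ltn_eqF.
have [h1 h2 h3] := h x xi; split=> [|i il|v vV].
- by rewrite al3 /s1; mem; rewrite xm (negbTE xm').
- by rewrite cl3 C2' // h2.
- by rewrite A3' // h3.
Qed.

Lemma closest_spec s K : imem s aK 0 0 = K ->
  (exists x y, [/\ (x < y)%N, (y < K)%N, (0 < imem s aAlive x 0)%N & (0 < imem s aAlive y 0)%N]) ->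
  let s' := run p_closest s in let a := imem s' aPa 0 0 in let b := imem s' aPb 0 0 in
  [/\ (a < b)%N, (b < K)%N, (0 < imem s aAlive a 0)%N, (0 < imem s aAlive b 0)%N &
   forall x y, (x < y)%N -> (y < K)%N -> (0 < imem s aAlive x 0)%N -> (0 < imem s aAlive y 0)%N ->
     rmem s rU a b <= rmem s rU x y].
Proof.
move=> hK [x0 [y0 [xy0 y0K ax ay]]] s'.
pose al x := (0 < imem s aAlive x 0)%N.
pose Q i j x y := (x < i)%N || (x == i) && (y < j)%N.
pose P i j s' := (imem s' aFlag 0 0 = 0%N /\ forall x y, (x < y)%N -> (y < K)%N -> al x -> al y -> ~~ Q i j x y) \/
  [/\ imem s' aFlag 0 0 = 1%N, (imem s' aPa 0 0 < imem s' aPb 0 0 < K)%N, al (imem s' aPa 0 0), al (imem s' aPb 0 0) &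
   forall x y, (x < y)%N -> (y < K)%N -> al x -> al y -> Q i j x y ->
     rmem s rU (imem s' aPa 0 0) (imem s' aPb 0 0) <= rmem s rU x y].
suff : P K 0%N s'.
  have QK x y : (x < y)%N -> (y < K)%N -> Q K 0%N x y by move=> xy yK; rewrite /Q (ltn_trans xy yK).
  case=> [[_ h]|[_ /andP[h1 h2] h3 h4 h5]]; first by have := h x0 y0 xy0 y0K ax ay; rewrite QK.
  by split=> // x y xy yK hx hy; apply: h5 => //; exact: QK.
rewrite /s' /p_closest runSeq; set s1 := run (seti aFlag _) s.
apply: (@for2_ind _ P K K) => //.
- have QS i x y : (x < y)%N -> (y < K)%N -> Q i.+1 0%N x y -> Q i K x y by rewrite /Q; lia.
  move=> i s2 lti [[h1 h2]|[h1 h2 h3 h4 h5]]; [left|right]; split=> // x y xy yK hx hy.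
    by apply: contra (h2 x y xy yK hx hy); exact: QS.
  by move=> q; apply: h5 => //; exact: QS.
- by left; split; [rewrite /s1; mem|move=> x y _ _ _ _; rewrite /Q; lia].
move=> i j s2 lti ltj h xi xj [kI kR].
have A2 x : imem s2 aAlive x 0 = imem s aAlive x 0 by rewrite kI // /s1; frame.
have U2 x y : rmem s2 rU x y = rmem s rU x y by rewrite kR // /s1; frame.
have QS x y : Q i j.+1 x y -> (x = i /\ y = j) \/ Q i j x y.
  by rewrite /Q; lia.
rewrite runIf /= xi xj !A2 !U2 -!ltnNge -!ltNge.
case: ifP => [/and3P[c1 /andP[c2 c3] c4]|cF].
  rewrite /P; mem; rewrite xi xj; right; split=> //; first by rewrite c1.
  move=> x y xy yK hx hy /QS[[-> ->]//|q].
  case: h => [[h1 h2]|[h1 h2 h3 h4 h5]]; first by rewrite (negbTE (h2 x y xy yK hx hy)) in q.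
  by move: c4; rewrite h1 /= negbK => /ltW le; apply: le_trans le _; exact: h5.
rewrite runSkip; case: h => [[h1 h2]|[h1 h2 h3 h4 h5]]; [left|right]; split=> // x y xy yK hx hy.
  apply/negP => /QS[[ex ey]|q]; last by rewrite (negbTE (h2 x y xy yK hx hy)) in q.
  by move: cF; rewrite h1 -ex -ey xy -/(al x) -/(al y) hx hy.
move/QS => [[ex ey]|q]; last exact: h5.
move: cF; rewrite h1 -ex -ey xy -/(al x) -/(al y) hx hy /= negbK => /negbT.
by rewrite -leNgt.
Qed.

Lemma match_spec s l u w a b : imem s aL 0 0 = l -> imem s xX 0 0 = u -> imem s xY 0 0 = w ->
  imem s aPa 0 0 = a -> imem s aPb 0 0 = b -> imem s aCnt 0 0 = 0%N -> imem s aFlag 0 0 = 1%N ->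
  let s' := run p_match s in
  imem s' aCnt 0 0 = matched l (imem s aClu a) (imem s aClu b) (imem s aDig u) (imem s aDig w) /\
  ((0 < imem s' aFlag 0 0)%N <-> no_carry l (fun v i => imem s aDig v i) u w).
Proof.
move=> hl hu hw ha hb c0 f1.
apply: (@for_ind _ (fun m s' => imem s' aCnt 0 0 = matched m (imem s aClu a) (imem s aClu b) (imem s aDig u) (imem s aDig w) /\
  ((0 < imem s' aFlag 0 0)%N <-> no_carry m (fun v i => imem s aDig v i) u w)) l) => //.
  by rewrite /matched big_ord0 c0 f1.
move=> i s' lti [h1 h2] xi [kI kR]; rewrite runSeq; set s1 := run (seti aCnt _) s'.
have c1 : imem s1 aCnt 0 0 = matched i.+1 (imem s aClu a) (imem s aClu b) (imem s aDig u) (imem s aDig w).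
  rewrite /s1; mem; rewrite h1 xi (kI aPa) // (kI aPb) // (kI xX) // (kI xY) // ha hb hu hw !(kI aClu) // !(kI aDig) //.
  rewrite /matched big_ord_recr /=; congr (_ + _)%N.
  set p := (imem s aClu a i - imem s aDig u i)%N; set q := (imem s aDig w i - imem s aClu b i)%N.
  set p' := (imem s aDig u i - imem s aClu a i)%N; set q' := (imem s aClu b i - imem s aDig w i)%N.
  by congr (_ + _)%N; lia.
have d1 v j : imem s1 aDig v j = imem s aDig v j by rewrite /s1; frame; rewrite kI.
have x1 : imem s1 xI 0 0 = i by rewrite /s1; frame.
have u1 : imem s1 xX 0 0 = u by rewrite /s1; frame; rewrite kI.
have w1 : imem s1 xY 0 0 = w by rewrite /s1; frame; rewrite kI.
have f' : imem s1 aFlag 0 0 = imem s' aFlag 0 0 by rewrite /s1; frame.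
move: s1 c1 d1 x1 u1 w1 f' => s1 c1 d1 x1 u1 w1 f'.
rewrite runIf /= x1 u1 w1 !d1 -eqn_leq; case: eqP => hq.
  rewrite runSkip c1 f'; split=> //; split=> [/h2 h j|h].
    by rewrite ltnS leq_eqVlt => /orP[/eqP->|]; [exact: hq|exact: h].
  by apply/h2 => j ji; apply: h; rewrite ltnS ltnW.
by split; [mem|mem; split=> // /(_ i (ltnSn i))/hq].
Qed.

Lemma convolve_spec s l V a b h t : imem s aL 0 0 = l -> imem s aV 0 0 = V ->
  imem s aPa 0 0 = a -> imem s aPb 0 0 = b -> imem s xT 0 0 = t -> rmem s rMh t 0 = h -> 0 <= h ->
  let s' := run p_convolve s in
  is_conv l V (fun v i => imem s aDig v i) (imem s aClu a) (imem s aClu b) h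
    (rmem s rA a) (rmem s rA b) (imem s' aCh t) (fun v => rmem s' rT v 0).
Proof.
move=> hl hV ha hb ht hh h0 s'.
rewrite /s' /p_convolve runSeq; set s1 := run (PFor xV aV _) s.
pose dig v i := imem s aDig v i.
pose Na := imem s aClu a; pose Nb := imem s aClu b.
pose val u w := rmem s rA a u + rmem s rA b w + h * (matched l Na Nb (dig u) (dig w))%:R.
have T1 : forall v, (v < V)%N -> rmem s1 rT v 0 = -1.
  apply: (@for_ind _ (fun m s' => forall v, (v < m)%N -> rmem s' rT v 0 = -1) V) => //.
  move=> v s2 ltv h2 xv [k2 _] w; rewrite ltnS leq_eqVlt; mem; rewrite xv.
  by case: eqP => [_|_ /=]; [rewrite sub0r|exact: h2].
have kI1 c i j : c \notin wI p_convolve -> imem s1 c i j = imem s c i j.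
  by move=> hc; rewrite /s1 runI //; exact: notin_sub hc.
have kR1 c i j : c \notin wR p_convolve -> rmem s1 c i j = rmem s c i j.
  by move=> hc; rewrite /s1 runR //; exact: notin_sub hc.
pose ok u w := [/\ (u + w < V)%N, 0 <= rmem s rA a u, 0 <= rmem s rA b w & no_carry l dig u w].
have val0 u w : ok u w -> 0 <= val u w.
  by case=> _ p1 p2 _; rewrite /val !addr_ge0 // mulr_ge0.
pose Q i j u w := (u < i)%N || (u == i) && (w < j)%N.
pose P i j s' := (forall u w, (u < V)%N -> (w < V)%N -> Q i j u w -> ok u w ->
      0 <= rmem s' rT (u + w)%N 0 <= val u w) /\
  (forall v, (v < V)%N -> 0 <= rmem s' rT v 0 -> (imem s' aCh t v <= v)%N /\
     ok (imem s' aCh t v) (v - imem s' aCh t v)%N /\ rmem s' rT v 0 = val (imem s' aCh t v) (v - imem s' aCh t v)%N).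
set s2 := run (PFor xX aV (PFor xY aV p_try)) s1.
suff : P V 0%N s2.
  case=> h1 h2; split.
    move=> u w uw p1 p2 nc; apply: h1 => //; try by lia.
    by rewrite /Q; lia.
  by move=> v vV p1; have [q1 [[q2 q3 q4 q5] q6]] := h2 v vV p1; split.
apply: (@for2_ind _ P V V) => //; try by rewrite kI1.
- move=> i s3 lti [h1 h2]; split=> // u w uV wV q; apply: h1 => //; move: q; rewrite /Q; lia.
- split=> [u w _ _|v vV]; first by rewrite /Q; lia.
  by rewrite T1 // ler0N1.
move=> i j s3 lti ltj [h1 h2] xi xj [k3 r3].
have kI3 c u v : c \notin wI p_convolve -> imem s3 c u v = imem s c u v.
  by move=> hc; rewrite k3 ?kI1 //; exact: notin_sub hc.
have kR3 c u v : c \notin wR p_convolve -> rmem s3 c u v = rmem s c u v.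
  by move=> hc; rewrite r3 ?kR1 //; exact: notin_sub hc.
have QS u w : Q i j.+1 u w -> (u = i /\ w = j) \/ Q i j u w by rewrite /Q; lia.
have keep s4 : (forall v, rmem s4 rT v 0 = rmem s3 rT v 0) -> (forall v, imem s4 aCh t v = imem s3 aCh t v) ->
    (ok i j -> 0 <= rmem s3 rT (i + j)%N 0 <= val i j) -> P i j.+1 s4.
  move=> e1 e2 hk; split; last by move=> v vV; rewrite e1 e2; exact: h2.
  by move=> u w uV wV /QS[[-> ->]|q]; rewrite e1 //; exact: h1.
rewrite /p_try runIf /= xi xj (kI3 aV) // hV (kI3 aPa) // (kI3 aPb) // ha hb !(kR3 rA) // -ltnNge.
case: ifP => [/and3P[c1 c2 c3]|cF]; last first.
  apply: keep => // -[p1 p2 p3 _]; by rewrite p1 p2 p3 in cF.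
rewrite !runSeq; set s4 := run (seti aCnt _) s3; set s5 := run (seti aFlag _) s4.
set s6 := run p_match s5; set s7 := run (setr rMin _) s6.
have kI5 c u v : c \notin wI p_convolve -> imem s5 c u v = imem s c u v.
  by move=> hc; rewrite /s5 /s4 !runI ?kI3 //; exact: notin_sub hc.
have X5 : imem s5 xX 0 0 = i by rewrite /s5 /s4; frame.
have Y5 : imem s5 xY 0 0 = j by rewrite /s5 /s4; frame.
have l5 : imem s5 aL 0 0 = l by rewrite kI5.
have a5 : imem s5 aPa 0 0 = a by rewrite kI5.
have b5 : imem s5 aPb 0 0 = b by rewrite kI5.
have c5 : imem s5 aCnt 0 0 = 0%N by rewrite /s5; frame; rewrite /s4; mem.
have f5 : imem s5 aFlag 0 0 = 1%N by rewrite /s5; mem.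
have [m1 m2] := match_spec l5 X5 Y5 a5 b5 c5 f5.
have m6 : imem s6 aCnt 0 0 = matched l Na Nb (dig i) (dig j).
  rewrite m1; apply: eq_bigr => k _; by rewrite !kI5.
have nc6 : (0 < imem s6 aFlag 0 0)%N <-> no_carry l dig i j.
  rewrite m2; split=> hn k lk; have := hn k lk; by rewrite !kI5.
have kI6 c u v : c \notin wI p_convolve -> imem s6 c u v = imem s c u v.
  by move=> hc; rewrite /s6 runI ?kI5 //; exact: notin_sub hc.
have kR6 c u v : c \notin wR p_convolve -> rmem s6 c u v = rmem s c u v.
  by move=> hc; rewrite /s6 /s5 /s4 !runR ?kR3 //; exact: notin_sub hc.
have X6 : imem s6 xX 0 0 = i by rewrite /s6; frame.
have Y6 : imem s6 xY 0 0 = j by rewrite /s6; frame.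
have v7 : rmem s7 rMin 0 0 = val i j.
  rewrite /s7; mem; rewrite X6 Y6 m6 !(kR6 rA) // (kI6 aPa) // (kI6 aPb) // (kI6 xT) // ha hb ht.
  by rewrite (kR6 rMh) // hh.
have X7 : imem s7 xX 0 0 = i by rewrite /s7; frame.
have Y7 : imem s7 xY 0 0 = j by rewrite /s7; frame.
have t7 : imem s7 xT 0 0 = t by rewrite /s7; frame; rewrite kI6.
have T7 v : rmem s7 rT v 0 = rmem s3 rT v 0 by rewrite /s7 /s6 /s5 /s4; frame.
have C7 v : imem s7 aCh t v = imem s3 aCh t v by rewrite /s7 /s6 /s5 /s4; frame.
have F7 : imem s7 aFlag 0 0 = imem s6 aFlag 0 0 by rewrite /s7; frame.
move: s7 v7 X7 Y7 t7 T7 C7 F7 => s7 v7 X7 Y7 t7 T7 C7 F7.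
rewrite runIf /= F7 X7 Y7 v7 T7 -!ltNge.
case: ifP => [/andP[d1 d2]|dF]; last first.
  rewrite runSkip; apply: keep => // -[p1 p2 p3 p4].
  move: dF; have -> : (0 < imem s6 aFlag 0 0)%N by apply/nc6.
  by move/negbFE => /andP[]; rewrite -!leNgt => -> ->.
have okij : ok i j by split=> //; exact/nc6.
rewrite /P; mem; rewrite X7 Y7 t7 v7; split.
  move=> u w uV wV; rewrite T7; case: (altP (u + w =P i + j)%N) => [e|ne] q hok /=.
    rewrite val0 //=; case: (QS _ _ q) => [[-> ->]//|q'].
    have /andP[g1 g2] := h1 u w uV wV q' hok; move: d2; rewrite -e negb_and !negbK.
    by case/orP=> [|/ltW le]; [rewrite ltNge g1|exact: le_trans le g2].
  by case: (QS _ _ q) => [[eu ew]|q']; [rewrite eu ew eqxx in ne|exact: h1].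
move=> v vV; rewrite T7 C7 eqxx /=; case: (altP (v =P (i + j)%N)) => [->|ne] /=; last exact: h2.
by move=> _; rewrite leq_addr addKn.
Qed.

Definition alive_in s (x : nat) : bool := (0 < imem s aAlive x 0)%N.

Lemma merge_spec s K l V t : imem s aK 0 0 = K -> imem s aL 0 0 = l -> imem s aV 0 0 = V ->
  imem s xT 0 0 = t ->
  (exists x y, [/\ (x < y)%N, (y < K)%N, alive_in s x & alive_in s y]) ->
  (forall x y, (x < K)%N -> (y < K)%N -> 0 <= rmem s rU x y) ->
  let s' := run p_merge s in
  merge_step l V (imem s aDig) K (rmem s rU) (alive_in s) (alive_in s')
    (imem s aClu) (imem s' aClu) (rmem s rA) (rmem s' rA)
    (imem s' aMa t 0) (imem s' aMb t 0) (rmem s' rMh t 0) (imem s' aCh t) /\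
  (forall t', t' != t -> [/\ imem s' aMa t' 0 = imem s aMa t' 0, imem s' aMb t' 0 = imem s aMb t' 0,
     rmem s' rMh t' 0 = rmem s rMh t' 0 & forall v, imem s' aCh t' v = imem s aCh t' v]).
Proof.
move=> hK hl hV ht h2 U0 s'; rewrite /s' /p_merge !runSeq.
set s1 := run p_closest s; set s2 := run (PSetI aMa _ _ _) s1; set s3 := run (PSetI aMb _ _ _) s2.
set s4 := run (PSetR rMh _ _ _) s3; set s5 := run p_convolve s4.
set s6 := run (PFor xV aV _) s5; set s7 := run (PFor xI aL _) s6.
set s8 := run (PSetI aAlive _ _ _) s7.
have [c1 c2 c3 c4 c5] := closest_spec hK h2.
set a := imem s1 aPa 0 0 in c1 c2 c3 c4 c5; set b := imem s1 aPb 0 0 in c1 c2 c3 c4 c5.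
rewrite -/s1 -/a -/b in c1 c2 c3 c4 c5.
have aK' : (a < K)%N := ltn_trans c1 c2.
have T1 : imem s1 xT 0 0 = t by rewrite /s1; frame.
have kI4 c i j : c \notin [:: aMa; aMb] -> imem s4 c i j = imem s1 c i j.
  by rewrite !inE negb_or => /andP[/negbTE g1 /negbTE g2]; rewrite /s4 /s3 /s2; mem; rewrite g1 g2.
have A4 : imem s4 aPa 0 0 = a by rewrite kI4.
have B4 : imem s4 aPb 0 0 = b by rewrite kI4.
have T4 : imem s4 xT 0 0 = t by rewrite kI4.
have S4 c i j : c \notin wI p_merge -> imem s4 c i j = imem s c i j.
  move=> h; rewrite kI4; last exact: notin_sub h.
  by rewrite /s1 runI //; exact: notin_sub h.
have R1 c i j : c \notin wR p_merge -> rmem s1 c i j = rmem s c i j.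
  by move=> h; rewrite /s1 runR //; exact: notin_sub h.
have R3 c i j : rmem s3 c i j = rmem s1 c i j by [].
have H4 : rmem s4 rMh t 0 = rmem s rU a b.
  by rewrite /s4; mem; rewrite T1 eqxx /= R1.
have l4 : imem s4 aL 0 0 = l by rewrite S4.
have V4 : imem s4 aV 0 0 = V by rewrite S4.
have dig4 : imem s4 aDig = imem s aDig by apply/funext => v; apply/funext => i; rewrite S4.
have A4r x v : rmem s4 rA x v = rmem s rA x v by rewrite /s4; frame; rewrite R3 /s1; frame.
have clu4 x i : imem s4 aClu x i = imem s aClu x i by rewrite kI4 // /s1; frame.
have U4 : 0 <= rmem s rU a b by apply: U0.
have [C1 C2] := convolve_spec l4 V4 A4 B4 T4 H4 U4.
rewrite -/s5 in C1 C2.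
have A5 : imem s5 aPa 0 0 = a by rewrite /s5; frame.
have B5 : imem s5 aPb 0 0 = b by rewrite /s5; frame.
have [A6 A6'] : (forall v, (v < V)%N -> rmem s6 rA a v = rmem s5 rT v 0) /\
   (forall x v, x != a -> rmem s6 rA x v = rmem s5 rA x v).
  apply: (@for_ind _ (fun m s' => (forall v, (v < m)%N -> rmem s' rA a v = rmem s5 rT v 0) /\
   (forall x v, x != a -> rmem s' rA x v = rmem s5 rA x v)) V) => //.
    by rewrite /s5; frame.
  move=> i st lti [g1 g2] xi [k r]; split=> [v|x v xa]; mem; rewrite (k aPa) // A5 xi ?(r rT) //.
    by rewrite eqxx ltnS leq_eqVlt /=; case: eqP => [->//|_ /=]; exact: g1.
  by rewrite (negbTE xa) /= g2.
have A6n : imem s6 aPa 0 0 = a by rewrite /s6; frame.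
have B6n : imem s6 aPb 0 0 = b by rewrite /s6; frame.
have ab : (b == a) = false by rewrite gtn_eqF.
have [N7 N7'] : (forall i, (i < l)%N -> imem s7 aClu a i = (imem s6 aClu a i + imem s6 aClu b i)%N) /\
   (forall x i, x != a -> imem s7 aClu x i = imem s6 aClu x i).
  have : [/\ forall i, (i < l)%N -> imem s7 aClu a i = (imem s6 aClu a i + imem s6 aClu b i)%N,
     forall i, (l <= i)%N -> imem s7 aClu a i = imem s6 aClu a i &
     forall x i, x != a -> imem s7 aClu x i = imem s6 aClu x i].
    apply: (@for_ind _ (fun m s' => [/\ forall i, (i < m)%N -> imem s' aClu a i = (imem s6 aClu a i + imem s6 aClu b i)%N,
     forall i, (m <= i)%N -> imem s' aClu a i = imem s6 aClu a i &
     forall x i, x != a -> imem s' aClu x i = imem s6 aClu x i]) l) => //.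
      by rewrite /s6 /s5; frame.
    move=> i st lti [g1 g2 g3] xi [k r]; have ap : imem st aPa 0 0 = a by rewrite k.
    have bp : imem st aPb 0 0 = b by rewrite k.
    split=> [j|j ij|x j xa]; mem; rewrite ap bp xi.
    - rewrite eqxx ltnS leq_eqVlt /=; case: eqP => [->_|_ /=]; last exact: g1.
      by rewrite g2 // g3 // ab.
    - by rewrite eqxx (gtn_eqF ij) /= g2 // ltnW.
    - by rewrite (negbTE xa) /= g3.
  by case.
have al7 x : imem s7 aAlive x 0 = imem s aAlive x 0.
  by rewrite /s7 /s6 /s5; frame; rewrite kI4 // /s1; frame.
have b7 : imem s7 aPb 0 0 = b by rewrite /s7; frame.
have al8 x : alive_in s8 x = alive_in s x && (x != b).
  by rewrite /alive_in /s8; mem; rewrite b7 al7; case: eqP; rewrite ?andbF ?andbT.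
have clu8 x i : imem s8 aClu x i = imem s7 aClu x i by rewrite /s8; frame.
have clu6 x i : imem s6 aClu x i = imem s aClu x i by rewrite /s6 /s5; frame.
have A8 x v : rmem s8 rA x v = rmem s6 rA x v by rewrite /s8 /s7; frame.
have ma8 t' : imem s8 aMa t' 0 = imem s2 aMa t' 0.
  by rewrite /s8 /s7 /s6 /s5 /s4; frame; rewrite /s3; frame.
have mb8 t' : imem s8 aMb t' 0 = imem s3 aMb t' 0.
  by rewrite /s8 /s7 /s6 /s5 /s4; frame.
have mh8 t' : rmem s8 rMh t' 0 = rmem s4 rMh t' 0.
  by rewrite /s8 /s7 /s6 /s5; frame.
have ch8 t' v : imem s8 aCh t' v = imem s5 aCh t' v.
  by rewrite /s8 /s7 /s6; frame.
have T2 : imem s2 xT 0 0 = t by rewrite /s2; frame.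
have T3 : imem s3 xT 0 0 = t by rewrite /s3; frame.
split.
  have -> : imem s8 aMa t 0 = a by rewrite ma8 /s2; mem; rewrite T1 eqxx.
  have -> : imem s8 aMb t 0 = b.
    by rewrite mb8 /s3; mem; rewrite T1 eqxx.
  have -> : rmem s8 rMh t 0 = rmem s rU a b by rewrite mh8 H4.
  split.
  - by split.
  - by split.
  - by move=> x _; rewrite al8.
  - move=> x i xK il; rewrite clu8; case: (altP (x =P a)) => [->|xa].
      by rewrite N7 // !clu6.
    by rewrite N7' // clu6.
  split.
    by move=> x v xK vV xa; rewrite A8 A6' // /s5; frame; rewrite A4r.
  have ech : imem s8 aCh t = imem s5 aCh t by apply/funext => v; rewrite ch8.
  have e1 : imem s4 aClu a = imem s aClu a by apply/funext => i; rewrite clu4.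
  have e2 : imem s4 aClu b = imem s aClu b by apply/funext => i; rewrite clu4.
  rewrite ech; move: C1 C2; rewrite e1 e2 (_ : (fun v i => imem s4 aDig v i) = imem s aDig) // => C1 C2.
  split=> [u w uw p1 p2 nc|v vV].
    rewrite A8 A6 //; have := C1 u w uw; rewrite !A4r dig4; exact.
  by rewrite A8 A6 // => p; have := C2 v vV p; rewrite !A4r dig4.
move=> t' tt'; split.
- by rewrite ma8 /s2; mem; rewrite T1 (negbTE tt') /s1; frame.
- by rewrite mb8 /s3; mem; rewrite T1 (negbTE tt') /s1; frame.
- by rewrite mh8 /s4; mem; rewrite T1 (negbTE tt') /s1; frame.
move=> v; rewrite ch8.
have : imem s5 aCh t' v = imem s4 aCh t' v; last first.
  by move=> ->; rewrite kI4 // /s1; frame.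
rewrite /s5 /p_convolve runSeq; set s9 := run _ s4.
have : imem s9 aCh t' v = imem s4 aCh t' v by rewrite /s9; frame.
have : imem s9 xT 0 0 = t by rewrite /s9; frame.
have : imem s9 aV 0 0 = V by rewrite /s9; frame.
move: s9 => s9 v9 t9 e9; rewrite -e9.
apply: (@for2_ind _ (fun _ _ s' => imem s' aCh t' v = imem s9 aCh t' v) V V) => //.
move=> i j st lti ltj g xi xj [k r]; rewrite /p_try runIf; case: ifP => // _.
rewrite !runSeq; set q1 := run _ st; set q2 := run _ q1; set q3 := run _ q2; set q4 := run _ q3.
have e4 : imem q4 aCh t' v = imem st aCh t' v by rewrite /q4 /q3 /q2 /q1; frame.
have t4' : imem q4 xT 0 0 = t by rewrite /q4 /q3 /q2 /q1; frame; rewrite k.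
move: q4 e4 t4' => q4 e4 t4'.
rewrite runIf; case: ifP => _; last by rewrite runSkip e4.
by mem; rewrite t4' (negbTE tt') e4.
Qed.

Lemma dp_spec s K l V : imem s aK 0 0 = K -> imem s aK1 0 0 = K.-1 -> imem s aL 0 0 = l -> imem s aV 0 0 = V ->
  (forall x y, (x < K)%N -> (y < K)%N -> 0 <= rmem s rU x y) ->
  let s' := run p_dp s in
  exists al N A, dp_run l V (imem s aDig) K K.-1 (rmem s rU) (imem s aCnt0) (fun v => 0 < imem s aFair v 0)%N
     al N A (fun t => imem s' aMa t 0) (fun t => imem s' aMb t 0) (fun t => rmem s' rMh t 0) (imem s' aCh) /\
     A K.-1 = rmem s' rA.
Proof.
move=> hK hK1 hl hV U0 s'; rewrite /s' /p_dp runSeq.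
have L := leaves_spec hK hl hV; rewrite /= in L.
have : forall c i j, c \notin wI p_leaves -> imem (run p_leaves s) c i j = imem s c i j by move=> *; exact: runI.
have : forall c i j, c \notin wR p_leaves -> rmem (run p_leaves s) c i j = rmem s c i j by move=> *; exact: runR.
move: (run p_leaves s) L => s1 L R1 I1.
pose P m s' := exists al N A, dp_run l V (imem s aDig) K m (rmem s rU) (imem s aCnt0) (fun v => 0 < imem s aFair v 0)%N
     al N A (fun t => imem s' aMa t 0) (fun t => imem s' aMb t 0) (fun t => rmem s' rMh t 0) (imem s' aCh) /\
   [/\ al m = alive_in s', N m = imem s' aClu & A m = rmem s' rA].
suff : P K.-1 (run (PFor xT aK1 p_merge) s1).
  by case=> al [N [A [h1 [_ _ h4]]]]; exists al, N, A.
apply: (@for_ind _ P K.-1) => //; first by rewrite I1.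
  exists (fun _ => alive_in s1), (fun _ => imem s1 aClu), (fun _ => rmem s1 rA); split=> //; split=> //.
  - by move=> x xK; have [h _ _] := L x xK; rewrite /alive_in h.
  - by move=> x i xK il; have [_ h _] := L x xK; rewrite h.
  - by move=> x v xK vV; have [_ _ h] := L x xK; rewrite h.
move=> m s2 ltm [al [N [A [hr [e1 e2 e3]]]]] xm [kI kR].
have S2 c i j : c \notin wI p_dp -> imem s2 c i j = imem s c i j.
  move=> h; rewrite kI ?I1 //; exact: notin_sub h.
have Q2 c i j : c \notin wR p_dp -> rmem s2 c i j = rmem s c i j.
  move=> h; rewrite kR ?R1 //; exact: notin_sub h.
have K2 : imem s2 aK 0 0 = K by rewrite S2.
have l2 : imem s2 aL 0 0 = l by rewrite S2.
have V2 : imem s2 aV 0 0 = V by rewrite S2.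
have U2 : rmem s2 rU = rmem s rU by apply/funext => x; apply/funext => y; rewrite Q2.
have D2 : imem s2 aDig = imem s aDig by apply/funext => x; apply/funext => y; rewrite S2.
have ex : exists x y, [/\ (x < y)%N, (y < K)%N, alive_in s2 x & alive_in s2 y].
  have cA := dp_run_alive hr (leqnn m).
  have : (1 < #|[set x : 'I_K | al m x]|)%N by rewrite cA; lia.
  case/card_gt1P => x [y]; rewrite !inE e1 => -[hx hy].
  rewrite neq_ltn => /orP[lt|lt]; [exists x, y|exists y, x]; split=> //.
have [|M1 M2] := merge_spec K2 l2 V2 xm ex; first by rewrite U2.
rewrite U2 D2 in M1.
move: (run p_merge s2) M1 M2 => s3 M1 M2.
case: hr => r1 r2 r3 r4.
exists (fun t => if t == m.+1 then alive_in s3 else al t), (fun t => if t == m.+1 then imem s3 aClu else N t),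
  (fun t => if t == m.+1 then rmem s3 rA else A t); split; last by rewrite eqxx.
split=> // t; rewrite ltnS leq_eqVlt eqSS => /orP[/eqP->|tm].
  by rewrite eqxx (ltn_eqF (ltnSn m)) e1 e2 e3.
rewrite (ltn_eqF tm) (ltn_eqF (ltnW tm : (t < m.+1)%N)).
have tm' : t != m by rewrite (ltn_eqF tm).
have [m1 m2 m3 m4] := M2 t tm'; rewrite m1 m2 m3.
have -> : imem s3 aCh t = imem s2 aCh t by apply/funext => v; rewrite m4.
exact: r4.
Qed.

End DpProgram.

(** * Dynamic program over the merges: optimality *)

Section Codes.
Variables (n : nat).

Lemma code_lt l (f : nat -> nat) : (forall i, (i < l)%N -> (f i <= n)%N) ->
  (\sum_(i < l) f i * n.+1 ^ i < n.+1 ^ l)%N.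
Proof.
elim: l => [|l IH] h; first by rewrite big_ord0.
rewrite big_ord_recr /= expnS; have := h l (ltnSn l).
have := IH (fun i il => h i (ltnW il)); set S := (\sum_(_ < _) _)%N; set E := (n.+1 ^ l)%N; nia.
Qed.

Lemma code_inj l (f g : nat -> nat) : (forall i, (i < l)%N -> (f i <= n)%N) ->
  (forall i, (i < l)%N -> (g i <= n)%N) ->
  (\sum_(i < l) f i * n.+1 ^ i = \sum_(i < l) g i * n.+1 ^ i)%N -> forall i, (i < l)%N -> f i = g i.
Proof.
elim: l => [|l IH] hf hg //; rewrite !big_ord_recr /= => e i.
have hf' j : (j < l)%N -> (f j <= n)%N by move=> jl; apply: hf; exact: ltnW.
have hg' j : (j < l)%N -> (g j <= n)%N by move=> jl; apply: hg; exact: ltnW.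
have Lf := code_lt hf'; have Lg := code_lt hg'.
have el : f l = g l.
  move: e Lf Lg; set S := (\sum_(_ < _) _)%N; set S' := (\sum_(_ < _) _)%N; set E := (n.+1 ^ l)%N => e Lf Lg.
  by case: (ltngtP (f l) (g l)) => // h; nia.
rewrite ltnS leq_eqVlt => /orP[/eqP->//|]; apply: IH => //.
by move: e; rewrite el => /addIn.
Qed.

End Codes.

Section Abel.
Context {R : realType}.

(** Summation by parts: with [Z = X - Y] nonnegative and zero at the end, the difference of the two
    sides is [h 0 * Z 0] plus the sum of the terms [(h t - h (t-1)) * Z t]. It is used in both
    directions: no transport beats the surplus, and the greedy one does not exceed it. *)
Lemma abel_le (h : nat -> R) (X Y : nat -> nat) m :
  (forall t, (t < m)%N -> 0 <= h t) -> (forall t, (t.+1 < m)%N -> h t <= h t.+1) ->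
  (forall t, (t <= m)%N -> (Y t <= X t)%N) -> X m = Y m ->
  \sum_(t < m) h t * ((Y t)%:R - (Y t.+1)%:R) <= \sum_(t < m) h t * ((X t)%:R - (X t.+1)%:R).
Proof.
move=> h0 hm YX e; pose Z t : R := (X t)%:R - (Y t)%:R.
have Z0 t : (t <= m)%N -> 0 <= Z t by move=> tm; rewrite /Z subr_ge0 ler_nat YX.
pose hh t := if t is t'.+1 then h t' else 0.
have : forall k, (k <= m)%N -> - (hh k * Z k) <= \sum_(t < k) h t * (Z t - Z t.+1).
  elim=> [|k IH] km; first by rewrite big_ord0 mul0r oppr0.
  rewrite big_ord_recr /=; have := IH (ltnW km).
  have : hh k <= h k by case: k {IH} km => [|k] km; [apply: h0|apply: hm].
  have := Z0 k (ltnW km); have := Z0 k.+1 km; nra.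
move/(_ m (leqnn _)); have -> : Z m = 0 by rewrite /Z e subrr.
rewrite mulr0 oppr0 => H; rewrite -subr_ge0 -sumrB.
by apply: le_trans H _; apply: ler_sum => t _; rewrite /Z; lra.
Qed.

End Abel.

(** * Clusters of an ultrametric under successive merges *)

Section DpMath.
Context {R : realType}.
Variables (K l V : nat) (dig : nat -> nat -> nat) (U : nat -> nat -> R) (N0 : nat -> nat -> nat)
  (fair : nat -> bool) (al : nat -> nat -> bool) (N : nat -> nat -> nat -> nat)
  (A : nat -> nat -> nat -> R) (ma mb : nat -> nat) (mh : nat -> R) (ch : nat -> nat -> nat).
Hypothesis K0 : (0 < K)%N.
Hypothesis Uxx : forall x, (x < K)%N -> U x x = 0.
Hypothesis Usym : forall x y, (x < K)%N -> (y < K)%N -> U x y = U y x.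
Hypothesis U0 : forall x y, (x < K)%N -> (y < K)%N -> 0 <= U x y.
Hypothesis Utri : forall x y z, (x < K)%N -> (y < K)%N -> (z < K)%N -> U x z <= Num.max (U x y) (U y z).
Hypothesis run : dp_run l V dig K K.-1 U N0 fair al N A ma mb mh ch.
Local Notation m := K.-1.

(** The representative of the cluster that contains slot [s] after [t] merges. *)
Fixpoint rep (t s : nat) : nat :=
  if t is t'.+1 then if rep t' s == mb t' then ma t' else rep t' s else s.

Let steps t : (t < m)%N -> merge_step l V dig K U (al t) (al t.+1) (N t) (N t.+1) (A t) (A t.+1)
      (ma t) (mb t) (mh t) (ch t).
Proof. by case: run => _ _ _; apply. Qed.

Lemma rep_alive t s : (t <= m)%N -> (s < K)%N -> (rep t s < K)%N && al t (rep t s).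
Proof.
elim: t => [|t IH] tm sK /=; first by rewrite sK; case: run => ->.
have [[ab bK aa bb] _ hal _ _] := steps tm; have /andP[h1 h2] := IH (ltnW tm) sK.
case: (altP (rep t s =P mb t)) => [e|ne].
  by rewrite (ltn_trans ab bK) hal ?(ltn_trans ab bK) // aa (ltn_eqF ab).
by rewrite h1 hal // h2 ne.
Qed.

Lemma alive_rep t x : (t <= m)%N -> (x < K)%N -> al t x -> rep t x = x.
Proof.
elim: t => [|t IH] tm xK //=; have [_ _ hal _ _] := steps tm.
by rewrite hal // => /andP[h1 h2]; rewrite (IH (ltnW tm) xK h1) (negbTE h2).
Qed.

Lemma rep_mono t s s' : rep t s = rep t s' -> rep t.+1 s = rep t.+1 s'.
Proof. by move=> /= ->. Qed.

(** One cluster is left, and it is that of 0, because a merge retires the larger of two indices. *)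
Lemma rep_final s : (s < K)%N -> rep m s = 0%N.
Proof.
move=> sK; have c := dp_run_alive run (leqnn m).
have a0 : al m 0%N.
  have : forall t, (t <= m)%N -> al t 0%N.
    elim=> [|t IH] tm; first by case: run => ->.
    have [[ab _ _ _] _ hal _ _] := steps tm; rewrite hal // IH ?(ltnW tm) //=.
    by rewrite ltn_eqF // (leq_ltn_trans _ ab).
  exact.
have /andP[rK ra] := rep_alive (leqnn m) sK.
have /eqP/cards1P[z hz] : #|[set x : 'I_K | al m x]| = 1%N by rewrite c; lia.
have : Ordinal rK \in [set z] by rewrite -hz inE.
have : Ordinal K0 \in [set z] by rewrite -hz inE.
by rewrite !inE => /eqP<- /eqP/(congr1 val).
Qed.

Let hh t : R := if t is t'.+1 then mh t' else 0.

(** With [hh t] the height of the latest merge, clusters have diameter at most [hh t], and slots of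
    different clusters are at least the height of the next merge apart. The minimality of a merge
    concerns representatives only; the ultrametric inequality carries it to arbitrary slots, since
    moving inside a cluster costs at most [hh t]. *)
Lemma separation t : (t <= m)%N ->
  (forall s s', (s < K)%N -> (s' < K)%N -> rep t s = rep t s' -> U s s' <= hh t) /\
  (forall s s', (s < K)%N -> (s' < K)%N -> rep t s != rep t s' ->
     hh t <= U s s' /\ ((t < m)%N -> mh t <= U s s')).
Proof.
have key u : (u <= m)%N ->
    (forall s s', (s < K)%N -> (s' < K)%N -> rep u s = rep u s' -> U s s' <= hh u) ->
    (forall s s', (s < K)%N -> (s' < K)%N -> rep u s != rep u s' -> hh u <= U s s') ->
    forall s s', (s < K)%N -> (s' < K)%N -> rep u s != rep u s' -> (u < m)%N -> mh u <= U s s'.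
  move=> um i1 i2 s s' sK s'K ne lt; have h2 := i2 s s' sK s'K ne.
  have [_ [_ hmin] _ _ _] := steps lt.
  have /andP[aK a1] := rep_alive um sK; have /andP[bK b1] := rep_alive um s'K.
  have hab : mh u <= U (rep u s) (rep u s').
    by move: ne; rewrite neq_ltn => /orP[lt'|lt']; [|rewrite Usym //]; apply: hmin.
  have e1 : U (rep u s) s <= hh u by apply: i1 => //; rewrite alive_rep.
  have e2 : U s' (rep u s') <= hh u by apply: i1 => //; rewrite [RHS]alive_rep.
  apply: le_trans hab _; apply: le_trans (Utri aK sK bK) _.
  rewrite ge_max (le_trans e1 h2) /=; apply: le_trans (Utri sK s'K bK) _.
  by rewrite ge_max lexx (le_trans e2 h2).
elim: t => [|t IH] tm.
  have b1 s s' : (s < K)%N -> (s' < K)%N -> rep 0 s = rep 0 s' -> U s s' <= hh 0.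
    by move=> sK s'K /= ->; rewrite Uxx.
  have b2 s s' : (s < K)%N -> (s' < K)%N -> rep 0 s != rep 0 s' -> hh 0 <= U s s'.
    by move=> sK s'K _; exact: U0.
  by split=> // s s' sK s'K ne; split; [exact: b2|exact: (key 0%N)].
have [i1 i2] := IH (ltnW tm).
have [[ab bK aa bb] [hU hmin] hal _ _] := steps tm.
have aK := ltn_trans ab bK.
have ra := alive_rep (ltnW tm) aK aa; have rb := alive_rep (ltnW tm) bK bb.
have hmono : hh t <= mh t.
  by rewrite hU; have [] := i2 _ _ aK bK; rewrite ?ra ?rb ?(ltn_eqF ab).
have toa s : (s < K)%N -> rep t s = ma t -> U s (ma t) <= mh t.
  by move=> sK e; apply: le_trans hmono; apply: i1; rewrite ?ra.
have tob s : (s < K)%N -> rep t s = mb t -> U s (mb t) <= mh t.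
  by move=> sK e; apply: le_trans hmono; apply: i1; rewrite ?rb.
have tri3 x y z w : (x < K)%N -> (y < K)%N -> (z < K)%N -> (w < K)%N ->
    U x y <= mh t -> U y z <= mh t -> U z w <= mh t -> U x w <= mh t.
  move=> xK yK zK wK l1 l2 l3; apply: le_trans (Utri xK yK wK) _; rewrite ge_max l1.
  by apply: le_trans (Utri yK zK wK) _; rewrite ge_max l2.
have b1 s s' : (s < K)%N -> (s' < K)%N -> rep t.+1 s = rep t.+1 s' -> U s s' <= hh t.+1.
  move=> sK s'K /=; case: (altP (rep t s =P mb t)) => e1; case: (altP (rep t s' =P mb t)) => e2 e.
  - by apply: le_trans hmono; apply: i1; rewrite ?e1 ?e2.
  - apply: (@tri3 s (mb t) (ma t) s') => //; first exact: tob.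
      by rewrite Usym // hU.
    by rewrite Usym //; apply: toa.
  - apply: (@tri3 s (ma t) (mb t) s') => //; first exact: toa.
      by rewrite hU.
    by rewrite Usym //; apply: tob.
  - by apply: le_trans hmono; apply: i1.
have b2 s s' : (s < K)%N -> (s' < K)%N -> rep t.+1 s != rep t.+1 s' -> hh t.+1 <= U s s'.
  move=> sK s'K ne; have ne' : rep t s != rep t s' by apply: contra ne => /eqP/rep_mono->.
  by have [_] := i2 s s' sK s'K ne'; apply.
by split=> // s s' sK s'K ne; split; [exact: b2|exact: (key t.+1)].
Qed.

Lemma mh_ge0 t : (t < m)%N -> 0 <= mh t.
Proof.
move=> tm; have [[ab bK _ _] [-> _] _ _ _] := steps tm.
by apply: U0 => //; exact: ltn_trans ab bK.
Qed.

Lemma mh_mono t : (t.+1 < m)%N -> mh t <= mh t.+1.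
Proof.
move=> tm; have [[ab bK aa bb] [-> _] _ _ _] := steps tm.
have aK := ltn_trans ab bK; have [_ h] := separation (ltnW tm).
by have [] := h _ _ aK bK; rewrite ?alive_rep ?(ltn_eqF ab) // ltnW.
Qed.

(** Only the merge that joins the two clusters contributes, and its height is the distance of the
    slots. *)
Lemma ultra_sum s s' : (s < K)%N -> (s' < K)%N ->
  U s s' = \sum_(t < m) mh t * ((rep t s != rep t s')%:R - (rep t.+1 s != rep t.+1 s')%:R).
Proof.
move=> sK s'K.
pose g t := mh t * ((rep t s != rep t s')%:R - (rep t.+1 s != rep t.+1 s')%:R).
have : forall k, (k <= m)%N -> rep k s = rep k s' -> U s s' = \sum_(t < k) g t.
  elim=> [|k IH] km e; first by rewrite big_ord0 (_ : s = s') // Uxx.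
  rewrite big_ord_recr /=; case: (eqVneq (rep k s) (rep k s')) => [e'|ne].
    by rewrite -(IH (ltnW km) e') /g e e' !eqxx subrr mulr0 addr0.
  rewrite big1 ?add0r.
    rewrite /g ne e eqxx subr0 mulr1; have [h1 _] := separation km; have [_ h2] := separation (ltnW km).
    apply/eqP; rewrite eq_le h1 //=; have [_] := h2 s s' sK s'K ne; exact.
  move=> t _; have nt u : (u <= k)%N -> rep u s != rep u s'.
    move=> uk; apply: contra ne => /eqP eu; apply/eqP.
    by rewrite -(subnKC uk); elim: (k - u)%N => [|j]; rewrite ?addn0 // addnS; exact: rep_mono.
  by rewrite /g (nt t (ltnW (ltn_ord t))) (nt t.+1 (ltn_ord t)) subrr mulr0.
by move/(_ m (leqnn _)); apply; rewrite !rep_final.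
Qed.

Definition agg (t : nat) (F : nat -> nat) (x : nat) : nat := (\sum_(s < K) (rep t s == x) * F s)%N.

Lemma agg0 F x : (x < K)%N -> agg 0 F x = F x.
Proof.
move=> xK; rewrite /agg (bigD1 (Ordinal xK)) //= eqxx mul1n big1 ?addn0 // => s.
by rewrite -val_eqE /= => /negbTE->; rewrite mul0n.
Qed.

Lemma aggS t F x : (t < m)%N ->
  agg t.+1 F x = if x == ma t then (agg t F (ma t) + agg t F (mb t))%N else if x == mb t then 0%N else agg t F x.
Proof.
move=> tm; have [[ab bK _ _] _ _ _ _] := steps tm.
rewrite /agg; case: (altP (x =P ma t)) => [->|xa].
  rewrite -big_split; apply: eq_bigr => s _ /=.
  by case: (altP (rep t s =P mb t)) => [->|ne]; rewrite ?eqxx ?(gtn_eqF ab) // addn0.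
case: (altP (x =P mb t)) => [->|xb].
  rewrite big1 // => s _ /=; case: (altP (rep t s =P mb t)) => [_|/negbTE->//].
  by rewrite (ltn_eqF ab).
apply: eq_bigr => s _ /=; case: (altP (rep t s =P mb t)) => [->|//].
by rewrite eq_sym (negbTE xa) eq_sym (negbTE xb).
Qed.

Lemma agg_final F : agg m F 0 = (\sum_(s < K) F s)%N.
Proof. by apply: eq_bigr => s _; rewrite rep_final // mul1n. Qed.

(** The truncated subtraction counts, per cluster and group, the clients of [F] beyond the demand
    [G]; these must leave their cluster. *)
Definition surplus (F G : nat -> nat -> nat) (t : nat) : nat :=
  (\sum_(x < K) \sum_(i < l) (agg t (F^~ i) x - agg t (G^~ i) x))%N.

Definition match_at (F G : nat -> nat -> nat) (t : nat) : nat :=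
  matched l (fun i => agg t (F^~ i) (ma t)) (fun i => agg t (F^~ i) (mb t))
    (fun i => agg t (G^~ i) (ma t)) (fun i => agg t (G^~ i) (mb t)).

(** A merge cancels the surplus of one part against the deficit of the other. *)
Lemma surplusS F G t : (t < m)%N -> (surplus F G t = surplus F G t.+1 + match_at F G t)%N.
Proof.
move=> tm; have [[ab bK _ _] _ _ _ _] := steps tm; have aK := ltn_trans ab bK.
rewrite /surplus (bigD1 (Ordinal aK)) //= [in RHS](bigD1 (Ordinal aK)) //=.
have nab : Ordinal bK != Ordinal aK by rewrite -val_eqE /= (gtn_eqF ab).
rewrite (bigD1 (Ordinal bK)) //= [in RHS](bigD1 (Ordinal bK)) //=.
have -> : (\sum_(x < K | (x != Ordinal aK) && (x != Ordinal bK)) \sum_(i < l)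
    (agg t.+1 (F^~ i) x - agg t.+1 (G^~ i) x) =
   \sum_(x < K | (x != Ordinal aK) && (x != Ordinal bK)) \sum_(i < l)
    (agg t (F^~ i) x - agg t (G^~ i) x))%N.
  apply: eq_bigr => x; rewrite -!val_eqE /= => /andP[/negbTE xa /negbTE xb].
  by apply: eq_bigr => i _; rewrite !aggS // xa xb.
have -> : (\sum_(i < l) (agg t.+1 (F^~ i) (mb t) - agg t.+1 (G^~ i) (mb t)) = 0)%N.
  by rewrite big1 // => i _; rewrite !aggS // eqxx (gtn_eqF ab).
have -> : (\sum_(i < l) (agg t.+1 (F^~ i) (ma t) - agg t.+1 (G^~ i) (ma t)) =
   \sum_(i < l) (agg t (F^~ i) (ma t) + agg t (F^~ i) (mb t) - (agg t (G^~ i) (ma t) + agg t (G^~ i) (mb t))))%N.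
  by apply: eq_bigr => i _; rewrite !aggS // eqxx.
rewrite add0n [in LHS]addnA [in RHS]addnAC; congr (_ + _)%N.
(* For each group, [(a - u) + (b - w) = (a + b - (u + w)) + min (a - u) (w - b) + min (u - a) (b -
   w)] in truncated subtraction. *)
rewrite /match_at /matched -!big_split; apply: eq_bigr => i _ /=; lia.
Qed.

Lemma N_agg t x i : (t <= m)%N -> (x < K)%N -> (i < l)%N -> al t x -> N t x i = agg t (N0^~ i) x.
Proof.
elim: t x => [|t IH] x tm xK il; first by case: run => _ h _ _ _; rewrite h // agg0.
have [[ab bK aa bb] _ hal hN _] := steps tm; rewrite hal // => /andP[hx xb].
rewrite hN // aggS // (negbTE xb); case: eqP => [_|_]; last exact: IH (ltnW tm) xK il hx.
by rewrite !IH ?(ltnW tm) // (ltn_trans ab bK).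
Qed.

(** * Prescribed demands bound the table *)

Section LowerBound.
Variable M : nat -> nat.
Hypothesis MV : forall s, (s < K)%N -> (M s < V)%N /\ fair (M s).
Hypothesis MA : forall t x, (t <= m)%N -> (x < K)%N -> (agg t M x < V)%N /\
  forall i, (i < l)%N -> dig (agg t M x) i = agg t (fun s => dig (M s) i) x.

Lemma match_atE t : (t < m)%N ->
  matched l (N t (ma t)) (N t (mb t)) (dig (agg t M (ma t))) (dig (agg t M (mb t))) =
  match_at N0 (fun s i => dig (M s) i) t.
Proof.
move=> tm; have [[ab bK aa bb] _ _ _ _] := steps tm; have aK := ltn_trans ab bK.
have [_ ha] := MA (ltnW tm) aK; have [_ hb] := MA (ltnW tm) bK.
apply: eq_bigr => i _; rewrite !N_agg ?(ltnW tm) //.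
by rewrite ha // hb.
Qed.

Lemma sum_alive_step t (f g : nat -> R) : (t < m)%N ->
  (forall x, (x < K)%N -> x != ma t -> f x = g x) ->
  \sum_(x < K | al t.+1 x) g x = \sum_(x < K | al t x) f x - f (ma t) - f (mb t) + g (ma t).
Proof.
move=> tm e; have [[ab bK aa bb] _ hal _ _] := steps tm; have aK := ltn_trans ab bK.
rewrite (bigD1 (Ordinal aK)) /=; last by rewrite hal // aa (ltn_eqF ab).
rewrite [in RHS](bigD1 (Ordinal aK)) //= [in RHS](bigD1 (Ordinal bK)) /=; last first.
  by rewrite bb -val_eqE /= (gtn_eqF ab).
have -> : \sum_(x < K | al t.+1 x && (x != Ordinal aK)) g x =
   \sum_(x < K | al t x && (x != Ordinal aK) && (x != Ordinal bK)) f x.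
  apply: eq_big => [x|x /andP[_ xa]]; first by rewrite hal // -!val_eqE /= andbAC.
  by rewrite e //; move: xa; rewrite -val_eqE.
by lra.
Qed.

(** At each merge the split given by the demands [M] is one of those compared, so the entries of the
    live clusters stay reachable and their sum stays below the cost of these splits. *)
Lemma dp_lower t : (t <= m)%N ->
  (forall x, (x < K)%N -> al t x -> 0 <= A t x (agg t M x)) /\
  \sum_(x < K | al t x) A t x (agg t M x) <=
    \sum_(u < t) mh u * (match_at N0 (fun s i => dig (M s) i) u)%:R.
Proof.
elim: t => [|t IH] tm.
  case: run => _ _ h _; have e x : (x < K)%N -> A 0%N x (agg 0 M x) = 0.
    by move=> xK; have [mV mf] := MV xK; rewrite agg0 // h // mf.
  split=> [x xK _|]; first by rewrite e.
  by rewrite big_ord0 big1 // => x _; rewrite e.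
have [i1 i2] := IH (ltnW tm).
have [[ab bK aa bb] [hU _] hal hN [hA [C1 _]]] := steps tm; have aK := ltn_trans ab bK.
have [va da] := MA (ltnW tm) aK; have [vb db] := MA (ltnW tm) bK.
have [vab dab] := MA tm aK.
have sab : agg t.+1 M (ma t) = (agg t M (ma t) + agg t M (mb t))%N by rewrite aggS // eqxx.
rewrite sab in vab dab.
have nc : no_carry l dig (agg t M (ma t)) (agg t M (mb t)).
  by move=> i il; rewrite da // db // dab // aggS // eqxx.
have := C1 _ _ vab (i1 _ aK aa) (i1 _ bK bb) nc; rewrite match_atE // -sab => /andP[c1 c2].
have oth x : (x < K)%N -> x != ma t -> al t.+1 x -> A t.+1 x (agg t.+1 M x) = A t x (agg t M x).
  move=> xK xa; rewrite hal // => /andP[_ xb].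
  have [vx _] := MA tm xK; rewrite hA //; by rewrite aggS // (negbTE xa) (negbTE xb).
split=> [x xK ax|].
  case: (eqVneq x (ma t)) => [->//|xa]; rewrite oth //; apply: i1 => //.
  by move: ax; rewrite hal // => /andP[].
have -> : \sum_(x < K | al t.+1 x) A t.+1 x (agg t.+1 M x) =
   \sum_(x < K | al t.+1 x) (if x == ma t :> nat then A t.+1 x (agg t.+1 M x) else A t x (agg t M x)).
  by apply: eq_bigr => x ax; case: eqP => // /eqP xa; rewrite oth.
rewrite (@sum_alive_step t (fun x => A t x (agg t M x))
  (fun x => if x == ma t then A t.+1 x (agg t.+1 M x) else A t x (agg t M x))) //; last first.
  by move=> x xK /negbTE->.
rewrite eqxx big_ord_recr /=; lra.
Qed.

Lemma dp_value_le : A m 0%N (\sum_(s < K) M s)%N <=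
  \sum_(t < m) mh t * ((surplus N0 (fun s i => dig (M s) i) t)%:R -
                       (surplus N0 (fun s i => dig (M s) i) t.+1)%:R) /\ 0 <= A m 0%N (\sum_(s < K) M s)%N.
Proof.
have [h1 h2] := dp_lower (leqnn m).
have /andP[_ a0] := rep_alive (leqnn m) K0; rewrite rep_final // in a0.
rewrite -agg_final; split; last exact: h1.
have e : \sum_(x < K | al m x) A m x (agg m M x) = A m 0%N (agg m M 0).
  rewrite (bigD1 (Ordinal K0)) //= big1 ?addr0 // => x /andP[ax x0].
  move: x0; rewrite -val_eqE /=; have := alive_rep (leqnn m) (ltn_ord x) ax.
  by rewrite rep_final // => <-; rewrite eqxx.
rewrite e in h2; apply: le_trans h2 _; rewrite le_eqVlt; apply/orP; left; apply/eqP.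
apply: eq_bigr => t _; rewrite surplusS // natrD; congr (_ * _); lra.
Qed.

End LowerBound.

(** * Demands read off the table *)

Section Backtrack.
Variable need : nat -> nat -> nat.
Variable total : nat.
Hypothesis totV : (total < V)%N.
Hypothesis need_final : forall x, (x < K)%N -> need m x = if x == 0%N then total else 0%N.
Hypothesis need_step : forall t x, (t < m)%N -> (x < K)%N -> need t x =
  if x == ma t then ch t (need t.+1 (ma t)) else
  if x == mb t then (need t.+1 (ma t) - ch t (need t.+1 (ma t)))%N else need t.+1 x.
Hypothesis A_total : 0 <= A m 0%N total.

(** The induction goes from the last merge backwards; a slot retired before time [t] has not yet
    received any demand. *)
Lemma need_spec k : (k <= m)%N -> let t := (m - k)%N in
  [/\ forall x, (x < K)%N -> (need t x < V)%N,
      forall x, (x < K)%N -> al t x -> 0 <= A t x (need t x) &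
      forall x, (x < K)%N -> ~~ al t x -> need t x = 0%N].
Proof.
elim: k => [|k IH] km /=.
  rewrite subn0; split=> x xK; rewrite need_final //.
  - by case: eqP => // _; apply: leq_ltn_trans totV.
  - move=> ax; have := alive_rep (leqnn m) xK ax; rewrite rep_final // => <-; by rewrite eqxx.
  - move=> nax; case: eqP => // x0; move: nax; rewrite x0.
    by have /andP[_] := rep_alive (leqnn m) K0; rewrite rep_final // => ->.
have [i1 i2 i3] := IH (ltnW km); set t := (m - k.+1)%N.
have tS : (m - k)%N = t.+1 by rewrite /t; lia.
have tm : (t < m)%N by rewrite /t; lia.
rewrite tS in i1 i2 i3.
have [[ab bK aa bb] _ hal _ [hA [_ C2]]] := steps tm; have aK := ltn_trans ab bK.
have ala : al t.+1 (ma t) by rewrite hal // aa (ltn_eqF ab).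
have [c1 c2 c3 _ _] := C2 _ (i1 _ aK) (i2 _ aK ala).
split=> x xK; rewrite need_step //.
- case: eqP => _; first exact: leq_ltn_trans c1 (i1 _ aK).
  case: eqP => _; last exact: i1.
  exact: leq_ltn_trans (leq_subr _ _) (i1 _ aK).
- case: eqP => [->//|/eqP xa]; case: eqP => [->//|/eqP xb] ax.
  have ax' : al t.+1 x by rewrite hal // ax xb.
  by rewrite -hA ?i1 //; apply: i2.
- case: eqP => [->|xa]; first by rewrite aa.
  case: eqP => [->|xb]; first by rewrite bb.
  by move=> nax; apply: i3; rewrite // hal // (negbTE nax).
Qed.

Lemma need_agg t x : (t <= m)%N -> (x < K)%N -> agg t (need 0) x = need t x /\
  forall i, (i < l)%N -> al t x -> agg t (fun s => dig (need 0%N s) i) x = dig (need t x) i.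
Proof.
elim: t x => [|t IH] x tm xK; first by split=> [|i il _]; rewrite agg0.
have [|i1 i2 i3] := @need_spec (m - t.+1); first exact: leq_subr.
have e : (m - (m - t.+1))%N = t.+1 by lia.
rewrite e in i1 i2 i3.
have [[ab bK aa bb] _ hal _ [hA [_ C2]]] := steps tm; have aK := ltn_trans ab bK.
have ala : al t.+1 (ma t) by rewrite hal // aa (ltn_eqF ab).
have [c1 c2 c3 c4 _] := C2 _ (i1 _ aK) (i2 _ aK ala).
have [ea da] := IH _ (ltnW tm) aK; have [eb db] := IH _ (ltnW tm) bK.
have na : need t (ma t) = ch t (need t.+1 (ma t)) by rewrite need_step // eqxx.
have nb : need t (mb t) = (need t.+1 (ma t) - ch t (need t.+1 (ma t)))%N.
  by rewrite need_step // eqxx (gtn_eqF ab).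
split=> [|i il ax]; rewrite aggS //.
  case: eqP => [->|/eqP xa]; first by rewrite ea eb na nb subnKC.
  case: eqP => [->|/eqP xb].
    by rewrite i3 // hal // eqxx andbF.
  by have [-> _] := IH x (ltnW tm) xK; rewrite need_step // (negbTE xa) (negbTE xb).
case: eqP => [->|/eqP xa]; first by rewrite da // db // na nb c4 // subnKC.
have xb : x != mb t by move: ax; rewrite hal // => /andP[].
rewrite (negbTE xb); have [_ ->] := IH x (ltnW tm) xK => //.
  by rewrite need_step // (negbTE xa) (negbTE xb).
by move: ax; rewrite hal // => /andP[].
Qed.

(** Reachable entries at the leaves are exactly those of fair codes, splits without carry preserve
    the sums of the digits, and the recorded splits attain the entries, so the total value is the
    weighted surplus of the demands found. *)
Lemma dp_backtrack :
  [/\ forall s, (s < K)%N -> (need 0%N s < V)%N /\ fair (need 0%N s),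
      forall i, (i < l)%N -> (\sum_(s < K) dig (need 0%N s) i)%N = dig total i &
      \sum_(t < m) mh t * ((surplus N0 (fun s i => dig (need 0%N s) i) t)%:R -
        (surplus N0 (fun s i => dig (need 0%N s) i) t.+1)%:R) = A m 0%N total].
Proof.
have [|i1 i2 i3] := @need_spec m; first by [].
rewrite subnn in i1 i2 i3; have [r1 r2 r3 r4] := run.
have fairM s : (s < K)%N -> fair (need 0%N s).
  move=> sK; have := i2 s sK (r1 s sK); rewrite r3 ?i1 //; case: ifP => // _.
  by rewrite ler0N1.
have /andP[_ a0] := rep_alive (leqnn m) K0; rewrite rep_final // in a0.
split.
- by move=> s sK; split; [exact: i1|exact: fairM].
- move=> i il; have [_ h] := need_agg (leqnn m) K0.
  by rewrite -(agg_final (fun s => dig (need 0%N s) i)) h // need_final.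
have matchE t : (t < m)%N -> matched l (N t (ma t)) (N t (mb t)) (dig (need t (ma t))) (dig (need t (mb t))) =
    match_at N0 (fun s i => dig (need 0%N s) i) t.
  move=> tm; have [[ab bK aa bb] _ _ _ _] := steps tm; have aK := ltn_trans ab bK.
  have [_ ha] := need_agg (ltnW tm) aK; have [_ hb] := need_agg (ltnW tm) bK.
  by apply: eq_bigr => i _; rewrite !N_agg ?(ltnW tm) // ha // hb.
have sumE : forall t, (t <= m)%N -> \sum_(x < K | al t x) A t x (need t x) =
   \sum_(u < t) mh u * (match_at N0 (fun s i => dig (need 0%N s) i) u)%:R.
  elim=> [|t IH] tm.
    rewrite big_ord0 big1 // => x _; rewrite r3 ?i1 // fairM //.
  have [|j1 j2 j3] := @need_spec (m - t.+1); first exact: leq_subr.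
  have e : (m - (m - t.+1))%N = t.+1 by lia.
  rewrite e in j1 j2 j3.
  have [[ab bK aa bb] [hU _] hal hN [hA [_ C2]]] := steps tm; have aK := ltn_trans ab bK.
  have ala : al t.+1 (ma t) by rewrite hal // aa (ltn_eqF ab).
  have [c1 c2 c3 c4 c5] := C2 _ (j1 _ aK) (j2 _ aK ala).
  have na : need t (ma t) = ch t (need t.+1 (ma t)) by rewrite need_step // eqxx.
  have nb : need t (mb t) = (need t.+1 (ma t) - ch t (need t.+1 (ma t)))%N.
    by rewrite need_step // eqxx (gtn_eqF ab).
  have -> : \sum_(x < K | al t.+1 x) A t.+1 x (need t.+1 x) =
     \sum_(x < K | al t.+1 x) (if x == ma t :> nat then A t.+1 x (need t.+1 x) else A t x (need t x)).
    apply: eq_bigr => x ax; case: eqP => // /eqP xa.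
    have xb : x != mb t :> nat by move: ax; rewrite hal // => /andP[].
    by rewrite (need_step tm (ltn_ord x)) (negbTE xa) (negbTE xb) hA // j1.
  rewrite (@sum_alive_step t (fun x => A t x (need t x))
    (fun x => if x == ma t then A t.+1 x (need t.+1 x) else A t x (need t x))) //; last first.
    by move=> x xK /negbTE->.
  rewrite eqxx big_ord_recr /= -IH ?(ltnW tm) // c5 -nb -na matchE //; lra.
have e : \sum_(x < K | al m x) A m x (need m x) = A m 0%N total.
  rewrite (bigD1 (Ordinal K0)) //= big1 ?addr0; first by rewrite need_final // eqxx.
  move=> x /andP[ax x0]; move: x0; rewrite -val_eqE /=; have := alive_rep (leqnn m) (ltn_ord x) ax.
  by rewrite rep_final // => <-; rewrite eqxx.
rewrite -e sumE //; apply: eq_bigr => t _; rewrite surplusS // natrD; congr (_ * _); lra.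
Qed.

End Backtrack.

(** * Transport cost as a sum over merges *)

Section Clients.
Variables (I : finType) (P : pred I) (x y : I -> nat) (ty : I -> nat).
Hypothesis xK : forall c, P c -> (x c < K)%N.
Hypothesis yK : forall c, P c -> (y c < K)%N.
Hypothesis tyl : forall c, P c -> (ty c < l)%N.

Definition headcount (z : I -> nat) (s i : nat) : nat := (\sum_(c | P c) ((z c == s) && (ty c == i)))%N.

Lemma agg_headcount z t u i : (forall c, P c -> (z c < K)%N) ->
  agg t ((headcount z)^~ i) u = (\sum_(c | P c) ((rep t (z c) == u) && (ty c == i)))%N.
Proof.
move=> zK; rewrite /agg /headcount.
rewrite (eq_bigr (fun s : 'I_K => \sum_(c | P c) (rep t s == u) * ((z c == s) && (ty c == i)))%N); last first.
  by move=> s _; rewrite big_distrr.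
rewrite exchange_big /=; apply: eq_bigr => c Pc.
rewrite (bigD1 (Ordinal (zK c Pc))) //= eqxx big1 ?addn0; first by case: (rep _ _ == u); case: (ty c == i).
by move=> s; rewrite -val_eqE /= eq_sym => /negbTE->; rewrite muln0.
Qed.

(** The clients whose two slots are still in different clusters; each pays for the merge that joins
    them. *)
Definition unsettled (t : nat) : nat := (\sum_(c | P c) (rep t (x c) != rep t (y c)))%N.

Lemma cost_unsettled : \sum_(c | P c) U (x c) (y c) =
  \sum_(t < m) mh t * ((unsettled t)%:R - (unsettled t.+1)%:R).
Proof.
rewrite (eq_bigr (fun c => \sum_(t < m) mh t * ((rep t (x c) != rep t (y c))%:R -
   (rep t.+1 (x c) != rep t.+1 (y c))%:R))); last by move=> c Pc; apply: ultra_sum; [exact: xK|exact: yK].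
rewrite exchange_big /=; apply: eq_bigr => t _; rewrite -mulr_sumr sumrB.
by rewrite /unsettled !natr_sum.
Qed.

Lemma unsettled_final : unsettled m = 0%N.
Proof. by rewrite /unsettled big1 // => c Pc; rewrite !rep_final ?xK ?yK. Qed.

(** Whatever the assignment, at least the surplus of a cluster has its target outside it. *)
Lemma surplus_le_unsettled t : (t <= m)%N -> (surplus (headcount x) (headcount y) t <= unsettled t)%N.
Proof.
move=> tm; rewrite /surplus.
have h u i : (agg t ((headcount x)^~ i) u - agg t ((headcount y)^~ i) u <=
   \sum_(c | P c) [&& rep t (x c) == u, ty c == i & rep t (x c) != rep t (y c)])%N.
  rewrite !agg_headcount // leq_subLR -big_split; apply: leq_sum => c _ /=.
  case: eqP => [->|_] //=; case: (ty c == i) => //=; rewrite ?andbT.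
  by rewrite eq_sym; case: eqP.
apply: (@leq_trans (\sum_(u < K) \sum_(i < l) \sum_(c | P c)
   [&& rep t (x c) == u, ty c == i & rep t (x c) != rep t (y c)])%N).
  by apply: leq_sum => u _; apply: leq_sum => i _.
rewrite (eq_bigr (fun u : 'I_K => \sum_(c | P c) \sum_(i < l)
  [&& rep t (x c) == u, ty c == i & rep t (x c) != rep t (y c)])%N); last by move=> u _; rewrite exchange_big.
rewrite exchange_big /=; apply: leq_sum => c Pc.
have /andP[rK _] := rep_alive tm (xK Pc).
rewrite (bigD1 (Ordinal rK)) //= eqxx [X in (_ + X)%N]big1 ?addn0; last first.
  move=> u; rewrite -val_eqE /= eq_sym => /negbTE->; by rewrite big1.
rewrite (bigD1 (Ordinal (tyl Pc))) //= eqxx big1 ?addn0 // => i.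
by rewrite -val_eqE /= eq_sym => /negbTE->.
Qed.

Lemma surplus_final : surplus (headcount x) (headcount y) m = 0%N.
Proof.
rewrite /surplus big1 // => u _; rewrite big1 // => i _; rewrite !agg_headcount //.
apply/eqP; rewrite subn_eq0; apply: leq_sum => c Pc; by rewrite !rep_final ?xK ?yK.
Qed.

Lemma surplus_cost_le : \sum_(t < m) mh t * ((surplus (headcount x) (headcount y) t)%:R -
    (surplus (headcount x) (headcount y) t.+1)%:R) <= \sum_(c | P c) U (x c) (y c).
Proof.
rewrite cost_unsettled; apply: abel_le.
- exact: mh_ge0.
- exact: mh_mono.
- exact: surplus_le_unsettled.
- by rewrite unsettled_final surplus_final.
Qed.

End Clients.

(** * Greedy service attains the surplus *)

Section Greedy.
Variables (I : finType) (P : pred I) (x y : I -> nat) (ty : I -> nat) (M : nat -> nat -> nat).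
Hypothesis xK : forall c, P c -> (x c < K)%N.
Hypothesis tyl : forall c, P c -> (ty c < l)%N.
Hypothesis Msum : forall i, (i < l)%N -> (\sum_(s < K) M s i)%N = (\sum_(c | P c) (ty c == i))%N.

(* [dn] are the clients served when the clusters are those of time [t], and
   [res] is the demand of the slots that is then left over. *)
Definition greedy_stage (t : nat) (dn : pred I) (res : nat -> nat -> nat) : Prop :=
  [/\ forall c, dn c -> [/\ P c, (y c < K)%N & rep t (x c) = rep t (y c)],
      forall s i, (s < K)%N -> (i < l)%N -> M s i = (res s i + \sum_c [&& dn c, y c == s & ty c == i])%N &
      forall c s, P c -> (s < K)%N -> rep t (x c) = rep t s -> dn c \/ res s (ty c) = 0%N].

Hypothesis greedy : forall t, (t <= m)%N -> exists dn res, greedy_stage t dn res.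

(** If a client of group [i] is left unserved in a cluster, the demand for group [i] in that cluster
    is exhausted. The clients served there then number exactly the demand, and those left over are
    the surplus. *)
Lemma undone_le_surplus t dn res : (t <= m)%N -> greedy_stage t dn res ->
  (\sum_(c | P c) ~~ dn c <= surplus (headcount P ty x) M t)%N.
Proof.
move=> tm [h1 h2 h3].
have key u i : (u < K)%N -> (i < l)%N ->
    (\sum_(c | P c) [&& ~~ dn c, rep t (x c) == u & ty c == i] <=
     agg t ((headcount P ty x)^~ i) u - agg t (M^~ i) u)%N.
  move=> uK il; case: (boolP [exists c, [&& P c, ~~ dn c, rep t (x c) == u & ty c == i]]); last first.
    move/existsPn => no; rewrite big1 // => c Pc; have := no c; rewrite Pc /=.
    by case: (~~ dn c && _).
  case/existsP => c0 /and4P[Pc0 dc0 /eqP ec0 /eqP et0].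
  have -> : agg t (M^~ i) u = (\sum_(c | P c) [&& dn c, rep t (x c) == u & ty c == i])%N.
    rewrite /agg (eq_bigr (fun s : 'I_K => \sum_c [&& dn c, rep t s == u, y c == s & ty c == i])%N); last first.
      move=> s _; case: (altP (rep t s =P u)) => [e|_]; last first.
        by rewrite mul0n big1 // => c _; rewrite andbF.
      have := h3 c0 s Pc0 (ltn_ord s); rewrite ec0 e et0 (negbTE dc0) => /(_ erefl)[//|r0].
      by rewrite mul1n h2 // r0.
    rewrite exchange_big /= [RHS]big_mkcond; apply: eq_bigr => c _.
    case: (boolP (dn c)) => [/h1[Pc yK e]|_] /=; last by rewrite big1 ?if_same //; case: ifP.
    rewrite Pc (bigD1 (Ordinal yK)) //= eqxx big1 ?addn0 ?e // => s.
    by rewrite -val_eqE /= eq_sym => /negbTE->; rewrite andbF.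
  rewrite agg_headcount // -(leq_add2r (\sum_(c | P c) [&& dn c, rep t (x c) == u & ty c == i])%N).
  rewrite subnK; last by apply: leq_sum => c _; case: (dn c).
  by rewrite -big_split; apply: leq_sum => c _ /=; case: (dn c); rewrite ?addn0.
rewrite /surplus; apply: (@leq_trans (\sum_(u < K) \sum_(i < l) \sum_(c | P c)
    [&& ~~ dn c, rep t (x c) == u & ty c == i])%N); last first.
  by apply: leq_sum => u _; apply: leq_sum => i _; exact: key.
rewrite (eq_bigr (fun u : 'I_K => \sum_(c | P c) \sum_(i < l)
  [&& ~~ dn c, rep t (x c) == u & ty c == i])%N); last by move=> u _; rewrite exchange_big.
rewrite exchange_big /=; apply: leq_sum => c Pc.
have /andP[rK _] := rep_alive tm (xK Pc).
rewrite (bigD1 (Ordinal rK)) //= (bigD1 (Ordinal (tyl Pc))) //= !eqxx !andbT -addnA.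
exact: leq_addr.
Qed.

Lemma greedy_complete : exists dn res, greedy_stage m dn res /\ forall c, P c -> dn c.
Proof.
have [dn [res hg]] := greedy (leqnn m); exists dn, res; split=> // c Pc.
have := undone_le_surplus (leqnn m) hg; rewrite [surplus _ _ _]big1.
  by rewrite leqn0 sum_nat_eq0 => /forallP/(_ c); rewrite Pc /=; case: (dn c).
move=> u _; rewrite big1 // => i _; apply/eqP; rewrite subn_eq0 agg_headcount //.
case: (altP (val u =P 0%N)) => [->|u0].
  rewrite agg_final Msum //; apply: leq_sum => c' Pc'.
  by rewrite rep_final ?xK.
by rewrite big1 // => c' Pc'; rewrite rep_final ?xK // eq_sym (negbTE u0).
Qed.

Lemma greedy_slot c : P c -> (y c < K)%N.
Proof. by move=> Pc; have [dn [res [[h _ _] d]]] := greedy_complete; have [] := h c (d c Pc). Qed.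

(** Demands are never exceeded and all clients are served, so equality of the totals leaves no
    residual demand anywhere. *)
Lemma greedy_headcount s i : (s < K)%N -> (i < l)%N -> headcount P ty y s i = M s i.
Proof.
move=> sK il; have [dn [res [[h1 h2 _] d]]] := greedy_complete.
have hT s' : (s' < K)%N -> M s' i = (res s' i + headcount P ty y s' i)%N.
  move=> sK'; rewrite h2 //; congr (_ + _)%N; rewrite /headcount [RHS]big_mkcond; apply: eq_bigr => c _.
  by case: (boolP (P c)) => [/d->//|nP]; case: (boolP (dn c)) => // /(h1 c)[Pc]; rewrite Pc in nP.
have : (\sum_(s < K) M s i = \sum_(s < K) headcount P ty y s i)%N.
  rewrite Msum // /headcount exchange_big /=; apply: eq_bigr => c Pc.
  rewrite (bigD1 (Ordinal (greedy_slot Pc))) //= eqxx big1 ?addn0 // => s'.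
  by rewrite -val_eqE /= eq_sym => /negbTE->.
rewrite (eq_bigr (fun s : 'I_K => res s i + headcount P ty y s i)%N); last by move=> s' _; rewrite hT.
rewrite big_split /= -[RHS]add0n => /addIn/eqP; rewrite sum_nat_eq0 => /forallP/(_ (Ordinal sK)) /= /eqP r0.
by rewrite (hT s) // r0.
Qed.

(** A client unsettled at time [t] cannot have been served by then, so the unsettled clients number
    at most the surplus; summation by parts does the rest. *)
Lemma greedy_cost : \sum_(c | P c) U (x c) (y c) <=
  \sum_(t < m) mh t * ((surplus (headcount P ty x) M t)%:R - (surplus (headcount P ty x) M t.+1)%:R).
Proof.
rewrite (cost_unsettled xK greedy_slot); apply: abel_le.
- exact: mh_ge0.
- exact: mh_mono.
- move=> t tm; have [dn [res hg]] := greedy tm; apply: leq_trans (undone_le_surplus tm hg).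
  apply: leq_sum => c Pc; case: (boolP (dn c)) => [|_]; last by case: eqP.
  by case: hg => h _ _ /h[_ _ ->]; rewrite eqxx.
rewrite (unsettled_final xK greedy_slot) /surplus big1 // => u _; rewrite big1 // => i _.
apply/eqP; rewrite subn_eq0 agg_headcount //.
case: (altP (val u =P 0%N)) => [->|u0].
  rewrite agg_final Msum //; apply: leq_sum => c' Pc'.
  by rewrite rep_final ?xK.
by rewrite big1 // => c' Pc'; rewrite rep_final ?xK // eq_sym (negbTE u0).
Qed.

End Greedy.

End DpMath.

(** * Greedy assignment *)

Section GreedyProgram.
Context {R : realType}.
Implicit Types (s : state R).

(** The loop runs against the time of the merges: after [m] rounds the memory holds the demands of
    time [K.-1 - m]. *)
Lemma backtrack_spec s K : imem s aK 0 0 = K -> imem s aK1 0 0 = K.-1 ->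
  let s' := run p_backtrack s in
  exists need : nat -> nat -> nat,
  [/\ forall x, (x < K)%N -> need K.-1 x = if x == 0%N then imem s aTot 0 0 else 0%N,
      forall t x, (t < K.-1)%N -> (x < K)%N -> need t x =
        if x == imem s aMa t 0 then imem s aCh t (need t.+1 (imem s aMa t 0)) else
        if x == imem s aMb t 0 then (need t.+1 (imem s aMa t 0) -
           imem s aCh t (need t.+1 (imem s aMa t 0)))%N else need t.+1 x &
      forall x, imem s' aNeed x 0 = need 0%N x].
Proof.
move=> hK hK1 s'; rewrite /s' /p_backtrack !runSeq.
set s1 := run (PFor xX aK _) s; set s2 := run (PSetI aNeed _ _ _) s1.
have n1 : forall x, (x < K)%N -> imem s1 aNeed x 0 = 0%N.
  apply: (@for_ind _ (fun m s' => forall x, (x < m)%N -> imem s' aNeed x 0 = 0%N) K) => //.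
  move=> i st lti h xi _ x; rewrite ltnS leq_eqVlt; mem; rewrite xi.
  by case: eqP => [_|_ /=]; [|exact: h].
have n2 x : (x < K)%N -> imem s2 aNeed x 0 = if x == 0%N then imem s aTot 0 0 else 0%N.
  move=> xK; rewrite /s2; mem; case: eqP => _ /=; last exact: n1.
  by rewrite /s1; frame.
have kI2 c i j : c \notin wI p_backtrack -> imem s2 c i j = imem s c i j.
  by move=> hc; rewrite /s2 runI ?/s1 ?runI //; exact: notin_sub hc.
pose step (need : nat -> nat -> nat) t := forall x, (x < K)%N -> need t x =
        if x == imem s aMa t 0 then imem s aCh t (need t.+1 (imem s aMa t 0)) else
        if x == imem s aMb t 0 then (need t.+1 (imem s aMa t 0) -
           imem s aCh t (need t.+1 (imem s aMa t 0)))%N else need t.+1 x.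
pose P m s' := exists need : nat -> nat -> nat,
  [/\ forall x, (x < K)%N -> need K.-1 x = if x == 0%N then imem s aTot 0 0 else 0%N,
      forall t, (K.-1 - m <= t < K.-1)%N -> step need t &
      forall x, imem s' aNeed x 0 = need (K.-1 - m)%N x].
move: s2 n2 kI2 => s2 n2 kI2.
set F := PFor xT aK1 _.
have : P K.-1 (run F s2).
  apply: (@for_ind _ P K.-1) => //; first by rewrite kI2.
    exists (fun _ x => imem s2 aNeed x 0); split=> // t; lia.
  move=> m s3 ltm [need [h1 h2 h3]] xm [k _].
  have k3 c i j : c \notin wI p_backtrack -> imem s3 c i j = imem s c i j.
    by move=> hc; rewrite k ?kI2 //; exact: notin_sub hc.
  set t := (K.-1 - m.+1)%N; have tS : (K.-1 - m)%N = t.+1 by rewrite /t; lia.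
  rewrite tS in h2 h3.
  rewrite !runSeq; set s4 := run (seti aTi _) s3.
  have t4 : imem s4 aTi 0 0 = t by rewrite /s4; mem; rewrite (k3 aK1) // hK1 xm addn1.
  have n4 x : imem s4 aNeed x 0 = need t.+1 x by rewrite /s4; frame.
  have k4 c i j : c \notin wI p_backtrack -> imem s4 c i j = imem s c i j.
    by move=> hc; rewrite /s4 runI ?k3 //; exact: notin_sub hc.
  move: s4 t4 n4 k4 => s4 t4 n4 k4.
  set s5 := run (seti aFlag _) s4.
  have f5 : imem s5 aFlag 0 0 = imem s aCh t (need t.+1 (imem s aMa t 0)).
    by rewrite /s5; mem; rewrite t4 (k4 aMa) // n4 (k4 aCh).
  have t5 : imem s5 aTi 0 0 = t by rewrite /s5; frame.
  have n5 x : imem s5 aNeed x 0 = need t.+1 x by rewrite /s5; frame.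
  have k5 c i j : c \notin wI p_backtrack -> imem s5 c i j = imem s c i j.
    by move=> hc; rewrite /s5 runI ?k4 //; exact: notin_sub hc.
  move: s5 f5 t5 n5 k5 => s5 f5 t5 n5 k5.
  set new := fun x => imem (run (PSetI aNeed (iv aMa (rg aTi)) (IConst 0) (rg aFlag))
    (run (PSetI aNeed (iv aMb (rg aTi)) (IConst 0) (ISub (iv aNeed (iv aMa (rg aTi))) (rg aFlag))) s5)) aNeed x 0.
  have newE x : new x = if x == imem s aMa t 0 then imem s aCh t (need t.+1 (imem s aMa t 0)) else
        if x == imem s aMb t 0 then (need t.+1 (imem s aMa t 0) -
           imem s aCh t (need t.+1 (imem s aMa t 0)))%N else need t.+1 x.
    by rewrite /new; mem; rewrite t5 !(k5 aMa) // !(k5 aMb) // !n5 f5.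
  exists (fun u x => if u == t then new x else need u x); split.
  - move=> x xK; rewrite gtn_eqF ?h1 //; rewrite /t; lia.
  - move=> u; case: (altP (u =P t)) => [->|ut] hu x xK; rewrite /= ?eqxx.
      by rewrite (_ : t.+1 == t = false) ?newE //; lia.
    rewrite (negbTE ut) (_ : u.+1 == t = false); last by rewrite /t in ut hu *; lia.
    by apply: h2 => //; rewrite /t in ut hu *; lia.
  - by move=> x; rewrite eqxx.
case=> need [h1 h2 h3]; exists need; split=> //; last by move=> x; rewrite h3 subnn.
by move=> t x tK xK; apply: h2 => //; rewrite subnn.
Qed.

Definition assigned s n (x i : nat) : nat :=
  (\sum_(c < n) [&& 0 < imem s aDone c 0, imem s aAsg c 0 == x & imem s aTyp c 0 == i])%N.

Lemma stage_spec s n K l (M : nat -> nat -> nat) : imem s aN 0 0 = n -> imem s aK 0 0 = K ->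
  (forall c, (c < n)%N -> (0 < imem s aCl c 0)%N -> (imem s aNear c 0 < K)%N /\ (imem s aTyp c 0 < l)%N) ->
  (forall x i, (x < K)%N -> (i < l)%N -> M x i = (imem s aRes x i + assigned s n x i)%N) ->
  let s' := run p_stage s in
  [/\ forall c, (c < n)%N -> (0 < imem s aDone c 0)%N ->
        (0 < imem s' aDone c 0)%N /\ imem s' aAsg c 0 = imem s aAsg c 0,
      forall c, (c < n)%N -> (0 < imem s' aDone c 0)%N -> (0 < imem s aDone c 0)%N \/
        [/\ (0 < imem s aCl c 0)%N, (imem s' aAsg c 0 < K)%N &
            imem s aRep (imem s aNear c 0) 0 = imem s aRep (imem s' aAsg c 0) 0],
      forall x i, (x < K)%N -> (i < l)%N -> M x i = (imem s' aRes x i + assigned s' n x i)%N &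
      forall c x, (c < n)%N -> (0 < imem s aCl c 0)%N -> (x < K)%N ->
        imem s aRep (imem s aNear c 0) 0 = imem s aRep x 0 ->
        (0 < imem s' aDone c 0)%N \/ imem s' aRes x (imem s aTyp c 0) = 0%N].
Proof.
move=> hn hK hcl hM s'.
pose P i j s' := [/\ forall c, (c < n)%N -> (0 < imem s aDone c 0)%N ->
        (0 < imem s' aDone c 0)%N /\ imem s' aAsg c 0 = imem s aAsg c 0,
      forall c, (c < n)%N -> (0 < imem s' aDone c 0)%N -> (0 < imem s aDone c 0)%N \/
        [/\ (0 < imem s aCl c 0)%N, (imem s' aAsg c 0 < K)%N &
            imem s aRep (imem s aNear c 0) 0 = imem s aRep (imem s' aAsg c 0) 0],
      forall x i, (x < K)%N -> (i < l)%N -> M x i = (imem s' aRes x i + assigned s' n x i)%N &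
      forall c x, (c < n)%N -> (0 < imem s aCl c 0)%N -> (x < K)%N ->
        imem s aRep (imem s aNear c 0) 0 = imem s aRep x 0 -> (c < i)%N || (c == i) && (x < j)%N ->
        (0 < imem s' aDone c 0)%N \/ imem s' aRes x (imem s aTyp c 0) = 0%N].
suff : P n 0%N s'.
  case=> h1 h2 h3 h4; split=> // c x cn cc xK e; apply: h4 => //; by rewrite cn.
apply: (@for2_ind _ P n K) => //.
- move=> i st lti [h1 h2 h3 h4]; split=> // c x cn cc xK e q; apply: h4 => //; lia.
- split=> //; last by move=> c x _ _ _ _; lia.
  by move=> c _ h; left.
move=> c x st ltc ltx [h1 h2 h3 h4] xc xx [k _].
rewrite runIf /= xc xx (k aCl) // (k aNear) // !(k aRep) // (k aTyp) //.
have Q c' x' : (c' < c)%N || (c' == c) && (x' < x.+1)%N -> (c' = c /\ x' = x) \/ ((c' < c)%N || (c' == c) && (x' < x)%N) by lia.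
case: ifP => [/andP[/andP[c1 c2] /andP[c3 c4]]|cF]; last first.
  rewrite runSkip; split=> // c' x' cn cc xK e /Q[[ec ex]|]; last exact: h4.
  subst c' x'; move: cF; rewrite cc e leqnn /=.
  case: (posnP (imem st aDone c 0)) => [->|d0]; last by left.
  by case: (posnP (imem st aRes x _)) => [->|r0] //; right.
have ec : imem s aRep (imem s aNear c 0) 0 = imem s aRep x 0 by apply/eqP; rewrite eqn_leq.
have [nearK typl] := hcl c ltc c1.
have d0 : imem st aDone c 0 = 0%N by apply/eqP; rewrite -leqn0.
rewrite /P /assigned; mem; rewrite !xc !xx !(k aTyp) //.
split.
- move=> c' cn hd; have [g1 g2] := h1 c' cn hd.
  by case: (altP (c' =P c)) => [ec'|_] //; move: g1; rewrite ec' d0.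
- move=> c' cn; case: (altP (c' =P c)) => [->|_] hd; last exact: h2.
  by right; split.
- move=> x' i xK il; rewrite h3 // /assigned.
  rewrite (bigD1 (Ordinal ltc)) //= [in RHS](bigD1 (Ordinal ltc)) //= d0 eqxx /=.
  set S := bigop _ _ _; set S' := bigop _ _ _; have -> : S' = S.
    by apply: eq_bigr => c'; rewrite -val_eqE /= => /negbTE->.
  rewrite (k aTyp) // !(eq_sym _ i) (eq_sym x) add0n.
  case: (altP (x' =P x)) => [->|_] /=; last by rewrite add0n.
  case: (altP (i =P imem s aTyp c 0)) => [->|_] /=; last by rewrite add0n.
  by rewrite addnA; congr (_ + _)%N; lia.
- move=> c' x' cn cc xK e /Q[[-> _]|q]; first by left; rewrite eqxx.
  case: (h4 c' x' cn cc xK e q) => [hd|r0].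
    by left; case: ifP.
  by right; case: ifP => // /andP[/eqP ex /eqP ei]; rewrite -ei -ex r0.
Qed.

(** An assignment once made is never changed, so the final [asg] describes every stage; only the
    served set and the residual demands depend on [t]. *)
Lemma greedy_spec s n K l : imem s aN 0 0 = n -> imem s aK 0 0 = K -> imem s aK1 0 0 = K.-1 ->
  imem s aL 0 0 = l ->
  (forall c, (c < n)%N -> (0 < imem s aCl c 0)%N -> (imem s aNear c 0 < K)%N /\ (imem s aTyp c 0 < l)%N) ->
  let s' := run p_greedy s in let rp := rep (fun t => imem s aMa t 0) (fun t => imem s aMb t 0) in
  let asg c := imem s' aAsg c 0 in
  forall t, (t <= K.-1)%N -> exists (dn : nat -> bool) (res : nat -> nat -> nat),
  [/\ forall c, (c < n)%N -> dn c -> [/\ (0 < imem s aCl c 0)%N, (asg c < K)%N & rp t (imem s aNear c 0) = rp t (asg c)],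
      forall x i, (x < K)%N -> (i < l)%N -> imem s aDig (imem s aNeed x 0) i =
        (res x i + \sum_(c < n) [&& dn c, asg c == x & imem s aTyp c 0 == i])%N &
      forall c x, (c < n)%N -> (0 < imem s aCl c 0)%N -> (x < K)%N ->
        rp t (imem s aNear c 0) = rp t x -> dn c \/ res x (imem s aTyp c 0) = 0%N].
Proof.
move=> hn hK hK1 hl hcl s' rp asg.
pose M x i := imem s aDig (imem s aNeed x 0) i.
rewrite /asg /s' /p_greedy !runSeq.
set s1 := run (PFor xX aK _) s; set s2 := run (PFor xC aN _) s1.
have r1 : forall x, (x < K)%N -> imem s1 aRep x 0 = x /\ forall i, (i < l)%N -> imem s1 aRes x i = M x i.
  apply: (@for_ind _ (fun m s' => forall x, (x < m)%N -> imem s' aRep x 0 = x /\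
    forall i, (i < l)%N -> imem s' aRes x i = M x i) K) => //.
  move=> m st ltm h xm [k _] x; rewrite runSeq; set st1 := run (PSetI aRep _ _ _) st.
  have x1 : imem st1 xX 0 0 = m by rewrite /st1; frame.
  set st2 := run (PFor xI aL _) st1.
  have rep2 y : imem st2 aRep y 0 = if y == m then m else imem st aRep y 0.
    by rewrite /st2; frame; rewrite /st1; mem; rewrite xm.
  have [res2 res2'] : (forall i, (i < l)%N -> imem st2 aRes m i = M m i) /\
      (forall y i, y != m -> imem st2 aRes y i = imem st aRes y i).
    apply: (@for_ind _ (fun j s' => (forall i, (i < j)%N -> imem s' aRes m i = M m i) /\
      (forall y i, y != m -> imem s' aRes y i = imem st aRes y i)) l) => //.
      by rewrite /st1; frame; rewrite k.
    move=> j st3 ltj [g1 g2] xj [k3 _].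
    have x3 : imem st3 xX 0 0 = m by rewrite k3.
    have D3 u v : imem st3 aDig u v = imem s aDig u v by rewrite k3 // /st1; frame; rewrite k.
    have N3 u : imem st3 aNeed u 0 = imem s aNeed u 0 by rewrite k3 // /st1; frame; rewrite k.
    split=> [i|y i ym]; mem; rewrite x3 xj N3 D3.
      by rewrite eqxx ltnS leq_eqVlt /=; case: eqP => [->//|_ /=]; exact: g1.
    by rewrite (negbTE ym) /= g2.
  rewrite ltnS leq_eqVlt => /orP[/eqP->|xi]; first by rewrite rep2 eqxx.
  have [g1 g2] := h x xi; rewrite rep2 (ltn_eqF xi) g1; split=> // i il.
  by rewrite res2' ?(ltn_eqF xi) // g2.
have d2 : forall c, (c < n)%N -> imem s2 aDone c 0 = 0%N.
  apply: (@for_ind _ (fun m s' => forall c, (c < m)%N -> imem s' aDone c 0 = 0%N) n) => //.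
    by rewrite /s1; frame.
  move=> i st lti h xi _ c; rewrite ltnS leq_eqVlt; mem; rewrite xi.
  by case: eqP => [_|_ /=]; [|exact: h].
have k2 c i j : c \notin wI p_greedy -> imem s2 c i j = imem s c i j.
  move=> h; rewrite /s2 runI; last exact: notin_sub h.
  by rewrite /s1 runI //; exact: notin_sub h.
have r2 x : (x < K)%N -> imem s2 aRep x 0 = x /\ forall i, (i < l)%N -> imem s2 aRes x i = M x i.
  move=> xK; have [g1 g2] := r1 x xK; split=> [|i il]; rewrite /s2; frame; [exact: g1|exact: g2].
move: s2 d2 k2 r2 => s2 d2 k2 r2.
pose G t (asg : nat -> nat) (dn : nat -> bool) (res : nat -> nat -> nat) :=
  [/\ forall c, (c < n)%N -> dn c -> [/\ (0 < imem s aCl c 0)%N, (asg c < K)%N & rp t (imem s aNear c 0) = rp t (asg c)],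
      forall x i, (x < K)%N -> (i < l)%N -> M x i =
        (res x i + \sum_(c < n) [&& dn c, asg c == x & imem s aTyp c 0 == i])%N &
      forall c x, (c < n)%N -> (0 < imem s aCl c 0)%N -> (x < K)%N ->
        rp t (imem s aNear c 0) = rp t x -> dn c \/ res x (imem s aTyp c 0) = 0%N].
pose H m (s' : state R) := (forall t, (t < m)%N -> exists (dn : nat -> bool) (res : nat -> nat -> nat),
    (forall c, (c < n)%N -> dn c -> (0 < imem s' aDone c 0)%N) /\ G t (fun c => imem s' aAsg c 0) dn res).
pose P m s' := [/\ forall x, (x < K)%N -> imem s' aRep x 0 = rp m x,
   forall c, (c < n)%N -> (0 < imem s' aDone c 0)%N ->
     [/\ (0 < imem s aCl c 0)%N, (imem s' aAsg c 0 < K)%N & rp m (imem s aNear c 0) = rp m (imem s' aAsg c 0)],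
   forall x i, (x < K)%N -> (i < l)%N -> M x i = (imem s' aRes x i + assigned s' n x i)%N &
   H m s'].
have stage m s3 : (forall c i j, c \notin wI p_greedy -> imem s3 c i j = imem s c i j) -> P m s3 ->
  [/\ forall c, (c < n)%N -> (0 < imem (run p_stage s3) aDone c 0)%N ->
     [/\ (0 < imem s aCl c 0)%N, (imem (run p_stage s3) aAsg c 0 < K)%N & rp m (imem s aNear c 0) = rp m (imem (run p_stage s3) aAsg c 0)],
   forall x i, (x < K)%N -> (i < l)%N -> M x i = (imem (run p_stage s3) aRes x i + assigned (run p_stage s3) n x i)%N &
   H m.+1 (run p_stage s3)].
  move=> k3 [p1 p2 p3 p4].
  have n3 : imem s3 aN 0 0 = n by rewrite k3.
  have K3 : imem s3 aK 0 0 = K by rewrite k3.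
  have c3 c : (c < n)%N -> (0 < imem s3 aCl c 0)%N -> (imem s3 aNear c 0 < K)%N /\ (imem s3 aTyp c 0 < l)%N.
    by rewrite !k3 //; exact: hcl.
  have [q1 q2 q3 q4] := stage_spec n3 K3 c3 p3.
  have k4 c i j : c \notin wI p_greedy -> imem (run p_stage s3) c i j = imem s c i j.
    by move=> hc; rewrite runI ?k3 //; exact: notin_sub hc.
  move: (run p_stage s3) q1 q2 q3 q4 k4 => s4 q1 q2 q3 q4 k4.
  have J4 c : (c < n)%N -> (0 < imem s4 aDone c 0)%N ->
     [/\ (0 < imem s aCl c 0)%N, (imem s4 aAsg c 0 < K)%N & rp m (imem s aNear c 0) = rp m (imem s4 aAsg c 0)].
    move=> cn hd; case: (q2 c cn hd) => [hd'|[g1 g2 g3]].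
      by have [_ ->] := q1 c cn hd'; exact: p2.
    rewrite k3 // in g1; have [nK _] := hcl c cn g1.
    rewrite (k3 aNear) // in g3.
    by split=> //; rewrite -!p1.
  split=> // t; rewrite ltnS leq_eqVlt => /orP[/eqP->|tm].
    exists (fun c => (0 < imem s4 aDone c 0)%N), (fun x i => imem s4 aRes x i); split=> //; split=> //.
      move=> x i xK il; rewrite (q3 x i xK il); congr (_ + _)%N.
      by apply: eq_bigr => c _; rewrite (k4 aTyp).
    move=> c x cn cc xK e; have [nK _] := hcl c cn cc.
    have := q4 c x cn; rewrite (k3 aCl) // (k3 aNear) // (k3 aTyp) // => h.
    by apply: h => //; rewrite !p1.
  have [dn [res [g0 [g1 g2 g3]]]] := p4 t tm.
  have sa c : (c < n)%N -> dn c -> imem s4 aAsg c 0 = imem s3 aAsg c 0.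
    by move=> cn hd; have [_ ->] := q1 c cn (g0 c cn hd).
  exists dn, res; split.
    by move=> c cn hd; have [] := q1 c cn (g0 c cn hd).
  split=> //.
    by move=> c cn hd; rewrite sa //; exact: g1.
  move=> x i xK il; rewrite g2 //; congr (_ + _)%N; apply: eq_bigr => c _.
  by case hd: (dn c) => //=; rewrite sa.
set F := PFor xT aK1 _.
have : P K.-1 (run F s2) /\ (forall c i j, c \notin wI p_greedy -> imem (run F s2) c i j = imem s c i j).
  split; last by move=> c i j h; rewrite runI ?k2 //; exact: notin_sub h.
  apply: (@for_ind _ P K.-1) => //; first by rewrite k2.
    split=> //.
    - by move=> x xK; have [-> _] := r2 x xK.
    - by move=> c cn; rewrite d2.
    - move=> x i xK il; have [_ ->] := r2 x xK => //.
      by rewrite /assigned big1 ?addn0 // => c _; rewrite d2.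
  move=> m s3 ltm hP xm [k _].
  have k3 c i j : c \notin wI p_greedy -> imem s3 c i j = imem s c i j.
    by move=> hc; rewrite k ?k2 //; exact: notin_sub hc.
  have [a1 a2 a3] := stage m s3 k3 hP; have [p1 _ _ _] := hP.
  rewrite runSeq.
  have x4 : imem (run p_stage s3) xT 0 0 = m by frame.
  have k4 c i j : c \notin wI p_greedy -> imem (run p_stage s3) c i j = imem s c i j.
    by move=> hc; rewrite runI ?k3 //; exact: notin_sub hc.
  have rep4 x : (x < K)%N -> imem (run p_stage s3) aRep x 0 = rp m x by move=> xK; frame; exact: p1.
  move: (run p_stage s3) a1 a2 a3 x4 k4 rep4 => s4 a1 a2 a3 x4 k4 rep4.
  set s5 := run _ s4.
  have rep5 : forall x, (x < K)%N -> imem s5 aRep x 0 = rp m.+1 x.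
    have : forall x, (x < K)%N -> imem s5 aRep x 0 = if (x < K)%N then rp m.+1 x else imem s4 aRep x 0.
      apply: (@for_ind _ (fun j s' => forall x, (x < K)%N -> imem s' aRep x 0 = if (x < j)%N then rp m.+1 x else imem s4 aRep x 0) K) => //.
        by rewrite k4.
      move=> j st ltj g xj [kk _] x xK.
      have xt : imem st xT 0 0 = m by rewrite kk.
      have cj : imem st aRep j 0 = rp m j by rewrite g // ltnn rep4.
      have eb : imem st aMb m 0 = imem s aMb m 0 by rewrite kk // k4.
      have ea : imem st aMa m 0 = imem s aMa m 0 by rewrite kk // k4.
      rewrite runIf /= xj xt cj eb -eqn_leq ltnS leq_eqVlt; case: ifP => hif.
        mem; rewrite xj xt ea; case: (altP (x =P j)) => [->|_] /=; last exact: g.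
        by rewrite hif.
      rewrite runSkip; case: (altP (x =P j)) => [->|_] /=; last exact: g.
      by rewrite hif cj.
    by move=> h x xK; rewrite h // xK.
  have D5 c : imem s5 aDone c 0 = imem s4 aDone c 0 by rewrite /s5; frame.
  have A5 c : imem s5 aAsg c 0 = imem s4 aAsg c 0 by rewrite /s5; frame.
  have R5 x i : imem s5 aRes x i = imem s4 aRes x i by rewrite /s5; frame.
  have T5 c : imem s5 aTyp c 0 = imem s4 aTyp c 0 by rewrite /s5; frame.
  split=> //.
  - move=> c cn; rewrite D5 A5 => hd; have [g1 g2 g3] := a1 c cn hd.
    by split=> //; rewrite /rp; apply: rep_mono.
  - move=> x i xK il; rewrite R5 (a2 x i xK il); congr (_ + _)%N.
    by apply: eq_bigr => c _; rewrite D5 A5 T5.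
  - move=> t tm; have [dn [res [g0 [g1 g2 g3]]]] := a3 t tm; exists dn, res; split.
      by move=> c cn hd; rewrite D5; exact: g0.
    split=> //.
      by move=> c cn hd; rewrite A5; exact: g1.
    by move=> x i xK il; rewrite (g2 x i xK il); congr (_ + _)%N; apply: eq_bigr => c _; rewrite A5.
case=> hP kF; have [_ _ h3] := stage K.-1 (run F s2) kF hP.
move=> t tK; have [dn [res [_ g]]] := h3 t tK.
by exists dn, res.
Qed.

End GreedyProgram.

(** * Search over the scales *)

Lemma eq_surplus K l ma mb (F F' G G' : nat -> nat -> nat) t :
  (forall s i, (s < K)%N -> (i < l)%N -> F s i = F' s i) ->
  (forall s i, (s < K)%N -> (i < l)%N -> G s i = G' s i) ->
  surplus K l ma mb F G t = surplus K l ma mb F' G' t.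
Proof.
move=> eF eG; apply: eq_bigr => x _; apply: eq_bigr => i _.
by congr (_ - _)%N; apply: eq_bigr => s _; rewrite ?eF ?eG.
Qed.

Section Solve.
Context {R : realType}.
Variables (b : state R) (n K l : nat).
Hypothesis K0 : (0 < K)%N.
Hypothesis hN : imem b aN 0 0 = n.
Hypothesis hK : imem b aK 0 0 = K.
Hypothesis hK1 : imem b aK1 0 0 = K.-1.
Hypothesis hL : imem b aL 0 0 = l.
Hypothesis hV : imem b aV 0 0 = (n.+1 ^ l)%N.

Definition is_client (c : 'I_n) : bool := (0 < imem b aCl c 0)%N.
Local Notation near := (fun c : 'I_n => imem b aNear c 0).
Local Notation typ := (fun c : 'I_n => imem b aTyp c 0).

(* Cross-multiplied, so that an empty slot is fair. *)
Definition fair_counts (f : nat -> nat) : Prop := forall i, (i < l)%N ->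
  rmem b rAlpha i 0 * (\sum_(j < l) f j)%:R <= (f i)%:R <= rmem b rBeta i 0 * (\sum_(j < l) f j)%:R.

Definition fair_slots (nu : 'I_n -> nat) : Prop :=
  (forall c, is_client c -> (nu c < K)%N) /\
  forall s, (s < K)%N -> fair_counts (headcount is_client typ nu s).

Hypothesis hdig : forall v, (v < n.+1 ^ l)%N ->
  (forall i, (i < l)%N -> (imem b aDig v i <= n)%N) /\
  (\sum_(i < l) imem b aDig v i * n.+1 ^ i = v)%N.
Hypothesis hfair : forall v, (v < n.+1 ^ l)%N ->
  (0 < imem b aFair v 0)%N <-> fair_counts (imem b aDig v).
Hypothesis hcl : forall c : 'I_n, is_client c -> (near c < K)%N /\ (typ c < l)%N.
Hypothesis hcnt : forall a i, imem b aCnt0 a i = headcount is_client typ near a i.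
Hypothesis htot : imem b aTot 0 0 = (\sum_(c < n | is_client c) n.+1 ^ typ c)%N.

Lemma eq_fair_counts f g : (forall i, (i < l)%N -> f i = g i) -> fair_counts f -> fair_counts g.
Proof.
move=> e h i il; have := h i il; rewrite e //.
by rewrite (eq_bigr (fun j : 'I_l => g j)) // => j _; exact: e.
Qed.

Lemma headcount_le nu s i : (headcount is_client typ nu s i <= n)%N.
Proof.
apply: (@leq_trans (\sum_(c < n) 1)%N); last by rewrite sum1_card card_ord.
by rewrite /headcount big_mkcond leq_sum // => c _; case: ifP => // _; case: (_ && _).
Qed.

Let code (f : nat -> nat) : nat := (\sum_(i < l) f i * n.+1 ^ i)%N.

Lemma dig_code f : (forall i, (i < l)%N -> (f i <= n)%N) ->
  (code f < n.+1 ^ l)%N /\ forall i, (i < l)%N -> imem b aDig (code f) i = f i.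
Proof.
move=> fn; have cl := code_lt fn; split=> //; have [d1 d2] := hdig cl.
exact: (code_inj d1 fn).
Qed.

Lemma totalE : imem b aTot 0 0 = code (fun i => \sum_(c < n | is_client c) (typ c == i))%N.
Proof.
rewrite htot /code (eq_bigr (fun i : 'I_l => \sum_(c < n | is_client c) (typ c == i) * n.+1 ^ i)%N); last first.
  by move=> i _; rewrite big_distrl.
rewrite exchange_big /=; apply: eq_bigr => c /hcl[_ tl].
rewrite (bigD1 (Ordinal tl)) //= eqxx mul1n big1 ?addn0 // => i.
by rewrite -val_eqE /= eq_sym => /negbTE->.
Qed.

Lemma clients_le i : (\sum_(c < n | is_client c) (typ c == i) <= n)%N.
Proof.
apply: (@leq_trans (\sum_(c < n) 1)%N); last by rewrite sum1_card card_ord.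
by rewrite big_mkcond leq_sum // => c _; case: ifP => // _; case: (_ == _).
Qed.

Section Dp.
Variables (U : nat -> nat -> R) (al : nat -> nat -> bool) (N : nat -> nat -> nat -> nat)
  (A : nat -> nat -> nat -> R) (ma mb : nat -> nat) (mh : nat -> R) (ch : nat -> nat -> nat).
Hypothesis Uxx : forall x, (x < K)%N -> U x x = 0.
Hypothesis Usym : forall x y, (x < K)%N -> (y < K)%N -> U x y = U y x.
Hypothesis U0 : forall x y, (x < K)%N -> (y < K)%N -> 0 <= U x y.
Hypothesis Utri : forall x y z, (x < K)%N -> (y < K)%N -> (z < K)%N -> U x z <= Num.max (U x y) (U y z).
Hypothesis dprun : dp_run l (n.+1 ^ l) (imem b aDig) K K.-1 U (imem b aCnt0)
  (fun v => 0 < imem b aFair v 0)%N al N A ma mb mh ch.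

(** The head counts of a fair slot map are fair demands. No count exceeds [n], so the codes of
    clusters are sums of codes of slots without carry, and the table is bounded by the surplus of
    these demands, hence by the tree cost of [nu]. *)
Lemma dp_value nu : fair_slots nu ->
  0 <= A K.-1 0%N (imem b aTot 0 0) <= \sum_(c | is_client c) U (near c) (nu c).
Proof.
move=> [nuK nufair]; pose M s := code (headcount is_client typ nu s).
have nearK c : is_client c -> (near c < K)%N by move=> /hcl[].
have typl c : is_client c -> (typ c < l)%N by move=> /hcl[].
have digM s : (M s < n.+1 ^ l)%N /\ forall i, (i < l)%N -> imem b aDig (M s) i = headcount is_client typ nu s i.
  by apply: dig_code => i _; exact: headcount_le.
have MV s : (s < K)%N -> (M s < n.+1 ^ l)%N /\ (0 < imem b aFair (M s) 0)%N.
  move=> sK; have [h1 h2] := digM s; split=> //; apply/hfair => //.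
  by apply: eq_fair_counts (nufair s sK) => i il; rewrite h2.
have MA t x : (t <= K.-1)%N -> (x < K)%N -> (agg K ma mb t M x < n.+1 ^ l)%N /\
  forall i, (i < l)%N -> imem b aDig (agg K ma mb t M x) i =
    agg K ma mb t (fun s => imem b aDig (M s) i) x.
  move=> tm xK.
  have -> : agg K ma mb t M x = code (fun i => agg K ma mb t ((headcount is_client typ nu)^~ i) x).
    rewrite /agg /M /code (eq_bigr (fun s : 'I_K => \sum_(i < l) (rep ma mb t s == x) *
      headcount is_client typ nu s i * n.+1 ^ i)%N); last first.
      by move=> s _; rewrite big_distrr; apply: eq_bigr => i _; exact: mulnA.
    by rewrite exchange_big; apply: eq_bigr => i _; rewrite big_distrl.
  have [|h1 h2] := @dig_code (fun i => agg K ma mb t ((headcount is_client typ nu)^~ i) x).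
    move=> i _; rewrite agg_headcount //; apply: leq_trans (clients_le i).
    by apply: leq_sum => c _; rewrite andbC; case: (_ == i); case: (_ == x).
  split=> // i il; rewrite h2 //; apply: eq_bigr => s _.
  by have [_ ->] := digM s.
have [h1 h2] := dp_value_le K0 dprun MV MA.
have Mtot : (\sum_(s < K) M s)%N = imem b aTot 0 0.
  rewrite totalE /M /code exchange_big /=; apply: eq_bigr => i _; rewrite -big_distrl; congr (_ * _)%N.
  rewrite /headcount exchange_big /=; apply: eq_bigr => c cc.
  rewrite (bigD1 (Ordinal (nuK c cc))) //= eqxx big1 ?addn0 // => s.
  by rewrite -val_eqE /= eq_sym => /negbTE->.
rewrite Mtot in h1 h2; rewrite h2 /=; apply: le_trans h1 _.
apply: le_trans (surplus_cost_le K0 Uxx Usym U0 Utri dprun nearK nuK typl).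
rewrite le_eqVlt; apply/orP; left; apply/eqP; apply: eq_bigr => t _.
by congr (_ * (_%:R - _%:R)); apply: eq_surplus => s i sK il; rewrite ?hcnt //; have [_ ->] := digM s.
Qed.

Variables (need : nat -> nat -> nat) (asg : nat -> nat).
Hypothesis need_final : forall x, (x < K)%N -> need K.-1 x = if x == 0%N then imem b aTot 0 0 else 0%N.
Hypothesis need_step : forall t x, (t < K.-1)%N -> (x < K)%N -> need t x =
  if x == ma t then ch t (need t.+1 (ma t)) else
  if x == mb t then (need t.+1 (ma t) - ch t (need t.+1 (ma t)))%N else need t.+1 x.
Hypothesis A_total : 0 <= A K.-1 0%N (imem b aTot 0 0).
Hypothesis greedy : forall t, (t <= K.-1)%N -> exists (dn : nat -> bool) (res : nat -> nat -> nat),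
  [/\ forall c, (c < n)%N -> dn c -> [/\ (0 < imem b aCl c 0)%N, (asg c < K)%N &
        rep ma mb t (imem b aNear c 0) = rep ma mb t (asg c)],
      forall x i, (x < K)%N -> (i < l)%N -> imem b aDig (need 0%N x) i =
        (res x i + \sum_(c < n) [&& dn c, asg c == x & imem b aTyp c 0 == i])%N &
      forall c x, (c < n)%N -> (0 < imem b aCl c 0)%N -> (x < K)%N ->
        rep ma mb t (imem b aNear c 0) = rep ma mb t x -> dn c \/ res x (imem b aTyp c 0) = 0%N].

(** The demands found by backtracking have the totals of the clients, so the greedy assignment meets
    them exactly; it inherits their fairness, and its tree cost is at most the value of the
    table. *)
Lemma greedy_optimal : fair_slots asg /\
  \sum_(c | is_client c) U (near c) (asg c) <= A K.-1 0%N (imem b aTot 0 0).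
Proof.
have nearK c : is_client c -> (near c < K)%N by move=> /hcl[].
have typl c : is_client c -> (typ c < l)%N by move=> /hcl[].
have [totV totD] : (imem b aTot 0 0 < n.+1 ^ l)%N /\ forall i, (i < l)%N ->
    imem b aDig (imem b aTot 0 0) i = (\sum_(c < n | is_client c) (typ c == i))%N.
  by rewrite totalE; apply: dig_code => i _; exact: clients_le.
have [b1 b2 b3] := dp_backtrack K0 dprun totV need_final need_step A_total.
have Msum i : (i < l)%N -> (\sum_(s < K) imem b aDig (need 0%N s) i)%N =
    (\sum_(c < n | is_client c) (typ c == i))%N by move=> il; rewrite b2 // totD.
have G t : (t <= K.-1)%N -> exists dn res, greedy_stage K l ma mb is_client near asg typ
    (fun s i => imem b aDig (need 0%N s) i) t dn res.
  move=> /greedy[dn [res [g1 g2 g3]]]; exists (fun c : 'I_n => dn c), res; split.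
  - by move=> c; exact: g1.
  - exact: g2.
  - by move=> c s; exact: g3.
split; last first.
  apply: le_trans (greedy_cost K0 Uxx Usym U0 Utri dprun nearK typl Msum G) _.
  rewrite -b3 le_eqVlt; apply/orP; left; apply/eqP; apply: eq_bigr => t _.
  by congr (_ * (_%:R - _%:R)); apply: eq_surplus => s i sK il; rewrite ?hcnt.
split; first by move=> c cc; exact: (greedy_slot K0 dprun nearK typl Msum G cc).
move=> s sK; have [nV nF] := b1 s sK.
apply: eq_fair_counts ((hfair nV).1 nF) => i il.
by rewrite (greedy_headcount K0 dprun nearK typl Msum G).
Qed.

End Dp.

(** Here [b] is the state in which the search over scales begins; facts about the input tables are
    assumed for it once and transported to all later states. *)
Definition agrees (s : state R) : Prop :=
  (forall a i j, a \notin wI p_solve -> imem s a i j = imem b a i j) /\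
  (forall a i j, a \notin wR p_solve -> rmem s a i j = rmem b a i j).

Lemma agrees_run p s : all [in wI p_solve] (wI p) -> all [in wR p_solve] (wR p) ->
  agrees s -> agrees (run p s).
Proof.
move=> hi hr [aI aR]; split=> a i j h; rewrite ?runI ?runR ?aI ?aR //.
  exact: notin_sub h.
exact: notin_sub h.
Qed.

Local Notation D := (fun x y => rmem b rD x y).
Local Notation pri := (fun x => imem b aPri x 0).
Local Notation cen := (fun x => imem b aCen x 0).
Hypothesis D0 : forall x y, 0 <= D x y.
Hypothesis Dxx : forall x, (x < K)%N -> D x x = 0.
Hypothesis Dsym : forall x y, D x y = D y x.
Hypothesis Dtri : forall x y z, (x < K)%N -> (y < K)%N -> (z < K)%N -> D x z <= D x y + D y z.
Hypothesis Dtop : forall x y, (x < K)%N -> (y < K)%N -> D x y <= rmem b rTot 0 0.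
Hypothesis top0 : 0 <= rmem b rTot 0 0.

Definition outputs (s : state R) (asg : 'I_n -> nat) : Prop :=
  (forall c, is_client c -> imem s aAssign c 0 = cen (asg c)) /\
  forall x : 'I_n, (imem s aOpen x 0 != 0%N) = [exists c, is_client c && (cen (asg c) == x)].

Lemma output_spec s : agrees s -> outputs (run p_output s) (fun c => imem s aAsg c 0).
Proof.
move=> [aI _]; rewrite /p_output runSeq; set s1 := run (PFor xC aN _) s.
have o1 : forall x, (x < n)%N -> imem s1 aOpen x 0 = 0%N.
  apply: (@for_ind _ (fun m s' => forall x, (x < m)%N -> imem s' aOpen x 0 = 0%N) n) => //.
    by rewrite aI.
  move=> i st lti h xi _ x; rewrite ltnS leq_eqVlt; mem; rewrite xi.
  by case: eqP => [_|_ /=]; [|exact: h].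
have aI1 c i j : c \notin wI p_solve -> imem s1 c i j = imem b c i j.
  by move=> hc; rewrite /s1 runI ?aI //; exact: notin_sub hc.
have g1 c : imem s1 aAsg c 0 = imem s aAsg c 0 by rewrite /s1; frame.
move: s1 o1 aI1 g1 => s1 o1 aI1 g1.
pose P m (s' : state R) := (forall c : 'I_n, (c < m)%N -> is_client c -> imem s' aAssign c 0 = cen (imem s aAsg c 0)) /\
  forall x : 'I_n, (imem s' aOpen x 0 != 0%N) =
    [exists c : 'I_n, [&& (c < m)%N, is_client c & cen (imem s aAsg c 0) == x]].
have : P n (run (PFor xC aN (PIf (itrue (iv aCl (rg xC)))
     (PSetI aAssign (rg xC) (IConst 0) (iv aCen (iv aAsg (rg xC))) ;;
      PSetI aOpen (iv aCen (iv aAsg (rg xC))) (IConst 0) ione) PSkip)%P) s1).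
  apply: (@for_ind _ P n) => //.
  - by rewrite aI1.
  - split=> // x; rewrite o1 // eqxx; apply/esym/negbTE/existsPn => c; by rewrite ltn0.
  move=> i st lti [h1 h2] xi [k _].
  have k1 c u v : c \notin wI p_solve -> imem st c u v = imem b c u v.
    by move=> hc; rewrite k ?aI1 //; exact: notin_sub hc.
  rewrite runIf /= xi (k1 aCl) //; case: ifP => hc; last first.
    rewrite runSkip; split=> [c|x].
      rewrite ltnS leq_eqVlt => /orP[/eqP e|ci]; last exact: h1.
      by rewrite /is_client e hc.
    rewrite h2; apply: eq_existsb => c; rewrite ltnS (leq_eqVlt c).
    by case: (val c =P i) => // e; rewrite /is_client e hc !andbF.
  have gi : imem st aAsg i 0 = imem s aAsg i 0 by rewrite k // g1.
  split=> [c|x]; mem; rewrite ?xi !(k1 aCen) // gi.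
    rewrite ltnS leq_eqVlt; case: eqP => [->//|_] /=; exact: h1.
  case: (altP (val x =P cen (imem s aAsg i 0))) => [e|ne] /=.
    apply/esym/existsP; exists (Ordinal lti); by rewrite /= ltnSn /is_client hc e eqxx.
  rewrite h2; apply: eq_existsb => c; rewrite ltnS (leq_eqVlt c).
  case: (val c =P i) => // e; by rewrite e eq_sym (negbTE ne) !andbF.
case=> h1 h2; split=> [c|x]; first exact: h1.
by rewrite h2; apply: eq_existsb => c; rewrite ltn_ord.
Qed.

Definition holds_best (s : state R) : Prop := (0 < imem s aHas 0 0)%N -> exists asg : 'I_n -> nat,
  [/\ fair_slots asg, outputs s asg & \sum_(c | is_client c) D (near c) (asg c) <= rmem s rBest 0 0].

(** The tree is quantified existentially because its array is overwritten by the next candidate,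
    while the bound on [rBest] remains. *)
Definition covers (s : state R) (e : R) : Prop := exists U, tree_spec K D (rmem b rTot 0 0) pri e U /\
  forall nu, fair_slots nu -> (0 < imem s aHas 0 0)%N /\
    rmem s rBest 0 0 <= \sum_(c | is_client c) U (near c) (nu c).

Definition improves (s s' : state R) : Prop := (0 < imem s aHas 0 0)%N ->
  (0 < imem s' aHas 0 0)%N /\ rmem s' rBest 0 0 <= rmem s rBest 0 0.

Definition advance (s s' : state R) (E : R -> Prop) : Prop :=
  [/\ agrees s', holds_best s', improves s s' & forall e, E e -> covers s' e].

Definition scale (p q p' q' : nat) : R :=
  if 1 / 8 <= D p q / D p' q' < 1 / 4 then D p q / D p' q' else 1 / 8.

Lemma covers_improves s s' e : improves s s' -> covers s e -> covers s' e.
Proof.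
move=> im [U [h1 h2]]; exists U; split=> // nu /h2[has le].
by have [h le'] := im has; split=> //; exact: le_trans le' le.
Qed.

Lemma improves_trans s1 s2 s3 : improves s1 s2 -> improves s2 s3 -> improves s1 s3.
Proof.
by move=> h1 h2 /h1[/h2[h le] le']; split=> //; exact: le_trans le le'.
Qed.

(** The recorded value is that of the tree. It bounds the true transport cost because the tree
    metric dominates, and it is at most the tree cost of every fair slot map because the table is
    optimal. *)
Lemma candidate_spec s : agrees s -> holds_best s ->
  advance s (run p_candidate s) (eq (scale (imem s xP 0 0) (imem s xQ 0 0) (imem s xP' 0 0) (imem s xQ' 0 0))).
Proof.
move=> hs best; set sc := scale _ _ _ _.
rewrite /p_candidate 2!runSeq; set s1 := run (PIf _ _ _) _.
have a1 : agrees s1 by apply: agrees_run => //; apply: agrees_run.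
have sc1 : rmem s1 rScale 0 0 = sc.
  rewrite /s1; set s0 := run (setr rScale _) s.
  have -> : sc = if 1%:R / 8%:R <= rmem s0 rScale 0 0 < 1%:R / 4%:R then rmem s0 rScale 0 0 else 1 / 8.
    by rewrite /s0; mem; have [_ aR] := hs; rewrite /sc /scale !aR.
  move: s0 => s0; rewrite runIf /= -ltNge; case: ifP => _; first by rewrite runSkip.
  by mem.
have has1 : imem s1 aHas 0 0 = imem s aHas 0 0 by rewrite /s1; frame.
have best1 : rmem s1 rBest 0 0 = rmem s rBest 0 0 by rewrite /s1; frame.
have out1 c i : imem s1 aAssign c i = imem s aAssign c i /\ imem s1 aOpen c i = imem s aOpen c i.
  by rewrite /s1; frame.
have sc0 : 0 <= sc.
  rewrite /sc /scale; case: ifP => [/andP[h _]|_]; last by rewrite divr_ge0.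
  by apply: le_trans h; rewrite divr_ge0.
have scl : sc < 1 / 4.
  by rewrite /sc /scale; case: ifP => [/andP[]//|_]; lra.
move: s1 a1 sc1 has1 best1 out1 => s1 a1 sc1 has1 best1 out1.
rewrite runSeq; set s2 := run p_tree s1.
have tree : tree_spec K D (rmem b rTot 0 0) pri sc (rmem s2 rU).
  have [aI aR] := a1.
  have e1 x y : slotd s1 x y = D x y by rewrite /slotd aR.
  have := @tree_program R s1 K; rewrite aI // => /(_ hK).
  have eT : rmem s1 rTot 0 0 = rmem b rTot 0 0 by rewrite aR.
  rewrite sc1 eT => h.
  have {h} : tree_spec K (slotd s1) (rmem b rTot 0 0) (fun i => imem s1 aPri i 0) sc (rmem s2 rU).
    by apply: h => // [x y|x xK]; rewrite e1 //; exact: Dxx.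
  have -> : slotd s1 = D.
    by apply: boolp.funext => x; apply: boolp.funext => y; rewrite e1.
  by have -> : (fun i => imem s1 aPri i 0) = pri by apply: boolp.funext => x; rewrite aI.
have a2 : agrees s2 by exact: agrees_run.
have [u1 u2 u3 u4] := tree_ultra tree.
have has2 : imem s2 aHas 0 0 = imem s aHas 0 0 by rewrite /s2; frame.
have best2 : rmem s2 rBest 0 0 = rmem s rBest 0 0 by rewrite /s2; frame.
have out2 c i : imem s2 aAssign c i = imem s aAssign c i /\ imem s2 aOpen c i = imem s aOpen c i.
  by rewrite /s2; frame.
move: s2 tree a2 u1 u2 u3 u4 has2 best2 out2 => s2 tree a2 u1 u2 u3 u4 has2 best2 out2.
rewrite runSeq; set s3 := run p_dp s2.
have [al [N [A]]] : exists al N A, dp_run l (n.+1 ^ l) (imem b aDig) K K.-1 (rmem s2 rU) (imem b aCnt0)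
    (fun v => 0 < imem b aFair v 0)%N al N A (fun t => imem s3 aMa t 0) (fun t => imem s3 aMb t 0)
    (fun t => rmem s3 rMh t 0) (imem s3 aCh) /\ A K.-1 = rmem s3 rA.
  have [aI aR] := a2; have := @dp_spec R s2 K l (n.+1 ^ l).
  rewrite !aI // => /(_ hK hK1 hL hV u3).
  have -> : imem s2 aDig = imem b aDig by apply: boolp.funext => x; apply: boolp.funext => y; rewrite aI.
  have -> : imem s2 aCnt0 = imem b aCnt0 by apply: boolp.funext => x; apply: boolp.funext => y; rewrite aI.
  have -> // : (fun v => 0 < imem s2 aFair v 0)%N = (fun v => 0 < imem b aFair v 0)%N.
  by apply: boolp.funext => x; rewrite aI.
case=> dprun AE.
have a3 : agrees s3 by exact: agrees_run.
have has3 : imem s3 aHas 0 0 = imem s aHas 0 0 by rewrite /s3; frame.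
have best3 : rmem s3 rBest 0 0 = rmem s rBest 0 0 by rewrite /s3; frame.
have out3 c i : imem s3 aAssign c i = imem s aAssign c i /\ imem s3 aOpen c i = imem s aOpen c i.
  by rewrite /s3; frame.
move: s3 dprun AE a3 has3 best3 out3 => s3 dprun AE a3 has3 best3 out3.
have value nu : fair_slots nu ->
    0 <= rmem s3 rA 0 (imem b aTot 0 0) <= \sum_(c | is_client c) rmem s2 rU (near c) (nu c).
  by move=> fnu; rewrite -AE; exact: (dp_value u1 u2 u3 u4 dprun fnu).
have tot3 : imem s3 aTot 0 0 = imem b aTot 0 0 by case: a3 => aI _; rewrite aI.
rewrite runIf /= tot3 !has3 !best3 -ltNge -ltnNge.
case: ifP => hif; last first.
  rewrite runSkip; split=> //.
  - rewrite /holds_best has3 best3 => /best[asg [h1 [h2 h2'] h3]]; exists asg; split=> //.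
    split=> [c cc|x]; first by have [-> _] := out3 c 0%N; exact: h2.
    by have [_ ->] := out3 x 0%N; exact: h2'.
  - by rewrite /improves has3 best3.
  - move=> e <-; exists (rmem s2 rU); split=> // nu /value/andP[v0 v1].
    rewrite has3 best3; move: hif; rewrite v0 /=; case: posnP => //= _.
    by rewrite negbK => /negbT; rewrite -leNgt => hle; split=> //; exact: le_trans hle v1.
have A0 : 0 <= rmem s3 rA 0 (imem b aTot 0 0) by case/andP: hif.
rewrite 4!runSeq; set s4 := run (setr rBest _) _.
have a4 : agrees s4 by apply: agrees_run => //; apply: agrees_run.
have has4 : imem s4 aHas 0 0 = 1%N by rewrite /s4; frame; mem.
have best4 : rmem s4 rBest 0 0 = rmem s3 rA 0 (imem b aTot 0 0).
  by rewrite /s4; mem; rewrite tot3.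
have merges4 t v : [/\ imem s4 aMa t 0 = imem s3 aMa t 0, imem s4 aMb t 0 = imem s3 aMb t 0 &
    imem s4 aCh t v = imem s3 aCh t v] by rewrite /s4; frame.
move: s4 a4 has4 best4 merges4 => s4 a4 has4 best4 merges4.
have [need [n1 n2 n3]] : exists need : nat -> nat -> nat,
  [/\ forall x, (x < K)%N -> need K.-1 x = if x == 0%N then imem b aTot 0 0 else 0%N,
      forall t x, (t < K.-1)%N -> (x < K)%N -> need t x =
        if x == imem s3 aMa t 0 then imem s3 aCh t (need t.+1 (imem s3 aMa t 0)) else
        if x == imem s3 aMb t 0 then (need t.+1 (imem s3 aMa t 0) -
           imem s3 aCh t (need t.+1 (imem s3 aMa t 0)))%N else need t.+1 x &
      forall x, imem (run p_backtrack s4) aNeed x 0 = need 0%N x].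
  have [aI aR] := a4; have := @backtrack_spec R s4 K; rewrite !aI // => /(_ hK hK1)[need [n1 n2 n3]].
  exists need; split=> // t x tK xK; rewrite n2 //.
  have [-> -> _] := merges4 t 0%N; case: ifP => _; first by have [_ _ ->] := merges4 t (need t.+1 (imem s3 aMa t 0)).
  by case: ifP => // _; have [_ _ ->] := merges4 t (need t.+1 (imem s3 aMa t 0)).
set s5 := run p_backtrack s4 in n3 *.
have a5 : agrees s5 by exact: agrees_run.
have has5 : imem s5 aHas 0 0 = 1%N by rewrite /s5; frame.
have best5 : rmem s5 rBest 0 0 = rmem s3 rA 0 (imem b aTot 0 0) by rewrite /s5; frame.
have merges5 t : imem s5 aMa t 0 = imem s3 aMa t 0 /\ imem s5 aMb t 0 = imem s3 aMb t 0.
  by rewrite /s5; frame; have [-> -> _] := merges4 t 0%N.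
move: s5 n3 a5 has5 best5 merges5 => s5 n3 a5 has5 best5 merges5.
set s6 := run p_greedy s5.
have a6 : agrees s6 by exact: agrees_run.
have [fasg casg] : fair_slots (fun c => imem s6 aAsg c 0) /\
    \sum_(c | is_client c) rmem s2 rU (near c) (imem s6 aAsg c 0) <= rmem s3 rA 0 (imem b aTot 0 0).
  rewrite -AE; rewrite -AE in A0.
  apply: (greedy_optimal u1 u2 u3 u4 dprun n1 n2 A0 (asg := fun c => imem s6 aAsg c 0)).
  have [aI aR] := a5.
  have cl5 c : (c < n)%N -> (0 < imem s5 aCl c 0)%N -> (imem s5 aNear c 0 < K)%N /\ (imem s5 aTyp c 0 < l)%N.
    by move=> cn; rewrite !aI //; exact: (hcl (c := Ordinal cn)).
  have := @greedy_spec R s5 n K l; rewrite !aI // => /(_ hN hK hK1 hL cl5) G t tK.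
  have [dn [res [g1 g2 g3]]] := G t tK; exists dn, res.
  have rE u : rep (fun t => imem s5 aMa t 0) (fun t => imem s5 aMb t 0) t u =
      rep (fun t => imem s3 aMa t 0) (fun t => imem s3 aMb t 0) t u.
    elim: (t) => //= t' ->; by have [-> ->] := merges5 t'.
  split=> [c cn /(g1 c cn)[]|x i xK il|c x cn].
  - by rewrite !rE !aI.
  - rewrite -n3 -(aI aDig) // g2 //; congr (_ + _)%N; apply: eq_bigr => c _.
    by rewrite aI.
  - by move=> cc xK; have := g3 c x cn; rewrite !rE !aI //; apply.
have has6 : imem s6 aHas 0 0 = 1%N by rewrite /s6; frame.
have best6 : rmem s6 rBest 0 0 = rmem s3 rA 0 (imem b aTot 0 0) by rewrite /s6; frame.
move: s6 a6 fasg casg has6 best6 => s6 a6 fasg casg has6 best6.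
have has7 : imem (run p_output s6) aHas 0 0 = 1%N by frame.
have best7 : rmem (run p_output s6) rBest 0 0 = rmem s3 rA 0 (imem b aTot 0 0) by frame.
have o7 := output_spec a6; have a7 : agrees (run p_output s6) by exact: agrees_run.
split=> //.
- move=> _; exists (fun c => imem s6 aAsg c 0); split=> //; rewrite best7.
  apply: le_trans casg; apply: ler_sum => c cc; have [nK _] := hcl cc.
  by apply: (tree_dominates Dsym Dtri Dtop top0 tree scl) => //; case: fasg => h _; exact: h.
- rewrite /improves has7 best7 => has; split=> //.
  by case/andP: hif => _; rewrite has negbK => /ltW.
- move=> e <-; exists (rmem s2 rU); split=> // nu /value/andP[_ v1].
  by rewrite has7 best7.
Qed.

(** The scales [E i s] tried at counter value [i] may refer to the counters of the outer loops only,
    which the loop keeps; this lets the rule be applied four times in a row. *)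
Lemma advance_for x p (E : nat -> state R -> R -> Prop) :
  x \notin wI p -> x \in [:: xP; xQ; xP'; xQ'] ->
  (forall s s' i e, keeps (PFor x aK p) s s' -> E i s e -> E i s' e) ->
  (forall s, agrees s -> holds_best s -> advance s (run p s) (E (imem s x 0 0) s)) ->
  forall s, agrees s -> holds_best s ->
    advance s (run (PFor x aK p) s) (fun e => exists2 i, (i < K)%N & E i s e).
Proof.
move=> xp xs stab step s as_ bs.
have xo : (aOpen == x = false) /\ (aAssign == x = false) /\ (aHas == x = false).
  by move: xs; rewrite !inE => /or4P[] /eqP->.
have {}xs : x \in wI p_solve by move: xs; rewrite !inE => /or4P[] /eqP->.
suff [] : [/\ agrees (run (PFor x aK p) s), holds_best (run (PFor x aK p) s),
    improves s (run (PFor x aK p) s) &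
    forall i e, (i < K)%N -> E i s e -> covers (run (PFor x aK p) s) e].
  by move=> h1 h2 h3 h4; split=> // e [i]; exact: h4.
apply: (@for_ind _ (fun m s' => [/\ agrees s', holds_best s', improves s s' &
    forall i e, (i < m)%N -> E i s e -> covers s' e]) K) => //.
- by case: as_ => aI _; rewrite aI.
- move=> i s' v [[aI aR] hb im cv]; have [e5 [e6 e65]] := xo.
  split=> //.
  + split=> // a j k ha; rewrite /= /update; case: (altP (a =P x)) => [ea|_] /=; last exact: aI.
    by rewrite ea xs in ha.
  + rewrite /holds_best /= /update e65 /= => /hb[asg [h1 [h2 h2'] h3]]; exists asg; split=> //.
    by split=> [c cc|y]; rewrite /= /update ?e5 ?e6 /=; [exact: h2|exact: h2'].
  + by rewrite /improves /= /update e65.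
  + by move=> j e /cv h /h[U [h1 h2]]; exists U; split=> // nu /h2; rewrite /= /update e65.
move=> i s' lti [a1 b1 i1 c1] xi k.
have := step s' a1 b1; rewrite xi => -[a2 b2 i2 c2]; split=> //.
  exact: improves_trans i1 i2.
move=> j e; rewrite ltnS leq_eqVlt => /orP[/eqP->|ji] Ee.
  by apply: c2; exact: stab Ee.
by apply: (covers_improves i2); exact: c1 Ee.
Qed.

(** The fair slot map [nu] ensures that some candidate has a reachable total, so that an output is
    stored at all. *)
Lemma solve_spec : imem b aHas 0 0 = 0%N -> forall nu, fair_slots nu -> let s := run p_solve b in
  (exists asg : 'I_n -> nat, [/\ fair_slots asg, outputs s asg &
     \sum_(c | is_client c) D (near c) (asg c) <= rmem s rBest 0 0]) /\
  forall e, candidate K D e -> exists U, tree_spec K D (rmem b rTot 0 0) pri e U /\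
    forall nu, fair_slots nu -> rmem s rBest 0 0 <= \sum_(c | is_client c) U (near c) (nu c).
Proof.
move=> has0 nu fnu s.
pose E4 q' (s : state R) e := e = scale (imem s xP 0 0) (imem s xQ 0 0) (imem s xP' 0 0) q'.
pose E3 p' (s : state R) e := exists2 q', (q' < K)%N & e = scale (imem s xP 0 0) (imem s xQ 0 0) p' q'.
pose E2 q (s : state R) e := exists2 p', (p' < K)%N & exists2 q', (q' < K)%N & e = scale (imem s xP 0 0) q p' q'.
pose E1 p (s : state R) e := exists2 q, (q < K)%N & exists2 p', (p' < K)%N &
  exists2 q', (q' < K)%N & e = scale p q p' q'.
have [as_ bs _ cs] : advance b s (fun e => exists2 p, (p < K)%N & E1 p b e).
  apply: advance_for => //; last by rewrite /holds_best has0.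
  move=> s1 a1 b1; apply: (advance_for (E := E2)) => //.
    by move=> u v i e [k _]; rewrite /E2 k.
  move=> s2 a2 b2; apply: (advance_for (E := E3)) => //.
    by move=> u v i e [k _]; rewrite /E3 !k.
  move=> s3 a3 b3; apply: (advance_for (E := E4)) => //.
    by move=> u v i e [k _]; rewrite /E4 !k.
  move=> s4 a4 b4; have [h1 h2 h3 h4] := candidate_spec a4 b4.
  by split=> // e ->; exact: h4.
have cov e : candidate K D e -> covers s e.
  case=> [->|[he [x [y [p [q [xK yK pK qK eE]]]]]]]; apply: cs.
    (* The quotient 0 / 0 is 0, hence out of range, so the scale 1/8 is always among those tried. *)
    exists 0%N => //; exists 0%N => //; exists 0%N => //; exists 0%N => //.
    rewrite /scale Dxx // mul0r; case: ifP => // /andP[h _]; lra.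
  exists x => //; exists y => //; exists p => //; exists q => //.
  by rewrite /scale -eE he.
have [|U [_ hU]] := cov (1 / 8); first by left.
have [has _] := hU nu fnu; split; first exact: bs.
by move=> e /cov[V [h1 h2]]; exists V; split=> // nu' /h2[].
Qed.

End Solve.

(** * Preparation of an instance *)

Section Bounds.
Context {R : realType}.
Implicit Types (s : state R).

(** Centers must name points even when there is no client or no facility, a case about which
    [init_spec] says nothing. *)
Lemma init_bound s n : imem s aN 0 0 = n -> (forall j, (imem s aCen j 0 < n)%N) ->
  forall j, (imem (run p_init s) aCen j 0 < n)%N.
Proof.
move=> hn h0.
apply: (@for_ind _ (fun _ s' => forall j, (imem s' aCen j 0 < n)%N) (imem s aK 0 0)) => //.
move=> i st _ h _ [k _]; rewrite !runSeq.
set st1 := run (setr rMin _) _.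
have n1 : imem st1 aN 0 0 = n by rewrite /st1; frame; rewrite k.
have h1 j : (imem st1 aCen j 0 < n)%N by rewrite /st1; frame.
move: st1 n1 h1 => st1 n1 h1.
apply: (@for_ind _ (fun _ s' => forall j, (imem s' aCen j 0 < n)%N) n) => //.
move=> o st2 lto h2 xo _ j; rewrite runIf; case: ifP => _; last by rewrite runSkip.
by mem; rewrite xo; case: ifP.
Qed.

Lemma slots_out s K : imem s aK 0 0 = K -> forall i j, (K <= i)%N || (K <= j)%N ->
  rmem (run p_slots s) rD i j = rmem s rD i j.
Proof.
move=> hK i j ho.
apply: (@for2_ind _ (fun _ _ s' => rmem s' rD i j = rmem s rD i j) K K) => //.
move=> x y st xK yK h ex ey _; mem; rewrite ex ey.
by rewrite (_ : (i == x) && (j == y) = false) //; lia.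
Qed.

End Bounds.

(** * The input memory and its metric *)

Section Input.
Context {R : realType}.
Variable I : instance R.
Local Notation n := (npoints I).
Local Notation l := (ngroups I).

Definition start_state : state R := State (input_imem I) (input_rmem I).

Lemma extendE (V : Type) (x0 : V) m (f : 'I_m -> V) (i : 'I_m) : extend x0 f i = f i.
Proof. by rewrite /extend valK. Qed.

Lemma extend_out (V : Type) (x0 : V) m (f : 'I_m -> V) i : (m <= i)%N -> extend x0 f i = x0.
Proof. by move=> h; rewrite /extend insubF //; apply/negbTE; rewrite -leqNgt. Qed.

Definition edist (x y : nat) : R := extend 0 (fun x : 'I_n => extend 0 (pdist x) y) x.

Lemma edistE (x y : 'I_n) : edist x y = pdist x y.
Proof. by rewrite /edist !extendE. Qed.

Lemma edist_out x y : (n <= x)%N || (n <= y)%N -> edist x y = 0.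
Proof.
rewrite /edist; case: (ltnP x n) => [xn /= yn|xn _]; last exact: extend_out.
by rewrite (extendE 0 _ (Ordinal xn)) extend_out.
Qed.

Lemma edist_ge0 x y : 0 <= edist x y.
Proof.
case: (ltnP x n) => xn; last by rewrite edist_out ?xn.
case: (ltnP y n) => yn; last by rewrite edist_out ?yn ?orbT.
by rewrite (edistE (Ordinal xn) (Ordinal yn)) /pdist mdist_ge0.
Qed.

Lemma edistC x y : edist x y = edist y x.
Proof.
case: (ltnP x n) => xn; last by rewrite !edist_out ?xn ?orbT.
case: (ltnP y n) => yn; last by rewrite !edist_out ?yn ?orbT.
by rewrite (edistE (Ordinal xn) (Ordinal yn)) (edistE (Ordinal yn) (Ordinal xn)) /pdist metric_sym.
Qed.

Lemma edistxx x : edist x x = 0.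
Proof.
case: (ltnP x n) => xn; last by rewrite edist_out ?xn.
by rewrite (edistE (Ordinal xn) (Ordinal xn)) /pdist mdistxx.
Qed.

Lemma edist_triangle x y z : (x < n)%N -> (y < n)%N -> (z < n)%N -> edist x z <= edist x y + edist y z.
Proof.
move=> xn yn zn.
rewrite (edistE (Ordinal xn) (Ordinal yn)) (edistE (Ordinal yn) (Ordinal zn)) (edistE (Ordinal xn) (Ordinal zn)).
exact: metric_triangle.
Qed.

Lemma start_group (g : 'I_l) (c : 'I_n) : imem start_state aGroup g c = (c \in group g).
Proof. by rewrite /start_state /= !extendE. Qed.

Lemma start_facility (x : 'I_n) : imem start_state aFac x 0 = (x \in facilities I).
Proof. by rewrite /start_state /= extendE. Qed.

End Input.

(** * Tables, centers and slot distances of an instance *)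

Section Prepared.
Context {R : realType}.
Variable I : instance R.
Local Notation n := (npoints I).
Local Notation l := (ngroups I).
Local Notation K := (minn (nopen I) n).
Local Notation d := (edist I).

Definition sized : state R := run p_sizes (start_state I).

Let q1 := run p_types sized.
Let q2 := run p_digits q1.
Let q3 := run p_fair q2.
Let q4 := run p_total q3.
Let q5 := run p_init q4.
Let q6 := run p_search q5.
Let q7 := run p_near q6.
Let q8 := run p_slots q7.
Definition prepared : state R := run p_prepare sized.

Let preparedE : prepared = run p_count q8.
Proof. by rewrite /prepared /p_prepare 8!runSeq. Qed.

Ltac back := rewrite ?preparedE ?/q8 ?/q7 ?/q6 ?/q5 ?/q4 ?/q3 ?/q2 ?/q1; frame.

Lemma sized_spec : [/\ imem sized aK 0 0 = K, imem sized aK1 0 0 = K.-1, imem sized aB 0 0 = n.+1,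
  imem sized aM 0 0 = (n * n)%N & imem sized aV 0 0 = (n.+1 ^ l)%N /\
  forall i, (i <= l)%N -> imem sized aPow i 0 = (n.+1 ^ i)%N].
Proof. exact: (@sizes_spec R (start_state I)). Qed.

Lemma sized_start a i j : a \notin wI p_sizes -> imem sized a i j = imem (start_state I) a i j.
Proof. exact: runI. Qed.

Lemma sized_startR a i j : rmem sized a i j = rmem (start_state I) a i j.
Proof. exact: runR. Qed.

Let types1 (c : 'I_n) : [/\ (imem q1 aCl c 0 <= 1)%N,
  (0 < imem q1 aCl c 0)%N -> (imem q1 aTyp c 0 < l)%N /\ (0 < imem sized aGroup (imem q1 aTyp c 0) c)%N &
  forall g, (g < l)%N -> (0 < imem sized aGroup g c)%N -> (0 < imem q1 aCl c 0)%N].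
Proof.
have := @types_spec R sized; rewrite (@sized_start aN) // (@sized_start aL) // => h; apply: h => // c' _.
by rewrite sized_start.
Qed.

Lemma prepared_client (c : 'I_n) : is_client prepared c = (c \in clients I).
Proof.
have [h1 h2 h3] := types1 c.
rewrite /is_client; back; rewrite -/q1; apply/idP/bigcupP => [/h2[tl]|[g _ cg]].
  rewrite sized_start // (start_group (Ordinal tl) c) lt0b => cg; by exists (Ordinal tl).
by apply: (h3 g) => //; rewrite sized_start // start_group cg.
Qed.

Lemma prepared_type (c : 'I_n) (i : 'I_l) :
  (c \in group i) = is_client prepared c && (imem prepared aTyp c 0 == i).
Proof.
have [h1 h2 h3] := types1 c.
rewrite /is_client; back; rewrite -/q1; apply/idP/andP => [cg|[/h2[tl]]].
  have hc : (0 < imem q1 aCl c 0)%N by apply: (h3 i) => //; rewrite sized_start // start_group cg.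
  split=> //; have [tl] := h2 hc; rewrite sized_start // (start_group (Ordinal tl) c) lt0b => cg'.
  apply: contraT => ne; have /group_disjoint/pred0P/(_ c) : Ordinal tl != i by [].
  by rewrite /= cg cg'.
by rewrite sized_start // (start_group (Ordinal tl) c) lt0b => + /eqP e; rewrite (_ : i = Ordinal tl) //; apply: val_inj.
Qed.

Lemma prepared_type_lt (c : 'I_n) : is_client prepared c -> (imem prepared aTyp c 0 < l)%N.
Proof.
rewrite prepared_client => /bigcupP[i _]; rewrite prepared_type => /andP[_ /eqP->].
exact: ltn_ord.
Qed.

Lemma prepared_sizes : [/\ imem prepared aN 0 0 = n, imem prepared aK 0 0 = K, imem prepared aK1 0 0 = K.-1,
  imem prepared aL 0 0 = l & imem prepared aM 0 0 = (n * n)%N /\ imem prepared aV 0 0 = (n.+1 ^ l)%N].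
Proof.
have [h1 h2 h3 h4 [h5 _]] := sized_spec.
by split; [back; rewrite sized_start|back|back|back; rewrite sized_start|split; back].
Qed.

Lemma prepared_zero a i j : a \notin wI p_prepare -> a \notin wI p_sizes ->
  imem prepared a i j = imem (start_state I) a i j.
Proof. by move=> h1 h2; rewrite /prepared runI // sized_start. Qed.

Lemma prepared_digits v : (v < n.+1 ^ l)%N ->
  (forall i, (i < l)%N -> (imem prepared aDig v i <= n)%N) /\
  (\sum_(i < l) imem prepared aDig v i * n.+1 ^ i = v)%N.
Proof.
have [h1 h2 h3 h4 [h5 _]] := sized_spec.
move=> hv; have [] := @digits_spec R q1 n l _ _ _ _ v hv.
- by back; rewrite sized_start.
- by back.
- by back.
- by move=> i; back; rewrite sized_start.
rewrite -/q2 => g1 g2; split=> [i il|].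
  by back; rewrite -/q1 -/q2; exact: g1.
rewrite -[RHS]g2; apply: eq_bigr => i _; congr (_ * _)%N; by back.
Qed.

Lemma prepared_alpha i : rmem prepared rAlpha i 0 = extend 0 (@alpha R I) i.
Proof. by back; rewrite sized_startR. Qed.

Lemma prepared_beta i : rmem prepared rBeta i 0 = extend 0 (@beta R I) i.
Proof. by back; rewrite sized_startR. Qed.

Lemma prepared_fair v : (v < n.+1 ^ l)%N ->
  (0 < imem prepared aFair v 0)%N <-> fair_counts prepared l (imem prepared aDig v).
Proof.
have [h1 h2 h3 h4 [h5 _]] := sized_spec => hv.
have [] := @fair_spec R q2 l (n.+1 ^ l) _ _ v hv.
- by back; rewrite sized_start.
- by back.
rewrite -/q3 => g1 g2; have e1 : imem prepared aFair v 0 = imem q3 aFair v 0 by back.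
have e2 i : imem prepared aDig v i = imem q2 aDig v i by back.
have e3 i : rmem prepared rAlpha i 0 = rmem q2 rAlpha i 0 by back.
have e4 i : rmem prepared rBeta i 0 = rmem q2 rBeta i 0 by back.
have e5 : (\sum_(j < l) imem prepared aDig v j = \sum_(j < l) imem q2 aDig v j)%N.
  by apply: eq_bigr => j _; rewrite e2.
rewrite e1 /fair_counts; split=> [/g1 h i il|h].
  by rewrite e2 e3 e4 e5; exact: h.
by apply: g2 => i il; rewrite -e2 -e3 -e4 -e5; exact: h.
Qed.

Let dist4 x y : rmem q4 rDist x y = d x y.
Proof. by back; rewrite sized_startR. Qed.

Lemma prepared_top : 0 <= rmem prepared rTot 0 0 /\
  forall x y, (x < n)%N -> (y < n)%N -> d x y <= rmem prepared rTot 0 0.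
Proof.
have e : rmem prepared rTot 0 0 = rmem q4 rTot 0 0 by back.
have h : forall x y, (x < n)%N -> (y < n)%N -> d x y <= rmem q4 rTot 0 0.
  move=> x y xn yn; have := @total_spec R q3 n _ _ _ x y xn yn.
  have -> : rmem q3 rDist x y = d x y by back; rewrite sized_startR.
  apply.
  - by back; rewrite sized_start.
  - by move=> u w; back; rewrite sized_startR; exact: edist_ge0.
  - by back; rewrite sized_startR.
rewrite e; split=> //.
case: (posnP n) => [n0|npos]; last exact: le_trans (edist_ge0 I _ _) (h 0%N 0%N npos npos).
have -> : rmem q4 rTot 0 0 = rmem q3 rTot 0 0.
  rewrite /q4 /p_total /run -/run; have -> // : imem q3 aN 0 0 = 0%N by back; rewrite sized_start.
by back; rewrite sized_startR.
Qed.

Let aN4 : imem q4 aN 0 0 = n. Proof. by back; rewrite sized_start. Qed.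
Let aK4 : imem q4 aK 0 0 = K. Proof. by have [h _ _ _ _] := sized_spec; back. Qed.

Let cl4 (c : 'I_n) : (0 < imem q4 aCl c 0)%N = (c \in clients I).
Proof. by rewrite -prepared_client /is_client; back. Qed.

Let fac4 (c : 'I_n) : (0 < imem q4 aFac c 0)%N = (c \in facilities I).
Proof. by rewrite -[RHS]lt0b -start_facility; back; rewrite sized_start. Qed.

Lemma prepared_center x : (0 < K)%N -> (x < K)%N -> (imem prepared aCen x 0 < n)%N.
Proof.
move=> K0 xK; have -> : imem prepared aCen x 0 = imem q6 aCen x 0 by back.
have N5 : imem q5 aN 0 0 = n by back; rewrite sized_start.
have K5 : imem q5 aK 0 0 = K by have [h _ _ _ _] := sized_spec; back.
have h5 j : (imem q5 aCen j 0 < n)%N.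
  apply: init_bound => // j'; back; rewrite sized_start //=; by move: K0; rewrite leq_min => /andP[].
move: x xK; apply: (@search_spec R (fun _ t => forall x, (x < K)%N -> (t x < n)%N) q5 n K) => //.
move=> _ t t' h [_ _ [j [o [jK ho e]]]] x xK; rewrite e // /upd; case: eqP => _; last exact: h.
by case: ho => [->|[]//]; exact: h.
Qed.

Section Centers.
Variable S : solution I.
Hypothesis feasS : feasible S.
Hypothesis K0 : (0 < K)%N.
Variable c0 : 'I_n.
Hypothesis c0P : c0 \in clients I.

(** The comparison solution is fair, yet only its facilities and connection costs enter: the 8 is
    the limit 5 of the local search plus the 3 that remains after [n^2] swaps. *)
Lemma prepared_search :
  (forall x (xK : (x < K)%N) (xn : (imem prepared aCen x 0 < n)%N), Ordinal xn \in facilities I) /\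
  kcost d (fun c => 0 < imem prepared aCl c 0)%N n K (fun x => imem prepared aCen x 0) <= 8 * cost S.
Proof.
have [hO hk ho _] := feasS.
have cE x : imem prepared aCen x 0 = imem q6 aCen x 0 by back.
have N5 : imem q5 aN 0 0 = n by back; rewrite sized_start.
have K5 : imem q5 aK 0 0 = K by have [h _ _ _ _] := sized_spec; back.
pose cl c := (0 < imem q5 aCl c 0)%N; pose fac c := (0 < imem q5 aFac c 0)%N.
have clE c : (0 < imem prepared aCl c 0)%N = cl c by rewrite /cl; back.
have cl5 (c : 'I_n) : cl c = (c \in clients I) by rewrite -cl4 /cl; back.
have fac5 (c : 'I_n) : fac c = (c \in facilities I) by rewrite -fac4 /fac; back.
have D5 : (fun x y => rmem q5 rDist x y) = d.
  by apply: boolp.funext => x; apply: boolp.funext => y; rewrite -dist4; back.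
pose P : R := \sum_(c < n | cl c) d c (assign S c).
have PE : P = cost S.
  by rewrite /P /cost; apply: eq_big => [c|c _]; rewrite ?cl5 // edistE.
have OK : (#|opened S| <= K)%N.
  rewrite leq_min hk /=; apply: leq_trans (max_card _) _; by rewrite card_ord.
have Ofac (x : 'I_n) : x \in opened S -> fac x by rewrite fac5; exact: (subsetP hO).
have oO (c : 'I_n) : cl c -> assign S c \in opened S by rewrite cl5; exact: ho.
have P0 : 0 <= P by apply: (opt_ge0 cl (edist_ge0 I)).
have Kn : (K <= n)%N by exact: geq_minr.
have r0 : 0 <= 1 - K%:R^-1 :> R.
  by rewrite subr_ge0 invf_le1 ?ltr0n // ler1n.
have [T0 Tmax] := prepared_top.
have T4 : rmem q4 rTot 0 0 = rmem prepared rTot 0 0 by back.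
have tri := @edist_triangle R I.
have init j : (j < K)%N -> exists x, [/\ (x < n)%N, cl x, (imem q5 aCen j 0 < n)%N, fac (imem q5 aCen j 0) &
    (forall y, (y < n)%N -> fac y -> d x (imem q5 aCen j 0) <= d x y) /\
    (forall c, (c < n)%N -> cl c -> minf (rmem prepared rTot 0 0) (fun i => d c (imem q5 aCen i 0)) j <=
      minf (rmem prepared rTot 0 0) (fun i => d x (imem q5 aCen i 0)) j)].
  move=> jK; have := @init_spec R q4 n K aN4 aK4; rewrite T4.
  have -> : rmem q4 rDist = d by apply: boolp.funext => x; apply: boolp.funext => y; exact: dist4.
  move=> /(_ (edist_ge0 I) T0 Tmax c0 (assign S c0) (ltn_ord _)).
  rewrite cl4 fac4 -/q5 => /(_ c0P (ltn_ord _)) h.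
  have [|x [h1 h2 h3 h4 [h5 h6]]] := h _ j jK; first by rewrite -fac5; apply: Ofac; exact: ho.
  have clf x' : (0 < imem q4 aCl x' 0)%N = cl x' by rewrite /cl; back.
  have facf x' : (0 < imem q4 aFac x' 0)%N = fac x' by rewrite /fac; back.
  exists x; rewrite -clf -facf; split=> //; split=> [y yn|c cn]; rewrite -?facf -?clf; [exact: h5|exact: h6].
(* The excess over [5 * P] after [m] swaps, starting from the cost [3 n P] of the farthest-point
   solution. *)
pose Q m t := (forall j, (j < K)%N -> (t j < n)%N /\ fac (t j)) /\
  kcost d cl n K t - 5 * P <= (1 - K%:R^-1) ^+ m * (3 * n%:R * P).
have [h1 h2] : Q (n * n)%N (fun i => imem q6 aCen i 0).
  apply: (@search_spec R Q q5 n K) => //.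
    split=> [j /init[x [_ _ h1 h2 _]]//|].
    rewrite expr0 mul1r.
    have := @init_cost R n K d cl fac K0 (edist_ge0 I) (edistC I) tri (opened S) (assign S) OK Ofac oO
      _ _ Tmax init.
    by rewrite -/P; lra.
  move=> m t t' [t1 t2]; rewrite D5 => bs; split=> [j jK|].
    have [_ _ [k [o [kK hoo e]]]] := bs; rewrite e // /upd; case: eqP => _; last exact: t1.
    by case: hoo => [->|//]; exact: t1.
  rewrite exprS -mulrA.
  apply: (@swap_step R n K d cl fac K0 (edist_ge0 I) (edistC I) tri (opened S) (assign S) OK Ofac oO t t') => //.
    by move=> j jK; have [] := t1 j jK.
  by rewrite mulr_ge0 ?exprn_ge0 // mulr_ge0 // mulr_ge0.
split=> [x xK xn|].
  have [_] := h1 x xK; rewrite -cE => h; rewrite -(fac5 (Ordinal xn)); exact: h.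
have := search_rate cl K0 (edist_ge0 I) (assign S) Kn; rewrite -/P => h3.
rewrite -PE (_ : (fun c => _) = cl); last by apply: boolp.funext => c; rewrite clE.
rewrite (_ : (fun x => imem prepared _ _ _) = (fun i => imem q6 aCen i 0)); last by apply: boolp.funext => c; rewrite cE.
lra.
Qed.

End Centers.

Let aN6 : imem q6 aN 0 0 = n. Proof. by back; rewrite sized_start. Qed.
Let aK6 : imem q6 aK 0 0 = K. Proof. by have [h _ _ _ _] := sized_spec; back. Qed.

Lemma prepared_near (c : 'I_n) : (0 < K)%N -> (imem prepared aNear c 0 < K)%N /\
  forall i, (i < K)%N -> d c (imem prepared aCen (imem prepared aNear c 0) 0) <= d c (imem prepared aCen i 0).
Proof.
move=> K0; have hz c' : (c' < n)%N -> imem q6 aNear c' 0 = 0%N by move=> _; back; rewrite sized_start.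
have [h1 h2] := @near_spec R q6 n K K0 aN6 aK6 hz c (ltn_ord c).
have cE x : imem prepared aCen x 0 = imem q6 aCen x 0 by back.
have nE : imem prepared aNear c 0 = imem q7 aNear c 0 by back.
rewrite nE; split=> // i iK; rewrite !cE.
have dE y : d c y = rmem q6 rDist c y by rewrite -dist4; back.
by rewrite !dE; exact: h2.
Qed.

Lemma prepared_slots x y : rmem prepared rD x y =
  if (x < K)%N && (y < K)%N then d (imem prepared aCen x 0) (imem prepared aCen y 0) else 0.
Proof.
have aK7 : imem q7 aK 0 0 = K by rewrite -aK6; back.
have -> : rmem prepared rD x y = rmem q8 rD x y by back.
case: ifP => [/andP[xK yK]|h].
  rewrite /q8 (slots_spec aK7) //.
  have cE z : imem prepared aCen z 0 = imem q7 aCen z 0 by back.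
  by rewrite !cE -dist4; back.
rewrite /q8 (slots_out aK7); first by back; rewrite sized_startR.
by move: h; lia.
Qed.

Lemma prepared_count :
  (forall a i, imem prepared aCnt0 a i = headcount (@is_client R prepared n) (fun c : 'I_n => imem prepared aTyp c 0)
     (fun c : 'I_n => imem prepared aNear c 0) a i) /\
  imem prepared aTot 0 0 = (\sum_(c < n | is_client prepared c) n.+1 ^ imem prepared aTyp c 0)%N.
Proof.
have [h1 h2] : (forall a i, imem (run p_count q8) aCnt0 a i =
    \sum_(c < n) [&& 0 < imem q8 aCl c 0, imem q8 aNear c 0 == a & imem q8 aTyp c 0 == i])%N /\
  imem (run p_count q8) aTot 0 0 =
    (\sum_(c < n | 0 < imem q8 aCl c 0) imem q8 aPow (imem q8 aTyp c 0) 0)%N.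
  apply: count_spec => [|a i|]; last by back; rewrite sized_start.
    by back; rewrite sized_start.
  by back; rewrite sized_start.
have cE c : imem prepared aCl c 0 = imem q8 aCl c 0 by back.
have nE c : imem prepared aNear c 0 = imem q8 aNear c 0 by back.
have tE c : imem prepared aTyp c 0 = imem q8 aTyp c 0 by back.
split=> [a i|].
  rewrite preparedE h1 /headcount [RHS]big_mkcond; apply: eq_bigr => c _.
  by rewrite /is_client cE nE tE; case: (0 < _)%N.
rewrite preparedE h2; apply: eq_big => [c|c]; first by rewrite /is_client cE.
move=> cc; have := @prepared_type_lt c; rewrite /is_client cE => /(_ cc) tl.
rewrite -preparedE tE in tl *; have [_ _ _ _ [_ hp]] := sized_spec.
rewrite -hp ?(ltnW tl) //; by back.
Qed.

End Prepared.

(** * Fairness of the output *)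

Section Merging.
Context {R : realType}.
Variables (b : state R) (n l : nat) (P : pred 'I_n) (ty : 'I_n -> nat).

(** After cross-multiplication the constraints are linear in the counts, so they can be added up. *)
Lemma fair_counts_sum (J : finType) (Q : pred J) (F : J -> nat -> nat) :
  (forall j, Q j -> fair_counts b l (F j)) -> fair_counts b l (fun i => \sum_(j | Q j) F j i)%N.
Proof.
move=> h i il; rewrite exchange_big /= !natr_sum !mulr_sumr; apply/andP; split.
  by apply: ler_sum => j Qj; have /andP[] := h j Qj i il.
by apply: ler_sum => j Qj; have /andP[] := h j Qj i il.
Qed.

Lemma fair_counts_merge N (z : 'I_n -> nat) (g : nat -> nat) s : (forall c, P c -> (z c < N)%N) ->
  (forall f, (f < N)%N -> fair_counts b l (headcount P ty z f)) ->
  fair_counts b l (headcount P ty (fun c => g (z c)) s).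
Proof.
move=> zN h.
apply: (@eq_fair_counts R b l (fun i => \sum_(f < N | g f == s) headcount P ty z f i)%N).
  move=> i il; rewrite /headcount exchange_big /=; apply: eq_bigr => c Pc.
  case: (altP (g (z c) =P s)) => e /=.
    rewrite (bigD1 (Ordinal (zN c Pc))) /= ?e // eqxx big1 ?addn0 // => f /andP[_].
    by rewrite -val_eqE /= eq_sym => /negbTE->.
  by rewrite big1 // => f /eqP ef; case: eqP => // ez; rewrite ez ef eqxx in e.
by apply: fair_counts_sum => f _; apply: h.
Qed.

End Merging.

Opaque prepared.

(** * From slot assignments to solutions *)

Section Reduction.
Context {R : realType}.
Variables (I : instance R) (t : seq nat).
Local Notation n := (npoints I).
Local Notation l := (ngroups I).
Local Notation K := (minn (nopen I) n).
Local Notation d := (edist I).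

Definition randomized : state R := drawn aPri xX t (prepared I).
Definition solved : state R := run p_solve randomized.
Local Notation b := randomized.
Local Notation cen := (fun x => imem (prepared I) aCen x 0).
Local Notation near := (fun c : 'I_n => imem (prepared I) aNear c 0).
Local Notation typ := (fun c : 'I_n => imem (prepared I) aTyp c 0).

Lemma randomizedI a i j : a \notin [:: aPri; xX] -> imem b a i j = imem (prepared I) a i j.
Proof. by have [_ h _] := @drawnP R aPri xX t (prepared I) isT; exact: h. Qed.

Lemma randomizedR a i j : rmem b a i j = rmem (prepared I) a i j.
Proof. by have [_ _ h] := @drawnP R aPri xX t (prepared I) isT; exact: h. Qed.

Opaque randomized.

Lemma randomized_fair f : fair_counts b l f <-> fair_counts (prepared I) l f.
Proof. by rewrite /fair_counts; split=> h i il; have := h i il; rewrite !randomizedR. Qed.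

Lemma randomized_client (c : 'I_n) : is_client b c = (c \in clients I).
Proof. by rewrite -prepared_client /is_client randomizedI. Qed.

Lemma clientE : @is_client R b n = mem (clients I).
Proof. by apply: boolp.funext => c; rewrite randomized_client. Qed.

Lemma served_group (S : solution I) (z : 'I_n -> nat) (f : 'I_n) (i : 'I_l) :
  (forall c, c \in clients I -> val (assign S c) = z c) ->
  served S (group i) f = headcount (mem (clients I)) typ z f i.
Proof.
move=> e; rewrite /served /headcount -sum1_card big_mkcond [RHS]big_mkcond; apply: eq_bigr => c _ /=.
rewrite inE prepared_type prepared_client.
case: (boolP (c \in clients I)) => //= cc; rewrite -(e c cc) val_eqE andbC.
by case: (_ && _).
Qed.

Lemma served_clients (S : solution I) (f : 'I_n) :
  served S (clients I) f = (\sum_(i < l) served S (group i) f)%N.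
Proof.
rewrite /served -sum1_card; under [RHS]eq_bigr do rewrite -sum1_card big_mkcond.
rewrite exchange_big /= big_mkcond; apply: eq_bigr => c _ /=.
rewrite inE; case: (boolP (c \in clients I)) => /= [cc|nc]; last first.
  rewrite big1 // => i _; rewrite inE; case: (boolP (c \in group i)) => // ci.
  by case/negP: nc; apply/bigcupP; exists i.
have tl := @prepared_type_lt R I c; rewrite prepared_client in tl.
rewrite (bigD1 (Ordinal (tl cc))) //= big1 ?addn0.
  by rewrite inE prepared_type prepared_client cc eqxx.
move=> i; rewrite -val_eqE /= inE prepared_type eq_sym => /negbTE->.
by rewrite andbF.
Qed.

(** For a facility serving nobody both sides vanish, which matches the absence of a constraint on
    empty facilities; at the others the ratios are multiplied out. *)
Lemma feasible_fair (S : solution I) : feasible S -> forall f : nat, (f < n)%N ->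
  fair_counts b l (headcount (mem (clients I)) typ (fun c => assign S c) f).
Proof.
move=> [_ _ ho hf] f fn i il; pose f' := Ordinal fn.
have e (j : 'I_l) : headcount (mem (clients I)) typ (fun c => assign S c) f j = served S (group j) f'.
  by rewrite (@served_group S (fun c => assign S c)).
rewrite (eq_bigr (fun j : 'I_l => served S (group j) f')) // -served_clients (e (Ordinal il)).
rewrite !randomizedR prepared_alpha prepared_beta (extendE 0 _ (Ordinal il)) (extendE 0 _ (Ordinal il)).
case: (posnP (served S (clients I) f')) => [s0|spos].
  have -> : served S (group (Ordinal il)) f' = 0%N.
    by apply/eqP; rewrite -leqn0 -s0 served_clients (bigD1 (Ordinal il)) //= leq_addr.
  by rewrite s0 !mulr0 lexx.
have fO : f' \in opened S.
  move: spos; rewrite card_gt0 => /set0Pn[c]; rewrite inE => /andP[cc /eqP<-].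
  exact: ho.
have /andP[h1 h2] := hf f' fO spos (Ordinal il).
by rewrite -ler_pdivlMr ?ltr0n // h1 -ler_pdivrMr ?ltr0n.
Qed.

Opaque solved.

(** Only centers that serve a client are opened, so they are images of the [K] slots. Slots holding
    the same facility are merged, which keeps the counts fair. *)
Lemma output_feasible (asg : 'I_n -> nat) : (0 < K)%N ->
  (forall x (xK : (x < K)%N) (xn : (cen x < n)%N), clients I != set0 -> Ordinal xn \in facilities I) ->
  fair_slots b K l asg -> outputs b solved asg ->
  feasible (output I solved) /\ forall c, c \in clients I -> val (assign (output I solved) c) = cen (asg c).
Proof.
move=> K0 cfac [asgK afair] [o1 o2].
have cn x : (x < K)%N -> (cen x < n)%N by apply: prepared_center.
rewrite clientE in asgK afair o1 o2.
have aE c : c \in clients I -> val (assign (output I solved) c) = cen (asg c).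
  by move=> cc; rewrite /= o1 // randomizedI // insubdK // -topredE /= cn ?asgK.
have oE x : (x \in opened (output I solved)) = [exists c, (c \in clients I) && (cen (asg c) == x)].
  by rewrite inE o2; apply: eq_existsb => c; rewrite randomizedI.
split=> //; split.
- apply/subsetP => x; rewrite oE => /existsP[c /andP[cc /eqP e]].
  have xn : (cen (asg c) < n)%N by apply: cn; exact: asgK.
  rewrite (_ : x = Ordinal xn); last exact: val_inj.
  by apply: cfac; [exact: asgK|apply/set0Pn; exists c].
- apply: (@leq_trans #|[set Ordinal (cn x (ltn_ord x)) | x : 'I_K]|); last first.
    by apply: leq_trans (leq_imset_card _ _) _; rewrite card_ord geq_minl.
  apply: subset_leq_card; apply/subsetP => x; rewrite oE => /existsP[c /andP[cc /eqP e]].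
  by apply/imsetP; exists (Ordinal (asgK c cc)) => //; apply: val_inj.
- by move=> c cc; rewrite oE; apply/existsP; exists c; rewrite cc aE //=.
move=> f _ spos i.
have := @fair_counts_merge R b n l (mem (clients I)) typ K asg cen f asgK.
have tE : (fun c : 'I_n => imem b aTyp c 0) = typ by apply: boolp.funext => c; rewrite randomizedI.
rewrite tE in afair => /(_ afair i (ltn_ord i)).
rewrite -(served_group (S := output I solved)) //.
rewrite (eq_bigr (fun j : 'I_l => served (output I solved) (group j) f)); last first.
  by move=> j _; rewrite -(served_group (S := output I solved)).
rewrite -served_clients !randomizedR prepared_alpha prepared_beta !extendE => /andP[h1 h2].
by rewrite ler_pdivlMr ?ltr0n // h1 ler_pdivrMr ?ltr0n.
Qed.

End Reduction.

(** * Expected cost *)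

Lemma tree_spec_ext (R : realType) K (D : nat -> nat -> R) top f g b U :
  (forall x, (x < K)%N -> f x = g x) -> tree_spec K D top f b U -> tree_spec K D top g b U.
Proof.
move=> e [ctr [h1 h2]]; exists ctr; split=> // i x iT xK; have [cK cD cm] := h1 i x iT xK.
by split=> // s sK sD; have := cm s sK sD; rewrite /lexle !e.
Qed.

Section Approximation.
Context {R : realType}.
Variable I : instance R.
Local Notation n := (npoints I).
Local Notation l := (ngroups I).
Local Notation K := (minn (nopen I) n).
Local Notation d := (edist I).
Local Notation cen := (fun x => imem (prepared I) aCen x 0).
Local Notation near := (fun c : 'I_n => imem (prepared I) aNear c 0).
Local Notation typ := (fun c : 'I_n => imem (prepared I) aTyp c 0).
Local Notation D := (rmem (prepared I) rD).
Local Notation top := (rmem (prepared I) rTot 0 0).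

Variable S : solution I.
Hypothesis feasS : feasible S.
Hypothesis K0 : (0 < K)%N.

Let cen_lt x : (x < K)%N -> (cen x < n)%N. Proof. exact: prepared_center. Qed.

Lemma slot_distE x y : (x < K)%N -> (y < K)%N -> D x y = d (cen x) (cen y).
Proof. by move=> xK yK; rewrite prepared_slots xK yK. Qed.

Lemma slot_dist_ge0 x y : 0 <= D x y.
Proof. by rewrite prepared_slots; case: ifP => // _; exact: edist_ge0. Qed.

Lemma slot_distxx x : (x < K)%N -> D x x = 0.
Proof. by move=> xK; rewrite slot_distE // edistxx. Qed.

Lemma slot_distC x y : D x y = D y x.
Proof. by rewrite !prepared_slots andbC edistC. Qed.

Lemma slot_dist_triangle x y z : (x < K)%N -> (y < K)%N -> (z < K)%N -> D x z <= D x y + D y z.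
Proof. by move=> xK yK zK; rewrite !slot_distE // edist_triangle ?cen_lt. Qed.

Lemma slot_dist_top x y : (x < K)%N -> (y < K)%N -> D x y <= top.
Proof. by move=> xK yK; rewrite slot_distE //; have [_ h] := prepared_top I; apply: h; exact: cen_lt. Qed.

Lemma near_cost : \sum_(c in clients I) d c (cen (near c)) <= 8 * cost S.
Proof.
case: (set_0Vmem (clients I)) => [e|[c0 c0P]].
  by rewrite /cost e !big_set0 mulr0.
have [_] := prepared_search feasS K0 c0P; apply: le_trans; rewrite /kcost.
rewrite [leRHS](eq_bigl (fun c => c \in clients I)); last first.
  by move=> c; rewrite -prepared_client.
apply: ler_sum => c _; have [j ->] := mind_ex d K0 cen c.
by have [_ h] := prepared_near c K0; apply: h.
Qed.

(** Each facility of the fair solution sends all its clients to its nearest slot, so clusters are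
    merged but never split. The map does not depend on the draws. *)
Lemma fair_slots_exist : exists nu : 'I_n -> 'I_K,
  (forall t, fair_slots (randomized I t) K l nu) /\
  \sum_(c in clients I) D (near c) (nu c) <= 18 * cost S.
Proof.
have [phi hphi] := exists_nearest_slot n d K0 cen.
exists (fun c => phi (assign S c)); split=> [t|].
  split=> [c _|s sK]; first exact: ltn_ord.
  rewrite clientE.
  have -> : (fun c : 'I_n => imem (randomized I t) aTyp c 0) = typ.
    by apply: boolp.funext => c; rewrite randomizedI.
  pose g x := oapp (fun x : 'I_n => val (phi x)) 0%N (insub x).
  have -> : (fun c => nat_of_ord (phi (assign S c))) = (fun c => g (assign S c)).
    by apply: boolp.funext => c; rewrite /g valK.
  apply: (@fair_counts_merge R _ n l (mem (clients I)) typ n (fun c => assign S c) g s) => //.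
  by move=> f fn; exact: feasible_fair.
(* The slot nearest to [f] is no farther from [f] than the slot of the client, so a client moves at
   most twice the distance from [f] to its slot, hence at most twice its cost in [S] plus twice its
   distance to that slot. *)
have -> : 18 * cost S = 2 * (8 * cost S) + 2 * cost S by lra.
apply: le_trans (lerD (ler_wpM2l _ near_cost) (lexx _)) => //.
rewrite /cost !mulr_sumr -big_split; apply: ler_sum => c cc /=.
have [nK nle] := prepared_near c K0.
set f := assign S c; have pK := ltn_ord (phi f).
rewrite slot_distE // -edistE -/f.
have h1 : d (cen (near c)) (cen (phi f)) <= d (cen (near c)) f + d f (cen (phi f)).
  by rewrite edist_triangle // cen_lt.
have h2 : d f (cen (phi f)) <= d f (cen (near c)) by exact: (hphi f (Ordinal nK)).
have h3 : d f (cen (near c)) <= d f c + d c (cen (near c)) by rewrite edist_triangle // cen_lt.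
have h4 := edistC I f c; have h5 := edistC I f (cen (near c)).
by lra.
Qed.

(** A client travels through its nearest slot: reaching the slots costs [8 * cost S] in all, and the
    rest is the transport between slots, bounded by [rBest]. *)
Lemma solved_spec t (nu : 'I_n -> nat) : fair_slots (randomized I t) K l nu ->
  [/\ feasible (output I (solved I t)),
     cost (output I (solved I t)) <= 8 * cost S + rmem (solved I t) rBest 0 0 &
     forall e, candidate K D e -> exists U, tree_spec K D top (fun x => imem (randomized I t) aPri x 0) e U /\
       forall nu, fair_slots (randomized I t) K l nu ->
       rmem (solved I t) rBest 0 0 <= \sum_(c in clients I) U (near c) (nu c)].
Proof.
move=> fnu.
have [z1 z2 z3 z4 [z5 z6]] := prepared_sizes I.
have [c1 c2] := prepared_count I; have [t0 _] := prepared_top I.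
have hz a i j : a \notin [:: aPri; xX] -> imem (randomized I t) a i j = imem (prepared I) a i j.
  exact: randomizedI.
have nearE : (fun c : 'I_n => imem (randomized I t) aNear c 0) = near.
  by apply: boolp.funext => c; rewrite hz.
have typE : (fun c : 'I_n => imem (randomized I t) aTyp c 0) = typ.
  by apply: boolp.funext => c; rewrite hz.
have DE : (fun x y => rmem (randomized I t) rD x y) = D.
  by apply: boolp.funext => x; apply: boolp.funext => y; rewrite randomizedR.
have clE : @is_client R (randomized I t) n = @is_client R (prepared I) n.
  by apply: boolp.funext => c; rewrite randomized_client prepared_client.
have has0 : imem (randomized I t) aHas 0 0 = 0%N.
  by rewrite hz // prepared_zero.
have [] := @solve_spec R (randomized I t) n K l K0 _ _ _ _ _ _ _ _ _ _ _ _ _ _ _ _ has0 nu fnu.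
- by rewrite hz.
- by rewrite hz.
- by rewrite hz.
- by rewrite hz.
- by rewrite hz.
- move=> v hv; have [g1 g2] := prepared_digits hv; split=> [i il|]; rewrite ?hz ?g1 //.
  by rewrite -[RHS]g2; apply: eq_bigr => i _; rewrite hz.
- move=> v hv; rewrite hz // randomized_fair.
  by rewrite (_ : imem _ aDig v = imem (prepared I) aDig v) ?prepared_fair //; apply: boolp.funext => i; rewrite hz.
- move=> c; rewrite clE => cc; rewrite !hz //; split; first by have [] := prepared_near c K0.
  exact: prepared_type_lt.
- by move=> a i; rewrite hz // c1 clE nearE typE.
- by rewrite hz // c2 clE; apply: eq_bigr => c _; rewrite hz.
- by move=> x y; rewrite randomizedR slot_dist_ge0.
- by move=> x xK; rewrite randomizedR slot_distxx.
- by move=> x y; rewrite !randomizedR slot_distC.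
- by move=> x y z xK yK zK; rewrite !randomizedR slot_dist_triangle.
- by move=> x y xK yK; rewrite !randomizedR slot_dist_top.
- by rewrite randomizedR.
rewrite -/(solved I t) => -[asg [fasg oasg casg]] hU; rewrite DE randomizedR in hU.
have sumE F : \sum_(c | is_client (randomized I t) c) F c = \sum_(c in clients I) F c :> R.
  by rewrite clientE.
have {}casg : \sum_(c in clients I) D (near c) (asg c) <= rmem (solved I t) rBest 0 0.
  apply: le_trans casg; rewrite sumE le_eqVlt; apply/orP; left; apply/eqP; apply: eq_bigr => c _.
  by rewrite randomizedR hz.
have cfac x (xK : (x < K)%N) (xn : (cen x < n)%N) : clients I != set0 -> Ordinal xn \in facilities I.
  by move=> /set0Pn[c0 c0P]; have [h _] := prepared_search feasS K0 c0P; exact: h.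
have [fo ao] := output_feasible K0 cfac fasg oasg.
split=> //; last first.
  move=> e he; have [U [h1 h2]] := hU e he; exists U; split=> // nu' /h2.
  rewrite sumE => h; apply: (le_trans h); rewrite le_eqVlt; apply/orP; left; apply/eqP.
  by apply: eq_bigr => c _; rewrite hz.
apply: le_trans (lerD near_cost casg); rewrite -big_split.
apply: ler_sum => c cc; have [nK _] := prepared_near c K0.
have aK : (asg c < K)%N by case: fasg => h _; apply: h; rewrite randomized_client.
rewrite -edistE ao // /= slot_distE //; apply: edist_triangle => //; exact: cen_lt.
Qed.

(** The constant is 584 = 8 + 16 * 2 * 18: connecting to the slots costs 8, some fair transport
    between slots costs 18 in the metric, the random tree with the best scale stretches it by 16
    harmonic sums, and a harmonic sum is at most [2 * max(1, ln k)]. *)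
Lemma expected_cost : (\sum_(t : K.-tuple 'I_(n * n).-1.+1)
    cost (output I (solved I [seq val i | i <- t]))) / ((n * n).-1.+1 ^ K)%:R
  <= 584 * Num.max 1 (ln (nopen I)%:R) * cost S.
Proof.
have [nu [fnu cnu]] := fair_slots_exist.
set N := (n * n).-1; set L := Num.max 1 _.
have C0 : 0 <= cost S by rewrite /cost sumr_ge0 // => c _; rewrite -edistE edist_ge0.
have nearK c : (near c < K)%N by have [] := prepared_near c K0.
pose x (c : {c in clients I}) := Ordinal (nearK (val c)).
pose y (c : {c in clients I}) := nu (val c).
have NK : (K * K <= N.+1)%N.
  have : (K * K <= n * n)%N by apply: leq_mul; exact: geq_minr.
  rewrite /N; lia.
have p0 : 0 < (N.+1 ^ K)%:R :> R by rewrite ltr0n expn_gt0.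
have [T0 _] := prepared_top I.
have := @tree_expectation R K D top slot_dist_ge0 slot_distC slot_dist_triangle T0 N _ x y
  (fun t => rmem (solved I t) rBest 0 0) NK.
rewrite -(big_sub (clients I) (fun c => D (near c) (nu c))) => hE.
have {hE} avg : (\sum_(t : K.-tuple 'I_N.+1) rmem (solved I [seq val i | i <- t]) rBest 0 0) / (N.+1 ^ K)%:R
    <= 16 * harmonic_sum K * (18 * cost S).
  apply: (le_trans (hE _)); last first.
    by rewrite ler_wpM2l // mulr_ge0 // sumr_ge0 // => i _; rewrite invr_ge0.
  move=> t; have [_ _ hU] := solved_spec (fnu [seq val i | i <- t]).
  (* A tree is chosen for every real scale at once; for those that are not candidates [D] is a dummy
     value. *)
  have hU' e : exists U, candidate K D e -> tree_spec K D top (nth 0%N [seq val i | i <- t]) e U /\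
      rmem (solved I [seq val i | i <- t]) rBest 0 0 <= \sum_c U (x c) (y c).
    case: (boolp.pselect (candidate K D e)) => [he|ne]; last by exists D.
    have [U [h1 h2]] := hU e he; exists U => _; split.
      apply: tree_spec_ext h1 => z zK.
      have [h _ _] := @drawnP R aPri xX [seq val i | i <- t] (prepared I) isT.
      by apply: h; rewrite size_map size_tuple.
    rewrite -(big_sub (clients I) (fun c => U (near c) (nu c))); apply: h2; exact: fnu.
  have [U hU2] := boolp.choice hU'; exists U; split=> e he; by have [] := hU2 e he.
have H0 : 1 <= L by rewrite /L le_max lexx.
have HL : harmonic_sum K <= 2 * L :> R.
  apply: le_trans (harmonic_le K) _; rewrite ler_wpM2l // ge_max H0 /= /L le_max.
  apply/orP; right; rewrite ler_ln ?posrE ?ltr0n // ?ler_nat ?geq_minl //.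
  by apply: leq_trans K0 (geq_minl _ _).
have : (\sum_(t : K.-tuple 'I_N.+1) cost (output I (solved I [seq val i | i <- t]))) / (N.+1 ^ K)%:R <=
    8 * cost S + (\sum_(t : K.-tuple 'I_N.+1) rmem (solved I [seq val i | i <- t]) rBest 0 0) / (N.+1 ^ K)%:R.
  rewrite ler_pdivrMr // mulrDl divfK ?gt_eqF //.
  have -> : 8 * cost S * (N.+1 ^ K)%:R = \sum_(t : K.-tuple 'I_N.+1) 8 * cost S.
    by rewrite sumr_const card_tuple card_ord mulr_natr.
  rewrite -big_split; apply: ler_sum => t _.
  by have [] := solved_spec (fnu [seq val i | i <- t]).
move=> h; apply: (le_trans h); apply: (le_trans (lerD (lexx _) avg)).
have H1 : harmonic_sum K * cost S <= 2 * L * cost S by rewrite ler_wpM2r.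
have H2 : cost S <= L * cost S by rewrite ler_peMl.
lra.
Qed.

End Approximation.

(** * Execution *)

Lemma leq_expl (m1 m2 e : nat) : (m1 <= m2 -> m1 ^ e <= m2 ^ e)%N.
Proof. by case: e => // e; rewrite leq_exp2r. Qed.

Transparent prepared randomized solved.

Lemma solved_idle (R : realType) (I : instance R) t x :
  minn (nopen I) (npoints I) = 0%N -> imem (solved I t) aOpen x 0 = 0%N.
Proof.
move=> K0; have [_ z2 _ _ _] := prepared_sizes I.
rewrite /solved /p_solve /run -/run randomizedI // z2 K0 /= /update /= randomizedI //.
by rewrite prepared_zero.
Qed.

Section Execution.
Context {R : realType}.
Variable I : instance R.
Local Notation n := (npoints I).
Local Notation l := (ngroups I).
Local Notation K := (minn (nopen I) n).

Definition loop_bound : nat := (n.+1 ^ l + n + l)%N.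
Local Notation W := loop_bound.

Definition total_time : nat := (ptime W p_sizes + ptime W p_prepare + 3 + (K * 4 + 3 + ptime W p_solve))%N.

Lemma prefix_leads : exists2 t, (t <= ptime W p_sizes + ptime W p_prepare + 3)%N &
  leads t (start fair_kmedian I) ([:: draws aPri xX aK aM; compile p_solve], prepared I).
Proof.
have [h1 h2 h3 h4 [h5 _]] := sized_spec I.
have [||t1 l1 L1] := @compile_leads R (wI p_sizes) W p_sizes (start_state I)
  [:: Seq (compile p_prepare) (Seq (draws aPri xX aK aM) (compile p_solve))] wf_sizes; first by [].
  move=> a ha; have : a \in [:: aN; aL] by apply: (allP (_ : all [in [:: aN; aL]] (bounds p_sizes))) ha.
  by rewrite !inE => /orP[]/eqP->; rewrite /= /W; lia.
have [||t2 l2 L2] := @compile_leads R (wI p_prepare) W p_prepare (sized I)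
  [:: Seq (draws aPri xX aK aM) (compile p_solve)] wf_prepare; first by [].
  move=> a ha; have : a \in [:: aN; aL; aK; aV].
    by apply: (allP (_ : all [in [:: aN; aL; aK; aV]] (bounds p_prepare))) ha.
  have zN : imem (sized I) aN 0 0 = n by rewrite sized_start.
  have zL : imem (sized I) aL 0 0 = l by rewrite sized_start.
  have hK := geq_minr (nopen I) n.
  by rewrite !inE => /or4P[]/eqP->; rewrite ?zN ?zL ?h1 ?h5 /W; lia.
exists (1 + (t1 + (1 + (t2 + 1))))%N; first by lia.
apply: leads_trans; first by apply: leads_det; reflexivity.
apply: leads_trans L1 _; apply: leads_trans; first by apply: leads_det; reflexivity.
by apply: leads_trans L2 _; apply: leads_det; reflexivity.
Qed.

Lemma solve_leads t : exists2 u, (u <= ptime W p_solve)%N &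
  leads u ([:: compile p_solve], randomized I t) ([::], solved I t).
Proof.
have [z1 z2 z3 z4 [z5 z6]] := prepared_sizes I.
apply: (@compile_leads R (wI p_solve) W p_solve (randomized I t) [::] wf_solve) => // a ha.
have : a \in [:: aN; aK; aK1; aL; aV].
  by apply: (allP (_ : all [in [:: aN; aK; aK1; aL; aV]] (bounds p_solve))) ha.
have := geq_minr (nopen I) n => hK.
rewrite !inE => /or4P[||/eqP->|/orP[]]; try move=> /eqP->; rewrite randomizedI // ?z1 ?z2 ?z3 ?z4 ?z6 /W; lia.
Qed.

Lemma execution T : (total_time <= T)%N ->
  (forall P, (forall t, P (solved I t)) -> always T P (start fair_kmedian I)) /\
  forall g, expect T g (start fair_kmedian I) =
    (\sum_(t : K.-tuple 'I_(n * n).-1.+1) g (solved I [seq val i | i <- t])) / ((n * n).-1.+1 ^ K)%:R.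
Proof.
move=> hT; have [t0 l0 L0] := prefix_leads.
have [z1 z2 z3 z4 [z5 z6]] := prepared_sizes I.
set ps := ptime W p_solve.
have [] := @draws_correct R aPri xX aK aM (prepared I) [:: compile p_solve] isT isT isT.
rewrite z2 z5 => A E.
have fin t : (forall P, P (solved I t) -> always ps P ([:: compile p_solve], randomized I t)) /\
    (forall g, expect ps g ([:: compile p_solve], randomized I t) = g (solved I t)).
  have [u lu L] := solve_leads t; have [La Le] := L (ps - u)%N; rewrite subnKC // in La Le.
  split=> [P h|g]; first by apply/La; case: (ps - u)%N.
  by rewrite Le; case: (ps - u)%N.
pose T0 := (t0 + (K * 4 + 3 + ps))%N.
have lT : (T0 <= T)%N by apply: leq_trans hT; rewrite /T0 /total_time -/ps; lia.
have alw P : (forall t, P (solved I t)) -> always T0 P (start fair_kmedian I).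
  move=> h; have [La _] := L0 (K * 4 + 3 + ps)%N; apply/La; apply: A => t.
  by have [h1 _] := fin [seq val i | i <- t]; exact: h1.
split=> [P h|g]; first exact: always_leq lT (alw P h).
rewrite (expect_leq _ lT); last exact: alw.
have [_ Le] := L0 (K * 4 + 3 + ps)%N; rewrite /T0 Le E; congr (_ / _).
by apply: eq_bigr => t _; have [_ h] := fin [seq val i | i <- t]; exact: h.
Qed.

(** Each of the three programs takes at most [W + 2] to the power of its size, and the draws take
    linear time; six more factors absorb the sum and its constants. *)
Lemma total_time_le : (total_time <= maxn 2 n ^
  (4 * (psize p_sizes + psize p_prepare + psize p_solve + 6) * maxn 1 l))%N.
Proof.
set m := maxn 2 n; set l' := maxn 1 l.
have m2 : (2 <= m)%N by exact: leq_maxl.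
(* With [u = m ^ (2 * l')], each of [n.+1 ^ l], [n], [l] and 2 is at most [u], the first because
   [n + 1 <= m ^ 2]; as [u >= 4], their sum is at most [u ^ 2]. *)
have W2 : (W + 2 <= m ^ (4 * l'))%N.
  have e1 : (n.+1 ^ l <= m ^ (2 * l'))%N.
    apply: (@leq_trans ((m ^ 2) ^ l)%N); last by rewrite -expnM leq_pexp2l ?leq_mul ?leq_maxr //; lia.
    apply: leq_expl => //; rewrite /m; nia.
  have e2 : (2 <= m ^ (2 * l'))%N.
    by apply: leq_trans m2 _; rewrite -{1}(expn1 m) leq_pexp2l //; rewrite /l'; lia.
  have e3 : (n <= m ^ (2 * l'))%N.
    apply: (@leq_trans m); first exact: leq_maxr.
    by rewrite -{1}(expn1 m) leq_pexp2l //; rewrite /l'; lia.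
  have e4 : (l <= m ^ (2 * l'))%N.
    apply: (@leq_trans (2 ^ l)); first by apply: ltnW; exact: ltn_expl.
    apply: (@leq_trans (m ^ l)%N); first by apply: leq_expl.
    by rewrite leq_pexp2l // /l'; lia.
  have -> : (4 * l' = 2 * l' + 2 * l')%N by lia.
  rewrite expnD; have e5 : (4 <= m ^ (2 * l'))%N.
    apply: (@leq_trans (2 ^ 2)) => //; apply: (@leq_trans (m ^ 2)%N); first by apply: leq_expl.
    by rewrite leq_pexp2l // /l'; lia.
  by rewrite /W; move: e1 e2 e3 e4 e5; set u := (m ^ _)%N; nia.
have B1 := ptime_le W p_sizes; have B2 := ptime_le W p_prepare; have B3 := ptime_le W p_solve.
rewrite /total_time; move: B1 B2 B3; set a := psize p_sizes; set b := psize p_prepare; set c := psize p_solve.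
set x := ptime W p_sizes; set y := ptime W p_prepare; set z := ptime W p_solve => B1 B2 B3.
have KW : (K <= W)%N by have := geq_minr (nopen I) n; rewrite /W; lia.
set B := (W + 2)%N in B1 B2 B3 W2; set s := (a + b + c)%N.
have B2' : (2 <= B)%N by rewrite /B; lia.
have up e : (e <= s)%N -> (B ^ e <= B ^ s)%N by move=> es; rewrite leq_pexp2l //; lia.
have U1 := leq_trans B1 (up a (leq_trans (leq_addr b a) (leq_addr c _))).
have U2 := leq_trans B2 (up b (leq_trans (leq_addl a b) (leq_addr c _))).
have U3 := leq_trans B3 (up c (leq_addl _ c)).
apply: (@leq_trans (B ^ (s + 6))); last first.
  by apply: leq_trans (leq_expl _ W2) _; rewrite -expnM leq_pexp2l //; lia.
rewrite expnD; have : (1 <= B ^ s)%N by rewrite expn_gt0; lia.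
have : (32 * B <= B ^ 6)%N.
  by rewrite (expnSr B 5) leq_mul2r; apply/orP; right; apply: (@leq_trans (2 ^ 5)%N) => //; exact: leq_expl.
have : (K + 2 <= B)%N by rewrite /B; lia.
move: U1 U2 U3; set u := (B ^ s)%N; set v := (B ^ 6)%N; nia.
Qed.

End Execution.

Theorem theorem2 (R : realType) :
  exists (p : cmd) (C : R) (D : nat),
  forall I : instance R,
  let T := (maxn 2 (npoints I) ^ (D * maxn 1 (ngroups I)))%N in
  always T (fun _ => True) (start p I) /\
  forall S : solution I, optimal S ->
    always T (fun s => feasible (output I s)) (start p I) /\
    expect T (fun s => cost (output I s)) (start p I)
      <= C * Num.max 1 (ln (nopen I)%:R) * cost S.
Proof.
exists fair_kmedian, 584, (4 * (psize p_sizes + psize p_prepare + psize p_solve + 6))%N => I T.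
have [alw exp] := execution (total_time_le I); rewrite -/T in alw exp.
split=> [|S [feasS _]]; first exact: alw.
(* Without slots a feasible solution can exist only if there are no clients. All costs are then 0,
   the search loop is empty, and the output opens nothing. *)
case: (posnP (minn (nopen I) (npoints I))) => [K0|K0]; last first.
  split; last by rewrite exp; exact: expected_cost feasS K0.
  apply: alw => t; have [nu [fnu _]] := fair_slots_exist feasS K0.
  by have [] := solved_spec feasS K0 (fnu t).
have cl0 : clients I = set0.
  apply/eqP; apply: contraT => /set0Pn[c cc]; have [_ hk ho _] := feasS.
  have : (0 < #|opened S|)%N by apply/card_gt0P; exists (assign S c); exact: ho.
  have := ltn_ord c; lia.
have cost0 (S' : solution I) : cost S' = 0 by rewrite /cost cl0 big_set0.
split; last by rewrite exp cost0 mulr0 big1 ?mul0r.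
apply: alw => t; have op0 : opened (output I (solved I t)) = set0.
  apply/setP => x; rewrite !inE solved_idle //.
split; rewrite ?op0 ?sub0set ?cards0 //.
  by move=> c; rewrite cl0 inE.
by move=> f; rewrite inE.
Qed.
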